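(* Let $(\psi_+,\psi_-)$ be a massless Dirac field on the Schwarzschild exterior, smooth on $\Omega_{\tau_0,\infty}$, and let $\Phi_+=\psi_+$, $\Phi_-=\Delta^{1/2}\psi_-$. For any $\tau_0\le\tau_1<\tau_2$ and any $k\in\mathbb N$, $$\|\psi_+\|^2_{\tilde W_0^{k+1}(\Sigma_{\tau_2})}+\|\psi_-\|^2_{\tilde W_0^{k+1}(\Sigma_{\tau_2})}+\sum_{|\mathbf a|\le k+1}\Big(\int_{\mathcal H^+_{\tau_1,\tau_2}}|\Phi_+^{(\mathbf a)}|^2\,dv\,d^2\mu+\int_{\mathcal I^+_{\tau_1,\tau_2}}\big(|\Phi_+^{(\mathbf a)}|^2+|\Phi_-^{(\mathbf a)}|^2\big)\,du\,d^2\mu\Big)$$ $$\lesssim\ \|\psi_+\|^2_{\tilde W_0^{k+1}(\Sigma_{\tau_1})}+\|\psi_-\|^2_{\tilde W_0^{k+1}(\Sigma_{\tau_1})},$$ where the implicit constant depends only on $M$, the foliation and $k$ (not on $\tau_1,\tau_2$ or the field).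
   Context: **Geometry and operators.** Fix $M>0$; $\mu=1-2M/r$, $\Delta=r^2-2Mr$. The Schwarzschild exterior is $\{(t,r,\omega)\in\mathbb R\times(2M,\infty)\times S^2\}$ together with the future event horizon $\mathcal H^+$ at $r=2M$, with $g=-\mu dt^2+\mu^{-1}dr^2+r^2(d\theta^2+\sin^2\theta d\phi^2)$. $Y=\mu^{-1}\partial_t-\partial_r$, $\hat V=\mu^{-1}\partial_t+\partial_r$. On a spin-weight $s$ scalar, $\mathring\eth f=\partial_\theta f+i\csc\theta\,\partial_\phi f-s\cot\theta f$ (spin weight $s+1$), $\mathring\eth' f=\partial_\theta f-i\csc\theta\,\partial_\phi f+s\cot\theta f$ (spin weight $s-1$). $d^2\mu=\sin\theta\,d\theta\,d\phi$. **Dirac field.** A pair $(\psi_+,\psi_-)$ of scalars of spin weights $+\frac12,-\frac12$, smooth up to and including $\mathcal H^+$ (in ingoing Eddington–Finkelstein coordinates), with $\mathring\eth'\psi_+=\Delta^{1/2}\hat V(\Delta^{1/2}\psi_-)$, $\mathring\eth\psi_-=Y\psi_+$. **Foliation.** $dr^*=\mu^{-1}dr$, $r^*(3M)=0$, $u=t-r^*$, $v=t+r^*$. $\tau=v-h(r)$, $\rho=r$; coordinates $(\tau,\rho,\theta,\phi)$, $\partial_\tau=\partial_t$. $h$ is a fixed smooth function on $[2M,\infty)$ with $h(2M)=2M$, $h'(2M)=1$, $h'\ge0$, $h=r^*$ on some $[r_{away},R]$ ($r_{away}>2M$, $R/M$ large), and $H:=2\mu^{-1}-h'$ is $O(r^{-2})$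 at infinity (with the corresponding decay of derivatives) with $\lim r^2H\in(0,\infty)$; the level sets of $\tau$ are spacelike with $-g(\nabla\tau,\nabla\tau)\sim r^{-2}$. $\Sigma_{\tau_1}=\{\tau=\tau_1\}$, $\Omega_{\tau_1,\tau_2}=\bigcup_{\tau_1\le\tau\le\tau_2}\Sigma_\tau$, $\mathcal H^+_{\tau_1,\tau_2}=\Omega_{\tau_1,\tau_2}\cap\mathcal H^+$, $\mathcal I^+_{\tau_1,\tau_2}=\lim_{c\to\infty}\{v=c\}\cap\Omega_{\tau_1,\tau_2}$ (integrals over it are limits as $c\to\infty$). $\tau_0\ge1$ is fixed so that $v\ge M$ on $\Sigma_{\tau_0}$ and $v\ge c(\tau+\rho)$ in $\Omega_{\tau_0,\infty}$. **Norms and derivatives.** With $\mathbb H=\{\partial_\tau,Y,\mathring\eth,\mathring\eth'\}$, $|f|^2_{k,\mathbb H}$ is the sum of $|X_1\cdots X_nf|^2$ over all words of length $n\le k$ in $\mathbb H$, and $\|f\|^2_{\tilde W^k_\gamma(\Sigma)}=\int_\Sigma r^\gamma|f|^2_{k,\mathbb H}\,d\rho\,d^2\mu$. For $\mathbf a=(a_1,a_2,a_3,a_4)$ with $a_1\in\{0,1\}$, $a_2\ge0$ even, $a_3,a_4\ge0$ integers, $|\mathbf a|=a_1+a_2+a_3+a_4$: $f^{(\mathbf a)}=\mathring\eth^{a_1}(\mathring\eth'\mathring\eth)^{a_2/2}\partial_\tau^{a_3}\partial_\phi^{a_4}f$ for spin weight $-\frac12$, and $f^{(\mathbf a)}=(\mathring\eth')^{a_1}(\mathring\eth\mathring\eth')^{a_2/2}\partial_\tau^{a_3}\partial_\phi^{a_4}f$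 for spin weight $+\frac12$. *)

(* Defs.v *)
From HB Require Import structures.
From mathcomp Require Import all_boot all_order all_algebra.
From mathcomp Require Import all_classical all_reals all_analysis.
From mathcomp Require Import complex.
From mathcomp Require Import ring lra.

Set Implicit Arguments.
Unset Strict Implicit.
Unset Printing Implicit Defensive.

Import Order.TTheory GRing.Theory Num.Theory.
Import numFieldNormedType.Exports.

Local Open Scope classical_set_scope.
Local Open Scope ring_scope.
Local Open Scope complex_scope.

Section Schwarzschild.
Variables (R : realType) (M : R).

Definition mu (r : R) : R := 1 - 2 * M / r.

Definition Delta (r : R) : R := r ^+ 2 - 2 * M * r.

(* The primitive of 1 / mu on (2M, oo) vanishing at 3M; see is_derive_rstar
   and rstar_3M. *)
Definition rstar (r : R) : R :=
  r - 3 * M + 2 * M * (ln (r - 2 * M) - ln M).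

Lemma rstar_3M : rstar (3 * M) = 0.
Proof.
rewrite /rstar (_ : 3 * M - 2 * M = M); last by ring.
by rewrite !subrr mulr0 addr0.
Qed.

Lemma is_derive_rstar (r : R) : 0 < M -> 2 * M < r ->
  is_derive r 1 rstar (mu r)^-1.
Proof.
move=> M0 Mr.
have r0 : 0 < r by apply: lt_trans Mr; rewrite mulr_gt0.
have rM : 0 < r - 2 * M by rewrite subr_gt0.
have dsub a : is_derive r 1 (fun x : R => x - a) 1.
  by apply: is_derive_eq; rewrite subr0.
have dl := @is_derive1_comp _ (@ln R) (fun x : R => x - 2 * M) r _ _
  (is_derive1_ln rM) (dsub _).
rewrite (_ : rstar = (fun x => x - 3 * M) +
    (2 * M) \*: ((@ln R \o (fun x : R => x - 2 * M)) - cst (ln M))); last first.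
  by apply/funext => x; rewrite /rstar /= !fctE.
have dr := is_deriveD (dsub (3 * M))
  (is_deriveZ (2 * M) (is_deriveB dl (is_derive_cst (ln M) r 1))).
apply: is_derive_eq.
rewrite subr0 mulr1 /mu /GRing.scale/=.
by field; rewrite ?gt_eqF.
Qed.

(* - g(grad f, grad f) for f = f(t, r), in the coordinates (t, r), in which g
   is diagonal with entries - mu and 1 / mu; ft and fr are the partial
   derivatives of f at r. *)
Definition neg_grad_sq (r ft fr : R) : R :=
  - (- (mu r)^-1 * ft ^+ 2 + mu r * fr ^+ 2).

Variable h : R -> R.

Definition H_fol (r : R) : R := 2 / mu r - h^`()%classic r.

(* As a function of (t, r), tau = v - h(r) = t + (rstar r - h r). *)
Definition neg_grad_tau (r : R) : R :=
  neg_grad_sq r 1 ((fun x => rstar x - h x)^`()%classic r).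

(* h is a total function; smoothness on the closed half-line [2M, oo) means
   smoothness on a neighbourhood of each of its points.  Since the level sets
   of tau extend smoothly through r = 2M, the bound on neg_grad_tau (whose
   expression is singular there) is required for r > 2M only. *)
Record foliation (r_away r_far tau0 : R) : Prop := {
  fol_smooth : forall (n : nat) (r : R), 2 * M <= r ->
    \forall x \near r, derivable (h^`(n)%classic) x 1 ;
  fol_horizon : h (2 * M) = 2 * M ;
  fol_horizon1 : h^`()%classic (2 * M) = 1 ;
  fol_ge0 : forall r, 2 * M <= r -> 0 <= h^`()%classic r ;
  fol_away : 2 * M < r_away /\ r_away < r_far ;
  fol_rstar : forall r, r_away <= r <= r_far -> h r = rstar r ;
  fol_decay : forall n : nat, exists C : R,
    \forall r \near +oo, `|H_fol^`(n)%classic r| <= C / r ^+ (n + 2) ;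
  fol_lim : exists2 l : R, 0 < l & r ^+ 2 * H_fol r @[r --> +oo] --> l ;
  fol_spacelike : exists c C : R, [/\ 0 < c, 0 < C &
    forall r, 2 * M < r -> c / r ^+ 2 <= neg_grad_tau r <= C / r ^+ 2] ;
  fol_tau0 : 1 <= tau0 ;
  fol_v_init : forall rho, 2 * M <= rho -> M <= tau0 + h rho ;
  fol_v_lower : exists2 c : R, 0 < c & forall tau rho,
    tau0 <= tau -> 2 * M <= rho -> c * (tau + rho) <= tau + h rho
}.

(* The arguments are tau, rho, theta, phi. *)
Definition field := R -> R -> R -> R -> R[i].

Definition cderive1 (g : R -> R[i]) (x : R) : R[i] :=
  (fun y => complex.Re (g y))^`()%classic x +i* (fun y => complex.Im (g y))^`()%classic x.

Definition d_tau (f : field) : field :=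
  fun tau rho theta phi => cderive1 (fun x => f x rho theta phi) tau.
Definition d_rho (f : field) : field :=
  fun tau rho theta phi => cderive1 (fun x => f tau x theta phi) rho.
Definition d_theta (f : field) : field :=
  fun tau rho theta phi => cderive1 (fun x => f tau rho x phi) theta.
Definition d_phi (f : field) : field :=
  fun tau rho theta phi => cderive1 (fun x => f tau rho theta x) phi.

(* The coordinate fields of (t, r, theta, phi), by the chain rule from
   tau = t + rstar r - h r and rho = r. *)
Definition d_t (f : field) : field := d_tau f.
Definition d_r (f : field) : field := fun tau rho theta phi =>
  d_rho f tau rho theta phi
  + ((mu rho)^-1 - h^`()%classic rho)%:C * d_tau f tau rho theta phi.

(* The terms in 1 / mu cancel: Y = h' d_tau - d_rho, also at rho = 2M where
   (mu rho)^-1 is 0 by convention. *)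
Definition Y (f : field) : field := fun tau rho theta phi =>
  ((mu rho)^-1)%:C * d_t f tau rho theta phi - d_r f tau rho theta phi.

Definition Vhat (f : field) : field := fun tau rho theta phi =>
  ((mu rho)^-1)%:C * d_t f tau rho theta phi + d_r f tau rho theta phi.

Definition eth (s : R) (f : field) : field := fun tau rho theta phi =>
  d_theta f tau rho theta phi
  + 'i * ((sin theta)^-1)%:C * d_phi f tau rho theta phi
  - (s * (cos theta / sin theta))%:C * f tau rho theta phi.

Definition ethp (s : R) (f : field) : field := fun tau rho theta phi =>
  d_theta f tau rho theta phi
  - 'i * ((sin theta)^-1)%:C * d_phi f tau rho theta phi
  + (s * (cos theta / sin theta))%:C * f tau rho theta phi.

Definition sqrtDelta (f : field) : field := fun tau rho theta phi =>
  (Num.sqrt (Delta rho))%:C * f tau rho theta phi.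

Definition iterD (l : seq 'I_4) (F : 'rV[R]_4 -> R) : 'rV[R]_4 -> R :=
  foldr (fun i G x => 'D_(delta_mx 0 i) G x) F l.

(* C^oo on U x R^2, the first two coordinates being tau and rho. *)
Definition smooth4 (U : set (R * R)) (F : 'rV[R]_4 -> R) : Prop :=
  forall (l : seq 'I_4) (x : 'rV[R]_4), U (x 0 0, x 0 1) ->
    {for x, continuous (iterD l F)} /\
    forall i : 'I_4, derivable (iterD l F) x (delta_mx 0 i).

Definition csmooth4 (U : set (R * R)) (F : 'rV[R]_4 -> R[i]) : Prop :=
  smooth4 U (fun x => complex.Re (F x)) /\ smooth4 U (fun x => complex.Im (F x)).

Definition pt4 (a b c d : R) : 'rV[R]_4 := \row_(i < 4) [:: a; b; c; d]`_i.

Definition expi (x : R) : R[i] := cos x +i* sin x.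

(* A spin-weight s scalar is a component in the frame adapted to
   (theta, phi), which is singular at the poles.  It is smooth on U x S^2 when,
   after rotation of the frame by the angle phi (resp. - phi), it is a smooth
   function FN (resp. FS) in the stereographic chart centred at the north
   (resp. south) pole.  Half-integer weights are thus antiperiodic in phi. *)
Definition spin_smooth (s : R) (U : set (R * R)) (f : field) : Prop :=
  exists FN FS : 'rV[R]_4 -> R[i],
  [/\ csmooth4 U FN, csmooth4 U FS &
    forall tau rho theta phi, U (tau, rho) -> 0 < theta < pi ->
      f tau rho theta phi = expi (- (s * phi)) *
        FN (pt4 tau rho (tan (theta / 2) * cos phi) (tan (theta / 2) * sin phi))
      /\
      f tau rho theta phi = expi (s * phi) *
        FS (pt4 tau rho ((tan (theta / 2))^-1 * cos phi)
                        ((tan (theta / 2))^-1 * sin phi))].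

(* Smoothness on the closed region {tau >= tau0, rho >= 2M}, which contains the
   horizon, is smoothness on an open neighbourhood of it.  At the horizon
   (tau, rho, theta, phi) and ingoing Eddington-Finkelstein coordinates
   v = tau + h(rho), r = rho define the same smooth structure.  The equations
   are written for rho > 2M because Vhat is singular at rho = 2M; their regular
   forms extend to rho = 2M by continuity. *)
Definition Dirac_field (tau0 : R) (psip psim : field) : Prop :=
  (exists U : set (R * R),
    [/\ open U,
        (forall tau rho, tau0 <= tau -> 2 * M <= rho -> U (tau, rho)),
        spin_smooth 2^-1 U psip & spin_smooth (- 2^-1) U psim])
  /\
  (forall tau rho theta phi, tau0 <= tau -> 2 * M < rho -> 0 < theta < pi ->
    ethp 2^-1 psip tau rho theta phi
      = sqrtDelta (Vhat (sqrtDelta psim)) tau rho theta phi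
    /\
    eth (- 2^-1) psim tau rho theta phi = Y psip tau rho theta phi).

(* A field together with its spin weight. *)
Definition spin_scalar := (R * field)%type.

Definition op_tau (F : spin_scalar) : spin_scalar := (F.1, d_tau F.2).
Definition op_phi (F : spin_scalar) : spin_scalar := (F.1, d_phi F.2).
Definition op_Y (F : spin_scalar) : spin_scalar := (F.1, Y F.2).
Definition op_eth (F : spin_scalar) : spin_scalar := (F.1 + 1, eth F.1 F.2).
Definition op_ethp (F : spin_scalar) : spin_scalar := (F.1 - 1, ethp F.1 F.2).

Definition sqmod (F : spin_scalar) (tau rho theta phi : R) : R :=
  Normc.normc (F.2 tau rho theta phi) ^+ 2.

Definition HH : seq (spin_scalar -> spin_scalar) :=
  [:: op_tau; op_Y; op_eth; op_ethp].

(* The X_1 ... X_n F, over all words X_1 ... X_n of length n in HH. *)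
Fixpoint Hwords (n : nat) (F : spin_scalar) : seq spin_scalar :=
  if n is m.+1 then [seq X G | X <- HH, G <- Hwords m F] else [:: F].

Definition sqmodH (k : nat) (F : spin_scalar) (tau rho theta phi : R) : R :=
  \sum_(n < k.+1) \sum_(G <- Hwords n F) sqmod G tau rho theta phi.

Definition Lint (D : set R) (f : R -> \bar R) : \bar R :=
  (\int[lebesgue_measure]_(x in D) f x)%E.

Definition sphere_int (g : R -> R -> R) : \bar R :=
  Lint `]0, pi[ (fun theta => Lint `[0, 2 * pi] (fun phi =>
    (g theta phi * sin theta)%:E)).

Definition W_norm_sq (gamma : R) (k : nat) (tau : R) (F : spin_scalar) : \bar R :=
  Lint `[2 * M, +oo[ (fun rho => sphere_int (fun theta phi =>
    rho `^ gamma * sqmodH k F tau rho theta phi)).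

Definition horizon_int (tau1 tau2 : R) (g : R -> R -> R -> R -> R) : \bar R :=
  Lint `[tau1 + h (2 * M), tau2 + h (2 * M)] (fun v =>
    sphere_int (g (v - h (2 * M)) (2 * M))).

(* The radius r > 2M of the points of double null coordinates (u, v). *)
Definition r_uv (u v : R) : R :=
  xget (3 * M) [set r | 2 * M < r /\ rstar r = (v - u) / 2].

Definition v_int (tau1 tau2 : R) (g : R -> R -> R -> R -> R) (c : R) : \bar R :=
  Lint [set u | tau1 <= c - h (r_uv u c) <= tau2] (fun u =>
    sphere_int (g (c - h (r_uv u c)) (r_uv u c))).

(* The limit as c -> oo of the integrals over {v = c}, taken as a lower limit
   so as to be meaningful for every field; see scri_intE. *)
Definition scri_int (tau1 tau2 : R) (g : R -> R -> R -> R -> R) : \bar R :=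
  limf_einf (v_int tau1 tau2 g) (pinfty_nbhs R).

Lemma scri_intE (tau1 tau2 : R) (g : R -> R -> R -> R -> R) (l : \bar R) :
  v_int tau1 tau2 g c @[c --> +oo] --> l -> scri_int tau1 tau2 g = l.
Proof.
rewrite /scri_int; move: (v_int _ _ _) => f fl.
rewrite limf_einfE; apply/eqP; rewrite eq_le; apply/andP; split.
  apply: ge_ereal_sup => _ [V VF <-].
  rewrite -(cvg_lim _ fl)//; apply: lime_ge; first by apply/cvg_ex; exists l.
  by near=> c; apply: ereal_inf_lbound; exists c => //; near: c.
rewrite leNgt; apply/negP => sl.
have [a sa al] : exists2 a : R,
    (ereal_sup [set ereal_inf (f @` V) | V in (pinfty_nbhs R)] < a%:E)%E
    & (a%:E < l)%E.
  move: (ereal_sup _) (l) sl => [x| |] [y| |]//.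
  - rewrite lte_fin => xy; exists ((x + y) / 2); rewrite lte_fin; lra.
  - by exists (x + 1); rewrite ?ltry// lte_fin ltrDl.
  - by exists (y - 1); rewrite ?ltNyr// lte_fin ltrBlDr ltrDl.
  - by exists 0; rewrite ?ltNyr ?ltry.
have Va : pinfty_nbhs R [set c | (a%:E < f c)%E].
  exact: (fl _ (open_ereal_gt' al)).
move: sa; apply/negP; rewrite -leNgt.
apply: le_ereal_sup_tmp; exists (ereal_inf (f @` [set c | (a%:E < f c)%E])).
  by exists [set c | (a%:E < f c)%E].
by apply: le_ereal_inf_tmp => _ [c /= ac <-]; exact: ltW.
Unshelve. all: by end_near. Qed.

Definition multi (e e' : spin_scalar -> spin_scalar) (a1 a2 a3 a4 : nat)
    (F : spin_scalar) : spin_scalar :=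
  iter a1 e (iter a2./2 (e' \o e) (iter a3 op_tau (iter a4 op_phi F))).

Definition multi_m := multi op_eth op_ethp.
Definition multi_p := multi op_ethp op_eth.

(* Sum over the multi-indices a with |a| <= N, a1 <= 1 and a2 even. *)
Definition sum_multi (N : nat) (G : nat -> nat -> nat -> nat -> \bar R) : \bar R :=
  (\sum_(a1 < 2) \sum_(a2 < N.+1 | ~~ odd a2) \sum_(a3 < N.+1)
    \sum_(a4 < N.+1 | (a1 + a2 + a3 + a4 <= N)%N) G a1 a2 a3 a4)%E.

End Schwarzschild.

(* Main.v *)
(* Both components are kept in the horizon-regular form
   [Y P = eth Q], [Delta Y Q = 2 r^2 d_tau Q + (r - M) Q - eth' P] with
   [Y = h' d_tau - d_rho]. Pairing the two equations with [P] and [Q], the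
   angular terms cancel upon integration over the spheres, which leaves an exact
   conservation law for [h' |P|^2 + (2 r^2 - h' Delta) |Q|^2], a density
   comparable to [|P|^2 + |Q|^2]. The law is integrated against a cutoff in
   [v], which is nonincreasing and so produces terms of a good sign, to be
   removed by monotone convergence.

   The system is preserved by [d_tau], by [d_phi] and by
   [(P, Q) |-> (eth' P, eth Q)] up to exchanging the roles of the weights, so all
   these derivatives satisfy the same bound. Commuting [b] times with [Y] adds
   the term [4 b (r - M) |Y^b Q|^2], whose sign is the red-shift: near the
   horizon it absorbs the commutator terms, uniformly in time, when the weight is
   [e^(k t) / r] with [k] small, and away from the horizon the equation expresses
   [Y^(b+1) Q] by derivatives already bounded. An arbitrary word in [d_tau], [Y],
   [eth], [eth'] is reordered and its angular part is estimated by alternating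
   products of [eth] and [eth'], whose commutator is a constant.

   The flux through future null infinity is a lower limit over [v = c], hence is
   bounded by an average over [c] in [[N, 2 N]]; the derivative of the cutoff
   at [3 N] controls this average for [Delta^(1/2) psi_-], and [psi_+]
   contributes at most [(tau_2 - tau_1) / N] times the energy. *)

Require Import Defs.
From HB Require Import structures.
From mathcomp Require Import all_boot all_order all_algebra.
From mathcomp Require Import all_classical all_reals all_analysis.
From mathcomp Require Import measurable_realfun.
From mathcomp Require Import complex ring lra.

Set Implicit Arguments.
Unset Strict Implicit.
Unset Printing Implicit Defensive.

Import Order.TTheory GRing.Theory Num.Theory.
Import numFieldNormedType.Exports.

Local Open Scope classical_set_scope.
Local Open Scope ring_scope.

(** * Functions with continuous partial derivatives *)

Section Partials.
Variables (R : realType) (n : nat).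
Implicit Types (F G : 'rV[R]_n -> R) (D : set 'rV[R]_n).

(** That the density is comparable rests on an identity: [- g(grad tau, grad tau)] equals
    [h' (2 r^2 - h' Delta) / r^2]. The condition on the slices thus says that the product of the two
    coefficients is bounded above and below, and the decay of [H_fol] bounds [h'] itself. No power
    of [r] is lost. The weight [1 / r] in the commuted estimate is forced by the commutator term
    [4 b r <d_tau Y^(b-1) Q, Y^b Q>]: divided by [r] it has a bounded coefficient, while the
    red-shift term stays above [2 |Y^b Q|^2]. The price is an energy that degenerates at infinity,
    repaired by solving the equation for the top derivative. The factor [e^(k t)] turns a source
    merely bounded in time into a bound without growth, since the integral of [e^(k s)] up to [t] is
    at most [e^(k t) / k]. Two restrictions shape the argument. The equations are given only for
    [rho > 2M] and [tau >= tau0], so they are differentiated in the open set [Oset] and the initial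
    slice is treated apart. And [Phi_-] need not be smooth at the horizon, so the estimates are for
    [psi_-], and [Phi_-] enters only through its modulus. *)

Definition e_ (i : 'I_n) : 'rV[R]_n := delta_mx 0 i.

Lemma is_derive_line F (q v : 'rV[R]_n) (s : R) : derivable F (q + s *: v) v ->
  is_derive s (1 : R) (fun t : R => F (q + t *: v)) ('D_v F (q + s *: v)).
Proof.
move=> dF.
have E : (fun h : R => h^-1 *: (F (q + (h *: (1:R) + s) *: v) - F (q + s *: v))) =
         (fun h : R => h^-1 *: (F (h *: v + (q + s *: v)) - F (q + s *: v))).
  apply/funext => h; congr (_ *: (F _ - _)).
  by rewrite [h *: (1 : R)]mulr1 scalerDl addrCA.
by apply: DeriveDef; rewrite /derivable /derive /= E.
Qed.

(** Increments of either sign are needed: both the coordinate increments and the parameter of the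
    second differences below have arbitrary sign. *)
Lemma MVT_signed (f df : R -> R) (h : R) :
  (forall s, `|s| <= `|h| -> is_derive s (1 : R) f (df s)) ->
  exists2 c, `|c| <= `|h| & f h - f 0 = df c * h.
Proof.
move=> dfd; have [h0|h0] := leP 0 h.
  have [||c] := @MVT_segment R f df 0 h h0.
  - move=> x; rewrite in_itv/= => /andP[x0 xh]; apply: dfd.
    by rewrite !ger0_norm// ltW.
  - apply: derivable_within_continuous => x; rewrite in_itv/= => /andP[x0 xh].
    by have := dfd x; rewrite !ger0_norm// => /(_ xh) [].
  rewrite in_itv/= subr0 => /andP[c0 ch ->]; exists c => //.
  by rewrite !ger0_norm.
have [||c] := @MVT_segment R f df h 0 (ltW h0).
- move=> x; rewrite in_itv/= => /andP[x0 xh]; apply: dfd.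
  by rewrite !ltr0_norm// lerN2 ltW.
- apply: derivable_within_continuous => x; rewrite in_itv/= => /andP[x0 xh].
  by have := dfd x; rewrite ler0_norm// ltr0_norm// lerN2 => /(_ x0) [].
rewrite in_itv/= => /andP[c0 ch E]; exists c.
  by rewrite ler0_norm// ltr0_norm// lerN2.
by rewrite -opprB E sub0r mulrN opprK.
Qed.

Lemma continuous_bigsum (T : topologicalType) (I : Type) (r : seq I)
    (f : I -> T -> R) (x : T) :
  (forall i, {for x, continuous (f i)}) ->
  {for x, continuous (fun v => \sum_(i <- r) f i v)}.
Proof.
move=> cf; elim: r => [|i r IH].
  rewrite (_ : (fun _ => _) = cst 0); first exact: cvg_cst.
  by apply/funext => v; rewrite big_nil.
rewrite (_ : (fun _ => _) = (fun v => f i v + \sum_(j <- r) f j v)).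
  by apply: (continuousD (cf i) IH).
by apply/funext => v; rewrite big_cons.
Qed.

Lemma norm_coord (x : 'rV[R]_n) i : `|x 0 i| <= `|x|.
Proof.
rewrite [leRHS]/Num.norm /= mx_normrE.
by apply: (le_bigmax _ (fun j : 'I_1 * 'I_n => `|x j.1 j.2|) (0, i)).
Qed.

Lemma norm_rV_le (x : 'rV[R]_n) (c : R) : 0 <= c ->
  (forall i, `|x 0 i| <= c) -> `|x| <= c.
Proof.
move=> c0 xc; rewrite [leLHS]/Num.norm /= mx_normrE; apply: bigmax_le => // -[j i] _.
by rewrite (ord1 j).
Qed.

Lemma e_E i j : e_ i 0 j = (i == j)%:R.
Proof. by rewrite mxE eqxx eq_sym. Qed.

(* The increments along the coordinate axes are compared with the partial
   derivatives at x by the mean value theorem. *)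
Lemma partials_increment F (x : 'rV[R]_n) :
  (\forall y \near x, forall i, derivable F y (e_ i)) ->
  (forall i, {for x, continuous ('D_(e_ i) F)}) ->
  forall eps : R, 0 < eps -> \forall h \near (0 : 'rV[R]_n),
    `|F (h + x) - F x - \sum_i h 0 i * 'D_(e_ i) F x| <= eps * `|h|.
Proof.
move=> dF cF eps eps0.
have e0 : 0 < eps / n.+1%:R by rewrite divr_gt0.
have cF' : \forall y \near x, forall i, `|'D_(e_ i) F x - 'D_(e_ i) F y| <= eps / n.+1%:R.
  have H i : \forall y \near x, `|'D_(e_ i) F x - 'D_(e_ i) F y| <= eps / n.+1%:R.
    by have /cvgrPdist_le/(_ _ e0) := cF i.
  exact: (filter_forall _ H).
have /nbhs_normP[d /= d0 dP] : nbhs x [set y | (forall i, derivable F y (e_ i)) /\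
   forall i, `|'D_(e_ i) F x - 'D_(e_ i) F y| <= eps / n.+1%:R].
  by apply: filterI.
apply/nbhs_normP; exists d => // h /=; rewrite sub0r normrN => hd.
(* Staircase from [0] to [h]: [t k] keeps the first [k] coordinates of [h]. Points met on the way
   differ from [x] by at most [|h|] in each coordinate, so they stay in the ball where the partial
   derivatives are close to those at [x]. *)
pose t k : 'rV[R]_n := \row_j (if (j < k)%N then h 0 j else 0).
have t0 : t 0%N = 0 by apply/rowP => j; rewrite !mxE.
have tn : t n = h by apply/rowP => j; rewrite !mxE ltn_ord.
have tS (k : 'I_n) : t k.+1 = t k + h 0 k *: e_ k.
  apply/rowP => j; rewrite !mxE eqxx /= ltnS leq_eqVlt -val_eqE /=.
  have [jk|jk] := eqVneq (j : nat) k.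
    by rewrite (_ : j = k) ?ltnn ?mulr1 ?add0r//; exact: val_inj.
  by rewrite mulr0 addr0.
have -> : F (h + x) - F x = \sum_(k < n) (F (x + t k.+1) - F (x + t k)).
  rewrite -(big_mkord xpredT (fun k => F (x + t k.+1) - F (x + t k))) telescope_sumr//.
  by rewrite tn t0 addr0 [h + x]addrC.
rewrite -sumrB.
apply: (le_trans (ler_norm_sum _ _ _)).
apply: (@le_trans _ _ (\sum_(k < n) eps / n.+1%:R * `|h|)); last first.
  rewrite sumr_const card_ord -[leLHS]mulr_natl mulrA ler_wpM2r// mulrCA.
  by rewrite ler_piMr ?(ltW eps0)// ler_pdivrMr// mul1r ler_nat.
apply: ler_sum => k _.
have near_x s : `|s| <= `|h 0 k| -> `|x - ((x + t k) + s *: e_ k)| < d.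
  move=> sh; apply: le_lt_trans hd.
  rewrite opprD addrA opprD addrA subrr sub0r -opprD normrN.
  apply: norm_rV_le => // j; rewrite !mxE eqxx /=.
  have [->|jk] := eqVneq j k; first by rewrite ltnn mulr1 add0r (le_trans sh)// norm_coord.
  by rewrite mulr0 addr0; case: ifP => _; rewrite ?normr0 ?norm_coord.
have [s sh|c ch] := @MVT_signed (fun s => F ((x + t k) + s *: e_ k))
  (fun s => 'D_(e_ k) F ((x + t k) + s *: e_ k)) (h 0 k).
  by apply: is_derive_line; have [+ _] := dP _ (near_x _ sh); exact.
rewrite scale0r addr0 -addrA -tS => ->.
rewrite mulrC -mulrBr normrM mulrC; apply: ler_pM => //; last exact: norm_coord.
by have [_ /(_ k)] := dP _ (near_x _ ch); rewrite distrC.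
Qed.

Lemma differentiable_partials F (x : 'rV[R]_n) :
  (\forall y \near x, forall i, derivable F y (e_ i)) ->
  (forall i, {for x, continuous ('D_(e_ i) F)}) ->
  differentiable F x /\ forall v, 'd F x v = \sum_i v 0 i * 'D_(e_ i) F x.
Proof.
move=> dF cF.
pose L (v : 'rV[R]_n) : R^o := \sum_i v 0 i * 'D_(e_ i) F x.
have Llin : linear L.
  move=> a u v; rewrite /L scaler_sumr -big_split /=; apply: eq_bigr => i _.
  by rewrite !mxE mulrDl /GRing.scale /= mulrA.
pose lL := GRing.isLinear.Build _ _ _ _ _ Llin.
pose Ll : {linear 'rV[R]_n -> R^o} := HB.pack L lL.
have cL : continuous Ll.
  move=> v; rewrite /Ll /= /L.
  by apply: continuous_bigsum => i; apply: (@continuousM _ _ (fun v : 'rV[R]_n => v 0 i)); [exact: coord_continuous|exact: cst_continuous].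
have E : F \o shift x = cst (F x) + Ll +o_ (0 : 'rV[R]_n) id.
  apply/eqaddoP => _/posnumP[e].
  have := partials_increment dF cF [gt0 of e%:num].
  apply: filterS => h /=; rewrite /Ll /= /L.
  by rewrite opprD addrA.
have dE : 'd F x = Ll :> (_ -> _) by apply: diff_unique.
split; last by move=> v; rewrite dE.
by apply/diff_locallyP; rewrite dE.
Qed.

(** The chain rule along a curve, by way of the total differential. The polar change of coordinates
    is given by its components, so the derivative of the curve is also asked coordinatewise. *)
Lemma is_derive_curve F (g dg : R -> 'rV[R]_n) (t : R) :
  (\forall y \near g t, forall i, derivable F y (e_ i)) ->
  (forall i, {for g t, continuous ('D_(e_ i) F)}) ->
  (forall i, is_derive t (1 : R) (fun s => g s 0 i) (dg t 0 i)) ->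
  is_derive t (1 : R) (F \o g) (\sum_i dg t 0 i * 'D_(e_ i) F (g t)).
Proof.
move=> dF cF dg'.
have [diF dFE] := differentiable_partials dF cF.
have dgt : derivable g t 1.
  apply/derivable_mxP => i j; rewrite (ord1 i).
  by have [] := dg' j.
have digt : differentiable g t by apply/derivable1_diffP.
have dgE : 'D_1 g t = dg t.
  rewrite derive_mx//; apply/rowP => j; rewrite mxE.
  by have [_] := dg' j.
apply: DeriveDef.
  by apply/derivable1_diffP; exact: differentiable_comp.
rewrite deriveE; last exact: differentiable_comp.
by rewrite diff_comp//= dFE -deriveE// dgE.
Qed.

(** The order is finite because the neighbourhood on which [h] can be differentiated depends on the
    order; every statement is made at a fixed order, on a set that may shrink with it. The closure
    properties follow by induction on [k]. *)
Fixpoint Cn (k : nat) D F : Prop :=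
  (forall x, D x -> {for x, continuous F}) /\
  if k is k'.+1 then forall i,
    (forall x, D x -> derivable F x (e_ i)) /\ Cn k' D ('D_(e_ i) F)
  else True.

Lemma Cn_continuous k D F x : Cn k D F -> D x -> {for x, continuous F}.
Proof. by case: k => [|k] [+ _] Dx; exact. Qed.

Lemma Cn_derivable k D F i x : Cn k.+1 D F -> D x -> derivable F x (e_ i).
Proof. by move=> [_ /(_ i)[+ _]] Dx; exact. Qed.

Lemma Cn_D k D F i : Cn k.+1 D F -> Cn k D ('D_(e_ i) F).
Proof. by move=> [_ /(_ i)[]]. Qed.

Lemma Cn_sub k D D' F : D' `<=` D -> Cn k D F -> Cn k D' F.
Proof.
move=> DD'; elim: k F => [|k IH] F [cF dF].
  by split=> // x /DD' /cF.
split=> [x /DD' /cF//|i]; have [dFi CFi] := dF i.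
by split=> [x /DD' /dFi//|]; exact: IH.
Qed.

Lemma Cn_leS k D F : Cn k.+1 D F -> Cn k D F.
Proof.
elim: k F => [|k IH] F [cF dF]; first by split.
split=> // i; have [? ?] := dF i; split=> //; exact: IH.
Qed.

Lemma Cn_le k l D F : (k <= l)%N -> Cn l D F -> Cn k D F.
Proof.
move=> /subnKC <-; elim: (l - k)%N => [|m IH]; first by rewrite addn0.
by rewrite addnS => /Cn_leS.
Qed.

Lemma near_eq_for (T : topologicalType) (D : set T) (A B : T -> R) (x : T) :
  open D -> (forall y, D y -> A y = B y) -> D x -> {near x, A =1 B}.
Proof.
move=> oD AB Dx; have : nbhs x D by apply: open_nbhs_nbhs.
by apply: filterS => y /AB.
Qed.

Lemma eq_on_continuous (T : topologicalType) (D : set T) (A B : T -> R) (x : T) :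
  open D -> (forall y, D y -> A y = B y) -> D x ->
  {for x, continuous A} -> {for x, continuous B}.
Proof.
move=> oD AB Dx cA; rewrite /prop_for /continuous_at -(AB x Dx).
apply: cvg_trans cA; apply: near_eq_cvg.
exact: (near_eq_for oD AB Dx).
Qed.

Lemma eq_on_derive D F G x v : open D -> (forall y, D y -> F y = G y) -> D x ->
  'D_v F x = 'D_v G x.
Proof.
move=> oD FG Dx; have [->|v0] := eqVneq v 0; first by rewrite !derive0.
apply: near_eq_derive => //; exact: (near_eq_for oD FG Dx).
Qed.

Lemma eq_on_derivable D F G x v : open D -> (forall y, D y -> F y = G y) -> D x ->
  derivable F x v -> derivable G x v.
Proof.
move=> oD FG Dx; have [->|v0] := eqVneq v 0; first by move=> _; exact: derivable0.
apply: near_eq_derivable => //; exact: (near_eq_for oD FG Dx).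
Qed.

Lemma eq_Cn k D F G : open D -> (forall x, D x -> F x = G x) ->
  Cn k D F -> Cn k D G.
Proof.
move=> oD; elim: k F G => [|k IH] F G FG [cF dF].
  by split=> // x Dx; apply: (eq_on_continuous oD FG Dx); exact: cF.
split=> [x Dx|i]; first by apply: (eq_on_continuous oD FG Dx); exact: cF.
have [dFi CFi] := dF i; split=> [x Dx|].
  by apply: (eq_on_derivable oD FG Dx); exact: dFi.
by apply: IH CFi => x Dx; exact: (eq_on_derive _ oD FG Dx).
Qed.

Lemma Cn_cst k D (c : R) : open D -> Cn k D (cst c).
Proof.
move=> oD; elim: k c => [|k IH] c; first by split=> // x _; exact: cst_continuous.
split=> [x _|i]; first exact: cst_continuous.
split=> [x _|]; first exact: derivable_cst.
by apply: (@eq_Cn _ _ (cst 0)) => // x _; rewrite derive_cst.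
Qed.

Lemma CnD k D F G : open D -> Cn k D F -> Cn k D G -> Cn k D (F \+ G).
Proof.
move=> oD; elim: k F G => [|k IH] F G [cF dF] [cG dG].
  by split=> // x Dx; exact: (continuousD (cF _ Dx) (cG _ Dx)).
split=> [x Dx|i]; first by exact: (continuousD (cF _ Dx) (cG _ Dx)).
have [dFi CFi] := dF i; have [dGi CGi] := dG i; split=> [x Dx|].
  by apply: derivableD; [exact: dFi|exact: dGi].
apply: (@eq_Cn _ _ ('D_(e_ i) F \+ 'D_(e_ i) G)) => //; last exact: IH.
by move=> x Dx; rewrite /= deriveD//; [exact: dFi|exact: dGi].
Qed.

Lemma CnM k D F G : open D -> Cn k D F -> Cn k D G -> Cn k D (F \* G).
Proof.
move=> oD; elim: k F G => [|k IH] F G CF CG.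
  by split=> // x Dx; exact: (continuousM (Cn_continuous CF Dx) (Cn_continuous CG Dx)).
split=> [x Dx|i].
  by exact: (continuousM (Cn_continuous CF Dx) (Cn_continuous CG Dx)).
split=> [x Dx|].
  exact: (derivableM (Cn_derivable (i:=i) CF Dx) (Cn_derivable (i:=i) CG Dx)).
apply: (@eq_Cn _ _ ((F \* 'D_(e_ i) G) \+ (G \* 'D_(e_ i) F))) => //.
  by move=> x Dx; rewrite /= (deriveM (Cn_derivable (i:=i) CF Dx) (Cn_derivable (i:=i) CG Dx)).
by apply: CnD => //; apply: IH => //; do ?[exact: Cn_leS|exact: Cn_D].
Qed.

Lemma CnZ k D (c : R) F : open D -> Cn k D F -> Cn k D (fun x => c * F x).
Proof. by move=> oD CF; apply: (@CnM _ _ (cst c)) => //; exact: Cn_cst. Qed.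

Lemma CnB k D F G : open D -> Cn k D F -> Cn k D G -> Cn k D (F \- G).
Proof.
move=> oD CF CG; apply: (@eq_Cn _ _ (F \+ (fun x => -1 * G x))) => //.
  by move=> x _ /=; rewrite mulN1r.
by apply: CnD => //; exact: CnZ.
Qed.

Lemma derivable_coord (i j : 'I_n) (x : 'rV[R]_n) :
  is_derive x (e_ j) (fun y : 'rV[R]_n => y 0 i) (i == j)%:R.
Proof.
have E : (fun h : R => h^-1 *: ((h *: e_ j + x) 0 i - x 0 i)) =
   (fun h : R => h^-1 * h * (i == j)%:R).
  apply/funext => h; rewrite !mxE addrK eqxx /= [_ *: _]mulrA //.
have H : h^-1 * h * (i == j)%:R @[h --> (0:R)^'] --> ((i == j)%:R : R).
  rewrite -[X in _ --> X]mul1r; apply: cvgM; last exact: cvg_cst.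
  apply: (@cvg_trans _ ((cst 1 : R -> R) @ 0^')); last exact: cvg_cst.
  apply: near_eq_cvg; near=> h; rewrite /= mulVf//; near: h.
  exact: nbhs_dnbhs_neq.
apply: DeriveDef; first by apply/cvg_ex; exists (i == j)%:R; rewrite /= E.
by rewrite /derive /= E; exact: cvg_lim.
Unshelve. all: by end_near. Qed.

Lemma Cn_coord k D (i : 'I_n) : open D -> Cn k D (fun x => x 0 i).
Proof.
move=> oD; case: k => [|k].
  by split=> // x _; exact: coord_continuous.
split=> [x _|j]; first exact: coord_continuous.
split=> [x _|]; first by have [] := derivable_coord i j x.
apply: (@eq_Cn _ _ (cst (i == j)%:R)) => //; last exact: Cn_cst.
by move=> x _; have [_ ->] := derivable_coord i j x.
Qed.

Lemma is_derive_comp_coord (g : R -> R) (i j : 'I_n) (x : 'rV[R]_n) (d : R) :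
  is_derive (x 0 i) (1 : R) g d ->
  is_derive x (e_ j) (fun y : 'rV[R]_n => g (y 0 i)) ((i == j)%:R * d).
Proof.
move=> [dg gd]; have [<-|ij] := eqVneq i j.
  have E : (fun h : R => h^-1 *: (g ((h *: e_ i + x) 0 i) - g (x 0 i))) =
           (fun h : R => h^-1 *: (g (h *: (1:R) + x 0 i) - g (x 0 i))).
    by apply/funext => h; rewrite !mxE !eqxx.
  apply: DeriveDef; first by move: dg; rewrite /derivable /= E.
  by rewrite /derive /= E mul1r -gd.
have E : (fun h : R => h^-1 *: (g ((h *: e_ j + x) 0 i) - g (x 0 i))) = cst 0.
  by apply/funext => h; rewrite !mxE eqxx /= (negbTE ij) mulr0 add0r subrr scaler0.
apply: DeriveDef; first by apply/cvg_ex; exists 0; rewrite /= E; exact: cvg_cst.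
by rewrite /derive /= E mul0r; apply: cvg_lim => //; exact: cvg_cst.
Qed.

(* The mean value theorem, applied twice, to the second difference. *)
Lemma second_difference D F (i j : 'I_n) (x : 'rV[R]_n) : open D -> Cn 2 D F -> D x ->
  \forall t \near (0 : R)^', exists2 y : 'rV[R]_n, `|x - y| <= 2 * `|t| &
    F (x + t *: e_ i + t *: e_ j) - F (x + t *: e_ i) - (F (x + t *: e_ j) - F x)
    = t * t * 'D_(e_ j) ('D_(e_ i) F) y.
Proof.
move=> oD CF Dx.
have : nbhs x D by apply: open_nbhs_nbhs.
move=> /nbhs_normP[d /= d0 dP].
have inD (y z : R) k l (t : R) : `|y| <= `|t| -> `|z| <= `|t| -> `|t| < d / 2 ->
    D (x + y *: e_ k + z *: e_ l) /\ `|x - (x + y *: e_ k + z *: e_ l)| <= 2 * `|t|.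
  move=> yt zt td.
  have ne m : `|e_ m| <= 1.
    apply: norm_rV_le => // o; rewrite e_E; case: (_ == _); by rewrite ?normr1 ?normr0.
  have H : `|x - (x + y *: e_ k + z *: e_ l)| <= 2 * `|t|.
    rewrite opprD addrA opprD addrA subrr add0r -opprD normrN (le_trans (ler_normD _ _))//.
    rewrite !normrZ mulrDl !mul1r; apply: lerD.
      by rewrite -[leRHS]mulr1 ler_pM.
    by rewrite -[leRHS]mulr1 ler_pM.
  split=> //; apply: dP; rewrite /= (le_lt_trans H)// mulrC -ltr_pdivlMr//.
near=> t.
have td : `|t| < d / 2.
  near: t; apply/nbhs_dnbhs/nbhs_normP; exists (d / 2); first by rewrite /= divr_gt0.
  by move=> z /=; rewrite sub0r normrN.
have L0 y k l z : `|y| <= `|t| -> `|z| <= `|t| -> D (x + y *: e_ k + z *: e_ l).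
  by move=> yt zt; have [] := inD y z k l t yt zt td.
have L1 y k : `|y| <= `|t| -> D (x + y *: e_ k).
  by move=> yt; have := L0 y k k 0 yt; rewrite normr0 normr_ge0 scale0r addr0 => /(_ isT).
have [s st|c ct] := @MVT_signed
   (fun s => F (x + t *: e_ j + s *: e_ i) - F (x + s *: e_ i))
   (fun s => 'D_(e_ i) F (x + t *: e_ j + s *: e_ i) - 'D_(e_ i) F (x + s *: e_ i)) t.
  by apply: is_deriveB; apply: is_derive_line; apply: (Cn_derivable CF); do ?[exact: L0|exact: L1].
rewrite !scale0r !addr0 [X in F X - _ - _]addrAC => ->.
have [s st|c' c't] := @MVT_signed
   (fun s => 'D_(e_ i) F (x + c *: e_ i + s *: e_ j))
   (fun s => 'D_(e_ j) ('D_(e_ i) F) (x + c *: e_ i + s *: e_ j)) t.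
  by apply: is_derive_line; apply: (Cn_derivable (Cn_D i CF)); exact: L0.
rewrite scale0r addr0 [x + t *: _ + _]addrAC => ->.
exists (x + c *: e_ i + c' *: e_ j); last by rewrite [RHS]mulrC mulrA.
by have [] := inD c c' i j t ct c't td.
Unshelve. all: by end_near. Qed.

(** The second difference is symmetric in [i] and [j]. Dividing by [t^2] shows that the two mixed
    derivatives agree at two points within [2 |t|] of [x]; continuity at [x] concludes as [t] tends
    to [0]. *)
Lemma schwarz D F (i j : 'I_n) (x : 'rV[R]_n) : open D -> Cn 2 D F -> D x ->
  'D_(e_ j) ('D_(e_ i) F) x = 'D_(e_ i) ('D_(e_ j) F) x.
Proof.
move=> oD CF Dx.
have H1 := second_difference i j oD CF Dx.
have H2 := second_difference j i oD CF Dx.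
have close (G : 'rV[R]_n -> R) (e : R) : {for x, continuous G} -> 0 < e ->
   \forall t \near (0 : R)^', forall y, `|x - y| <= 2 * `|t| -> `|G x - G y| < e.
  move=> /cvgrPdist_lt/(_ _) /[apply] /nbhs_normP[d /= d0 dP].
  near=> t => y xy; apply: dP; rewrite /= (le_lt_trans xy)// mulrC -ltr_pdivlMr//.
  near: t; apply/nbhs_dnbhs/nbhs_normP; exists (d / 2); first by rewrite /= divr_gt0.
  by move=> z /=; rewrite sub0r normrN.
have c1 : {for x, continuous ('D_(e_ j) ('D_(e_ i) F))}.
  exact: Cn_continuous (Cn_D _ (Cn_D _ CF)) Dx.
have c2 : {for x, continuous ('D_(e_ i) ('D_(e_ j) F))}.
  exact: Cn_continuous (Cn_D _ (Cn_D _ CF)) Dx.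
have tri (a b c e : R) : `|a - b| < e / 2 -> `|c - b| < e / 2 -> `|a - c| <= e.
  by rewrite !ltr_norml ler_norml => /andP[? ?] /andP[? ?]; apply/andP; split; lra.
apply/eqP; rewrite -subr_eq0 -normr_le0; apply/ler_addgt0Pr => e e0; rewrite add0r.
have e2 : 0 < e / 2 by rewrite divr_gt0.
have FF := @dnbhs_filter R (0 : R).
have A := filterI (close _ _ c1 e2) (close _ _ c2 e2).
have t0 : \forall t \near (0 : R)^', t != 0 by exact: nbhs_dnbhs_neq.
have [t [[[y1 xy1 E1] [y2 xy2 E2]] [[A1 A2] {}t0]]] :=
  @filter_ex _ _ (@Proper_dnbhs_numFieldType R 0) _
    (@filterI _ _ FF _ _ (@filterI _ _ FF _ _ H1 H2) (@filterI _ _ FF _ _ (A FF) t0)).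
have E : 'D_(e_ j) ('D_(e_ i) F) y1 = 'D_(e_ i) ('D_(e_ j) F) y2.
  apply: (@mulfI _ (t * t)); first by rewrite mulf_neq0.
  apply: etrans (esym E1) _; apply: etrans _ E2; rewrite (addrAC x (t *: e_ j)).
  by have sw (a b c d : R) : a - b - (c - d) = a - c - (b - d) by [ring]; exact: sw.
have {}A1 := A1 _ xy1; have {}A2 := A2 _ xy2.
rewrite E in A1; exact: tri A1 A2.
Unshelve. all: by end_near. Qed.

End Partials.

Definition o0 : 'I_4 := Ordinal (isT : (0 < 4)%N).
Definition o1 : 'I_4 := Ordinal (isT : (1 < 4)%N).
Definition o2 : 'I_4 := Ordinal (isT : (2 < 4)%N).
Definition o3 : 'I_4 := Ordinal (isT : (3 < 4)%N).

Lemma I4_0 : (0 : 'I_4) = o0. Proof. exact: val_inj. Qed.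
Lemma I4_1 : (1 : 'I_4) = o1. Proof. exact: val_inj. Qed.

Lemma I4_ind (P : 'I_4 -> Prop) : P o0 -> P o1 -> P o2 -> P o3 -> forall i, P i.
Proof.
move=> P0 P1 P2 P3 [[|[|[|[|i]]]] Hi] //.
- by rewrite (_ : Ordinal Hi = o0)//; exact: val_inj.
- by rewrite (_ : Ordinal Hi = o1)//; exact: val_inj.
- by rewrite (_ : Ordinal Hi = o2)//; exact: val_inj.
- by rewrite (_ : Ordinal Hi = o3)//; exact: val_inj.
Qed.

(** * Spin-weighted fields in stereographic charts *)

Section Charts.
Variable R : realType.
Implicit Types (V : set (R * R)) (A B F : 'rV[R]_4 -> R) (x : 'rV[R]_4).

Lemma sum_I4 (f : 'I_4 -> R) : \sum_i f i = f o0 + f o1 + f o2 + f o3.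
Proof.
rewrite !big_ord_recl big_ord0 addr0 !addrA.
by do 3?[congr (_ + _)]; congr f; exact: val_inj.
Qed.

Lemma pt4E (a b c d : R) : [/\ pt4 a b c d 0 o0 = a, pt4 a b c d 0 o1 = b,
  pt4 a b c d 0 o2 = c & pt4 a b c d 0 o3 = d].
Proof. by rewrite /pt4 !mxE. Qed.

Lemma pt4_0 (a b c d : R) : pt4 a b c d 0 o0 = a. Proof. by case: (pt4E a b c d). Qed.
Lemma pt4_1 (a b c d : R) : pt4 a b c d 0 o1 = b. Proof. by case: (pt4E a b c d). Qed.
Lemma pt4_2 (a b c d : R) : pt4 a b c d 0 o2 = c. Proof. by case: (pt4E a b c d). Qed.
Lemma pt4_3 (a b c d : R) : pt4 a b c d 0 o3 = d. Proof. by case: (pt4E a b c d). Qed.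
Definition pt4S := (pt4_0, pt4_1, pt4_2, pt4_3).

Lemma eq_pt4 (x y : 'rV[R]_4) : x 0 o0 = y 0 o0 -> x 0 o1 = y 0 o1 -> x 0 o2 = y 0 o2 ->
  x 0 o3 = y 0 o3 -> x = y.
Proof. by move=> h0 h1 h2 h3; apply/rowP; apply: I4_ind. Qed.

Lemma pt4_coord x : pt4 (x 0 o0) (x 0 o1) (x 0 o2) (x 0 o3) = x.
Proof. by apply: eq_pt4; rewrite !pt4S. Qed.

Lemma is_derive_lineP n (F : 'rV[R]_n -> R) (x v : 'rV[R]_n) (d : R) :
  is_derive (0 : R) (1 : R) (fun t : R => F (x + t *: v)) d -> is_derive x v F d.
Proof.
move=> [dF dE].
have E : (fun h : R => h^-1 *: (F (x + (h *: (1:R) + 0) *: v) - F (x + (0:R) *: v))) =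
         (fun h : R => h^-1 *: (F (h *: v + x) - F x)).
  apply/funext => h; rewrite addr0 scale0r addr0 [h *: (1:R)]mulr1.
  by rewrite (addrC x).
apply: DeriveDef; first by move: dF; rewrite /derivable E.
by rewrite -dE /derive E.
Qed.

Lemma e_4 (i j : 'I_4) (x : 'rV[R]_4) (t : R) :
  (x + t *: e_ R j) 0 i = x 0 i + t * (j == i)%:R.
Proof. by rewrite mxE [X in _ + X]mxE e_E. Qed.

Lemma continuous_pairs (T U W : topologicalType) (f : T -> U) (g : T -> W) (x : T) :
  {for x, continuous f} -> {for x, continuous g} ->
  {for x, continuous (fun y => (f y, g y))}.
Proof. by move=> cf cg; apply: (cvg_pair cf cg). Qed.

(** Two domains over the same set of [(tau, rho)]: in [dom] the last two coordinates are
    stereographic and unrestricted, in [domF] they are the angles and the poles are removed. *)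
Definition dom V : set 'rV[R]_4 := [set x | V (x 0 o0, x 0 o1)].
Definition domF V : set 'rV[R]_4 := [set x | V (x 0 o0, x 0 o1) /\ 0 < x 0 o2 < pi].

Lemma open_dom V : open V -> open (dom V).
Proof.
move=> oV; rewrite /dom.
apply: (@open_comp _ _ (fun x : 'rV[R]_4 => (x 0 o0, x 0 o1)) V) => // x _.
by apply: continuous_pairs; exact: coord_continuous.
Qed.

Lemma open_domF V : open V -> open (domF V).
Proof.
move=> oV; rewrite (_ : domF V = dom V `&` [set x | 0 < x 0 o2 < pi]).
  apply: openI; first exact: open_dom.
  apply: (@open_comp _ _ (fun x : 'rV[R]_4 => x 0 o2) [set t | 0 < t < pi]) => [x _|].
    exact: coord_continuous.
  rewrite (_ : [set t : R | 0 < t < pi] = `]0, pi[%classic); last by rewrite set_itvoo.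
  exact: interval_open.
by apply/seteqP; split => x /=.
Qed.

(** One sign serves two purposes: it distinguishes the north chart from the south chart, and raising
    from lowering of the spin weight. *)
Definition sg (b : bool) : R := if b then 1 else - 1.

Lemma sg2 b : sg b * sg b = 1.
Proof. by case: b; rewrite /sg ?mulr1 ?mulrNN ?mulr1. Qed.

Definition rad (b : bool) (theta : R) : R :=
  if b then tan (theta / 2) else (tan (theta / 2))^-1.

Lemma half_angle (theta : R) : 0 < theta < pi ->
  [/\ 0 < sin (theta / 2), 0 < cos (theta / 2),
  sin theta = 2 * sin (theta / 2) * cos (theta / 2) &
  cos theta = cos (theta / 2) ^+ 2 - sin (theta / 2) ^+ 2].
Proof.
move=> /andP[t0 tp]; split.
- apply: sin_gt0_pi; rewrite divr_gt0//= ltr_pdivrMr//.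
  by rewrite (lt_le_trans tp)// ler_peMr ?pi_ge0// ler1n.
- apply: cos_gt0_pihalf; apply/andP; split.
    rewrite (@lt_trans _ _ 0)// ?oppr_lt0 ?divr_gt0// ?pi_gt0//.
  by rewrite ltr_pM2r// invr_gt0.
- by rewrite {1}(splitr theta) sinD; ring.
- by rewrite {1}(splitr theta) cosD; ring.
Qed.

Lemma rad_gt0 b theta : 0 < theta < pi -> 0 < rad b theta.
Proof.
by move=> /half_angle[s0 c0 _ _]; case: b; rewrite /rad /tan ?invr_gt0 divr_gt0.
Qed.

Lemma sin_rad b theta : 0 < theta < pi ->
  sin theta = 2 * rad b theta / (1 + rad b theta ^+ 2).
Proof.
move=> H; have [s0 c0 -> _] := half_angle H.
have E := cos2Dsin2 (theta / 2).
rewrite /rad /tan; move: (sin _) (cos _) s0 c0 E => s c s0 c0 E; case: b.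
- rewrite expr_div_n -[in X in _ / X](divff (lt0r_neq0 (exprn_gt0 2 c0))) -mulrDl E.
  by field; rewrite gt_eqF.
- rewrite invf_div expr_div_n -[in X in _ / X](divff (lt0r_neq0 (exprn_gt0 2 s0))) -mulrDl.
  by rewrite [s ^+ 2 + _]addrC E; field; rewrite gt_eqF.
Qed.

Lemma cos_rad b theta : 0 < theta < pi ->
  cos theta = sg b * (1 - rad b theta ^+ 2) / (1 + rad b theta ^+ 2).
Proof.
move=> H; have [s0 c0 _ ->] := half_angle H.
have E := cos2Dsin2 (theta / 2).
rewrite /rad /tan; move: (sin _) (cos _) s0 c0 E => s c s0 c0 E; case: b.
- rewrite expr_div_n -[in X in _ / X](divff (lt0r_neq0 (exprn_gt0 2 c0))) -mulrDl E.
  by rewrite /sg; field; rewrite gt_eqF.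
- rewrite invf_div expr_div_n -[in X in _ / X](divff (lt0r_neq0 (exprn_gt0 2 s0))) -mulrDl.
  by rewrite [s ^+ 2 + _]addrC E /sg; field; rewrite gt_eqF.
Qed.

(** The right-hand side is, up to sign, the conformal factor of the stereographic chart. Being a
    polynomial in [rad], it lets regularity of any order follow by induction. *)
Lemma is_derive_rad b theta : 0 < theta < pi ->
  is_derive theta (1 : R) (rad b) (sg b * (1 + rad b theta ^+ 2) / 2).
Proof.
move=> H; have [s0 c0 _ _] := half_angle H.
have E := cos2Dsin2 (theta / 2).
have dh : is_derive theta (1 : R) (fun t : R => t / 2) 2^-1.
  by apply: is_derive_eq; rewrite scaler0 scaler0 add0r [LHS]mulr1.
have dt := @is_derive1_comp _ (@tan R) (fun t : R => t / 2) theta _ _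
  (is_derive_tan (lt0r_neq0 c0)) dh.
have t0 : tan (theta / 2) != 0 by rewrite gt_eqF// /tan divr_gt0.
case: b; rewrite /rad /sg.
  apply: is_derive_eq; rewrite mul1r /tan expr_div_n.
  rewrite -[X in X + _ / _](divff (lt0r_neq0 (exprn_gt0 2 c0))) -mulrDl E.
  by field; rewrite gt_eqF.
have [d1 d2] := dt.
apply: DeriveDef; first exact: derivableV.
rewrite (deriveV _ d1)// d2 /tan invf_div !expr_div_n.
rewrite -[X in X + _ / _](divff (lt0r_neq0 (exprn_gt0 2 s0))) -mulrDl
  [sin (theta / 2) ^+ 2 + _]addrC E.
by rewrite /GRing.scale /=; field; rewrite !gt_eqF.
Qed.

Definition cosf (k : R) x := cos (k * x 0 o3).
Definition sinf (k : R) x := sin (k * x 0 o3).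
Definition radf b x := rad b (x 0 o2).

Lemma is_derive_cosf (k : R) i x :
  is_derive x (e_ R i) (cosf k) ((o3 == i)%:R * - (k * sinf k x)).
Proof.
apply: (@is_derive_comp_coord _ _ (fun t => cos (k * t))).
have dk : is_derive (x 0 o3) (1 : R) (fun t : R => k * t) k.
  by apply: is_derive_eq; rewrite [LHS]mulr1.
have dt := @is_derive1_comp _ (@cos R) (fun t : R => k * t) (x 0 o3) _ _
  (is_derive_cos _) dk.
by apply: is_derive_eq; rewrite mulNr mulrC.
Qed.

Lemma is_derive_sinf (k : R) i x :
  is_derive x (e_ R i) (sinf k) ((o3 == i)%:R * (k * cosf k x)).
Proof.
apply: (@is_derive_comp_coord _ _ (fun t => sin (k * t))).
have dk : is_derive (x 0 o3) (1 : R) (fun t : R => k * t) k.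
  by apply: is_derive_eq; rewrite [LHS]mulr1.
have dt := @is_derive1_comp _ (@sin R) (fun t : R => k * t) (x 0 o3) _ _
  (is_derive_sin _) dk.
by apply: is_derive_eq; rewrite mulrC.
Qed.

Lemma is_derive_radf b i x : 0 < x 0 o2 < pi ->
  is_derive x (e_ R i) (radf b) ((o2 == i)%:R * (sg b * (1 + radf b x ^+ 2) / 2)).
Proof. by move=> H; apply: is_derive_comp_coord; exact: is_derive_rad. Qed.

Lemma cosf_sinf_Cn (k : R) n D : open D -> Cn n D (cosf k) /\ Cn n D (sinf k).
Proof.
move=> oD; elim: n => [|n [IHc IHs]].
  split; split=> // x _; apply: continuous_comp; do ?[exact: continuous_cos|exact: continuous_sin].
  - by apply: continuousM; [exact: cst_continuous|exact: coord_continuous].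
  - by apply: continuousM; [exact: cst_continuous|exact: coord_continuous].
split; split.
- by move=> x; exact: Cn_continuous IHc.
- move=> i; split=> [x _|]; first by have [] := is_derive_cosf k i x.
  apply: (@eq_Cn _ _ _ _ (fun x => ((o3 == i)%:R * - k) * sinf k x)) => //.
    by move=> x Dx; have [_ ->] := is_derive_cosf k i x; rewrite -mulrA mulNr.
  exact: CnZ.
- by move=> x; exact: Cn_continuous IHs.
- move=> i; split=> [x _|]; first by have [] := is_derive_sinf k i x.
  apply: (@eq_Cn _ _ _ _ (fun x => ((o3 == i)%:R * k) * cosf k x)) => //.
    by move=> x Dx; have [_ ->] := is_derive_sinf k i x; rewrite -mulrA.
  exact: CnZ.
Qed.

Lemma radf_Cn b n V : open V -> Cn n (domF V) (radf b).
Proof.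
move=> /open_domF oD.
have cr x : domF V x -> {for x, continuous (radf b)}.
  move=> [_ H]; apply: (@continuous_comp _ _ _ (fun x : 'rV[R]_4 => x 0 o2)).
    exact: coord_continuous.
  have [d _] := is_derive_rad b H.
  exact/differentiable_continuous/derivable1_diffP.
elim: n => [|n IH]; first by split.
split=> // i; split=> [x [_ H]|]; first by have [] := is_derive_radf b i H.
apply: (@eq_Cn _ _ _ _ (fun x => ((o2 == i)%:R * sg b / 2) * (1 + radf b x * radf b x))) => //.
  by move=> x [_ H]; have [_ ->] := is_derive_radf b i H; rewrite expr2; ring.
by apply: CnZ => //; apply: (@CnD _ _ _ _ (cst 1)) => //; [exact: Cn_cst|exact: CnM].
Qed.

Definition polar b x : 'rV[R]_4 :=
  pt4 (x 0 o0) (x 0 o1) (radf b x * cosf 1 x) (radf b x * sinf 1 x).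

Lemma dom_polar V b x : domF V x -> dom V (polar b x).
Proof. by move=> [Vx _]; rewrite /dom /= /polar !pt4S. Qed.

(** The [i]-th column of the Jacobian matrix of [polar b]. *)
Definition dpolar b (i : 'I_4) x : 'rV[R]_4 :=
  pt4 (o0 == i)%:R (o1 == i)%:R
    ((o2 == i)%:R * (sg b * (1 + radf b x ^+ 2) / 2) * cosf 1 x
      - (o3 == i)%:R * radf b x * sinf 1 x)
    ((o2 == i)%:R * (sg b * (1 + radf b x ^+ 2) / 2) * sinf 1 x
      + (o3 == i)%:R * radf b x * cosf 1 x).

Lemma is_derive_polar V b A i x : open V -> Cn 1 (dom V) A -> domF V x ->
  is_derive x (e_ R i) (A \o polar b)
    (\sum_j dpolar b i x 0 j * 'D_(e_ R j) A (polar b x)).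
Proof.
move=> oV CA Dx; apply: is_derive_lineP.
have p0 : polar b (x + (0 : R) *: e_ R i) = polar b x by rewrite scale0r addr0.
have := @is_derive_curve R 4 A (fun t => polar b (x + t *: e_ R i))
  (fun=> dpolar b i x) 0.
rewrite /= p0; apply.
- have : nbhs (polar b x) (dom V).
    by apply: open_nbhs_nbhs; split; [exact: open_dom|exact: dom_polar].
  by apply: filterS => y Vy j; apply: (Cn_derivable CA).
- by move=> j; apply: Cn_continuous (Cn_D j CA) (dom_polar b Dx).
have dline (G : 'rV[R]_4 -> R) (d : R) : is_derive x (e_ R i) G d ->
    is_derive (0 : R) (1 : R) (fun t : R => G (x + t *: e_ R i)) d.
  move=> [dG <-]; have := @is_derive_line _ _ G x (e_ R i) 0.
  by rewrite scale0r addr0; exact.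
have [_ H] := Dx.
apply: I4_ind.
- rewrite /polar /dpolar; under eq_fun do rewrite pt4S.
  by rewrite pt4S; exact: (dline (fun y => y 0 o0) _ (derivable_coord o0 i x)).
- rewrite /polar /dpolar; under eq_fun do rewrite pt4S.
  by rewrite pt4S; exact: (dline (fun y => y 0 o1) _ (derivable_coord o1 i x)).
- rewrite /polar /dpolar; under eq_fun do rewrite pt4S.
  rewrite pt4S; apply: (dline (fun y => radf b y * cosf 1 y)).
  have := is_deriveM (is_derive_radf b i H) (is_derive_cosf 1 i x).
  by move=> d; apply: (is_derive_eq d); rewrite /GRing.scale /=; ring.
- rewrite /polar /dpolar; under eq_fun do rewrite pt4S.
  rewrite pt4S; apply: (dline (fun y => radf b y * sinf 1 y)).
  have := is_deriveM (is_derive_radf b i H) (is_derive_sinf 1 i x).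
  by move=> d; apply: (is_derive_eq d); rewrite /GRing.scale /=; ring.
Qed.

Lemma continuous_rV (T : topologicalType) n (f : T -> 'rV[R]_n) (x : T) :
  (forall i, {for x, continuous (fun y => f y 0 i)}) -> {for x, continuous f}.
Proof.
move=> cf; apply/cvgrPdist_le => e e0.
have H i : \forall t \near x, `|f x 0 i - f t 0 i| <= e.
  by have /cvgrPdist_le/(_ _ e0) := cf i.
have := filter_forall (nbhs_filter x) H.
apply: filterS => t ft; apply: norm_rV_le; first exact: ltW.
by move=> i; rewrite !mxE.
Qed.

Lemma Cn_polar k V b A : open V -> Cn k (dom V) A -> Cn k (domF V) (A \o polar b).
Proof.
move=> oV; have oD := open_domF oV.
have Cr n : Cn n (domF V) (radf b) by exact: radf_Cn.
have Cc n : Cn n (domF V) (cosf 1) by have [] := @cosf_sinf_Cn 1 n _ oD.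
have Cs n : Cn n (domF V) (sinf 1) by have [] := @cosf_sinf_Cn 1 n _ oD.
have cp x : domF V x -> {for x, continuous (polar b)}.
  move=> Dx; apply: continuous_rV; apply: I4_ind.
  - have -> : (fun y => polar b y 0 o0) = (fun y => y 0 o0).
      by apply/funext => y; rewrite /polar pt4S.
    exact: coord_continuous.
  - have -> : (fun y => polar b y 0 o1) = (fun y => y 0 o1).
      by apply/funext => y; rewrite /polar pt4S.
    exact: coord_continuous.
  - have -> : (fun y => polar b y 0 o2) = (fun y => radf b y * cosf 1 y).
      by apply/funext => y; rewrite /polar pt4S.
    by apply: continuousM; [exact: Cn_continuous (Cr 0%N) Dx|exact: Cn_continuous (Cc 0%N) Dx].
  - have -> : (fun y => polar b y 0 o3) = (fun y => radf b y * sinf 1 y).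
      by apply/funext => y; rewrite /polar pt4S.
    by apply: continuousM; [exact: Cn_continuous (Cr 0%N) Dx|exact: Cn_continuous (Cs 0%N) Dx].
have Cd n i j : Cn n (domF V) (fun x => dpolar b i x 0 j).
  move: j; apply: I4_ind; rewrite /dpolar; under eq_fun do rewrite pt4S.
  - exact: Cn_cst.
  - exact: Cn_cst.
  - apply: (@eq_Cn _ _ _ _ ((fun x => (o2 == i)%:R * sg b / 2 * ((1 + radf b x * radf b x) * cosf 1 x))
      \- (fun x => (o3 == i)%:R * (radf b x * sinf 1 x)))) => //.
      by move=> x _ /=; rewrite expr2; ring.
    apply: CnB => //; apply: CnZ => //; apply: CnM => //.
    by apply: (@CnD _ _ _ _ (cst 1)) => //; [exact: Cn_cst|exact: CnM].
  - apply: (@eq_Cn _ _ _ _ ((fun x => (o2 == i)%:R * sg b / 2 * ((1 + radf b x * radf b x) * sinf 1 x))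
      \+ (fun x => (o3 == i)%:R * (radf b x * cosf 1 x)))) => //.
      by move=> x _ /=; rewrite expr2; ring.
    apply: CnD => //; apply: CnZ => //; apply: CnM => //.
    by apply: (@CnD _ _ _ _ (cst 1)) => //; [exact: Cn_cst|exact: CnM].
elim: k A => [|k IH] A CA.
  split=> // x Dx; apply: continuous_comp; first exact: cp.
  exact: Cn_continuous CA (dom_polar b Dx).
have C1 : Cn 1 (dom V) A by exact: Cn_le CA.
split=> [x Dx|i].
  apply: continuous_comp; first exact: cp.
  exact: Cn_continuous CA (dom_polar b Dx).
split=> [x Dx|]; first by have [] := is_derive_polar b i oV C1 Dx.
apply: (@eq_Cn _ _ _ _ (fun x => \sum_j dpolar b i x 0 j * ('D_(e_ R j) A \o polar b) x)) => //.
  by move=> x Dx; have [_ ->] := is_derive_polar b i oV C1 Dx.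
have Ct j : Cn k (domF V) (fun x => dpolar b i x 0 j * ('D_(e_ R j) A \o polar b) x).
  by apply: CnM => //; apply: IH; exact: Cn_D.
under eq_fun do rewrite sum_I4.
apply: (@CnD _ _ _ _ (fun x => _ + _ + _)) => //.
apply: (@CnD _ _ _ _ (fun x => _ + _)) => //.
exact: CnD.
Qed.

End Charts.

(** * Action of the differential operators on the chart representatives *)

Section Fields.
Variable R : realType.
Implicit Types (V : set (R * R)) (A B F : 'rV[R]_4 -> R) (x : 'rV[R]_4) (f g : field R).

Definition fre f x : R := complex.Re (f (x 0 o0) (x 0 o1) (x 0 o2) (x 0 o3)).
Definition fim f x : R := complex.Im (f (x 0 o0) (x 0 o1) (x 0 o2) (x 0 o3)).

Lemma fre_pt4 f (a b c d : R) : fre f (pt4 a b c d) = complex.Re (f a b c d).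
Proof. by rewrite /fre !pt4S. Qed.
Lemma fim_pt4 f (a b c d : R) : fim f (pt4 a b c d) = complex.Im (f a b c d).
Proof. by rewrite /fim !pt4S. Qed.

Lemma derive1_pt4 (F : 'rV[R]_4 -> R) (a b c d : R) :
  [/\ (fun t => F (pt4 t b c d))^`()%classic a = 'D_(e_ R o0) F (pt4 a b c d),
      (fun t => F (pt4 a t c d))^`()%classic b = 'D_(e_ R o1) F (pt4 a b c d),
      (fun t => F (pt4 a b t d))^`()%classic c = 'D_(e_ R o2) F (pt4 a b c d) &
      (fun t => F (pt4 a b c t))^`()%classic d = 'D_(e_ R o3) F (pt4 a b c d)].
Proof.
have E (t : R) i : t *: e_ R i + pt4 a b c d =
    pt4 (t * (i == o0)%:R + a) (t * (i == o1)%:R + b) (t * (i == o2)%:R + c)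
      (t * (i == o3)%:R + d).
  by apply: eq_pt4; rewrite pt4S mxE [X in X + _ = _]mxE e_E !pt4S.
have K (G : R -> R) (y : R) i : (forall t, G (t + y) = F (t *: e_ R i + pt4 a b c d)) ->
    G y = F (pt4 a b c d) -> G^`()%classic y = 'D_(e_ R i) F (pt4 a b c d).
  move=> G1 G2; rewrite /derive1 /derive.
  have -> : (fun h : R => h^-1 *: (G (h + y) - G y)) =
    (fun h : R => h^-1 *: (F (h *: e_ R i + pt4 a b c d) - F (pt4 a b c d))).
    by apply/funext => t; rewrite G1 G2.
  by [].
by split; apply: K => // t; rewrite E /= ?mulr1 ?mulr0 ?add0r.
Qed.

Lemma fre_d_tau f x : fre (d_tau f) x = 'D_(e_ R o0) (fre f) x.
Proof.
rewrite -{2}(pt4_coord x); have [<- _ _ _] := derive1_pt4 (fre f) (x 0 o0) (x 0 o1) (x 0 o2) (x 0 o3).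
by rewrite /fre /d_tau /cderive1 /=; congr (_^`()%classic _); apply/funext => t; rewrite !pt4S.
Qed.
Lemma fim_d_tau f x : fim (d_tau f) x = 'D_(e_ R o0) (fim f) x.
Proof.
rewrite -{2}(pt4_coord x); have [<- _ _ _] := derive1_pt4 (fim f) (x 0 o0) (x 0 o1) (x 0 o2) (x 0 o3).
by rewrite /fim /d_tau /cderive1 /=; congr (_^`()%classic _); apply/funext => t; rewrite !pt4S.
Qed.
Lemma fre_d_rho f x : fre (d_rho f) x = 'D_(e_ R o1) (fre f) x.
Proof.
rewrite -{2}(pt4_coord x); have [_ <- _ _] := derive1_pt4 (fre f) (x 0 o0) (x 0 o1) (x 0 o2) (x 0 o3).
by rewrite /fre /d_rho /cderive1 /=; congr (_^`()%classic _); apply/funext => t; rewrite !pt4S.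
Qed.
Lemma fim_d_rho f x : fim (d_rho f) x = 'D_(e_ R o1) (fim f) x.
Proof.
rewrite -{2}(pt4_coord x); have [_ <- _ _] := derive1_pt4 (fim f) (x 0 o0) (x 0 o1) (x 0 o2) (x 0 o3).
by rewrite /fim /d_rho /cderive1 /=; congr (_^`()%classic _); apply/funext => t; rewrite !pt4S.
Qed.
Lemma fre_d_theta f x : fre (d_theta f) x = 'D_(e_ R o2) (fre f) x.
Proof.
rewrite -{2}(pt4_coord x); have [_ _ <- _] := derive1_pt4 (fre f) (x 0 o0) (x 0 o1) (x 0 o2) (x 0 o3).
by rewrite /fre /d_theta /cderive1 /=; congr (_^`()%classic _); apply/funext => t; rewrite !pt4S.
Qed.
Lemma fim_d_theta f x : fim (d_theta f) x = 'D_(e_ R o2) (fim f) x.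
Proof.
rewrite -{2}(pt4_coord x); have [_ _ <- _] := derive1_pt4 (fim f) (x 0 o0) (x 0 o1) (x 0 o2) (x 0 o3).
by rewrite /fim /d_theta /cderive1 /=; congr (_^`()%classic _); apply/funext => t; rewrite !pt4S.
Qed.
Lemma fre_d_phi f x : fre (d_phi f) x = 'D_(e_ R o3) (fre f) x.
Proof.
rewrite -{2}(pt4_coord x); have [_ _ _ <-] := derive1_pt4 (fre f) (x 0 o0) (x 0 o1) (x 0 o2) (x 0 o3).
by rewrite /fre /d_phi /cderive1 /=; congr (_^`()%classic _); apply/funext => t; rewrite !pt4S.
Qed.
Lemma fim_d_phi f x : fim (d_phi f) x = 'D_(e_ R o3) (fim f) x.
Proof.
rewrite -{2}(pt4_coord x); have [_ _ _ <-] := derive1_pt4 (fim f) (x 0 o0) (x 0 o1) (x 0 o2) (x 0 o3).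
by rewrite /fim /d_phi /cderive1 /=; congr (_^`()%classic _); apply/funext => t; rewrite !pt4S.
Qed.

(** Treating [eth] and [ethp] as one operator with a sign lets commutation, integration by parts and
    the symmetry of the Dirac system each be proved once. *)
Definition ang (e : bool) (s : R) (f : field R) : field R :=
  if e then eth s f else ethp s f.

Lemma fre_ang e s f x : fre (ang e s f) x =
  'D_(e_ R o2) (fre f) x - sg R e * (sin (x 0 o2))^-1 * 'D_(e_ R o3) (fim f) x
  - sg R e * s * (cos (x 0 o2) / sin (x 0 o2)) * fre f x.
Proof.
rewrite -fre_d_theta -fim_d_phi /fre /fim /ang /eth /ethp /sg.
case: e; move: (d_theta _ _ _ _ _) (d_phi _ _ _ _ _) (f _ _ _ _) => [? ?] [? ?] [? ?] /=; ring.
Qed.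

Lemma fim_ang e s f x : fim (ang e s f) x =
  'D_(e_ R o2) (fim f) x + sg R e * (sin (x 0 o2))^-1 * 'D_(e_ R o3) (fre f) x
  - sg R e * s * (cos (x 0 o2) / sin (x 0 o2)) * fim f x.
Proof.
rewrite -fim_d_theta -fre_d_phi /fre /fim /ang /eth /ethp /sg.
case: e; move: (d_theta _ _ _ _ _) (d_phi _ _ _ _ _) (f _ _ _ _) => [? ?] [? ?] [? ?] /=; ring.
Qed.

Section WithM.
Variables (M : R) (h : R -> R).

Lemma fre_Y f x : fre (Y M h f) x =
  h^`()%classic (x 0 o1) * 'D_(e_ R o0) (fre f) x - 'D_(e_ R o1) (fre f) x.
Proof.
rewrite -fre_d_rho -fre_d_tau /fre /Y /d_t /d_r.
move: (d_tau _ _ _ _ _) (d_rho _ _ _ _ _) => [? ?] [? ?] /=; ring.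
Qed.

Lemma fim_Y f x : fim (Y M h f) x =
  h^`()%classic (x 0 o1) * 'D_(e_ R o0) (fim f) x - 'D_(e_ R o1) (fim f) x.
Proof.
rewrite -fim_d_rho -fim_d_tau /fim /Y /d_t /d_r.
move: (d_tau _ _ _ _ _) (d_rho _ _ _ _ _) => [? ?] [? ?] /=; ring.
Qed.

End WithM.

(* [A] and [B] are the real and imaginary parts of the functions [FN] (for
   [b = true]) and [FS] of [spin_smooth]. *)
Definition rep b (s : R) V A B f := forall x, domF V x ->
  fre f x = cosf (sg R b * s) x * A (polar b x) + sinf (sg R b * s) x * B (polar b x) /\
  fim f x = cosf (sg R b * s) x * B (polar b x) - sinf (sg R b * s) x * A (polar b x).

Lemma rep_Cn k b s V A B f : open V -> Cn k (dom V) A -> Cn k (dom V) B ->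
  rep b s V A B f -> Cn k (domF V) (fre f) /\ Cn k (domF V) (fim f).
Proof.
move=> oV CA CB Hf; have oD := open_domF oV.
have [Cc Cs] := cosf_sinf_Cn (sg R b * s) k oD.
have CAp := Cn_polar b oV CA; have CBp := Cn_polar b oV CB; split.
  apply: (@eq_Cn _ _ _ _ ((cosf (sg R b * s) \* (A \o polar b)) \+
    (sinf (sg R b * s) \* (B \o polar b)))) => //.
    by move=> x /Hf [-> _].
  by apply: CnD => //; exact: CnM.
apply: (@eq_Cn _ _ _ _ ((cosf (sg R b * s) \* (B \o polar b)) \-
    (sinf (sg R b * s) \* (A \o polar b)))) => //.
  by move=> x /Hf [_ ->].
by apply: CnB => //; exact: CnM.
Qed.

Definition Dp b A i x : R := \sum_j dpolar b i x 0 j * 'D_(e_ R j) A (polar b x).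

Lemma rep_derive b s V A B f i x : open V -> Cn 1 (dom V) A -> Cn 1 (dom V) B ->
  rep b s V A B f -> domF V x -> let k := sg R b * s in let d : R := (o3 == i)%:R in
  'D_(e_ R i) (fre f) x =
    cosf k x * (Dp b A i x + d * k * B (polar b x))
     + sinf k x * (Dp b B i x - d * k * A (polar b x)) /\
  'D_(e_ R i) (fim f) x =
    cosf k x * (Dp b B i x - d * k * A (polar b x))
     - sinf k x * (Dp b A i x + d * k * B (polar b x)).
Proof.
move=> oV CA CB Hf Dx k d.
have dA := is_derive_polar b i oV CA Dx; have dB := is_derive_polar b i oV CB Dx.
have dc := is_derive_cosf k i x; have ds := is_derive_sinf k i x.
have oD := open_domF oV; split.
  rewrite (@eq_on_derive _ _ _ _ ((cosf k * (A \o polar b)) + (sinf k * (B \o polar b))) _ _ oD _ Dx).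
    have [_ ->] := is_deriveD (is_deriveM dc dA) (is_deriveM ds dB).
    by rewrite /GRing.scale /= /Dp -/d; ring.
  by move=> y /Hf [-> _].
rewrite (@eq_on_derive _ _ _ _ ((cosf k * (B \o polar b)) - (sinf k * (A \o polar b))) _ _ oD _ Dx).
  have [_ ->] := is_deriveB (is_deriveM dc dB) (is_deriveM ds dA).
  by rewrite /GRing.scale /= /Dp -/d; ring.
by move=> y /Hf [_ ->].
Qed.

Lemma DpE b A x :
  [/\ Dp b A o0 x = 'D_(e_ R o0) A (polar b x), Dp b A o1 x = 'D_(e_ R o1) A (polar b x),
  Dp b A o2 x = sg R b * (1 + radf b x ^+ 2) / 2 *
   (cosf 1 x * 'D_(e_ R o2) A (polar b x) + sinf 1 x * 'D_(e_ R o3) A (polar b x)) &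
  Dp b A o3 x = radf b x *
   (cosf 1 x * 'D_(e_ R o3) A (polar b x) - sinf 1 x * 'D_(e_ R o2) A (polar b x))].
Proof.
rewrite /Dp !sum_I4 /dpolar !pt4S /=.
move: ('D_(e_ R o0) A _) ('D_(e_ R o1) A _) ('D_(e_ R o2) A _) ('D_(e_ R o3) A _) => a0 a1 a2 a3.
by move: (radf b x) (cosf 1 x) (sinf 1 x) => r c t; split; ring.
Qed.

Lemma rep_d_tau b s V A B f : open V -> Cn 1 (dom V) A -> Cn 1 (dom V) B ->
  rep b s V A B f -> rep b s V ('D_(e_ R o0) A) ('D_(e_ R o0) B) (d_tau f).
Proof.
move=> oV CA CB Hf x Dx; rewrite fre_d_tau fim_d_tau.
have [-> ->] := rep_derive o0 oV CA CB Hf Dx.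
have [DA0 DA1 _ _] := DpE b A x; have [DB0 DB1 _ _] := DpE b B x.
by rewrite ?DA0 ?DA1 ?DB0 ?DB1 /= !mul0r !addr0 !subr0.
Qed.

Lemma rep_d_rho b s V A B f : open V -> Cn 1 (dom V) A -> Cn 1 (dom V) B ->
  rep b s V A B f -> rep b s V ('D_(e_ R o1) A) ('D_(e_ R o1) B) (d_rho f).
Proof.
move=> oV CA CB Hf x Dx; rewrite fre_d_rho fim_d_rho.
have [-> ->] := rep_derive o1 oV CA CB Hf Dx.
have [DA0 DA1 _ _] := DpE b A x; have [DB0 DB1 _ _] := DpE b B x.
by rewrite ?DA0 ?DA1 ?DB0 ?DB1 /= !mul0r !addr0 !subr0.
Qed.

Lemma rep_Y (M : R) (h : R -> R) b s V A B f : open V -> Cn 1 (dom V) A -> Cn 1 (dom V) B ->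
  rep b s V A B f ->
  rep b s V (fun x => h^`()%classic (x 0 o1) * 'D_(e_ R o0) A x - 'D_(e_ R o1) A x)
            (fun x => h^`()%classic (x 0 o1) * 'D_(e_ R o0) B x - 'D_(e_ R o1) B x) (Y M h f).
Proof.
move=> oV CA CB Hf x Dx; rewrite fre_Y fim_Y.
have [-> ->] := rep_derive o1 oV CA CB Hf Dx.
have [-> ->] := rep_derive o0 oV CA CB Hf Dx.
have [-> -> _ _] := DpE b A x; have [-> -> _ _] := DpE b B x.
rewrite {3 6 9 12}/polar !pt4S /=.
move: ('D_(e_ R o0) A _) ('D_(e_ R o1) A _) ('D_(e_ R o0) B _) ('D_(e_ R o1) B _) => a0 a1 b0 b1.
move: (h^`()%classic _) (A _) (B _) (cosf _ x) (sinf _ x) => h' a' b' c t.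
by split; ring.
Qed.

(* d_phi is x d_y - y d_x in the chart, plus the rotation of the frame. *)
Lemma rep_d_phi b s V A B f : open V -> Cn 1 (dom V) A -> Cn 1 (dom V) B ->
  rep b s V A B f ->
  rep b s V
   (fun x => x 0 o2 * 'D_(e_ R o3) A x - x 0 o3 * 'D_(e_ R o2) A x + sg R b * s * B x)
   (fun x => x 0 o2 * 'D_(e_ R o3) B x - x 0 o3 * 'D_(e_ R o2) B x - sg R b * s * A x)
   (d_phi f).
Proof.
move=> oV CA CB Hf x Dx; rewrite fre_d_phi fim_d_phi.
have [-> ->] := rep_derive o3 oV CA CB Hf Dx.
have [_ _ _ ->] := DpE b A x; have [_ _ _ ->] := DpE b B x.
have p2 : polar b x 0 o2 = radf b x * cosf 1 x by rewrite /polar pt4S.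
have p3 : polar b x 0 o3 = radf b x * sinf 1 x by rewrite /polar pt4S.
rewrite p2 p3 /=.
move: ('D_(e_ R o2) A _) ('D_(e_ R o3) A _) ('D_(e_ R o2) B _) ('D_(e_ R o3) B _) => a0 a1 b0 b1.
move: (radf b x) (A _) (B _) (cosf 1 x) (sinf 1 x) (cosf (_ * s) x) (sinf (_ * s) x) => r a' b' c t c' t'.
by split; ring.
Qed.

Lemma cosfD (k l : R) x : cosf (k + l) x = cosf k x * cosf l x - sinf k x * sinf l x.
Proof. by rewrite /cosf /sinf mulrDl cosD. Qed.
Lemma sinfD (k l : R) x : sinf (k + l) x = sinf k x * cosf l x + cosf k x * sinf l x.
Proof. by rewrite /cosf /sinf mulrDl sinD. Qed.
Lemma cosf_sg (e : bool) x : cosf (sg R e) x = cosf 1 x.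
Proof. by case: e; rewrite /cosf /sg// !mul1r mulN1r cosN. Qed.
Lemma sinf_sg (e : bool) x : sinf (sg R e) x = sg R e * sinf 1 x.
Proof. by case: e; rewrite /sinf /sg ?mul1r// !mulN1r sinN. Qed.

(* With r^2 = x^2 + y^2 and z = x + i eta y, the operator acts on the chart
   function as (1 + r^2)/2 (d_x + i eta d_y) + e s z, up to sign. *)
Lemma rep_ang e b s V A B f : open V -> Cn 1 (dom V) A -> Cn 1 (dom V) B ->
  rep b s V A B f -> let eta := sg R (e == b) in
  rep b (s + sg R e) V
   (fun x => sg R b * ((1 + x 0 o2 * x 0 o2 + x 0 o3 * x 0 o3) / 2 *
       ('D_(e_ R o2) A x - eta * 'D_(e_ R o3) B x)
       + sg R e * s * (x 0 o2 * A x - eta * x 0 o3 * B x)))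
   (fun x => sg R b * ((1 + x 0 o2 * x 0 o2 + x 0 o3 * x 0 o3) / 2 *
       ('D_(e_ R o2) B x + eta * 'D_(e_ R o3) A x)
       + sg R e * s * (x 0 o2 * B x + eta * x 0 o3 * A x)))
   (ang e s f).
Proof.
move=> oV CA CB Hf eta x Dx.
have [f1 f2] := Hf x Dx.
rewrite fre_ang fim_ang f1 f2.
have [-> ->] := rep_derive o3 oV CA CB Hf Dx.
have [-> ->] := rep_derive o2 oV CA CB Hf Dx.
have [_ _ -> ->] := DpE b A x; have [_ _ -> ->] := DpE b B x.
have p2 : polar b x 0 o2 = radf b x * cosf 1 x by rewrite /polar pt4S.
have p3 : polar b x 0 o3 = radf b x * sinf 1 x by rewrite /polar pt4S.
rewrite p2 p3 /= {f1 f2 p2 p3}.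
have [_ H] := Dx.
rewrite (sin_rad b H) (cos_rad b H) -/(radf b x).
have rp : 0 < radf b x by exact: rad_gt0.
have r0 : radf b x != 0 by rewrite gt_eqF.
have r1 : 1 + radf b x ^+ 2 != 0 by rewrite gt_eqF// addr_gt0// exprn_gt0.
have -> : sg R b * (s + sg R e) = sg R b * s + eta.
  by rewrite mulrDr; congr (_ + _); rewrite /eta /sg; case: e b {eta rp r0 r1 CA CB Hf H} => [] []; ring.
rewrite cosfD sinfD (cosf_sg (e == b)) (sinf_sg (e == b)) -/eta.
have cs1 : cosf 1 x ^+ 2 + sinf 1 x ^+ 2 - 1 = 0.
  by rewrite /sinf /cosf cos2Dsin2 subrr.
move: ('D_(e_ R o2) A _) ('D_(e_ R o3) A _) ('D_(e_ R o2) B _) ('D_(e_ R o3) B _) => a0 a1 b0 b1.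
move: (radf b x) (A _) (B _) (cosf 1 x) (sinf 1 x) (cosf (sg R b * s) x)
  (sinf (sg R b * s) x) r0 r1 cs1
  => r a' b' c t c' t' r0 r1 cs1.
(* The two sides agree only modulo [cos^2 + sin^2 = 1]; [X] and [X'] are the cofactors of this
   relation in the real and imaginary parts. *)
pose X (k l m n : R) := - (sg R b * (r ^+ 2 / 2) * ((c' * c - eta * (t' * t)) * (k - eta * l)
   + (t' * c + eta * (c' * t)) * (m + eta * n)) + eta * s * r * (c' * a' + t' * b')).
pose X' (k l m n : R) := - (sg R b * (r ^+ 2 / 2) * ((c' * c - eta * (t' * t)) * (m + eta * n)
   - (t' * c + eta * (c' * t)) * (k - eta * l)) + eta * s * r * (c' * b' - t' * a')).
have z0 k (u v : R) : u - v = k * (c ^+ 2 + t ^+ 2 - 1) -> u = v.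
  by rewrite cs1 mulr0 => /eqP; rewrite subr_eq0 => /eqP.
split; [apply: (z0 (X a0 b1 b0 a1))|apply: (z0 (X' a0 b1 b0 a1))]; rewrite /X /X' /eta {X X' z0 cs1 eta}.
- by case: e; case: b {CA CB Hf Dx H rp}; rewrite /sg /=; field; rewrite ?r0 ?r1.
- by case: e; case: b {CA CB Hf Dx H rp}; rewrite /sg /=; field; rewrite ?r0 ?r1.
Qed.

End Fields.

(** Locked so that partial derivatives stay atomic in the algebraic identities that follow. *)
HB.lock Definition pd (R : realType) (i : 'I_4) (F : 'rV[R]_4 -> R) : 'rV[R]_4 -> R :=
  'D_(e_ R i) F.

Section PD.
Variable R : realType.
Implicit Types (f : field R) (F : 'rV[R]_4 -> R) (x : 'rV[R]_4).

Lemma pdE i F : pd i F = 'D_(e_ R i) F. Proof. by rewrite pd.unlock. Qed.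

Lemma is_derive_pd W i F x k : Cn k.+1 W F -> W x -> is_derive x (e_ R i) F (pd i F x).
Proof. by move=> CF Wx; rewrite pdE; apply/derivableP; exact: Cn_derivable CF Wx. Qed.

Lemma Cn_pd k W i F : Cn k.+1 W F -> Cn k W (pd i F).
Proof. by rewrite pdE; exact: Cn_D. Qed.

Lemma pd_schwarz i j W F x : open W -> Cn 2 W F -> W x ->
  pd j (pd i F) x = pd i (pd j F) x.
Proof. by rewrite !pdE; exact: schwarz. Qed.

Lemma is_derive_pdE i F x d : is_derive x (e_ R i) F d -> pd i F x = d.
Proof. by rewrite pdE => -[_ ->]. Qed.

Lemma fre_d_tauE f x : fre (d_tau f) x = pd o0 (fre f) x.
Proof. by rewrite pdE fre_d_tau. Qed.
Lemma fim_d_tauE f x : fim (d_tau f) x = pd o0 (fim f) x.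
Proof. by rewrite pdE fim_d_tau. Qed.
Lemma fre_d_phiE f x : fre (d_phi f) x = pd o3 (fre f) x.
Proof. by rewrite pdE fre_d_phi. Qed.
Lemma fim_d_phiE f x : fim (d_phi f) x = pd o3 (fim f) x.
Proof. by rewrite pdE fim_d_phi. Qed.
Lemma fre_angE e s f x : fre (ang e s f) x =
  pd o2 (fre f) x - sg R e * (sin (x 0 o2))^-1 * pd o3 (fim f) x
  - sg R e * s * (cos (x 0 o2) / sin (x 0 o2)) * fre f x.
Proof. by rewrite !pdE fre_ang. Qed.
Lemma fim_angE e s f x : fim (ang e s f) x =
  pd o2 (fim f) x + sg R e * (sin (x 0 o2))^-1 * pd o3 (fre f) x
  - sg R e * s * (cos (x 0 o2) / sin (x 0 o2)) * fim f x.
Proof. by rewrite !pdE fim_ang. Qed.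
Lemma fre_YE (M : R) (h : R -> R) f x : fre (Y M h f) x =
  h^`()%classic (x 0 o1) * pd o0 (fre f) x - pd o1 (fre f) x.
Proof. by rewrite !pdE fre_Y. Qed.
Lemma fim_YE (M : R) (h : R -> R) f x : fim (Y M h f) x =
  h^`()%classic (x 0 o1) * pd o0 (fim f) x - pd o1 (fim f) x.
Proof. by rewrite !pdE fim_Y. Qed.

End PD.

(** * Commutators of the differential operators *)

Section SmoothOn.
Variable R : realType.
Implicit Types (V W : set (R * R)) (x : 'rV[R]_4) (f g : field R) (F G : spin_scalar R).

(** Convertible to [op_eth] for [e = true] and to [op_ethp] for [e = false]. *)
Definition op_ang (e : bool) F : spin_scalar R := (F.1 + sg R e, ang e F.1 F.2).

Definition smoothOn k W F := Cn k (domF W) (fre F.2) /\ Cn k (domF W) (fim F.2).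

Definition eqOn W F G := F.1 = G.1 /\ forall tau rho theta phi,
  W (tau, rho) -> 0 < theta < pi -> F.2 tau rho theta phi = G.2 tau rho theta phi.

Lemma eqOnP W F G : eqOn W F G <->
  F.1 = G.1 /\ forall x, domF W x -> fre F.2 x = fre G.2 x /\ fim F.2 x = fim G.2 x.
Proof.
split=> [] [FG E]; split=> //.
  by move=> x [Wx Hx]; rewrite /fre /fim E.
move=> a b c d Wab cpi.
have := E (pt4 a b c d); rewrite !fre_pt4 !fim_pt4 /domF /= !pt4S => /(_ (conj Wab cpi)).
by case: (F.2 _ _ _ _) (G.2 _ _ _ _) => [? ?] [? ?] /= [-> ->].
Qed.

Lemma eqOn_sym W F G : eqOn W F G -> eqOn W G F.
Proof. by move=> [FG E]; split=> // *; rewrite E. Qed.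
Lemma eqOn_trans W F G H : eqOn W F G -> eqOn W G H -> eqOn W F H.
Proof. by move=> [FG E] [GH E']; split=> [|*]; rewrite ?FG// E// E'. Qed.

Section Congruence.
Variables (W : set (R * R)) (F G : spin_scalar R).
Hypotheses (oW : open W) (FG : eqOn W F G).

Let dFG i x : domF W x -> pd i (fre F.2) x = pd i (fre G.2) x /\
  pd i (fim F.2) x = pd i (fim G.2) x.
Proof.
move=> Dx; have [_ E] := (eqOnP _ _ _).1 FG.
by rewrite !pdE; split; apply: (eq_on_derive _ (open_domF oW) _ Dx) => y /E [].
Qed.

Lemma eqOn_tau : eqOn W (op_tau F) (op_tau G).
Proof.
apply/eqOnP; split=> [|x Dx]; first by case: FG.
by rewrite !fre_d_tauE !fim_d_tauE; have [-> ->] := dFG o0 Dx.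
Qed.

Lemma eqOn_phi : eqOn W (op_phi F) (op_phi G).
Proof.
apply/eqOnP; split=> [|x Dx]; first by case: FG.
by rewrite !fre_d_phiE !fim_d_phiE; have [-> ->] := dFG o3 Dx.
Qed.

Lemma eqOn_Y (M : R) (h : R -> R) : eqOn W (op_Y M h F) (op_Y M h G).
Proof.
apply/eqOnP; split=> [|x Dx]; first by case: FG.
by rewrite !fre_YE !fim_YE; have [-> ->] := dFG o0 Dx; have [-> ->] := dFG o1 Dx.
Qed.

Lemma eqOn_ang e : eqOn W (op_ang e F) (op_ang e G).
Proof.
have [E1 E2] := (eqOnP _ _ _).1 FG.
apply/eqOnP; split=> [|x Dx]; first by rewrite /= E1.
rewrite !fre_angE !fim_angE E1; have [-> ->] := dFG o2 Dx; have [-> ->] := dFG o3 Dx.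
by have [-> ->] := E2 _ Dx.
Qed.
End Congruence.

Lemma is_derive_csc (t : R) : 0 < t < pi ->
  is_derive t (1 : R) (fun u => (sin u)^-1) (- cos t / sin t ^+ 2).
Proof.
move=> /sin_gt0_pi/gt_eqF/negbT s0.
apply: DeriveDef; first exact: derivableV.
by rewrite deriveV// derive_val /GRing.scale /=; field.
Qed.

Lemma is_derive_cot (t : R) : 0 < t < pi ->
  is_derive t (1 : R) (fun u => cos u / sin u) (- (sin t ^+ 2)^-1).
Proof.
move=> H; have /gt_eqF/negbT s0 := sin_gt0_pi H.
apply: (is_derive_eq (is_deriveM (is_derive_cos t) (is_derive_csc H))).
rewrite /GRing.scale /=; have := cos2Dsin2 t => E.
by apply: (@mulIf _ (sin t ^+ 2)); rewrite ?sqrf_eq0// [RHS]mulNr mulVf ?sqrf_eq0// -E; field.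
Qed.

Lemma derive_ang e W F i x : open W -> smoothOn 2 W F -> domF W x ->
  pd i (fre (op_ang e F).2) x =
    pd i (pd o2 (fre F.2)) x
    - sg R e * ((sin (x 0 o2))^-1 * pd i (pd o3 (fim F.2)) x
       + (o2 == i)%:R * (- cos (x 0 o2) / sin (x 0 o2) ^+ 2) * pd o3 (fim F.2) x)
    - sg R e * F.1 * (cos (x 0 o2) / sin (x 0 o2) * pd i (fre F.2) x
       - (o2 == i)%:R / sin (x 0 o2) ^+ 2 * fre F.2 x) /\
  pd i (fim (op_ang e F).2) x =
    pd i (pd o2 (fim F.2)) x
    + sg R e * ((sin (x 0 o2))^-1 * pd i (pd o3 (fre F.2)) x
       + (o2 == i)%:R * (- cos (x 0 o2) / sin (x 0 o2) ^+ 2) * pd o3 (fre F.2) x)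
    - sg R e * F.1 * (cos (x 0 o2) / sin (x 0 o2) * pd i (fim F.2) x
       - (o2 == i)%:R / sin (x 0 o2) ^+ 2 * fim F.2 x).
Proof.
move=> oW [Cr Ci] Dx; have [_ H] := Dx.
have dcsc := is_derive_comp_coord i (is_derive_csc H).
have dcot := is_derive_comp_coord i (is_derive_cot H).
have d1 (f : 'rV[R]_4 -> R) : Cn 2 (domF W) f -> is_derive x (e_ R i) f (pd i f x).
  by move=> Cf; exact: is_derive_pd Cf Dx.
have d2 (f : 'rV[R]_4 -> R) j : Cn 2 (domF W) f -> is_derive x (e_ R i) (pd j f) (pd i (pd j f) x).
  by move=> Cf; exact: is_derive_pd (Cn_pd j Cf) Dx.
split.
- rewrite (_ : fre (op_ang e F).2 = (pd o2 (fre F.2)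
    - (sg R e) *: ((fun y : 'rV[R]_4 => (sin (y 0 o2))^-1) * pd o3 (fim F.2))
    - (sg R e * F.1) *: ((fun y : 'rV[R]_4 => cos (y 0 o2) / sin (y 0 o2)) * fre F.2))); last first.
    by apply/funext => y; rewrite fre_angE /= !fctE /GRing.scale /= !mulrA.
  rewrite (is_derive_pdE (is_deriveB (is_deriveB (d2 _ o2 Cr)
    (is_deriveZ (sg R e) (is_deriveM dcsc (d2 _ o3 Ci))))
    (is_deriveZ (sg R e * F.1) (is_deriveM dcot (d1 _ Cr))))).
  rewrite /GRing.scale /=.
  move: (pd i (pd o2 (fre F.2)) x) (pd i (pd o3 (fim F.2)) x)
    (pd o3 (fim F.2) x) (pd i (fre F.2) x) (fre F.2 x) => a b c d f.
  by move: (sin _) (cos _) (sg R e) F.1 => s0 c0 e0 s; ring.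
- rewrite (_ : fim (op_ang e F).2 = (pd o2 (fim F.2)
    + (sg R e) *: ((fun y : 'rV[R]_4 => (sin (y 0 o2))^-1) * pd o3 (fre F.2))
    - (sg R e * F.1) *: ((fun y : 'rV[R]_4 => cos (y 0 o2) / sin (y 0 o2)) * fim F.2))); last first.
    by apply/funext => y; rewrite fim_angE /= !fctE /GRing.scale /= !mulrA.
  rewrite (is_derive_pdE (is_deriveB (is_deriveD (d2 _ o2 Ci)
    (is_deriveZ (sg R e) (is_deriveM dcsc (d2 _ o3 Cr))))
    (is_deriveZ (sg R e * F.1) (is_deriveM dcot (d1 _ Ci))))).
  rewrite /GRing.scale /=.
  move: (pd i (pd o2 (fim F.2)) x) (pd i (pd o3 (fre F.2)) x)
    (pd o3 (fre F.2) x) (pd i (fim F.2) x) (fim F.2 x) => a b c d f.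
  by move: (sin _) (cos _) (sg R e) F.1 => s0 c0 e0 s; ring.
Qed.

Lemma comm_tau_ang e W F : open W -> smoothOn 2 W F ->
  eqOn W (op_tau (op_ang e F)) (op_ang e (op_tau F)).
Proof.
move=> oW CF; apply/eqOnP; split=> [|x Dx]; first by rewrite /=.
have [Cr Ci] := CF; have oD := open_domF oW.
rewrite fre_d_tauE fim_d_tauE fre_angE fim_angE.
have [-> ->] := derive_ang e o0 oW CF Dx.
rewrite (funext (fre_d_tauE F.2)) (funext (fim_d_tauE F.2)).
rewrite !(pd_schwarz o2 o0 oD Cr Dx, pd_schwarz o2 o0 oD Ci Dx,
  pd_schwarz o3 o0 oD Cr Dx, pd_schwarz o3 o0 oD Ci Dx) /=.
split.
  move: (pd o2 _ x) (pd o3 (pd o0 _) x) (pd o3 (fim _) x)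
    (pd o0 _ x) (fre F.2 x) => a b c d f.
  by move: (sin _) (cos _) (sg R e) F.1 => s0 c0 e0 s; ring.
move: (pd o2 _ x) (pd o3 (pd o0 _) x) (pd o3 (fre _) x)
  (pd o0 _ x) (fim F.2 x) => a b c d f.
by move: (sin _) (cos _) (sg R e) F.1 => s0 c0 e0 s; ring.
Qed.

Lemma comm_phi_ang e W F : open W -> smoothOn 2 W F ->
  eqOn W (op_phi (op_ang e F)) (op_ang e (op_phi F)).
Proof.
move=> oW CF; apply/eqOnP; split=> [|x Dx]; first by rewrite /=.
have [Cr Ci] := CF; have oD := open_domF oW.
rewrite fre_d_phiE fim_d_phiE fre_angE fim_angE.
have [-> ->] := derive_ang e o3 oW CF Dx.
rewrite (funext (fre_d_phiE F.2)) (funext (fim_d_phiE F.2)).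
rewrite !(pd_schwarz o2 o3 oD Cr Dx, pd_schwarz o2 o3 oD Ci Dx) /=.
split.
  move: (pd o2 _ x) (pd o3 (pd o3 _) x) (pd o3 (fim _) x)
    (pd o3 (fre _) x) (fre F.2 x) => a b c d f.
  by move: (sin _) (cos _) (sg R e) F.1 => s0 c0 e0 s; ring.
move: (pd o2 _ x) (pd o3 (pd o3 _) x) (pd o3 (fre _) x)
  (pd o3 (fim _) x) (fim F.2 x) => a b c d f.
by move: (sin _) (cos _) (sg R e) F.1 => s0 c0 e0 s; ring.
Qed.

Lemma comm_phi_tau W F : open W -> smoothOn 2 W F ->
  eqOn W (op_phi (op_tau F)) (op_tau (op_phi F)).
Proof.
move=> oW [Cr Ci]; apply/eqOnP; split=> [|x Dx]; first by rewrite /=.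
have oD := open_domF oW.
split.
- apply: etrans (fre_d_phiE (d_tau F.2) x) _; rewrite (funext (fre_d_tauE F.2)).
  apply: etrans _ (esym (fre_d_tauE (d_phi F.2) x)); rewrite (funext (fre_d_phiE F.2)).
  exact: (pd_schwarz _ _ oD Cr Dx).
- apply: etrans (fim_d_phiE (d_tau F.2) x) _; rewrite (funext (fim_d_tauE F.2)).
  apply: etrans _ (esym (fim_d_tauE (d_phi F.2) x)); rewrite (funext (fim_d_phiE F.2)).
  exact: (pd_schwarz _ _ oD Ci Dx).
Qed.

Section CommY.
Variables (M : R) (h : R -> R).

Lemma derive_Y W F i x : smoothOn 2 W F -> domF W x ->
  derivable (h^`()%classic : R -> R) (x 0 o1) 1 ->
  pd i (fre (op_Y M h F).2) x =
    h^`()%classic (x 0 o1) * pd i (pd o0 (fre F.2)) x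
    + (o1 == i)%:R * h^`()%classic^`()%classic (x 0 o1) * pd o0 (fre F.2) x
    - pd i (pd o1 (fre F.2)) x /\
  pd i (fim (op_Y M h F).2) x =
    h^`()%classic (x 0 o1) * pd i (pd o0 (fim F.2)) x
    + (o1 == i)%:R * h^`()%classic^`()%classic (x 0 o1) * pd o0 (fim F.2) x
    - pd i (pd o1 (fim F.2)) x.
Proof.
move=> [Cr Ci] Dx dh.
have dh' : is_derive (x 0 o1) (1 : R) (h^`()%classic : R -> R) (h^`()%classic^`()%classic (x 0 o1)).
  by rewrite derive1E; exact/derivableP.
have dhx := is_derive_comp_coord i dh'.
have d2 (f : 'rV[R]_4 -> R) j : Cn 2 (domF W) f ->
    is_derive x (e_ R i) (pd j f) (pd i (pd j f) x).
  by move=> Cf; exact: is_derive_pd (Cn_pd j Cf) Dx.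
split.
- rewrite (_ : fre (op_Y M h F).2 =
    (fun y : 'rV[R]_4 => h^`()%classic (y 0 o1)) * pd o0 (fre F.2)
    - pd o1 (fre F.2)); last by apply/funext => y; rewrite fre_YE.
  apply/is_derive_pdE; apply: (is_derive_eq (is_deriveB (is_deriveM dhx (d2 _ o0 Cr)) (d2 _ o1 Cr))).
  rewrite /GRing.scale /=.
  move: (pd i _ x) (pd i _ x) (pd o0 _ x) => a b c.
  by move: (h^`()%classic _) (h^`()%classic^`()%classic _) => u v; ring.
- rewrite (_ : fim (op_Y M h F).2 =
    (fun y : 'rV[R]_4 => h^`()%classic (y 0 o1)) * pd o0 (fim F.2)
    - pd o1 (fim F.2)); last by apply/funext => y; rewrite fim_YE.
  apply/is_derive_pdE; apply: (is_derive_eq (is_deriveB (is_deriveM dhx (d2 _ o0 Ci)) (d2 _ o1 Ci))).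
  rewrite /GRing.scale /=.
  move: (pd i _ x) (pd i _ x) (pd o0 _ x) => a b c.
  by move: (h^`()%classic _) (h^`()%classic^`()%classic _) => u v; ring.
Qed.

Lemma comm_tau_Y W F : open W -> smoothOn 2 W F ->
  (forall x, domF W x -> derivable (h^`()%classic : R -> R) (x 0 o1) 1) ->
  eqOn W (op_tau (op_Y M h F)) (op_Y M h (op_tau F)).
Proof.
move=> oW CF dh; apply/eqOnP; split=> [|x Dx]; first by rewrite /=.
have [Cr Ci] := CF; have oD := open_domF oW.
rewrite fre_d_tauE fim_d_tauE fre_YE fim_YE.
have [-> ->] := derive_Y o0 CF Dx (dh _ Dx).
rewrite (funext (fre_d_tauE F.2)) (funext (fim_d_tauE F.2)).
by rewrite !(pd_schwarz o1 o0 oD Cr Dx, pd_schwarz o1 o0 oD Ci Dx) /= !mul0r !addr0.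
Qed.

Lemma comm_Y_ang e W F : open W -> smoothOn 2 W F ->
  (forall x, domF W x -> derivable (h^`()%classic : R -> R) (x 0 o1) 1) ->
  eqOn W (op_Y M h (op_ang e F)) (op_ang e (op_Y M h F)).
Proof.
move=> oW CF dh; apply/eqOnP; split=> [|x Dx]; first by rewrite /=.
have [Cr Ci] := CF; have oD := open_domF oW.
rewrite fre_YE fim_YE fre_angE fim_angE.
have [-> ->] := derive_ang e o0 oW CF Dx.
have [-> ->] := derive_ang e o1 oW CF Dx.
have [-> ->] := derive_Y o2 CF Dx (dh _ Dx).
have [-> ->] := derive_Y o3 CF Dx (dh _ Dx).
rewrite fre_YE fim_YE.
rewrite !(pd_schwarz o2 o0 oD Cr Dx, pd_schwarz o2 o0 oD Ci Dx,
  pd_schwarz o3 o0 oD Cr Dx, pd_schwarz o3 o0 oD Ci Dx, pd_schwarz o2 o1 oD Cr Dx, pd_schwarz o2 o1 oD Ci Dx,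
  pd_schwarz o3 o1 oD Cr Dx, pd_schwarz o3 o1 oD Ci Dx) /=.
split.
- move: (pd o2 (pd o0 _) x) (pd o2 (pd o1 _) x)
   (pd o3 (pd o0 _) x) (pd o3 (pd o1 _) x)
   (pd o3 (fim _) x) (pd o0 (fre _) x) (pd o0 (fim _) x)
   (pd o1 (fre _) x) (fre F.2 x) => a b c d e0 f g k l.
  by move: (h^`()%classic _) (h^`()%classic^`()%classic _) (sin _) (cos _) (sg R e) F.1
   => u v s0 c0 e1 s; ring.
- move: (pd o2 (pd o0 _) x) (pd o2 (pd o1 _) x)
   (pd o3 (pd o0 _) x) (pd o3 (pd o1 _) x)
   (pd o3 (fre _) x) (pd o0 (fim _) x) (pd o0 (fre _) x)
   (pd o1 (fim _) x) (fim F.2 x) => a b c d e0 f g k l.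
  by move: (h^`()%classic _) (h^`()%classic^`()%classic _) (sin _) (cos _) (sg R e) F.1
   => u v s0 c0 e1 s; ring.
Qed.

Lemma comm_phi_Y W F : open W -> smoothOn 2 W F ->
  (forall x, domF W x -> derivable (h^`()%classic : R -> R) (x 0 o1) 1) ->
  eqOn W (op_Y M h (op_phi F)) (op_phi (op_Y M h F)).
Proof.
move=> oW CF dh; apply/eqOnP; split=> [|x Dx]; first by rewrite /=.
have [Cr Ci] := CF; have oD := open_domF oW.
rewrite fre_d_phiE fim_d_phiE fre_YE fim_YE.
have [-> ->] := derive_Y o3 CF Dx (dh _ Dx).
rewrite (funext (fre_d_phiE F.2)) (funext (fim_d_phiE F.2)).
by rewrite !(pd_schwarz o3 o0 oD Cr Dx, pd_schwarz o3 o0 oD Ci Dx,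
  pd_schwarz o3 o1 oD Cr Dx, pd_schwarz o3 o1 oD Ci Dx) /= !mul0r !addr0.
Qed.

End CommY.

(** This is the curvature of the unit sphere. The commutator is a multiplication by a constant
    depending on the weight, hence of lower order, which makes the reordering of angular words
    possible. *)
Lemma comm_ang e W F x : open W -> smoothOn 2 W F -> domF W x ->
  fre (op_ang (~~ e) (op_ang e F)).2 x =
    fre (op_ang e (op_ang (~~ e) F)).2 x + 2 * sg R e * F.1 * fre F.2 x /\
  fim (op_ang (~~ e) (op_ang e F)).2 x =
    fim (op_ang e (op_ang (~~ e) F)).2 x + 2 * sg R e * F.1 * fim F.2 x.
Proof.
move=> oW CF Dx; have [Cr Ci] := CF; have oD := open_domF oW; have [_ H] := Dx.
rewrite !fre_angE !fim_angE.
have [-> ->] := derive_ang e o2 oW CF Dx.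
have [-> ->] := derive_ang e o3 oW CF Dx.
have [-> ->] := derive_ang (~~ e) o2 oW CF Dx.
have [-> ->] := derive_ang (~~ e) o3 oW CF Dx.
rewrite ?fre_angE ?fim_angE /=.
have -> : sg R (~~ e) = - sg R e by case: e; rewrite /sg /= ?opprK.
rewrite !(pd_schwarz o2 o3 oD Cr Dx, pd_schwarz o2 o3 oD Ci Dx).
have s0 : sin (x 0 o2) != 0 by rewrite gt_eqF// sin_gt0_pi.
have cs := cos2Dsin2 (x 0 o2).
have e2 := sg2 R e.
have K (k u v : R) : u - v = k * (cos (x 0 o2) ^+ 2 + sin (x 0 o2) ^+ 2 - 1) -> u = v.
  by rewrite cs subrr mulr0 => /eqP; rewrite subr_eq0 => /eqP.
split.
- apply: (K (- 2 * sg R e * F.1 * fre F.2 x / sin (x 0 o2) ^+ 2)).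
  move: s0 e2 {K cs}.
  move: (pd o2 (pd o2 _) x) (pd o2 (pd o3 (fim _)) x)
   (pd o3 (pd o3 _) x) (pd o2 (fre _) x) (pd o3 (fim _) x)
   (pd o3 (fre _) x) (fre F.2 x) => a b c d f g l.
  move: (sin _) (cos _) F.1 => s0 c0 s s00 e2.
  by case: e e2; rewrite /sg => _; field.
- apply: (K (- 2 * sg R e * F.1 * fim F.2 x / sin (x 0 o2) ^+ 2)).
  move: s0 e2 {K cs}.
  move: (pd o2 (pd o2 _) x) (pd o2 (pd o3 (fre _)) x)
   (pd o3 (pd o3 _) x) (pd o2 (fim _) x) (pd o3 (fre _) x)
   (pd o3 (fim _) x) (fim F.2 x) => a b c d f g l.
  move: (sin _) (cos _) F.1 => s0 c0 s s00 e2.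
  by case: e e2; rewrite /sg => _; field.
Qed.

End SmoothOn.

(** * The class of fields regular up to the poles and the boundary *)

Section Nice.
Variables (R : realType) (M tau0 : R) (h : R -> R).
Hypothesis hsmooth : forall (n : nat) (r : R), 2 * M <= r ->
  \forall x \near r, derivable (h^`(n)%classic) x 1.
Implicit Types (V W U : set (R * R)) (x : 'rV[R]_4) (f g : field R) (F G : spin_scalar R).

Definition reg : set (R * R) := [set p | tau0 <= p.1 /\ 2 * M <= p.2].

(** Each order has its own neighbourhood of the closed region, because [Y] multiplies by [h'], whose
    domain of differentiability varies with the order. Representatives in both charts are required:
    they give bounds up to the poles, which regularity in the angles alone does not. *)
Definition niceN k F := exists V, [/\ open V, reg `<=` V &
  forall b, exists A B, [/\ Cn k (dom V) A, Cn k (dom V) B & rep b F.1 V A B F.2]].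

Definition Nice F := forall k, niceN k F.

Lemma smooth4_iterD U (A : 'rV[R]_4 -> R) k (l : seq 'I_4) : smooth4 U A -> Cn k (dom U) (Defs.iterD l A).
Proof.
move=> sA; elim: k l => [|k IH] l.
  by split=> // x Ux; have := sA l x; rewrite I4_0 I4_1 => /(_ Ux) [].
split=> [x Ux|i]; first by have := sA l x; rewrite I4_0 I4_1 => /(_ Ux) [].
split; last exact: (IH (i :: l)).
by move=> x Ux; have := sA l x; rewrite I4_0 I4_1 => /(_ Ux) [_]; apply.
Qed.

Lemma smooth4_Cn U (A : 'rV[R]_4 -> R) k : smooth4 U A -> Cn k (dom U) A.
Proof. exact: (@smooth4_iterD _ _ _ [::]). Qed.

Lemma spin_smooth_Nice U s f : open U -> reg `<=` U -> spin_smooth s U f -> Nice (s, f).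
Proof.
move=> oU rU [FN [FS [[N1 N2] [S1 S2] Hf]]] k; exists U; split => // b.
exists (fun x => if b then complex.Re (FN x) else complex.Re (FS x)),
  (fun x => if b then complex.Im (FN x) else complex.Im (FS x)).
split; first by case: b; exact: smooth4_Cn.
  by case: b; exact: smooth4_Cn.
move=> x [Ux Hx] /=.
have [HN HS] := Hf _ _ _ (x 0 o3) Ux Hx.
rewrite /fre /fim; case: b; [rewrite HN|rewrite HS].
- have -> : pt4 (x 0 o0) (x 0 o1) (tan (x 0 o2 / 2) * cos (x 0 o3))
    (tan (x 0 o2 / 2) * sin (x 0 o3)) = polar true x.
    by rewrite /polar /radf /rad /cosf /sinf !mul1r.
  rewrite /expi /cosf /sinf /sg mul1r cosN sinN.
  by case: (FN _) => u v /=; split; ring.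
- have -> : pt4 (x 0 o0) (x 0 o1) ((tan (x 0 o2 / 2))^-1 * cos (x 0 o3))
    ((tan (x 0 o2 / 2))^-1 * sin (x 0 o3)) = polar false x.
    by rewrite /polar /radf /rad /cosf /sinf !mul1r.
  rewrite /expi /cosf /sinf /sg mulN1r mulNr cosN sinN.
  by case: (FS _) => u v /=; split; ring.
Qed.

Lemma Nice_smoothOn F k : Nice F -> exists V, [/\ open V, reg `<=` V & smoothOn k V F].
Proof.
move=> /(_ k)[V [oV rV H]]; exists V; split=> //.
by have [A [B [CA CB r]]] := H true; exact: (rep_Cn oV CA CB r).
Qed.

(* h is smooth near each point of [2M, oo), the size of the neighbourhood
   depending on the order of differentiation. *)
Lemma h_Cn k n : exists V, [/\ open V, reg `<=` V &
  Cn k (dom V) (fun x => h^`(n)%classic (x 0 o1))].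
Proof.
pose W : set R := [set r | forall m, (m <= k)%N -> \forall x \near r, derivable (h^`(n + m)%classic) x 1].
have oW : open W.
  rewrite openE => r Wr; rewrite /interior.
  suff : \forall y \near r, forall m : 'I_k.+1, \forall x \near y, derivable (h^`(n + m)%classic) x 1.
    by apply: filterS => y Hy m mk; exact: (Hy (Ordinal (mk : (m < k.+1)%N))).
  apply: (filter_forall (nbhs_filter r)) => m.
  exact: (nbhs_interior (Wr m (ltn_ord m))).
exists (setT `*` W).
have oV : open ([set: R] `*` W).
  rewrite (_ : _ `*` _ = [set p : R * R | W p.2]); last by apply/seteqP; split=> -[p q] //= [].
  by apply: (@open_comp _ _ (@snd R R) W) => // p _; exact: cvg_snd.
split => //.
  by move=> [t r] [/= _ Mr]; split=> // m _; exact: hsmooth.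
have dW m x : (m <= k)%N -> dom ([set: R] `*` W) x -> derivable (h^`(n + m)%classic) (x 0 o1) 1.
  by move=> mk [_ /= /(_ m mk)/nbhs_singleton].
have cW m x : (m <= k)%N -> dom ([set: R] `*` W) x ->
    {for x, continuous (fun x : 'rV[R]_4 => h^`(n + m)%classic (x 0 o1))}.
  move=> mk Dx; apply: (@continuous_comp _ _ _ (fun x : 'rV[R]_4 => x 0 o1)).
    exact: coord_continuous.
  exact/differentiable_continuous/derivable1_diffP/dW.
suff H j m : (m + j <= k)%N -> Cn j (dom ([set: R] `*` W)) (fun x => h^`(n + m)%classic (x 0 o1)).
  by have := H k 0%N; rewrite addn0 add0n => /(_ (leqnn k)).
elim: j m => [|j IH] m mj.
  by split=> // x Dx; apply: cW => //; rewrite addn0 in mj.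
have mk : (m <= k)%N by rewrite (leq_trans _ mj)// leq_addr.
split=> [x Dx|i]; first exact: cW.
have dd x : dom ([set: R] `*` W) x -> is_derive x (e_ R i)
    (fun x : 'rV[R]_4 => h^`(n + m)%classic (x 0 o1)) ((o1 == i)%:R * h^`(n + m.+1)%classic (x 0 o1)).
  move=> Dx; apply: is_derive_comp_coord; rewrite addnS derive1nS derive1E.
  exact/derivableP/dW.
split=> [x Dx|]; first by have [] := dd x Dx.
apply: (@eq_Cn _ _ _ _ (fun x => (o1 == i)%:R * h^`(n + m.+1)%classic (x 0 o1))).
- exact: open_dom.
- by move=> x Dx; have [_ ->] := dd x Dx.
- by apply: CnZ; [exact: open_dom|apply: IH; rewrite addSnnS].
Qed.

Lemma rep_sub b s V W A B f : W `<=` V -> rep b s V A B f -> rep b s W A B f.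
Proof. by move=> WV H x [/WV Vx Hx]; apply: H; split. Qed.

Lemma dom_sub V W : W `<=` V -> dom W `<=` dom V.
Proof. by move=> WV x /WV. Qed.

Lemma Nice_tau F : Nice F -> Nice (op_tau F).
Proof.
move=> NF k; have [V [oV rV H]] := NF k.+1; exists V; split => // b.
have [A [B [CA CB r]]] := H b.
exists ('D_(e_ R o0) A), ('D_(e_ R o0) B); split; do ?exact: Cn_D.
by apply: rep_d_tau => //; [exact: Cn_le CA|exact: Cn_le CB].
Qed.

Definition op_rho F : spin_scalar R := (F.1, d_rho F.2).

Lemma Nice_rho F : Nice F -> Nice (op_rho F).
Proof.
move=> NF k; have [V [oV rV H]] := NF k.+1; exists V; split => // b.
have [A [B [CA CB r]]] := H b.
exists ('D_(e_ R o1) A), ('D_(e_ R o1) B); split; do ?exact: Cn_D.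
by apply: rep_d_rho => //; [exact: Cn_le CA|exact: Cn_le CB].
Qed.

Lemma Nice_phi F : Nice F -> Nice (op_phi F).
Proof.
move=> NF k; have [V [oV rV H]] := NF k.+1; exists V; split => // b.
have [A [B [CA CB r]]] := H b; have oD := open_dom oV.
have Cc i : Cn k (dom V) (fun x => x 0 i) by exact: Cn_coord.
have [CA' CB'] := (Cn_leS CA, Cn_leS CB).
eexists; eexists; split; last first.
- by apply: rep_d_phi; [exact: oV|exact: Cn_le CA|exact: Cn_le CB|exact: r].
- apply: (@CnB _ _ _ _ (fun x => x 0 o2 * 'D_(e_ R o3) B x - x 0 o3 * 'D_(e_ R o2) B x)) => //.
    by apply: CnB => //; apply: CnM => //; exact: Cn_D.
  exact: CnZ.
- apply: (@CnD _ _ _ _ (fun x => x 0 o2 * 'D_(e_ R o3) A x - x 0 o3 * 'D_(e_ R o2) A x)) => //.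
    by apply: CnB => //; apply: CnM => //; exact: Cn_D.
  exact: CnZ.
Qed.

Lemma Nice_ang e F : Nice F -> Nice (op_ang e F).
Proof.
move=> NF k; have [V [oV rV H]] := NF k.+1; exists V; split => // b.
have [A [B [CA CB r]]] := H b; have oD := open_dom oV.
have Cc i : Cn k (dom V) (fun x => x 0 i) by exact: Cn_coord.
have [CA' CB'] := (Cn_leS CA, Cn_leS CB).
have Cg : Cn k (dom V) (fun x => (1 + x 0 o2 * x 0 o2 + x 0 o3 * x 0 o3) / 2).
  apply: (@eq_Cn _ _ _ _ (fun x => 2^-1 * ((1 + x 0 o2 * x 0 o2) + x 0 o3 * x 0 o3))) => //.
    by move=> x _; rewrite mulrC.
  apply: CnZ => //; apply: (@CnD _ _ _ _ (fun x => 1 + x 0 o2 * x 0 o2)) => //.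
    by apply: (@CnD _ _ _ _ (cst 1)) => //; [exact: Cn_cst|exact: CnM].
  exact: CnM.
eexists; eexists; split; last first.
- by apply: rep_ang; [exact: oV|exact: Cn_le CA|exact: Cn_le CB|exact: r].
- apply: CnZ => //.
  apply: (@CnD _ _ _ _ (fun x => (1 + x 0 o2 * x 0 o2 + x 0 o3 * x 0 o3) / 2 *
     ('D_(e_ R o2) B x + sg R (e == b) * 'D_(e_ R o3) A x))) => //.
    apply: CnM => //; apply: (@CnD _ _ _ _ ('D_(e_ R o2) B)) => //; first exact: Cn_D.
    by apply: CnZ => //; exact: Cn_D.
  apply: CnZ => //; apply: (@CnD _ _ _ _ (fun x => x 0 o2 * B x)) => //; first exact: CnM.
  by apply: CnM => //; exact: CnZ.
- apply: CnZ => //.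
  apply: (@CnD _ _ _ _ (fun x => (1 + x 0 o2 * x 0 o2 + x 0 o3 * x 0 o3) / 2 *
     ('D_(e_ R o2) A x - sg R (e == b) * 'D_(e_ R o3) B x))) => //.
    apply: CnM => //; apply: (@CnB _ _ _ _ ('D_(e_ R o2) A)) => //; first exact: Cn_D.
    by apply: CnZ => //; exact: Cn_D.
  apply: CnZ => //; apply: (@CnB _ _ _ _ (fun x => x 0 o2 * A x)) => //; first exact: CnM.
  by apply: CnM => //; exact: CnZ.
Qed.

Lemma Nice_Y F : Nice F -> Nice (op_Y M h F).
Proof.
move=> NF k; have [V [oV rV H]] := NF k.+1; have [V' [oV' rV' CH]] := h_Cn k 1.
have oW : open (V `&` V') by exact: openI.
have W1 : V `&` V' `<=` V by move=> ? [].
have W2 : V `&` V' `<=` V' by move=> ? [].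
exists (V `&` V'); split => //.
  by move=> p rp; split; [exact: rV|exact: rV'].
move=> b; have [A [B [CA CB r]]] := H b; have oD := open_dom oW.
have {}CA := Cn_sub (dom_sub W1) CA; have {}CB := Cn_sub (dom_sub W1) CB.
have {}CH := Cn_sub (dom_sub W2) CH; rewrite derive1n1 in CH.
eexists; eexists; split; last first.
- apply: rep_Y; [exact: oW|exact: Cn_le CA|exact: Cn_le CB|].
  exact: (rep_sub W1 r).
- apply: (@CnB _ _ _ _ (fun x => h^`()%classic (x 0 o1) * 'D_(e_ R o0) B x)) => //.
    by apply: CnM => //; exact: Cn_D.
  exact: Cn_D.
- apply: (@CnB _ _ _ _ (fun x => h^`()%classic (x 0 o1) * 'D_(e_ R o0) A x)) => //.
    by apply: CnM => //; exact: Cn_D.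
  exact: Cn_D.
Qed.

Definition box (a b c d : R) x := [&& a <= x 0 o0 <= b, c <= x 0 o1 <= d & 0 < x 0 o2 < pi].

Lemma rad_le1 b (t : R) : 0 < t < pi -> 0 <= sg R b * cos t -> rad b t <= 1.
Proof.
move=> H; rewrite (cos_rad b H) !mulrA sg2 mul1r; have r0 := rad_gt0 b H.
rewrite pmulr_lge0 ?invr_gt0 ?addr_gt0 ?exprn_gt0// subr_ge0.
by rewrite expr_le1// ltW.
Qed.

Lemma bounded_on_compact (T : topologicalType) (K : set T) (A : T -> R) : compact K ->
  (forall x : T, K x -> {for x, continuous A}) ->
  exists2 C : R, 0 <= C & forall x : T, K x -> `|A x| <= C.
Proof.
move=> cK cA.
have cA' : {within K, continuous A}.
  by apply: continuous_in_subspaceT => x /set_mem; exact: cA.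
have [C [_ HC]] := compact_bounded (continuous_compact cA' cK).
exists (`|C| + 1); first by rewrite addr_ge0.
move=> x Kx; apply: HC; last by exists x.
by rewrite (le_lt_trans (ler_norm _))// ltrDl.
Qed.

Lemma Nice_bounded F : Nice F -> exists V, [/\ open V, reg `<=` V & forall a b c d : R,
  (forall t r, a <= t <= b -> c <= r <= d -> V (t, r)) ->
  exists2 C : R, 0 <= C & forall x, box a b c d x -> `|fre F.2 x| <= C /\ `|fim F.2 x| <= C].
Proof.
move=> /(_ 0%N)[V [oV rV H]]; exists V; split => // a b c d bV.
pose I (i : 'I_4) : set R := nth setT [:: `[a, b]; `[c, d]; `[-1, 1]; `[-1, 1]]%classic i.
pose K := [set v : 'rV[R]_4 | forall i, I i (v ord0 i)].
have cK : compact K by apply: rV_compact; apply: I4_ind; exact: segment_compact.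
have KV : K `<=` dom V.
  by move=> v Kv; apply: bV; [have := Kv o0|have := Kv o1]; rewrite /I /= !in_itv.
have HB s : exists2 C : R, 0 <= C & forall x, box a b c d x -> 0 <= sg R s * cos (x 0 o2) ->
    `|fre F.2 x| <= C /\ `|fim F.2 x| <= C.
  have [A [B [CA CB r]]] := H s.
  have [C1 C10 HC1] := bounded_on_compact cK (fun x Kx => Cn_continuous CA (KV _ Kx)).
  have [C2 C20 HC2] := bounded_on_compact cK (fun x Kx => Cn_continuous CB (KV _ Kx)).
  exists (C1 + C2); first by rewrite addr_ge0.
  move=> x /and3P[xa xc xp] cx.
  have Kp : K (polar s x).
    have r1 : `|rad s (x 0 o2)| <= 1 by rewrite ger0_norm ?rad_le1// ltW// rad_gt0.
    apply: I4_ind; rewrite /I /= /polar !pt4S in_itv //= -ler_norml normrM.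
    - by rewrite mulr_ile1// /cosf ler_norml cos_geN1 cos_le1.
    - by rewrite mulr_ile1// /sinf ler_norml sin_geN1 sin_le1.
  have Dx : domF V x.
    by have := KV _ Kp; rewrite /dom /= /polar !pt4S.
  have [-> ->] := r x Dx.
  have hc k : `|cosf k x| <= 1 by rewrite /cosf ler_norml cos_geN1 cos_le1.
  have hs k : `|sinf k x| <= 1 by rewrite /sinf ler_norml sin_geN1 sin_le1.
  have k1 (u v w : R) : `|u| <= 1 -> `|v| <= w -> `|u * v| <= w.
    by move=> hu hv; rewrite normrM (le_trans _ hv)// ler_piMl.
  split; first by rewrite (le_trans (ler_normD _ _))// lerD// k1// ?HC1// HC2.
  by rewrite (le_trans (ler_normB _ _))// addrC lerD// k1// ?HC1// HC2.
have [C1 C10 HC1] := HB true; have [C2 C20 HC2] := HB false.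
exists (C1 + C2); first by rewrite addr_ge0.
move=> x bx; have [c0|c0] := leP 0 (cos (x 0 o2)).
  have [|H1 H2] := HC1 x bx _; first by rewrite /sg mul1r.
  by split; [rewrite (le_trans H1)|rewrite (le_trans H2)]; rewrite ?lerDl.
have [|H1 H2] := HC2 x bx _; first by rewrite /sg mulN1r oppr_ge0 ltW.
by split; [rewrite (le_trans H1)|rewrite (le_trans H2)]; rewrite ?lerDr.
Qed.

(* Going once around a circle of latitude multiplies a spin-weighted scalar by
   a phase depending only on the class of its weight modulo integers. *)
Lemma Nice_period F (a b c : R) : Nice F -> tau0 <= a -> 2 * M <= b -> 0 < c < pi ->
  let k := F.1 * (2 * pi) in
  fre F.2 (pt4 a b c (2 * pi)) = cos k * fre F.2 (pt4 a b c 0) + sin k * fim F.2 (pt4 a b c 0) /\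
  fim F.2 (pt4 a b c (2 * pi)) = cos k * fim F.2 (pt4 a b c 0) - sin k * fre F.2 (pt4 a b c 0).
Proof.
move=> /(_ 0%N)[V [oV rV H]] ta Mb cp k.
have [A [B [_ _ r]]] := H true.
have D p : domF V (pt4 a b c p) by rewrite /domF /= !pt4S; split=> //; exact: rV.
have [-> ->] := r _ (D (2 * pi)); have [-> ->] := r _ (D 0).
have -> : polar true (pt4 a b c (2 * pi)) = polar true (pt4 a b c 0).
  rewrite /polar /radf /cosf /sinf !pt4S !mul1r cos0 sin0.
  by rewrite [2 * pi]mulr_natl cos2pi sin2pi.
rewrite /cosf /sinf !pt4S mulr0 cos0 sin0 /sg !mul1r -/k.
by rewrite !mul0r addr0 subr0.
Qed.

Lemma is_derive_pt4 V (i : 'I_4) (A : 'rV[R]_4 -> R) (a b c d : R) : Cn 1 (domF V) A -> domF V (pt4 a b c d) ->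
  is_derive ([:: a; b; c; d]`_i) (1 : R)
    (fun t => A (pt4 (if i == o0 then t else a) (if i == o1 then t else b)
      (if i == o2 then t else c) (if i == o3 then t else d))) (pd i A (pt4 a b c d)).
Proof.
move=> CF Dx.
have dF := Cn_derivable (i:=i) CF Dx.
have := @is_derive_line R 4 A (pt4 a b c d - [:: a; b; c; d]`_i *: e_ R i) (e_ R i) [:: a; b; c; d]`_i.
rewrite subrK pdE => /(_ dF).
rewrite (_ : (fun t : R => A (_ + t *: _)) = (fun t => A (pt4 (if i == o0 then t else a) (if i == o1 then t else b)
      (if i == o2 then t else c) (if i == o3 then t else d))))//.
apply/funext => t; congr A; rewrite -addrA -scaleNr -scalerDl.
move: i {CF dF}; apply: I4_ind; apply: eq_pt4; rewrite e_4 !pt4S /= ?mulr0 ?addr0 ?mulr1 //; ring.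
Qed.

End Nice.

(** * Integration over the sphere *)

Section Caratheodory.
Context {R : realType} d (Y : measurableType d).
Notation RR := (measurableTypeR R).

Let grid (n : nat) (x : R) : R := (Num.floor (n.+1%:R * x))%:~R / n.+1%:R.

Let grid_cvg (x : R) : grid n x @[n --> \oo] --> x.
Proof.
apply/cvgrPdist_lt => _/posnumP[e]; near=> n.
have n0 : 0 < n.+1%:R :> R by [].
have /andP[f1 f2] := floor_itv (n.+1%:R * x).
have H : n.+1%:R^-1 < e%:num by near: n; exact: near_infty_natSinv_lt.
have g1 : grid n x <= x by rewrite /grid ler_pdivrMr// [x * _]mulrC.
rewrite ger0_norm ?subr_ge0// (le_lt_trans _ H)// lerBlDl /grid -[X in _ + X]mul1r -mulrDl.
by rewrite ler_pdivlMr// [x * _]mulrC (le_trans (ltW f2))// intrD.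
Unshelve. all: by end_near. Qed.

Let grid_comp (k : R -> R) (x : R) : {for x, continuous k} ->
  k (grid n x) @[n --> \oo] --> k x.
Proof. by move=> ck; apply: continuous_cvg => //; exact: grid_cvg. Qed.

(* A function of two variables, continuous in the first and measurable in the
   second, is a limit of functions that are constant in the first variable on
   the cells of a grid. *)
Lemma measurable_caratheodory (U : set R) (f : R -> Y -> R) : open U ->
  (forall y x, U x -> {for x, continuous (f ^~ y)}) ->
  (forall x, U x -> measurable_fun setT (f x)) ->
  measurable_fun ((U : set RR) `*` setT) (fun z : RR * Y => f z.1 z.2).
Proof.
move=> oU cf mf.
have mU : measurable U by exact: measurable_realfun.open_measurable.
(* A grid point may fall outside [U], where nothing is assumed of [f]; the value [0] given there
   does not affect the limit, since [U] is open and the grid points converge. *)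
pose g n (z : RR * Y) : R := if pselect (U (grid n z.1)) then f (grid n z.1) z.2 else 0.
have mg n : measurable_fun setT (g n).
  move=> _ B mB; rewrite setTI.
  pose q (m : int) : R := m%:~R / n.+1%:R.
  pose A (m : int) : set (RR * Y) :=
    [set x | Num.floor (n.+1%:R * x) = m] `*`
    [set y | B (if pselect (U (q m)) then f (q m) y else 0)].
  have mA m : measurable (A m).
    apply: measurableX.
      rewrite (_ : [set x | _] = `[q m, q (m + 1)[%classic) //.
      apply/seteqP; split=> x /=; rewrite in_itv /= /q.
        move/eqP; rewrite floor_eq => /andP[h1 h2].
        by rewrite ler_pdivrMr// ltr_pdivlMr// ![x * _]mulrC h1.
      rewrite ler_pdivrMr// ltr_pdivlMr// ![x * _]mulrC => /andP[h1 h2].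
      by apply/eqP; rewrite floor_eq h1.
    have [Uq|Uq] := pselect (U (q m)).
      rewrite (_ : [set y | _] = f (q m) @^-1` B).
        by have := mf _ Uq measurableT _ mB; rewrite setTI.
      by apply/seteqP; split=> y /=; case: pselect.
    have [B0|B0] := pselect (B 0).
      by rewrite (_ : [set y | _] = setT)//; apply/seteqP; split=> y //= _; case: pselect.
    by rewrite (_ : [set y | _] = set0)//; apply/seteqP; split=> y //=; case: pselect.
  rewrite (_ : _ @^-1` _ = \bigcup_(k in setT) (A (Posz k) `|` A (Negz k))).
    by apply: bigcupT_measurable => k; exact: measurableU.
  apply/seteqP; split => [[x y] /= Bg|[x y] /= [k _ [] [/= Ek Bk]]].
  - have Am : A (Num.floor (n.+1%:R * x)) (x, y) by split.
    by move: Am; case: (Num.floor _) => k Ak; exists k => //; [left|right].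
  - by rewrite /g /grid /= Ek.
  - by rewrite /g /grid /= Ek.
apply: (@measurable_fun_cvg _ _ _ _ g).
  by move=> n; exact: measurable_funTS.
move=> [x y] [/= Ux _].
have cg : f (grid n x) y @[n --> \oo] --> f x y.
  exact: (grid_comp (cf y x Ux)).
apply: cvg_trans cg; apply: near_eq_cvg.
have : \forall n \near \oo, U (grid n x).
  by apply: (@grid_cvg (x : R)); exact: open_nbhs_nbhs.
by apply: filterS => n Un; rewrite /g /=; case: pselect.
Qed.

End Caratheodory.

Section Fubini.
Context (R : realType).
Notation RR := (measurableTypeR R).
Notation lam := (@lebesgue_measure R).
Notation lam2 := (lam \x lam)%E.

Section Rectangle.
Variables (A B : set RR) (f : RR * RR -> \bar R).
Hypotheses (mA : measurable A) (mB : measurable B).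

Let patchE1 x : (\int[lam]_y (f \_ (A `*` B)) (x, y) =
  ((fun x => \int[lam]_(y in B) f (x, y)) \_ A) x)%E.
Proof.
rewrite /patch; case: ifPn => [/set_mem Ax|/negP Ax].
  rewrite [RHS]integral_mkcond; apply: eq_integral => y _; rewrite /patch.
  by congr (if _ then _ else _); apply/idP/idP => /set_mem H; apply/mem_set; [case: H|split].
rewrite integral0_eq// => y _; case: ifPn => // /set_mem[/= Ax' _].
by case: Ax; apply/mem_set.
Qed.

Let patchE2 y : (\int[lam]_x (f \_ (A `*` B)) (x, y) =
  ((fun y => \int[lam]_(x in A) f (x, y)) \_ B) y)%E.
Proof.
rewrite /patch; case: ifPn => [/set_mem By|/negP By].
  rewrite [RHS]integral_mkcond; apply: eq_integral => x _; rewrite /patch.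
  by congr (if _ then _ else _); apply/idP/idP => /set_mem H; apply/mem_set; [case: H|split].
rewrite integral0_eq// => x _; case: ifPn => // /set_mem[/= _ By'].
by case: By; apply/mem_set.
Qed.

Lemma fubini_rect : lam2.-integrable (A `*` B) f ->
  (\int[lam2]_(z in A `*` B) f z = \int[lam]_(x in A) \int[lam]_(y in B) f (x, y))%E /\
  (\int[lam2]_(z in A `*` B) f z = \int[lam]_(y in B) \int[lam]_(x in A) f (x, y))%E.
Proof.
move=> ig; have H : lam2.-integrable setT (f \_ (A `*` B)).
  by apply/(integrable_mkcond (mu := lam2) f (measurableX mA mB)).
split.
  apply: (etrans (integral_mkcond _ _)); apply: (etrans (esym (integral12_prod_meas1 H))).
  apply: (etrans _ (esym (integral_mkcond _ _))).
  by apply: eq_integral => x _; exact: patchE1.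
apply: (etrans (integral_mkcond _ _)); apply: (etrans (esym (integral21_prod_meas1 H))).
  apply: (etrans _ (esym (integral_mkcond _ _))).
by apply: eq_integral => y _; exact: patchE2.
Qed.

Lemma tonelli_rect : measurable_fun (A `*` B) f -> (forall z, (A `*` B) z -> (0 <= f z)%E) ->
  (\int[lam2]_(z in A `*` B) f z = \int[lam]_(x in A) \int[lam]_(y in B) f (x, y))%E /\
  (\int[lam2]_(z in A `*` B) f z = \int[lam]_(y in B) \int[lam]_(x in A) f (x, y))%E.
Proof.
move=> mf f0.
have mf' : measurable_fun setT (f \_ (A `*` B)).
  by apply/(measurable_restrictT _ (measurableX mA mB)).
have f0' z : (0 <= (f \_ (A `*` B)) z)%E.
  by rewrite /patch; case: ifPn => // /set_mem /f0.
split.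
  apply: (etrans (integral_mkcond _ _)); apply: (etrans (fubini_tonelli1 _ mf' f0')).
  apply: (etrans _ (esym (integral_mkcond _ _))).
  by apply: eq_integral => x _; exact: patchE1.
apply: (etrans (integral_mkcond _ _)); apply: (etrans (fubini_tonelli2 _ mf' f0')).
  apply: (etrans _ (esym (integral_mkcond _ _))).
by apply: eq_integral => y _; exact: patchE2.
Qed.

Lemma tonelli_measurable : measurable_fun (A `*` B) f -> (forall z, (A `*` B) z -> (0 <= f z)%E) ->
  measurable_fun A (fun x => \int[lam]_(y in B) f (x, y))%E /\
  measurable_fun B (fun y => \int[lam]_(x in A) f (x, y))%E.
Proof.
move=> mf f0.
have mf' : measurable_fun setT (f \_ (A `*` B)).
  by apply/(measurable_restrictT _ (measurableX mA mB)).
have f0' z : (0 <= (f \_ (A `*` B)) z)%E.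
  by rewrite /patch; case: ifPn => // /set_mem /f0.
split; apply/measurable_restrictT => //.
  have := measurable_fun_fubini_tonelli_F (m2 := lam) _ mf' f0'.
  by apply: eq_measurable_fun => x _; exact: patchE1.
have := measurable_fun_fubini_tonelli_G (m1 := lam) _ mf' f0'.
by apply: eq_measurable_fun => x _; exact: patchE2.
Qed.

End Rectangle.

Definition sphD : set (RR * RR) := `]0, pi[ `*` `[0, 2 * pi].

Lemma measurable_sphD : measurable sphD.
Proof. exact: measurableX. Qed.

Lemma lam2_rect (A B : set RR) : measurable A -> measurable B ->
  lam2 (A `*` B) = (lam A * lam B)%E.
Proof. by move=> mA mB; rewrite product_measure1E. Qed.

Lemma lam2_sphD : (lam2 sphD < +oo)%E.
Proof.
rewrite /sphD lam2_rect//= !lebesgue_measure_itv/= !lte_fin pi_gt0 mulr_gt0 ?pi_gt0//.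
by rewrite -!EFinD -EFinM ltry.
Qed.

(* Integrands on the sphere: continuous in each angle, away from the poles,
   and bounded. *)
Definition sphfun (g : R -> R -> R) := [/\
  forall theta phi, 0 < theta < pi -> {for theta, continuous (g ^~ phi)},
  forall theta, 0 < theta < pi -> continuous (g theta) &
  exists2 C : R, 0 <= C & forall theta phi, 0 < theta < pi -> `|g theta phi| <= C].

Lemma sphfun_measurable g : sphfun g -> measurable_fun sphD (fun z : RR * RR => g z.1 z.2).
Proof.
move=> [c1 c2 _].
apply: (@measurable_funS _ _ _ _ (`]0, pi[ `*` setT)) => //.
- exact: measurableX.
- by move=> z [? _].
apply: measurable_caratheodory.
- exact: interval_open.
- by move=> phi theta; rewrite /= in_itv /= => H; exact: c1.
- move=> theta; rewrite /= in_itv /= => H.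
  exact: continuous_measurable_fun (c2 _ H).
Qed.

Lemma sphfun_sin : sphfun (fun theta _ => sin theta).
Proof.
split.
- by move=> theta _ _; exact: continuous_sin.
- by move=> theta _; exact: cst_continuous.
- by exists 1 => // theta _ _; rewrite ler_norml sin_geN1 sin_le1.
Qed.

Lemma sphfunM g k : sphfun g -> sphfun k -> sphfun (fun t p => g t p * k t p).
Proof.
move=> [g1 g2 [C C0 gC]] [k1 k2 [D D0 kD]]; split.
- by move=> t p H; exact: (continuousM (g1 _ _ H) (k1 _ _ H)).
- by move=> t H p; exact: (continuousM (g2 _ H p) (k2 _ H p)).
- exists (C * D); first exact: mulr_ge0.
  by move=> t p H; rewrite normrM ler_pM// ?gC ?kD.
Qed.

Lemma sphfunD g k : sphfun g -> sphfun k -> sphfun (fun t p => g t p + k t p).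
Proof.
move=> [g1 g2 [C C0 gC]] [k1 k2 [D D0 kD]]; split.
- by move=> t p H; exact: (continuousD (g1 _ _ H) (k1 _ _ H)).
- by move=> t H p; exact: (continuousD (g2 _ H p) (k2 _ H p)).
- exists (C + D); first exact: addr_ge0.
  by move=> t p H; rewrite (le_trans (ler_normD _ _))// lerD// ?gC ?kD.
Qed.

Lemma sphfun_cst (c : R) : sphfun (fun _ _ => c).
Proof.
split=> *; [exact: cst_continuous|exact: cst_continuous|].
by exists `|c|.
Qed.

Lemma sphfun_integrable g : sphfun g ->
  lam2.-integrable sphD (EFin \o (fun z : RR * RR => g z.1 z.2 * sin z.1)).
Proof.
move=> sg; have sgs := sphfunM sg sphfun_sin.
apply: measurable_bounded_integrable.
- exact: measurable_sphD.
- exact: lam2_sphD.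
- exact: sphfun_measurable sgs.
- have [_ _ [C C0 gC]] := sgs.
  exists C; split; first exact: num_real.
  move=> D CD z [/= z1 _]; rewrite in_itv /= in z1.
  by rewrite (le_trans (gC _ _ z1))// ltW.
Qed.

(** A real number and an integral for the product measure: this form is additive and can be
    differentiated under the sign. [sphere_intE] relates it to the iterated extended-real integral
    [sphere_int]. *)
Definition Sint (g : R -> R -> R) : R := (\int[lam2]_(z in sphD) (g z.1 z.2 * sin z.1))%R.

Lemma SintE g : sphfun g -> (Sint g)%:E = (\int[lam2]_(z in sphD) (g z.1 z.2 * sin z.1)%:E)%E.
Proof.
move=> /sphfun_integrable ig; rewrite /Sint /Rintegral fineK//.
exact: (integrable_fin_num measurable_sphD ig).
Qed.

Lemma SintD g k : sphfun g -> sphfun k -> Sint (fun t p => g t p + k t p) = Sint g + Sint k.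
Proof.
move=> sg sk; rewrite /Sint -RintegralD//.
- by apply: eq_Rintegral => z _; rewrite mulrDl.
- exact: measurable_sphD.
- exact: sphfun_integrable sg.
- exact: sphfun_integrable sk.
Qed.

Lemma SintZ (c : R) g : sphfun g -> Sint (fun t p => c * g t p) = c * Sint g.
Proof.
move=> sg; rewrite /Sint -RintegralZl//.
- by apply: eq_Rintegral => z _; rewrite mulrA.
- exact: measurable_sphD.
- exact: sphfun_integrable sg.
Qed.

Lemma eq_Sint g k : (forall t p, 0 < t < pi -> g t p = k t p) -> Sint g = Sint k.
Proof.
move=> gk; apply: eq_Rintegral => z /set_mem[/= z1 _].
by rewrite in_itv /= in z1; rewrite gk.
Qed.

Lemma le_Sint g k : sphfun g -> sphfun k -> (forall t p, 0 < t < pi -> g t p <= k t p) ->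
  Sint g <= Sint k.
Proof.
move=> sg sk gk; apply: le_Rintegral.
- exact: measurable_sphD.
- exact: sphfun_integrable sg.
- exact: sphfun_integrable sk.
- move=> z [/= z1 _]; rewrite in_itv /= in z1.
  by rewrite ler_wpM2r ?gk// ltW// sin_gt0_pi.
Qed.

Lemma Sint_ge0 g : (forall t p, 0 < t < pi -> 0 <= g t p) -> 0 <= Sint g.
Proof.
move=> g0; apply: Rintegral_ge0 => z [/= z1 _]; rewrite in_itv /= in z1.
by rewrite mulr_ge0 ?g0// ltW// sin_gt0_pi.
Qed.

Lemma sphere_intE g : sphfun g -> (forall t p, 0 < t < pi -> 0 <= g t p) ->
  sphere_int g = (Sint g)%:E.
Proof.
move=> sg g0; rewrite SintE//.
apply: esym; exact: (fubini_rect (measurable_itv _) (measurable_itv _) (sphfun_integrable sg)).1.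
Qed.

End Fubini.

Section Under.
Context (R : realType).
Notation RR := (measurableTypeR R).
Notation lam := (@lebesgue_measure R).
Notation lam2 := (lam \x lam)%E.

Lemma is_derive_Sint (k k' : R -> R -> R -> R) (a u v C : R) : u < a < v ->
  (forall x, u < x < v -> sphfun (k x)) ->
  (forall x theta phi, u < x < v -> 0 < theta < pi ->
    is_derive x (1 : R) (fun x => k x theta phi) (k' x theta phi)) ->
  (forall x theta phi, u < x < v -> 0 < theta < pi -> `|k' x theta phi| <= C) ->
  is_derive a (1 : R) (fun x => Sint (k x)) (Sint (k' a)).
Proof.
move=> auv sk dk bk.
have C0 : 0 <= C.
  apply: le_trans (bk a (pi / 2) 0 auv _) => //; rewrite divr_gt0 ?pi_gt0//=.
  by rewrite ltr_pdivrMr// ltr_pMr ?pi_gt0// ltr1n.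
pose f x (z : RR * RR) := k x z.1 z.2 * sin z.1.
have Ia : `]u, v[%classic a by rewrite /= in_itv.
have intf x : `]u, v[%classic x -> lam2.-integrable (@sphD R) (EFin \o f x).
  by rewrite /= in_itv /= => xuv; exact: sphfun_integrable (sk x xuv).
have df x z : `]u, v[%classic x -> @sphD R z ->
    is_derive (x : R) (1 : R) (fun y : R => f y z) (k' x z.1 z.2 * sin z.1).
  move=> xuv [zs _]; rewrite /= !in_itv /= in xuv zs.
  have dk' := dk x z.1 z.2 xuv zs.
  apply: (is_derive_eq (is_deriveM dk' (is_derive_cst (sin z.1) x 1))).
  by rewrite /GRing.scale /= mulr0 add0r mulrC.
have derf x z : `]u, v[%classic x -> @sphD R z -> derivable (f ^~ z) x 1.
  by move=> xu zs; have [] := df x z xu zs.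
have Gub x z : `]u, v[%classic x -> @sphD R z -> `|partial1of2 f x z| <= C.
  move=> xu zs; rewrite partial1of2E; have [_ ->] := df x z xu zs.
  have [z1 _] := zs; rewrite /= !in_itv /= in xu z1.
  rewrite normrM -[leRHS]mulr1 ler_pM ?bk//.
  by rewrite ler_norml sin_geN1 sin_le1.
have iC : lam2.-integrable (@sphD R) (EFin \o (fun _ : RR * RR => C)).
  apply: measurable_bounded_integrable.
  - exact: measurable_sphD.
  - exact: lam2_sphD.
  - exact: measurable_cst.
  - by exists `|C|; split; [exact: num_real|move=> D CD z _; exact: ltW].
have H1 := derivable_under_integral (@measurable_sphD R) Ia intf derf (fun _ => C0) iC Gub.
have H2 := differentiation_under_integral (@measurable_sphD R) Ia intf derf (fun _ => C0) iC Gub.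
split; first exact: H1.
rewrite -derive1E H2; apply: eq_Rintegral => z /set_mem zs.
by rewrite partial1of2E; have [_ ->] := df a z Ia zs.
Qed.

End Under.

Lemma is_derive1_continuous (R : realType) (f : R -> R) (x d : R) : is_derive x (1 : R) f d ->
  {for x, continuous f}.
Proof. by move=> [H _]; apply: differentiable_continuous; exact/derivable1_diffP. Qed.

(** * The inner product on the spheres and its derivatives *)

Section Inner.
Variables (R : realType) (M tau0 : R) (h : R -> R).
Hypothesis hsmooth : forall (n : nat) (r : R), 2 * M <= r ->
  \forall x \near r, derivable (h^`(n)%classic) x 1.
Implicit Types F G : spin_scalar R.
Notation reg := (reg M tau0).
Notation Nice := (Nice M tau0).

(** The real part of [F] times the conjugate of [G]. *)
Definition dens F G (x : 'rV[R]_4) : R := fre F.2 x * fre G.2 x + fim F.2 x * fim G.2 x.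

Definition ip F G (t r : R) : R := Sint (fun theta phi => dens F G (pt4 t r theta phi)).

Lemma open_rect (V : set (R * R)) t r : open V -> V (t, r) -> exists2 e : R, 0 < e &
  forall t' r', t - e <= t' <= t + e -> r - e <= r' <= r + e -> V (t', r').
Proof.
move=> oV Vp; have : nbhs (t, r) V by exact: open_nbhs_nbhs.
move=> /nbhs_ballP[e /= e0 eV]; exists (e / 2); first by rewrite divr_gt0.
have e2 : e / 2 < e by rewrite ltr_pdivrMr// ltr_pMr// ltr1n.
move=> t' r' Ht Hr; apply: eV; split => /=; rewrite /ball /= distrC.
  by apply: le_lt_trans e2; rewrite ler_distl.
by apply: le_lt_trans e2; rewrite ler_distl.
Qed.

Lemma Nice_good F : Nice F -> exists V, [/\ open V, reg `<=` V, smoothOn 1 V F &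
  forall a b c d : R,
  (forall t r, a <= t <= b -> c <= r <= d -> V (t, r)) ->
  exists2 C : R, 0 <= C & forall x, box a b c d x ->
  [/\ `|fre F.2 x| <= C, `|fim F.2 x| <= C,
      `|fre (op_tau F).2 x| <= C /\ `|fim (op_tau F).2 x| <= C &
      `|fre (op_rho F).2 x| <= C /\ `|fim (op_rho F).2 x| <= C]].
Proof.
move=> NF.
have [V1 [oV1 r1 B1]] := Nice_bounded NF.
have [V2 [oV2 r2 B2]] := Nice_bounded (Nice_tau NF).
have [V3 [oV3 r3 B3]] := Nice_bounded (Nice_rho NF).
have [V4 [oV4 r4 [S1 S2]]] := Nice_smoothOn 1 NF.
exists (V1 `&` V2 `&` (V3 `&` V4)); split.
- by apply: openI; apply: openI.
- by move=> p rp; split; split; [exact: r1|exact: r2|exact: r3|exact: r4].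
- have HV : domF (V1 `&` V2 `&` (V3 `&` V4)) `<=` domF V4 by move=> x [[_ []]].
  by split; [exact: Cn_sub S1|exact: Cn_sub S2].
move=> a b c d H.
have [|C1 C10 H1] := B1 a b c d; first by move=> t r ht hr; have [[]] := H t r ht hr.
have [|C2 C20 H2] := B2 a b c d; first by move=> t r ht hr; have [[]] := H t r ht hr.
have [|C3 C30 H3] := B3 a b c d; first by move=> t r ht hr; have [_ []] := H t r ht hr.
exists (C1 + C2 + C3); first by rewrite !addr_ge0.
move=> x bx; have [[[e1 e2] [e3 e4]] [e5 e6]] := (H1 x bx, H2 x bx, H3 x bx).
have le1 y : y <= C1 -> y <= C1 + C2 + C3 by clear -C20 C30; lra.
have le2 y : y <= C2 -> y <= C1 + C2 + C3 by clear -C10 C30; lra.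
have le3 y : y <= C3 -> y <= C1 + C2 + C3 by clear -C10 C20; lra.
by split; [exact: le1|exact: le1|split; exact: le2|split; exact: le3].
Qed.

Lemma fre_d_rhoE F x : fre (op_rho F).2 x = pd o1 (fre F.2) x.
Proof. by rewrite pdE fre_d_rho. Qed.
Lemma fim_d_rhoE F x : fim (op_rho F).2 x = pd o1 (fim F.2) x.
Proof. by rewrite pdE fim_d_rho. Qed.

Lemma box_pt4 (a b c d t r th ph : R) : a <= t <= b -> c <= r <= d -> 0 < th < pi ->
  box a b c d (pt4 t r th ph).
Proof. by move=> h1 h2 h3; rewrite /box !pt4S h1 h2. Qed.

Lemma domF_pt4 V (t r th ph : R) : V (t, r) -> 0 < th < pi -> domF V (pt4 t r th ph).
Proof. by rewrite /domF /= !pt4S. Qed.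

Lemma is_derive_pt4_0 V (A : 'rV[R]_4 -> R) t r th ph : Cn 1 (domF V) A -> V (t, r) ->
  0 < th < pi -> is_derive t (1 : R) (fun t => A (pt4 t r th ph)) (pd o0 A (pt4 t r th ph)).
Proof. by move=> CA Vp tp; exact: (@is_derive_pt4 R V o0 A t r th ph CA (domF_pt4 ph Vp tp)). Qed.
Lemma is_derive_pt4_1 V (A : 'rV[R]_4 -> R) t r th ph : Cn 1 (domF V) A -> V (t, r) ->
  0 < th < pi -> is_derive r (1 : R) (fun r => A (pt4 t r th ph)) (pd o1 A (pt4 t r th ph)).
Proof. by move=> CA Vp tp; exact: (@is_derive_pt4 R V o1 A t r th ph CA (domF_pt4 ph Vp tp)). Qed.
Lemma is_derive_pt4_2 V (A : 'rV[R]_4 -> R) t r th ph : Cn 1 (domF V) A -> V (t, r) ->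
  0 < th < pi -> is_derive th (1 : R) (fun th => A (pt4 t r th ph)) (pd o2 A (pt4 t r th ph)).
Proof. by move=> CA Vp tp; exact: (@is_derive_pt4 R V o2 A t r th ph CA (domF_pt4 ph Vp tp)). Qed.
Lemma is_derive_pt4_3 V (A : 'rV[R]_4 -> R) t r th ph : Cn 1 (domF V) A -> V (t, r) ->
  0 < th < pi -> is_derive ph (1 : R) (fun ph => A (pt4 t r th ph)) (pd o3 A (pt4 t r th ph)).
Proof. by move=> CA Vp tp; exact: (@is_derive_pt4 R V o3 A t r th ph CA (domF_pt4 ph Vp tp)). Qed.

Lemma sphfun_comp V F t r : open V -> reg `<=` V -> smoothOn 1 V F ->
  (forall a b c d : R,
    (forall t r, a <= t <= b -> c <= r <= d -> V (t, r)) ->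
    exists2 C : R, 0 <= C & forall x, box a b c d x -> `|fre F.2 x| <= C /\ `|fim F.2 x| <= C) ->
  V (t, r) -> sphfun (fun th ph => fre F.2 (pt4 t r th ph)) /\
              sphfun (fun th ph => fim F.2 (pt4 t r th ph)).
Proof.
move=> oV rV [C1 C2] B Vp.
have [C C0 HC] : exists2 C : R, 0 <= C & forall x, box t t r r x -> `|fre F.2 x| <= C /\ `|fim F.2 x| <= C.
  apply: B => t' r' /andP[h1 h2] /andP[h3 h4].
  have -> : t' = t by lra.
  by have -> : r' = r by lra.
have bx th ph : 0 < th < pi -> box t t r r (pt4 t r th ph).
  by move=> H; apply: box_pt4 => //; rewrite lexx.
split; split.
- by move=> th ph H; exact: is_derive1_continuous (is_derive_pt4_2 ph C1 Vp H).
- by move=> th H ph; exact: is_derive1_continuous (is_derive_pt4_3 ph C1 Vp H).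
- by exists C => // th ph H; have [] := HC _ (bx th ph H).
- by move=> th ph H; exact: is_derive1_continuous (is_derive_pt4_2 ph C2 Vp H).
- by move=> th H ph; exact: is_derive1_continuous (is_derive_pt4_3 ph C2 Vp H).
- by exists C => // th ph H; have [] := HC _ (bx th ph H).
Qed.

(** The open set extends past [tau = tau0] and [rho = 2M], so these derivatives of the sphere
    integrals are two-sided even on the boundary of the region. *)
Lemma ip_good F G : Nice F -> Nice G -> exists V, [/\ open V, reg `<=` V,
  (forall t r, V (t, r) -> sphfun (fun th ph => dens F G (pt4 t r th ph))),
  (forall t r, V (t, r) -> is_derive t (1 : R) (fun t => ip F G t r)
     (ip (op_tau F) G t r + ip F (op_tau G) t r)) &
  (forall t r, V (t, r) -> is_derive r (1 : R) (fun r => ip F G t r)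
     (ip (op_rho F) G t r + ip F (op_rho G) t r))].
Proof.
move=> NF NG.
have [VF [oF rF SF BF]] := Nice_good NF; have [VG [oG rG SG BG]] := Nice_good NG.
have [V1 [oV1 r1 S1 B1]] := Nice_good (Nice_tau NF).
have [V2 [oV2 r2 S2 B2]] := Nice_good (Nice_tau NG).
have [V3 [oV3 r3 S3 B3]] := Nice_good (Nice_rho NF).
have [V4 [oV4 r4 S4 B4]] := Nice_good (Nice_rho NG).
have cut V H (B : forall a b c d : R,
    (forall t r, a <= t <= b -> c <= r <= d -> V (t, r)) ->
    exists2 C : R, 0 <= C & forall x, box a b c d x ->
    [/\ `|fre H.2 x| <= C, `|fim H.2 x| <= C,
      `|fre (op_tau H).2 x| <= C /\ `|fim (op_tau H).2 x| <= C &
      `|fre (op_rho H).2 x| <= C /\ `|fim (op_rho H).2 x| <= C]) (a b c d : R) :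
    (forall t r, a <= t <= b -> c <= r <= d -> V (t, r)) ->
    exists2 C : R, 0 <= C & forall x, box a b c d x -> `|fre H.2 x| <= C /\ `|fim H.2 x| <= C.
  by move=> /B[C C0 HC]; exists C => // x /HC[].
have sd V V' H K t r : open V -> reg `<=` V -> smoothOn 1 V H -> 
    open V' -> reg `<=` V' -> smoothOn 1 V' K -> 
    (forall a b c d : R,
    (forall t r, a <= t <= b -> c <= r <= d -> V (t, r)) ->
    exists2 C : R, 0 <= C & forall x, box a b c d x ->
    [/\ `|fre H.2 x| <= C, `|fim H.2 x| <= C,
      `|fre (op_tau H).2 x| <= C /\ `|fim (op_tau H).2 x| <= C &
      `|fre (op_rho H).2 x| <= C /\ `|fim (op_rho H).2 x| <= C]) ->
    (forall a b c d : R,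
    (forall t r, a <= t <= b -> c <= r <= d -> V' (t, r)) ->
    exists2 C : R, 0 <= C & forall x, box a b c d x ->
    [/\ `|fre K.2 x| <= C, `|fim K.2 x| <= C,
      `|fre (op_tau K).2 x| <= C /\ `|fim (op_tau K).2 x| <= C &
      `|fre (op_rho K).2 x| <= C /\ `|fim (op_rho K).2 x| <= C]) ->
    V (t, r) -> V' (t, r) -> sphfun (fun th ph => dens H K (pt4 t r th ph)).
  move=> oV rV SV oV' rV' SV' BV BV' Vp V'p.
  have [h1 h2] := sphfun_comp oV rV SV (cut V H BV) Vp.
  have [h3 h4] := sphfun_comp oV' rV' SV' (cut V' K BV') V'p.
  by apply: sphfunD; exact: sphfunM.
exists ((VF `&` VG) `&` ((V1 `&` V2) `&` (V3 `&` V4))).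
have oV : open ((VF `&` VG) `&` ((V1 `&` V2) `&` (V3 `&` V4))) by do !apply: openI.
split => //.
- by move=> p rp; split; split; [exact: rF|exact: rG|split; [exact: r1|exact: r2]|split; [exact: r3|exact: r4]].
- by move=> t r [[h1 h2] _]; exact: (sd VF VG).
- move=> t r Vp; have [e e0 He] := open_rect oV Vp.
  have [[SF1 SF2] [SG1 SG2]] := (SF, SG).
  have [|CF CF0 HF] := BF (t - e) (t + e) r r.
    move=> t' r' ht /andP[hr hr']; have [] : (VF `&` VG) (t', r') by apply: (He t' r' ht _).1; rewrite (le_trans _ hr) ?(le_trans hr') ?gerBl ?lerDl ?ltW.
    by [].
  have [|CG CG0 HG] := BG (t - e) (t + e) r r.
    move=> t' r' ht /andP[hr hr']; have [] : (VF `&` VG) (t', r') by apply: (He t' r' ht _).1; rewrite (le_trans _ hr) ?(le_trans hr') ?gerBl ?lerDl ?ltW.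
    by [].
  have inV x : t - e < x < t + e -> ((VF `&` VG) `&` ((V1 `&` V2) `&` (V3 `&` V4))) (x, r).
    by move=> /andP[x1 x2]; apply: He; rewrite ?ltW ?gtrBl ?ltrDl.
  rewrite /ip -SintD; last 2 first.
  + by have [[_ h2] [[h3 _] _]] := Vp; exact: (sd V1 VG).
  + by have [[h2 _] [[_ h3] _]] := Vp; exact: (sd VF V2).
  apply: (@is_derive_Sint _ (fun x th ph => dens F G (pt4 x r th ph))
    (fun x th ph => dens (op_tau F) G (pt4 x r th ph) + dens F (op_tau G) (pt4 x r th ph))
    t (t - e) (t + e) (CF * CG + CF * CG + (CF * CG + CF * CG))).
  + by rewrite gtrBl ltrDl e0.
  + by move=> x /inV[[h1 h2] _]; exact: (sd VF VG).
  + move=> x th ph /inV[[h1 h2] _] Hth.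
    have d1 := is_derive_pt4_0 ph SF1 h1 Hth; have d2 := is_derive_pt4_0 ph SF2 h1 Hth.
    have d3 := is_derive_pt4_0 ph SG1 h2 Hth; have d4 := is_derive_pt4_0 ph SG2 h2 Hth.
    apply: (is_derive_eq (is_deriveD (is_deriveM d1 d3) (is_deriveM d2 d4))).
    rewrite /dens /GRing.scale /= !fre_d_tauE !fim_d_tauE.
    by move: (pd _ _ _) (pd _ _ _) (pd _ _ _) (pd _ _ _) => a b c d; ring.
  + move=> x th ph /andP[hx hx'] Hth.
    have bx : box (t - e) (t + e) r r (pt4 x r th ph).
      by apply: box_pt4 => //; [rewrite !ltW|rewrite lexx].
    have [f1 f2 [f3 f4] _] := HF _ bx; have [g1 g2 [g3 g4] _] := HG _ bx.
    rewrite /dens; do !(apply: le_trans (ler_normD _ _) _; apply: lerD);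
      by rewrite normrM ler_pM.
- move=> t r Vp; have [e e0 He] := open_rect oV Vp.
  have [[SF1 SF2] [SG1 SG2]] := (SF, SG).
  have [|CF CF0 HF] := BF t t (r - e) (r + e).
    move=> t' r' /andP[ht ht'] hr; have [] : (VF `&` VG) (t', r') by apply: (He t' r' _ hr).1; rewrite (le_trans _ ht) ?(le_trans ht') ?gerBl ?lerDl ?ltW.
    by [].
  have [|CG CG0 HG] := BG t t (r - e) (r + e).
    move=> t' r' /andP[ht ht'] hr; have [] : (VF `&` VG) (t', r') by apply: (He t' r' _ hr).1; rewrite (le_trans _ ht) ?(le_trans ht') ?gerBl ?lerDl ?ltW.
    by [].
  have inV x : r - e < x < r + e -> ((VF `&` VG) `&` ((V1 `&` V2) `&` (V3 `&` V4))) (t, x).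
    by move=> /andP[x1 x2]; apply: He; rewrite ?ltW ?gtrBl ?ltrDl.
  rewrite /ip -SintD; last 2 first.
  + by have [[_ h2] [_ [h3 _]]] := Vp; exact: (sd V3 VG).
  + by have [[h2 _] [_ [_ h3]]] := Vp; exact: (sd VF V4).
  apply: (@is_derive_Sint _ (fun x th ph => dens F G (pt4 t x th ph))
    (fun x th ph => dens (op_rho F) G (pt4 t x th ph) + dens F (op_rho G) (pt4 t x th ph))
    r (r - e) (r + e) (CF * CG + CF * CG + (CF * CG + CF * CG))).
  + by rewrite gtrBl ltrDl e0.
  + by move=> x /inV[[h1 h2] _]; exact: (sd VF VG).
  + move=> x th ph /inV[[h1 h2] _] Hth.
    have d1 := is_derive_pt4_1 ph SF1 h1 Hth; have d2 := is_derive_pt4_1 ph SF2 h1 Hth.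
    have d3 := is_derive_pt4_1 ph SG1 h2 Hth; have d4 := is_derive_pt4_1 ph SG2 h2 Hth.
    apply: (is_derive_eq (is_deriveD (is_deriveM d1 d3) (is_deriveM d2 d4))).
    rewrite /dens /GRing.scale /= !fre_d_rhoE !fim_d_rhoE.
    by move: (pd _ _ _) (pd _ _ _) (pd _ _ _) (pd _ _ _) => a b c d; ring.
  + move=> x th ph /andP[hx hx'] Hth.
    have bx : box t t (r - e) (r + e) (pt4 t x th ph).
      by apply: box_pt4 => //; [rewrite lexx|rewrite !ltW].
    have [f1 f2 _ [f3 f4]] := HF _ bx; have [g1 g2 _ [g3 g4]] := HG _ bx.
    rewrite /dens; do !(apply: le_trans (ler_normD _ _) _; apply: lerD);
      by rewrite normrM ler_pM.
Qed.

End Inner.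

(** * One-dimensional integrals *)

Section OneDim.
Context (R : realType).
Notation RR := (measurableTypeR R).
Notation lam := (@lebesgue_measure R).

Lemma integral_deriv (f f' : R -> R) (a b : R) : a < b ->
  (forall x, a <= x <= b -> is_derive x (1 : R) f (f' x)) ->
  (forall x, a <= x <= b -> {for x, continuous f'}) ->
  (\int[lam]_(x in `[a, b]) (f' x)%:E = (f b - f a)%:E)%E.
Proof.
move=> ab df cf'; rewrite (@continuous_FTC2 _ f' f a b) ?EFinB//.
- by apply: continuous_in_subspaceT => x; rewrite inE /= in_itv /= => /cf'.
- split.
  + by move=> x; rewrite in_itv /= => /andP[ax xb]; have [|] := df x _; rewrite ?ltW.
  + by apply: cvg_at_right_filter; apply: is_derive1_continuous (df a _); rewrite lexx ltW.
  + by apply: cvg_at_left_filter; apply: is_derive1_continuous (df b _); rewrite lexx ltW.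
- move=> x; rewrite in_itv /= => /andP[ax xb]; rewrite derive1E.
  by have [|_ ->] := df x _; rewrite ?ltW.
Qed.

Lemma Rintegral_le_cst (A : set RR) (f : R -> R) (C l : R) : measurable A ->
  lam A = l%:E -> measurable_fun A f -> (forall x, A x -> `|f x| <= C) ->
  `|\int[lam]_(x in A) f x| <= C * l.
Proof.
move=> mA lA mf fC.
have iC : lam.-integrable A (EFin \o (fun=> C)).
  apply: measurable_bounded_integrable => //.
    by rewrite [X in (X < _)%E]lA ltry.
  by exists `|C|; split; [exact: num_real|move=> D CD z _; exact: ltW].
have if_ : lam.-integrable A (EFin \o f).
  apply: (le_integrable _ _ _ iC) => //; first exact/measurable_EFinP.
  by move=> x Ax /=; rewrite lee_fin (le_trans (fC x Ax))// ler_norm.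
apply: (le_trans (le_normr_Rintegral mA if_)).
have -> : C * l = \int[lam]_(x in A) C.
  by rewrite Rintegral_cst// [X in fine X]lA.
apply: le_Rintegral => //.
by apply: (integrable_norm if_).
Qed.

(* The primitive need not be differentiable at the ends of the interval. *)
Lemma integral_deriv_sin (f f' : R -> R) (C K : R) : 0 <= K ->
  (forall x, 0 < x < pi -> is_derive x (1 : R) f (f' x)) ->
  (forall x, 0 < x < pi -> {for x, continuous f'}) ->
  (forall x, 0 < x < pi -> `|f' x| <= C) ->
  (forall x, 0 < x < pi -> `|f x| <= K * sin x) ->
  (\int[lam]_(x in `]0%R, pi[) (f' x)%:E = 0)%E.
Proof.
move=> K0 df cf' f'C fK; have p0 := pi_gt0 R.
have C0 : 0 <= C by apply: le_trans (f'C (pi / 2) _) => //; apply/andP; split; lra.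
have mf : measurable_fun (`]0, pi[ : set RR) f'.
  apply: open_continuous_measurable_fun; first exact: interval_open.
  by move=> x; rewrite inE /= in_itv /= => /cf'.
have if_ : lam.-integrable `]0, pi[ (EFin \o f').
  apply: measurable_bounded_integrable => //.
    by rewrite /= lebesgue_measure_itv /= lte_fin p0 -EFinD ltry.
  exists C; split; first exact: num_real.
  by move=> D CD x; rewrite /= in_itv /= => /f'C fx; rewrite (le_trans fx)// ltW.
suff H0 : \int[lam]_(x in `]0, pi[) f' x = 0.
  have fn : (\int[lam]_(x in `]0%R, pi[) (f' x)%:E)%E \is a fin_num.
    exact: (integrable_fin_num _ if_).
  by rewrite -(fineK fn); move: H0; rewrite /Rintegral => ->.
(* Remove an interval of length [e] at each pole: each contributes at most [C e]. On the rest the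
   fundamental theorem applies, and the primitive is at most [K sin e] at either end. *)
have bound e : 0 < e < pi / 2 ->
    `|\int[lam]_(x in `]0, pi[) f' x| <= (C * e + C * e) + (K * sin e + K * sin e).
  move=> /andP[e0 ep].
  have sub (A : set RR) : measurable A -> A `<=` `]0, pi[ -> lam.-integrable A (EFin \o f').
    by move=> mA AI; apply: integrableS if_.
  have E1 : (`]0, pi[%classic : set R) = `]0, e[ `|` (`[e, pi - e] `|` `]pi - e, pi[).
    apply/seteqP; split=> x /=; rewrite !in_itv /=.
      move=> /andP[x0 xp]; have [xe|xe] := ltP x e; first by left; rewrite x0.
      by right; have [xe'|xe'] := leP x (pi - e); [left|right].
    by case=> [|[]] /andP[h1 h2]; apply/andP; split; lra.
  have i1 : (`[e, pi - e]%classic : set R) `<=` `]0, pi[.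
    by move=> x /=; rewrite !in_itv /= => /andP[h1 h2]; apply/andP; split; lra.
  have i2 : (`]0, e[%classic : set R) `<=` `]0, pi[.
    by move=> x /=; rewrite !in_itv /= => /andP[h1 h2]; apply/andP; split; lra.
  have i3 : (`]pi - e, pi[%classic : set R) `<=` `]0, pi[.
    by move=> x /=; rewrite !in_itv /= => /andP[h1 h2]; apply/andP; split; lra.
  have IM : \int[lam]_(x in `[e, pi - e]) f' x = f (pi - e) - f e.
    have H1 : e < pi - e by lra.
    have H2 x : e <= x <= pi - e -> 0 < x < pi.
      by move=> /andP[h1 h2]; apply/andP; split; lra.
    have H := integral_deriv H1 (fun x Hx => df x (H2 x Hx)) (fun x Hx => cf' x (H2 x Hx)).
    by rewrite /Rintegral H.
  rewrite E1 Rintegral_setU//=; last 3 first.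
  - exact: measurableU.
  - by rewrite -E1.
  - apply/disj_setPS => x [] /=; rewrite !in_itv /= => /andP[h1 h2].
    by case=> /andP[h3 h4]; lra.
  rewrite Rintegral_setU//=; last 2 first.
  - by apply: sub; [exact: measurableU|move=> x []; [exact: i1|exact: i3]].
  - by apply/disj_setPS => x [] /=; rewrite !in_itv /= => /andP[h1 h2] /andP[h3 h4]; lra.
  rewrite addrCA addrC (addrC (\int[lam]_(x in `]0, e[) _)); apply: le_trans (ler_normD _ _) _.
  apply: lerD; last first.
    rewrite IM; apply: le_trans (ler_normB _ _) _; apply: lerD.
      rewrite (le_trans (fK _ _))//; first by apply/andP; split; lra.
      by rewrite addrC sinDpi sinN opprK.
    by apply: fK; apply/andP; split; lra.
  apply: le_trans (ler_normD _ _) _; apply: lerD.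
    apply: Rintegral_le_cst => //=.
    - rewrite lebesgue_measure_itv /= lte_fin ifT; last by lra.
      by rewrite -EFinB opprB addrC subrK.
    - exact: measurable_funS mf.
    - by move=> x /i3; rewrite /= in_itv /= => /f'C.
  apply: Rintegral_le_cst => //=.
  - by rewrite lebesgue_measure_itv /= lte_fin e0 -EFinB subr0.
  - exact: measurable_funS mf.
  - by move=> x /i2; rewrite /= in_itv /= => /f'C.
apply/eqP/negPn/negP => X0; rewrite -normr_gt0 in X0.
set X := `| _ | in X0 bound.
pose q e := (C * e + C * e) + (K * sin e + K * sin e).
have q0 : q 0 = 0 by rewrite /q sin0 !mulr0 !addr0.
have cg : q e @[e --> 0^'+] --> q 0.
  apply: cvg_at_right_filter.
  have cs : sin e @[e --> (0 : R)] --> sin (0 : R) by exact: continuous_sin.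
  by apply: cvgD; apply: cvgD; apply: cvgMr.
have F1 : \forall e \near 0^'+, (C * e + C * e) + (K * sin e + K * sin e) < X.
  by apply: (cvgr_lt (q 0) cg); rewrite q0.
have F2 : \forall e \near (0 : R)^'+, 0 < e < pi / 2.
  by near=> e; apply/andP; split => //; near: e; apply: nbhs_right_lt; rewrite divr_gt0.
have [e [Xe He]] : exists e : R, (C * e + C * e) + (K * sin e + K * sin e) < X /\ 0 < e < pi / 2.
  by apply: (@filter_ex _ (0 : R)^'+); apply: filterI.
by have := le_lt_trans (bound e He) Xe; rewrite ltxx.
Unshelve. all: by end_near. Qed.

End OneDim.

Section Inner.
Variables (R : realType) (M tau0 : R) (h : R -> R).
Hypothesis hsmooth : forall (n : nat) (r : R), 2 * M <= r ->
  \forall x \near r, derivable (h^`(n)%classic) x 1.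
Implicit Types F G : spin_scalar R.
Notation RR := (measurableTypeR R).
Notation lam := (@lebesgue_measure R).
Notation lam2 := (lam \x lam)%E.
Notation reg := (reg M tau0).
Notation Nice := (Nice M tau0).

Lemma densC F G x : dens F G x = dens G F x.
Proof. by rewrite /dens [fre _ _ * _]mulrC [fim _ _ * _]mulrC. Qed.

Lemma ipC F G t r : ip F G t r = ip G F t r.
Proof. by apply: eq_Sint => th ph _; exact: densC. Qed.

Lemma dens_ge0 F x : 0 <= dens F F x.
Proof. by rewrite addr_ge0// -expr2 sqr_ge0. Qed.

Lemma ip_ge0 F t r : 0 <= ip F F t r.
Proof. by apply: Sint_ge0 => th ph _; exact: dens_ge0. Qed.

Lemma sqmod_dens F t r th ph : sqmod F t r th ph = dens F F (pt4 t r th ph).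
Proof.
rewrite /sqmod /dens fre_pt4 fim_pt4; case: (F.2 t r th ph) => a b.
by rewrite /Normc.normc sqr_sqrtr ?addr_ge0 ?sqr_ge0// !expr2.
Qed.

Section AtPoint.
Variables (t r : R).
Hypothesis regp : reg (t, r).

Lemma sphfun_dens F G : Nice F -> Nice G -> sphfun (fun th ph => dens F G (pt4 t r th ph)).
Proof.
by move=> NF NG; have [V [_ rV H _ _]] := ip_good NF NG; apply: H; exact: rV.
Qed.

Lemma sphfun_fre F : Nice F -> sphfun (fun th ph => fre F.2 (pt4 t r th ph)).
Proof.
by move=> NF; have [V [oV rV S H]] := Nice_good NF; have [] := sphfun_comp oV rV S
  (fun a b c d HV => let: ex_intro2 C C0 HC := H a b c d HV in
   ex_intro2 _ _ C C0 (fun x bx => let: And4 h1 h2 _ _ := HC x bx in conj h1 h2)) (rV _ regp).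
Qed.

Lemma sphfun_fim F : Nice F -> sphfun (fun th ph => fim F.2 (pt4 t r th ph)).
Proof.
by move=> NF; have [V [oV rV S H]] := Nice_good NF; have [] := sphfun_comp oV rV S
  (fun a b c d HV => let: ex_intro2 C C0 HC := H a b c d HV in
   ex_intro2 _ _ C C0 (fun x bx => let: And4 h1 h2 _ _ := HC x bx in conj h1 h2)) (rV _ regp).
Qed.

Lemma is_derive_ip_tau F G : Nice F -> Nice G ->
  is_derive t (1 : R) (fun t => ip F G t r) (ip (op_tau F) G t r + ip F (op_tau G) t r).
Proof.
by move=> NF NG; have [V [_ rV _ H _]] := ip_good NF NG; apply: H; exact: rV.
Qed.

Lemma is_derive_ip_rho F G : Nice F -> Nice G ->
  is_derive r (1 : R) (fun r => ip F G t r) (ip (op_rho F) G t r + ip F (op_rho G) t r).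
Proof.
by move=> NF NG; have [V [_ rV _ _ H]] := ip_good NF NG; apply: H; exact: rV.
Qed.

Lemma sphere_int_sqmod F : Nice F -> sphere_int (sqmod F t r) = (ip F F t r)%:E.
Proof.
move=> NF; have -> : sqmod F t r = (fun th ph => dens F F (pt4 t r th ph)).
  by apply/funext => th; apply/funext => ph; exact: sqmod_dens.
by rewrite sphere_intE//; [exact: sphfun_dens|move=> th ph _; exact: dens_ge0].
Qed.

Lemma eq_ip F F' G G' : (forall th ph, 0 < th < pi -> F.2 t r th ph = F'.2 t r th ph) ->
  (forall th ph, 0 < th < pi -> G.2 t r th ph = G'.2 t r th ph) ->
  ip F G t r = ip F' G' t r.
Proof.
by move=> e1 e2; apply: eq_Sint => th ph H; rewrite /dens !fre_pt4 !fim_pt4 e1// e2.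
Qed.

Lemma ip_Y F G : Nice F -> Nice G ->
  ip (op_Y M h F) G t r = h^`()%classic r * ip (op_tau F) G t r - ip (op_rho F) G t r.
Proof.
move=> NF NG; have NT := Nice_tau NF; have NP := Nice_rho NF.
rewrite /ip -SintZ; last exact: sphfun_dens.
rewrite -[X in _ - X]mul1r -mulNr -SintZ; last exact: sphfun_dens.
rewrite -SintD; last 2 first.
- by apply: sphfunM; [exact: sphfun_cst|exact: sphfun_dens].
- by apply: sphfunM; [exact: sphfun_cst|exact: sphfun_dens].
apply: eq_Sint => th ph _; rewrite /dens.
have xr : (pt4 t r th ph) 0 o1 = r by rewrite pt4S.
move: (pt4 t r th ph) xr => x xr.
have -> : fre (op_Y M h F).2 x = h^`()%classic r * pd o0 (fre F.2) x - pd o1 (fre F.2) x.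
  by rewrite -xr; exact: fre_YE.
have -> : fim (op_Y M h F).2 x = h^`()%classic r * pd o0 (fim F.2) x - pd o1 (fim F.2) x.
  by rewrite -xr; exact: fim_YE.
have -> : fre (op_tau F).2 x = pd o0 (fre F.2) x by exact: fre_d_tauE.
have -> : fim (op_tau F).2 x = pd o0 (fim F.2) x by exact: fim_d_tauE.
rewrite fre_d_rhoE fim_d_rhoE.
by move: (pd _ _ _) (pd _ _ _) (pd _ _ _) (pd _ _ _) => a b c d; ring.
Qed.

Lemma ip_young F G (c : R) : 0 < c -> Nice F -> Nice G ->
  `|2 * ip F G t r| <= c * ip F F t r + c^-1 * ip G G t r.
Proof.
move=> c0 NF NG.
have key e : e ^+ 2 = 1 -> 2 * e * ip F G t r <= c * ip F F t r + c^-1 * ip G G t r.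
  move=> e2; rewrite /ip -!SintZ; do ?exact: sphfun_dens.
  rewrite -SintD; last 2 first.
  - by apply: sphfunM; [exact: sphfun_cst|exact: sphfun_dens].
  - by apply: sphfunM; [exact: sphfun_cst|exact: sphfun_dens].
  apply: le_Sint.
  - by apply: sphfunM; [exact: sphfun_cst|exact: sphfun_dens].
  - by apply: sphfunD; apply: sphfunM; [exact: sphfun_cst|exact: sphfun_dens|exact: sphfun_cst|exact: sphfun_dens].
  move=> th ph _; rewrite /dens.
  move: (fre F.2 _) (fre G.2 _) (fim F.2 _) (fim G.2 _) => x y z w.
  rewrite -subr_ge0.
  have -> : c * (x * x + z * z) + c^-1 * (y * y + w * w) - 2 * e * (x * y + z * w) =
     c * ((x - e * (c^-1 * y)) ^+ 2 + (z - e * (c^-1 * w)) ^+ 2) + (1 - e ^+ 2) * (c^-1 * (y * y + w * w)).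
    by field; rewrite gt_eqF.
  by rewrite e2 subrr mul0r addr0 mulr_ge0 ?(ltW c0)// addr_ge0// sqr_ge0.
rewrite ler_norml; apply/andP; split.
  have := key (-1); rewrite sqrrN expr1n => /(_ erefl).
  by rewrite mulrN1 mulNr lerNl.
by have := key 1; rewrite expr1n mulr1 => /(_ erefl).
Qed.

Lemma sphfunB (g k : R -> R -> R) : sphfun g -> sphfun k -> sphfun (fun t p => g t p - k t p).
Proof.
move=> sg sk; have := sphfunD sg (sphfunM (sphfun_cst (-1)) sk).
by rewrite (_ : (fun t p => _) = (fun t p => g t p - k t p))//; apply/funext => ?; apply/funext => ?; rewrite mulN1r.
Qed.

Lemma sphfun_cos : sphfun (fun th _ : R => cos th).
Proof.
split.
- by move=> theta _ _; exact: continuous_cos.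
- by move=> theta _; exact: cst_continuous.
- by exists 1 => // theta _ _; rewrite ler_norml cos_geN1 cos_le1.
Qed.

Lemma sphfun_integrable0 (g : R -> R -> R) : sphfun g ->
  lam2.-integrable (@sphD R) (EFin \o (fun z : RR * RR => g z.1 z.2)).
Proof.
move=> sg; apply: measurable_bounded_integrable.
- exact: measurable_sphD.
- exact: lam2_sphD.
- exact: sphfun_measurable sg.
- have [_ _ [C C0 gC]] := sg.
  exists C; split; first exact: num_real.
  move=> D CD z [/= z1 _]; rewrite in_itv /= in z1.
  by rewrite (le_trans (gC _ _ z1))// ltW.
Qed.

(* d_theta is recovered from the two operators of opposite spin. *)
Let fth F th ph := (fre (op_ang true F).2 (pt4 t r th ph) + fre (op_ang false F).2 (pt4 t r th ph)) * 2^-1.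
Let gth F th ph := (fim (op_ang true F).2 (pt4 t r th ph) + fim (op_ang false F).2 (pt4 t r th ph)) * 2^-1.

Let fthE F th ph : fth F th ph = pd o2 (fre F.2) (pt4 t r th ph).
Proof.
rewrite /fth !fre_angE /sg; move: (pd _ _ _) (pd _ _ _) => a b; move: (cos _ / _) => c.
by move: (sin _)^-1 (fre _ _) => d f; field.
Qed.

Let gthE F th ph : gth F th ph = pd o2 (fim F.2) (pt4 t r th ph).
Proof.
rewrite /gth !fim_angE /sg; move: (pd _ _ _) (pd _ _ _) => a b; move: (cos _ / _) => c.
by move: (sin _)^-1 (fim _ _) => d f; field.
Qed.

Let sphfun_fth F : Nice F -> sphfun (fth F).
Proof.
move=> NF; apply: sphfunM; last exact: sphfun_cst.
by apply: sphfunD; apply: sphfun_fre; exact: Nice_ang.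
Qed.
Let sphfun_gth F : Nice F -> sphfun (gth F).
Proof.
move=> NF; apply: sphfunM; last exact: sphfun_cst.
by apply: sphfunD; apply: sphfun_fim; exact: Nice_ang.
Qed.

(** Multiplied by [sin], the sum of the two densities is a [theta] derivative plus a [phi]
    derivative. The first integrates to [0] because [sin] vanishes at the poles. The second does
    because the product of [F] with the conjugate of [G] is periodic: the weights differ by an
    integer, so the phases gained around a circle cancel, even when they are [-1]. *)
Lemma ip_ang e F G : Nice F -> Nice G -> G.1 = F.1 + sg R e ->
  ip (op_ang e F) G t r = - ip F (op_ang (~~ e) G) t r.
Proof.
move=> NF NG GF; apply/eqP; rewrite -addr_eq0; apply/eqP.
have NeF := Nice_ang e NF; have NeG := Nice_ang (~~ e) NG.
have NpF := Nice_phi NF; have NpG := Nice_phi NG.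
rewrite /ip -SintD; do ?exact: sphfun_dens.
pose D th ph := dens F G (pt4 t r th ph).
(* The [theta] derivative of [D], written through the two angular operators so that its boundedness
   up to the poles is visible. [k1] is then the [theta] derivative of [sin * D], and [k2] the [phi]
   derivative of the imaginary part of the product. *)
pose D' th ph := fth F th ph * fre G.2 (pt4 t r th ph) + gth F th ph * fim G.2 (pt4 t r th ph)
  + (fre F.2 (pt4 t r th ph) * fth G th ph + fim F.2 (pt4 t r th ph) * gth G th ph).
pose k1 th ph := sin th * D' th ph + cos th * D th ph.
pose k2 th ph := fre F.2 (pt4 t r th ph) * fim (op_phi G).2 (pt4 t r th ph)
  + fre (op_phi F).2 (pt4 t r th ph) * fim G.2 (pt4 t r th ph)
  - (fim F.2 (pt4 t r th ph) * fre (op_phi G).2 (pt4 t r th ph)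
  + fim (op_phi F).2 (pt4 t r th ph) * fre G.2 (pt4 t r th ph)).
have sD : sphfun D by exact: sphfun_dens.
have sD' : sphfun D'.
  exact: (sphfunD (sphfunD (sphfunM (sphfun_fth NF) (sphfun_fre NG)) (sphfunM (sphfun_gth NF) (sphfun_fim NG)))
    (sphfunD (sphfunM (sphfun_fre NF) (sphfun_fth NG)) (sphfunM (sphfun_fim NF) (sphfun_gth NG)))).
have s1 : sphfun k1.
  exact: (sphfunD (sphfunM (@sphfun_sin R) sD') (sphfunM sphfun_cos sD)).
have s2 : sphfun k2.
  exact: (sphfunB (sphfunD (sphfunM (sphfun_fre NF) (sphfun_fim NpG)) (sphfunM (sphfun_fre NpF) (sphfun_fim NG)))
    (sphfunD (sphfunM (sphfun_fim NF) (sphfun_fre NpG)) (sphfunM (sphfun_fim NpF) (sphfun_fre NG)))).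
have E : Sint (fun th ph => dens (op_ang e F) G (pt4 t r th ph) + dens F (op_ang (~~ e) G) (pt4 t r th ph)) =
    \int[lam2]_(z in @sphD R) (k1 z.1 z.2 + sg R e * k2 z.1 z.2).
  apply: eq_Rintegral => z /set_mem[/= z1 _]; rewrite in_itv /= in z1.
  have sz : sin z.1 != 0 by rewrite gt_eqF// sin_gt0_pi.
  rewrite /dens !fre_angE !fim_angE /k1 /k2 /D' /D /dens !fthE !gthE !fre_d_phiE !fim_d_phiE.
  rewrite !pt4S GF /=.
  move: (pd o3 _ _) (pd o3 _ _) (pd o3 _ _) (pd o3 _ _) (pd o2 _ _) (pd o2 _ _) (pd o2 _ _) (pd o2 _ _)
    (fre _ _) (fim _ _) (fre _ _) (fim _ _) => a1 a2 a3 a4 a5 a6 a7 a8 a9 b1 b2 b3.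
  move: (sin _) (cos _) (F.1) sz => S c s S0.
  by clear -S0; case: e; rewrite /sg /=; field.
rewrite E RintegralD//; last 3 first.
- exact: measurable_sphD.
- exact: (sphfun_integrable0 s1).
- exact: (sphfun_integrable0 (sphfunM (sphfun_cst _) s2)).
have -> : \int[lam2]_(z in @sphD R) k1 z.1 z.2 = 0.
  rewrite /Rintegral (fubini_rect _ _ (sphfun_integrable0 s1)).2//=.
  rewrite integral0_eq// => ph _.
  have [_ _ [C1 C10 H1]] := s1; have [_ _ [CD CD0 HD]] := sD.
  apply: (@integral_deriv_sin _ (fun th => sin th * D th ph) (fun th => k1 th ph) C1 CD) => //.
  - move=> th Hth.
    have [V1 [oV1 rV1 [S1 S2]]] := Nice_smoothOn 1 NF.
    have [V2 [oV2 rV2 [S3 S4]]] := Nice_smoothOn 1 NG.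
    have d1 := is_derive_pt4_2 ph S1 (rV1 _ regp) Hth; have d2 := is_derive_pt4_2 ph S2 (rV1 _ regp) Hth.
    have d3 := is_derive_pt4_2 ph S3 (rV2 _ regp) Hth; have d4 := is_derive_pt4_2 ph S4 (rV2 _ regp) Hth.
    apply: (is_derive_eq (is_deriveM (is_derive_sin th) (is_deriveD (is_deriveM d1 d3) (is_deriveM d2 d4)))).
    rewrite /k1 /D' /D /dens /GRing.scale /= !fctE !fthE !gthE.
    by move: (pd _ _ _) (pd _ _ _) (pd _ _ _) (pd _ _ _) => a b c d; ring.
  - by move=> th Hth; have [+ _ _] := s1; apply.
  - by move=> th Hth; exact: H1.
  - move=> th Hth; rewrite normrM mulrC ler_pM// ?HD//.
    by rewrite ger0_norm// ltW// sin_gt0_pi.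
have -> : \int[lam2]_(z in @sphD R) (sg R e * k2 z.1 z.2) = 0.
  have s2' := sphfunM (sphfun_cst (sg R e)) s2.
  rewrite /Rintegral (fubini_rect _ _ (sphfun_integrable0 s2')).1//=.
  rewrite integral0_eq// => th; rewrite /= in_itv /= => Hth.
  have p0 : 0 < 2 * pi :> R by rewrite mulr_gt0 ?pi_gt0.
  have df ph : is_derive ph (1 : R) (fun ph => fre F.2 (pt4 t r th ph) * fim G.2 (pt4 t r th ph) -
      fim F.2 (pt4 t r th ph) * fre G.2 (pt4 t r th ph)) (k2 th ph).
    have [V1 [oV1 rV1 [S1 S2]]] := Nice_smoothOn 1 NF.
    have [V2 [oV2 rV2 [S3 S4]]] := Nice_smoothOn 1 NG.
    have d1 := is_derive_pt4_3 ph S1 (rV1 _ regp) Hth; have d2 := is_derive_pt4_3 ph S2 (rV1 _ regp) Hth.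
    have d3 := is_derive_pt4_3 ph S3 (rV2 _ regp) Hth; have d4 := is_derive_pt4_3 ph S4 (rV2 _ regp) Hth.
    apply: (is_derive_eq (is_deriveB (is_deriveM d1 d4) (is_deriveM d2 d3))).
    rewrite /k2 /GRing.scale /= !fre_d_phiE !fim_d_phiE.
    by move: (pd _ _ _) (pd _ _ _) (pd _ _ _) (pd _ _ _) => a b c d; ring.
  have cf ph : {for ph, continuous (fun ph => sg R e * k2 th ph)}.
    by have [_ + _] := s2'; move=> /(_ th Hth); apply.
  have dk ph : is_derive ph (1 : R) (fun ph => sg R e * (fre F.2 (pt4 t r th ph) * fim G.2 (pt4 t r th ph) -
      fim F.2 (pt4 t r th ph) * fre G.2 (pt4 t r th ph))) (sg R e * k2 th ph).
    apply: (is_derive_eq (is_deriveM (is_derive_cst (sg R e) ph 1) (df ph))).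
    by rewrite /GRing.scale /= mulr0 addr0.
  rewrite (integral_deriv p0 (fun x _ => dk x) (fun x _ => cf x)).
  have [-> ->] := Nice_period NF regp.1 regp.2 Hth; have [-> ->] := Nice_period NG regp.1 regp.2 Hth.
  have [-> ->] : cos (G.1 * (2 * pi)) = cos (F.1 * (2 * pi)) /\ sin (G.1 * (2 * pi)) = sin (F.1 * (2 * pi)).
    rewrite GF mulrDl /sg; case: (e).
      by rewrite mul1r cosD sinD [2 * pi]mulr_natl cos2pi sin2pi !mulr0 !mulr1 subr0 addr0.
    by rewrite mulN1r cosB sinB [2 * pi]mulr_natl cos2pi sin2pi !mulr0 !mulr1 subr0 addr0.
  have := cos2Dsin2 (F.1 * (2 * pi)).
  move: (cos _) (sin _) (fre G.2 _) (fim G.2 _) (fre F.2 _) (fim F.2 _) (sg _ _) => c s u v a b ee cs.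
  have -> : ee * ((c * a + s * b) * (c * v - s * u) - (c * b - s * a) * (c * u + s * v)) -
     ee * (a * v - b * u) = ee * (c ^+ 2 + s ^+ 2 - 1) * (a * v - b * u) by ring.
  by rewrite cs subrr mulr0 mul0r.
by rewrite addr0.
Qed.

End AtPoint.

End Inner.

(** * Functions of [(tau, rho)] and the divergence theorem *)

Section Good.
Variables (R : realType) (M tau0 : R).
Notation RR := (measurableTypeR R).
Notation lam := (@lebesgue_measure R).
Notation lam2 := (lam \x lam)%E.
Notation reg := (reg M tau0).
Notation Nice := (Nice M tau0).

(* Separate continuity suffices for joint measurability. *)
Definition good (f : R -> R -> R) := [/\
  forall t r, reg (t, r) -> {for t, continuous (f ^~ r)},
  forall t r, reg (t, r) -> {for r, continuous (f t)} &
  forall b d : R, exists2 C : R, 0 <= C &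
    forall t r, tau0 <= t <= b -> 2 * M <= r <= d -> `|f t r| <= C].

Lemma goodD f g : good f -> good g -> good (fun t r => f t r + g t r).
Proof.
move=> [f1 f2 f3] [g1 g2 g3]; split.
- by move=> t r H; exact: (continuousD (f1 _ _ H) (g1 _ _ H)).
- by move=> t r H; exact: (continuousD (f2 _ _ H) (g2 _ _ H)).
- move=> b d; have [C C0 fC] := f3 b d; have [D D0 gD] := g3 b d.
  exists (C + D); first exact: addr_ge0.
  by move=> t r Ht Hr; rewrite (le_trans (ler_normD _ _))// lerD// ?fC ?gD.
Qed.

Lemma goodM f g : good f -> good g -> good (fun t r => f t r * g t r).
Proof.
move=> [f1 f2 f3] [g1 g2 g3]; split.
- by move=> t r H; exact: (continuousM (f1 _ _ H) (g1 _ _ H)).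
- by move=> t r H; exact: (continuousM (f2 _ _ H) (g2 _ _ H)).
- move=> b d; have [C C0 fC] := f3 b d; have [D D0 gD] := g3 b d.
  exists (C * D); first exact: mulr_ge0.
  by move=> t r Ht Hr; rewrite normrM ler_pM// ?fC ?gD.
Qed.

Lemma good_cst (c : R) : good (fun _ _ => c).
Proof.
split=> *; [exact: cst_continuous|exact: cst_continuous|].
by exists `|c|.
Qed.

Lemma goodB f g : good f -> good g -> good (fun t r => f t r - g t r).
Proof.
move=> gf gg; have := goodD gf (goodM (good_cst (-1)) gg).
by rewrite (_ : (fun t p => _) = (fun t p => f t p - g t p))//; apply/funext => ?; apply/funext => ?; rewrite mulN1r.
Qed.

Lemma good_rho (g : R -> R) : (forall r, 2 * M <= r -> {for r, continuous g}) ->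
  good (fun _ r => g r).
Proof.
move=> cg; split.
- by move=> *; exact: cst_continuous.
- by move=> t r [_ Hr]; exact: cg.
- move=> b d; have [C C0 HC] := @bounded_on_compact R R `[2 * M, d]%classic g (@segment_compact _ _ _)
    (fun x (xI : `[2 * M, d]%classic x) => cg x (proj1 (andP xI))).
  by exists C => // t r _ Hr; apply: HC; rewrite /= in_itv.
Qed.

Lemma good_tau (g : R -> R) : (forall t, tau0 <= t -> {for t, continuous g}) ->
  good (fun t _ => g t).
Proof.
move=> cg; split.
- by move=> t r [Ht _]; exact: cg.
- by move=> *; exact: cst_continuous.
- move=> b d; have [C C0 HC] := @bounded_on_compact R R `[tau0, b]%classic g (@segment_compact _ _ _)
    (fun x (xI : `[tau0, b]%classic x) => cg x (proj1 (andP xI))).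
  by exists C => // t r Ht _; apply: HC; rewrite /= in_itv.
Qed.

Lemma good_comp (g : R -> R) f : continuous g -> good f -> good (fun t r => g (f t r)).
Proof.
move=> cg [f1 f2 f3]; split.
- by move=> t r H; apply: continuous_comp; [exact: f1|exact: cg].
- by move=> t r H; apply: continuous_comp; [exact: f2|exact: cg].
- move=> b d; have [C C0 fC] := f3 b d.
  have [D D0 HD] := @bounded_on_compact R R `[- C, C]%classic g (@segment_compact _ _ _) (fun x _ => cg x).
  by exists D => // t r Ht Hr; apply: HD; rewrite /= in_itv /= -ler_norml fC.
Qed.

Lemma good_ip F G : Nice F -> Nice G -> good (ip F G).
Proof.
move=> NF NG; split.
- by move=> t r H; exact: is_derive1_continuous (is_derive_ip_tau H NF NG).
- by move=> t r H; exact: is_derive1_continuous (is_derive_ip_rho H NF NG).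
move=> b d.
have [V [oV rV SF BF]] := Nice_good NF; have [V' [oV' rV' SG BG]] := Nice_good NG.
have [|C C0 HC] := BF tau0 b (2 * M) d.
  by move=> t r /andP[h1 _] /andP[h2 _]; exact: rV.
have [|D D0 HD] := BG tau0 b (2 * M) d.
  by move=> t r /andP[h1 _] /andP[h2 _]; exact: rV'.
pose K := C * D + C * D.
have K0 : 0 <= K by rewrite addr_ge0// mulr_ge0.
pose S := Sint (fun _ _ : R => 1).
exists (K * S).
  by rewrite mulr_ge0//; apply: Sint_ge0 => *; exact: ler01.
move=> t r Ht Hr; have regp : reg (t, r) by split; [have /andP[] := Ht|have /andP[] := Hr].
have s1 := sphfun_cst (1 : R); have sd := sphfun_dens regp NF NG.
have bd th ph : 0 < th < pi -> `|dens F G (pt4 t r th ph)| <= K.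
  move=> Hth; have bx := box_pt4 ph Ht Hr Hth.
  have [f1 f2 _ _] := HC _ bx; have [g1 g2 _ _] := HD _ bx.
  by rewrite /dens (le_trans (ler_normD _ _))// lerD// normrM ler_pM.
have key (k : R) : `|k| = 1 -> k * ip F G t r <= K * S.
  move=> k1; rewrite /ip /S -!SintZ//; apply: le_Sint.
  - by apply: sphfunM; [exact: sphfun_cst|exact: sd].
  - by apply: sphfunM; [exact: sphfun_cst|exact: s1].
  - move=> th ph Hth; rewrite mulr1 (le_trans (ler_norm _))// normrM k1 mul1r.
    exact: bd.
have [k1 k2] := (key 1 (normr1 _), key (-1) (etrans (normrN 1) (normr1 _))).
by rewrite mul1r in k1; rewrite mulN1r lerNl in k2; rewrite ler_norml k1 k2.
Qed.

Lemma good_measurable f : good f ->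
  measurable_fun (`[tau0, +oo[ `*` `[2 * M, +oo[) (fun z : RR * RR => f z.1 z.2).
Proof.
move=> [f1 f2 _].
(* Clamping both variables to the closed region gives a function separately continuous on the whole
   plane. *)
pose f' t r := f (Num.max tau0 t) (Num.max (2 * M) r).
have cmax (a x : R) : {for x, continuous (Num.max a)}.
  by apply: continuous_max; [exact: cst_continuous|exact: cvg_id].
have m1 : measurable_fun setT (fun z : RR * RR => f' z.1 z.2).
  have := @measurable_caratheodory R _ RR setT f' openT.
  rewrite setXTT; apply.
  - move=> y x _; apply: (@continuous_comp _ _ _ (Num.max tau0) (fun t => f t (Num.max (2 * M) y))).
      exact: cmax.
    by apply: f1; split; rewrite /= le_max lexx.
  - move=> x _; apply: continuous_measurable_fun => y.
    apply: (@continuous_comp _ _ _ (Num.max (2 * M)) (f (Num.max tau0 x))).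
      exact: cmax.
    by apply: f2; split; rewrite /= le_max lexx.
apply: (@eq_measurable_fun _ _ _ _ _ (fun z : RR * RR => f' z.1 z.2)).
  move=> [t r] /set_mem[/=]; rewrite !in_itv /= !andbT => h1 h2.
  by rewrite /f' !max_r.
exact: measurable_funTS.
Qed.

Section Rect.
Variables (a b c : R).
Hypothesis ta : tau0 <= a.
Let T : set RR := `]a, b[%classic.
Let I : set RR := `]2 * M, c[%classic.

Let mT : measurable T. Proof. exact: measurable_itv. Qed.
Let mI : measurable I. Proof. exact: measurable_itv. Qed.

Lemma lam_oo_fin (x y : R) : (lam `]x, y[ < +oo)%E.
Proof. by rewrite lebesgue_measure_itv /=; case: ifP => _; rewrite -?EFinD ltry. Qed.

Lemma good_int2 f : good f -> lam2.-integrable (T `*` I) (EFin \o (fun z : RR * RR => f z.1 z.2)).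
Proof.
move=> gf; apply: measurable_bounded_integrable.
- exact: measurableX.
- apply: (le_lt_trans (_ : _ <= lam T * lam I)%E); first by rewrite -(lam2_rect mT mI).
  by apply: lte_mul_pinfty => //; [rewrite ge0_fin_numE//; exact: lam_oo_fin|exact: lam_oo_fin].
- apply: measurable_funS (good_measurable gf).
    by apply: measurableX; exact: measurable_itv.
  move=> z [/=]; rewrite /T /I /= !in_itv /= !andbT => /andP[h1 _] /andP[h2 _].
  by rewrite (le_trans ta) ltW// ltW.
- have [_ _ /(_ b c)[C C0 HC]] := gf.
  exists C; split; first exact: num_real.
  move=> D CD [t r] [/=]; rewrite /T /I /= !in_itv /= => /andP[h1 h2] /andP[h3 h4].
  by rewrite (le_trans (HC t r _ _))//; rewrite ?(ltW CD) ?(le_trans ta (ltW h1)) ?ltW.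
Qed.

Lemma good_int_r f t : tau0 <= t -> good f -> lam.-integrable I (EFin \o f t).
Proof.
move=> Ht gf; apply: measurable_bounded_integrable.
- exact: mI.
- exact: lam_oo_fin.
- apply: open_continuous_measurable_fun; first exact: interval_open.
  move=> r; rewrite inE /I /= in_itv /= => /andP[h1 h2].
  by have [_ + _] := gf; apply; split => //=; exact: ltW.
- have [_ _ /(_ t c)[C C0 HC]] := gf.
  exists C; split; first exact: num_real.
  move=> D CD r; rewrite /I /= !in_itv /= => /andP[h3 h4].
  by rewrite (le_trans (HC t r _ _))//; rewrite ?lexx ?Ht ?(ltW CD) ?ltW.
Qed.

Lemma good_int_t f r : 2 * M <= r -> good f -> lam.-integrable T (EFin \o f ^~ r).
Proof.
move=> Hr gf; apply: measurable_bounded_integrable.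
- exact: mT.
- exact: lam_oo_fin.
- apply: open_continuous_measurable_fun; first exact: interval_open.
  move=> t; rewrite inE /T /= in_itv /= => /andP[h1 h2].
  by have [+ _ _] := gf; apply; split => //=; rewrite (le_trans ta)// ltW.
- have [_ _ /(_ b r)[C C0 HC]] := gf.
  exists C; split; first exact: num_real.
  move=> D CD t; rewrite /T /= !in_itv /= => /andP[h3 h4].
  by rewrite (le_trans (HC t r _ _))//; rewrite ?lexx ?Hr ?(ltW CD) ?(le_trans ta (ltW h3)) ?ltW.
Qed.

Let fin_int (S : set RR) (f : R -> R) : measurable S -> lam.-integrable S (EFin \o f) ->
  (\int[lam]_(x in S) (f x)%:E = (\int[lam]_(x in S) f x)%R%:E)%E.
Proof. by move=> mS intf; rewrite /Rintegral fineK//; exact: (integrable_fin_num mS intf). Qed.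

Lemma integral_deriv_oo (f f' : R -> R) (x y : R) : x < y ->
  (forall z, x <= z <= y -> is_derive z (1 : R) f (f' z)) ->
  (forall z, x <= z <= y -> {for z, continuous f'}) ->
  (\int[lam]_(z in `]x, y[) (f' z)%:E = (f y - f x)%:E)%E.
Proof.
move=> xy df cf; rewrite -(integral_deriv xy df cf).
rewrite -(@integral_itv_bndoo _ _ _ _ true false)//.
apply/measurable_EFinP; apply: open_continuous_measurable_fun; first exact: interval_open.
by move=> z; rewrite inE /= in_itv /= => /andP[h1 h2]; apply: cf; rewrite !ltW.
Qed.

Lemma green A At B Br K : good A -> good At -> good B -> good Br -> good K ->
  (forall t r, reg (t, r) -> is_derive t (1 : R) (A ^~ r) (At t r)) ->
  (forall t r, reg (t, r) -> is_derive r (1 : R) (B t) (Br t r)) ->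
  a < b -> 2 * M < c ->
  (forall t r, a < t < b -> 2 * M < r < c -> At t r + Br t r <= K t r) ->
  \int[lam]_(r in I) A b r + (\int[lam]_(t in T) B t c - \int[lam]_(t in T) B t (2 * M)) <=
  \int[lam]_(r in I) A a r + fine (\int[lam2]_(z in T `*` I) (K z.1 z.2)%:E)%E.
Proof.
move=> gA gAt gB gBr gK dA dB ab Mc HK.
have tb : tau0 <= b by apply: (le_trans ta); exact: ltW.
have c2 : 2 * M <= c by exact: ltW.
have EA : (\int[lam2]_(z in T `*` I) (At z.1 z.2)%:E =
    (\int[lam]_(r in I) A b r - \int[lam]_(r in I) A a r)%R%:E)%E.
  rewrite (fubini_rect mT mI (good_int2 gAt)).2.
  rewrite -RintegralB//; last 2 first; [exact: good_int_r|exact: good_int_r|].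
  rewrite -fin_int//; last first.
    exact: (good_int_r (f := fun t r => A b r - A a r) ta (goodB (good_rho (fun r Hr => let: And3 _ h _ := gA in h b r (conj tb Hr))) (good_rho (fun r Hr => let: And3 _ h _ := gA in h a r (conj ta Hr))))).
  apply: eq_integral => r /set_mem; rewrite /I /= in_itv /= => /andP[r1 r2].
  have rt t : a <= t <= b -> reg (t, r).
    by move=> /andP[h1 h2]; split => /=; [exact: le_trans h1|exact: ltW].
  have [cAt _ _] := gAt.
  exact: (integral_deriv_oo ab (fun t Ht => dA t r (rt t Ht)) (fun t Ht => cAt t r (rt t Ht))).
have EB : (\int[lam2]_(z in T `*` I) (Br z.1 z.2)%:E =
    (\int[lam]_(t in T) B t c - \int[lam]_(t in T) B t (2 * M))%R%:E)%E.
  rewrite (fubini_rect mT mI (good_int2 gBr)).1.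
  rewrite -RintegralB//; last 2 first; [exact: (good_int_t c2 gB)|exact: (good_int_t (lexx _) gB)|].
  rewrite -fin_int//; last first.
    exact: (good_int_t (r := c) (f := fun t r => B t c - B t (2 * M)) c2 (goodB (good_tau (fun t Ht => let: And3 h _ _ := gB in h t c (conj Ht c2))) (good_tau (fun t Ht => let: And3 h _ _ := gB in h t (2 * M) (conj Ht (lexx _)))))).
  apply: eq_integral => t /set_mem; rewrite /T /= in_itv /= => /andP[t1 t2].
  have rt r : 2 * M <= r <= c -> reg (t, r).
    by move=> /andP[h1 h2]; split => //=; rewrite (le_trans ta)// ltW.
  have [_ cBr _] := gBr.
  exact: (integral_deriv_oo Mc (fun r Hr => dB t r (rt r Hr)) (fun r Hr => cBr t r (rt r Hr))).
have E : (\int[lam2]_(z in T `*` I) (At z.1 z.2 + Br z.1 z.2)%:E <=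
          \int[lam2]_(z in T `*` I) (K z.1 z.2)%:E)%E.
  apply: le_integral => //.
  - exact: measurableX.
  - exact: (good_int2 (goodD gAt gBr)).
  - exact: good_int2 gK.
  - by move=> [t r] /set_mem[/=]; rewrite /T /I /= !in_itv /= => Ht Hr; rewrite lee_fin HK.
move: E; under eq_integral do rewrite EFinD.
rewrite integralD//=; last 3 first.
- exact: measurableX.
- exact: good_int2 gAt.
- exact: good_int2 gBr.
have := integrable_fin_num (measurableX mT mI) (good_int2 gK).
rewrite /= EA EB; case: (\int[lam2]_(z in T `*` I) (K z.1 z.2)%:E)%E => // k _.
by rewrite -EFinD lee_fin /= => h1; lra.
Qed.

End Rect.

End Good.

(** * The cutoff in [v] *)

Section Cutoff.
Variable R : realType.

(** A quadratic error bound handles the join of the two branches of [zeta] at [v = c] together with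
    all other points. *)
Lemma is_derive_quadratic (f : R -> R) (x d K : R) :
  (forall t, `|f (t + x) - f x - d * t| <= K * t ^+ 2) -> is_derive x (1 : R) f d.
Proof.
move=> H.
have L : t^-1 *: ((f \o shift x) (t *: (1 : R)) - f x) @[t --> 0^'] --> (d : R).
  apply/cvgrPdist_le => e e0.
  have K0 : 0 <= `|K| + 1 by rewrite addr_ge0.
  have K1 : 0 < `|K| + 1 by rewrite ltr_wpDl.
  near=> t.
  have t0 : t != 0 by near: t; exact: nbhs_dnbhs_neq.
  have te : `|t| <= e / (`|K| + 1).
    near: t; apply: dnbhs0_le; exact: divr_gt0.
  have -> : d - t^-1 *: ((f \o shift x) (t *: (1 : R)) - f x) = - (t^-1 * (f (t + x) - f x - d * t)).
    rewrite /= [t *: 1]mulr1 /GRing.scale /=.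
    by field.
  rewrite normrN normrM normfV ler_pdivrMl ?normr_gt0//.
  apply: (le_trans (H t)).
  have -> : t ^+ 2 = `|t| * `|t| by rewrite -expr2 real_normK ?num_real.
  rewrite mulrCA ler_wpM2l//; apply: (@le_trans _ _ ((`|K| + 1) * `|t|)).
    by rewrite ler_wpM2r// (le_trans (ler_norm _))// lerDl.
  by rewrite mulrC -ler_pdivlMr.
split; first by apply/cvg_ex; exists d.
exact: cvg_lim L.
Unshelve. all: by end_near. Qed.

(* A C^1 cutoff: equal to 0 for v >= c, and increasing to 1 with c. *)
Definition zeta (c v : R) : R := (Num.max 0 (c - v) / c) ^+ 2.
Definition dzeta (c v : R) : R := - (2 * Num.max 0 (c - v) / c ^+ 2).

Lemma is_derive_zeta (c v : R) : 0 < c -> is_derive v (1 : R) (zeta c) (dzeta c v).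
Proof.
move=> c0; apply: (@is_derive_quadratic _ _ _ (c^-1 ^+ 2)) => t.
rewrite /zeta /dzeta; have ci : 0 <= c^-1 ^+ 2 by rewrite sqr_ge0.
set a := Num.max 0 (c - v); set b := Num.max 0 _.
have -> : (b / c) ^+ 2 - (a / c) ^+ 2 - - (2 * a / c ^+ 2) * t =
   (b ^+ 2 - a ^+ 2 + 2 * a * t) * c^-1 ^+ 2.
  by field; rewrite gt_eqF.
rewrite normrM (ger0_norm ci) [leRHS]mulrC ler_wpM2r//.
rewrite /a /b ler_norml; by case: (leP 0 (c - v)); case: (leP 0 (c - (t + v))) => h1 h2; apply/andP; split; nra.
Qed.

Lemma zeta_ge0 (c v : R) : 0 <= zeta c v. Proof. exact: sqr_ge0. Qed.

Lemma zeta0 (c v : R) : c <= v -> zeta c v = 0.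
Proof. by move=> cv; rewrite /zeta max_l ?subr_le0// mul0r expr0n. Qed.

Lemma zeta_le1 (c v : R) : 0 < c -> 0 <= v -> zeta c v <= 1.
Proof.
move=> c0 v0; rewrite /zeta expr_le1//; last by rewrite divr_ge0 ?(ltW c0)// le_max lexx.
by rewrite ler_pdivrMr// mul1r ge_max ltW//= gerBl.
Qed.

Lemma zeta_le (c d v : R) : 0 < c -> 0 <= v -> c <= d -> zeta c v <= zeta d v.
Proof.
move=> c0 v0 cd; have d0 : 0 < d by exact: lt_le_trans cd.
have m0 (x : R) : 0 <= Num.max 0 x by rewrite le_max lexx.
rewrite /zeta ler_pXn2r// ?nnegrE ?divr_ge0 ?(ltW c0) ?(ltW d0)//.
rewrite ler_pdivrMr// mulrAC ler_pdivlMr//.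
case: (leP 0 (c - v)) => h1; last by rewrite mul0r mulr_ge0// ltW.
rewrite max_r//; last by rewrite subr_ge0 (le_trans _ cd)// -subr_ge0.
by nra.
Qed.

Lemma dzeta_le0 (c v : R) : dzeta c v <= 0.
Proof. by rewrite /dzeta oppr_le0 divr_ge0 ?sqr_ge0// mulr_ge0// le_max lexx. Qed.

Lemma continuous_zeta (c : R) : 0 < c -> continuous (zeta c).
Proof. by move=> c0 v; exact: is_derive1_continuous (is_derive_zeta v c0). Qed.

Lemma continuous_dzeta (c : R) : continuous (dzeta c).
Proof.
move=> v; have cm : {for v, continuous (fun x => Num.max 0 (c - x))}.
  apply: continuous_max; first exact: cst_continuous.
  by apply: continuousB; [exact: cst_continuous|exact: cvg_id].
by apply: cvgN; apply: cvgMl; apply: cvgMr.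
Qed.

Lemma zeta_cvg (v : R) : zeta n.+1%:R v @[n --> \oo] --> (1 : R).
Proof.
have H : (1 - v * n.+1%:R^-1) * (1 - v * n.+1%:R^-1) @[n --> \oo] --> (1 : R).
  have c1 : 1 - v * n.+1%:R^-1 @[n --> \oo] --> (1 : R).
    rewrite -[X in _ --> X](_ : 1 - v * 0 = 1); last by rewrite mulr0 subr0.
    apply: cvgB; first exact: cvg_cst.
    by apply: cvgMr; exact: cvg_harmonic.
  rewrite -[X in _ --> X](mulr1 1); exact: cvgM.
apply: cvg_trans H; apply: near_eq_cvg; near=> n.
have n0 : n.+1%:R != 0 :> R by rewrite pnatr_eq0.
have nv : v <= n.+1%:R.
  near: n; exists (Num.bound `|v|) => // n /= Hn.
  rewrite (le_trans (ler_norm _))// (le_trans (ltW (archi_boundP (normr_ge0 v))))//.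
  by rewrite ler_nat (leq_trans Hn).
rewrite /zeta max_r ?subr_ge0//; congr (_ ^+ 2).
by rewrite mulrBl divff.
Unshelve. all: by end_near. Qed.

End Cutoff.

(** * Consequences of the conditions on the foliation *)

Section Foliation.
Variables (R : realType) (M tau0 : R) (h : R -> R) (r_away r_far : R).
Hypothesis M0 : 0 < M.
Hypothesis fol : foliation M h r_away r_far tau0.
Let hp := (h^`()%classic : R -> R).

Lemma fol_h_derive (r : R) : 2 * M <= r -> is_derive r (1 : R) h (hp r).
Proof.
move=> /(fol_smooth fol 0) H; have := nbhs_singleton H; rewrite /= => dh.
by split => //; rewrite /hp derive1E.
Qed.

Lemma fol_hp_continuous (r : R) : 2 * M <= r -> {for r, continuous hp}.
Proof.
move=> /(fol_smooth fol 1) H; have := nbhs_singleton H; rewrite /= => dh.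
by apply: differentiable_continuous; exact/derivable1_diffP.
Qed.

(** For [r > 2M] this is [Delta * H_fol], cleared of the singular [1 / mu]. It is the coefficient of
    [|Q|^2] in the conserved density. *)
Definition mfun (r : R) : R := 2 * r ^+ 2 - Delta M r * hp r.

(** Expanding [1 / mu - mu (1 / mu - h')^2] cancels the singular term and leaves [h' (2 - mu h')].
    Since [neg_grad_tau] is comparable to [r^-2], the product [h' * mfun] lies between two positive
    constants. *)
Let hm (r : R) : 2 * M < r -> neg_grad_tau M h r = hp r * mfun r / r ^+ 2.
Proof.
move=> Hr; have r0 : 0 < r by apply: lt_trans Hr; rewrite mulr_gt0.
have d1 := is_derive_rstar M0 Hr; have d2 := fol_h_derive (ltW Hr).
have -> : neg_grad_tau M h r = neg_grad_sq M r 1 ((mu M r)^-1 - hp r).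
  rewrite /neg_grad_tau derive1E; congr neg_grad_sq.
  by have [_ ->] := is_deriveB d1 d2.
rewrite /neg_grad_sq /mfun /Delta /mu; field.
by rewrite gt_eqF//= ?gt_eqF// subr_gt0.
Qed.

(** Far out, [h' = 2 / mu - H_fol], where [2 / mu <= 4] for [r >= 4 M] and the decay of order [0]
    bounds [H_fol]; on the remaining compact interval [h'] is continuous. *)
Let hp_bounded : exists2 C : R, 0 < C & forall r, 2 * M <= r -> hp r <= C.
Proof.
have [C HC] := fol_decay fol 0.
have [A [Ar HA]] : exists A : R, 2 * M < A /\ forall r, A <= r -> hp r <= 5 + `|C|.
  have H1 : \forall r \near (+oo : set_system R), 1 <= r /\ 4 * M < r.
    by near=> r; split; near: r; do ?[by apply: nbhs_pinfty_ge; exact: num_real|by apply: nbhs_pinfty_gt; exact: num_real].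
  have H2 := filterI HC H1.
  have [A [_ HA]] := H2.
  exists (Num.max (A + 1) (2 * M + 1)); split; first by rewrite lt_max [X in _ || X]ltrDl ltr01 orbT.
  move=> r; rewrite ge_max => /andP[Ar _].
  have [|/=] := HA r; first by rewrite (lt_le_trans _ Ar)// ltrDl.
  rewrite /H_fol add0n => Hr [r1 rM].
  have r0 : 0 < r by lra.
  have C1 : C / r ^+ 2 <= `|C|.
    rewrite ler_pdivrMr ?exprn_gt0// (le_trans (ler_norm _))// ler_peMr//.
    exact: exprn_ege1.
  have mu2 : 2^-1 <= mu M r by rewrite /mu lerBrDr -lerBrDl ler_pdivrMr//; lra.
  have imu : (mu M r)^-1 <= 2.
    by rewrite -[leRHS]invrK lef_pV2 ?posrE//; lra.
  by rewrite /hp; move: Hr; rewrite ler_norml => /andP[]; lra.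
have cK : compact (`[2 * M, A]%classic : set R) by exact: segment_compact.
have [D D0 HD] := bounded_on_compact cK (fun x (xI : `[2 * M, A]%classic x) => fol_hp_continuous (proj1 (andP xI))).
exists (5 + `|C| + D); first by rewrite ltr_wpDr// ltr_wpDr.
move=> r Hr; have [rA|rA] := leP A r.
  by rewrite (le_trans (HA r rA))// lerDl.
apply: (le_trans (ler_norm _)); rewrite (le_trans (HD r _))//=.
  by rewrite in_itv /= Hr ltW.
by rewrite lerDr addr_ge0.
Unshelve. all: by end_near. Qed.

(** A zero of [h'] would annihilate [neg_grad_tau], against its lower bound for [r > 2M]; at
    [r = 2M] that bound is not given, and the value [h' = 1] is used. *)
Let hp_gt0 (r : R) : 2 * M <= r -> 0 < hp r.
Proof.
move=> Hr; rewrite lt_neqAle (fol_ge0 fol)// andbT; apply/eqP => h0.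
have [Er|Hr'] := eqVneq r (2 * M).
  by move: h0; rewrite Er /hp (fol_horizon1 fol) => /eqP; rewrite eq_sym oner_eq0.
have {}Hr : 2 * M < r by rewrite lt_neqAle eq_sym Hr' Hr.
have r0 : 0 < r by apply: lt_trans Hr; rewrite mulr_gt0.
have [c [C [c0 C0 H]]] := fol_spacelike fol; have /andP[H1 _] := H r Hr.
by move: H1; rewrite hm// -h0 !mul0r leNgt divr_gt0// exprn_gt0.
Qed.

Let hp_ge : exists2 c : R, 0 < c & forall r, 2 * M <= r -> c <= hp r.
Proof.
have [C HC] := fol_decay fol 0.
have [A [Ar HA]] : exists A : R, 2 * M < A /\ forall r, A <= r -> 1 <= hp r.
  have H1 : \forall r \near (+oo : set_system R), 1 <= r /\ (2 * M < r /\ `|C| <= r).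
    by near=> r; split; [|split]; near: r; do ?[by apply: nbhs_pinfty_ge; exact: num_real|by apply: nbhs_pinfty_gt; exact: num_real].
  have H2 := filterI HC H1.
  have [A [_ HA]] := H2.
  exists (Num.max (A + 1) (2 * M + 1)); split; first by rewrite lt_max [X in _ || X]ltrDl ltr01 orbT.
  move=> r; rewrite ge_max => /andP[Ar _].
  have [|/=] := HA r; first by rewrite (lt_le_trans _ Ar)// ltrDl.
  rewrite /H_fol add0n => Hr [r1 [rM rC]].
  have r0 : 0 < r by lra.
  have C1 : C / r ^+ 2 <= 1.
    rewrite ler_pdivrMr ?exprn_gt0// mul1r (le_trans (ler_norm _))// (le_trans rC)//.
    by rewrite expr2 ler_peMl// ltW.
  have m0 : 0 < mu M r by rewrite /mu subr_gt0 ltr_pdivrMr// mul1r.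
  have m1 : mu M r <= 1 by rewrite /mu gerBl divr_ge0 ?ltW// mulr_gt0.
  have imu : 1 <= (mu M r)^-1 by rewrite -invr1 lef_pV2 ?posrE.
  by rewrite /hp; move: Hr; rewrite ler_norml => /andP[]; lra.
have [c cA Hc] := @EVT_min R hp (2 * M) A (ltW Ar) (continuous_in_subspaceT (fun x xI => fol_hp_continuous (proj1 (andP (set_mem xI))))).
exists (Num.min 1 (hp c)).
  by rewrite lt_min ltr01 hp_gt0//; have /andP[] := cA.
move=> r Hr; have [rA|rA] := leP A r; first by rewrite ge_min HA.
by rewrite ge_min Hc ?orbT// in_itv /= Hr ltW.
Unshelve. all: by end_near. Qed.

Lemma fol_bounds : exists c C : R, [/\ 0 < c, 0 < C & forall r, 2 * M <= r ->
  [/\ c <= hp r, hp r <= C, c <= mfun r & mfun r <= C]].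
Proof.
have [C1 C10 H1] := hp_bounded; have [c1 c10 H2] := hp_ge.
have [c2 [C2 [c20 C20 H3]]] := fol_spacelike fol.
(* The value of [mfun] at [r = 2M], where the slice condition gives nothing. Elsewhere the bounds on
   [mfun] come from dividing those on [h' * mfun] by those on [h']. *)
pose M8 := 8 * M ^+ 2; have M80 : 0 < M8 by rewrite mulr_gt0// exprn_gt0.
exists (Num.min c1 (Num.min (c2 / C1) M8)), (C1 + C2 / c1 + M8); split.
- by rewrite !lt_min c10 M80 divr_gt0.
- by rewrite !addr_gt0// divr_gt0.
move=> r Hr; have [h1 h2] := (H1 r Hr, H2 r Hr).
have D0 : 0 < C2 / c1 by rewrite divr_gt0.
have [g1 g2] : Num.min (c2 / C1) M8 <= mfun r /\ mfun r <= C2 / c1 + M8.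
  have [->|Hr'] := eqVneq r (2 * M).
    have -> : mfun (2 * M) = M8 by rewrite /mfun /Delta /M8; ring.
    by rewrite ge_min lexx orbT lerDr ltW.
  have {}Hr' : 2 * M < r by rewrite lt_neqAle eq_sym Hr' Hr.
  have r0 : 0 < r by apply: lt_trans Hr'; rewrite mulr_gt0.
  have r2 : 0 < r ^+ 2 by rewrite exprn_gt0.
  have /andP[] := H3 r Hr'; rewrite hm// !ler_pM2r ?invr_gt0// => k1 k2.
  have h0 := hp_gt0 Hr.
  have m0 : 0 < mfun r by rewrite -(pmulr_rgt0 _ h0) (lt_le_trans c20).
  split.
    by rewrite ge_min ler_pdivrMr// (le_trans k1)// mulrC ler_wpM2l// ltW.
  have : mfun r <= C2 / c1 by rewrite ler_pdivlMr// (le_trans _ k2)// mulrC ler_wpM2r// ltW.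
  by move=> /le_trans; apply; rewrite lerDl ltW.
split.
- by rewrite ge_min h2.
- by rewrite -addrA (le_trans h1)// lerDl addr_ge0 ?ltW.
- by rewrite ge_min g1 orbT.
- by rewrite (le_trans g2)// -addrA lerDr ltW.
Qed.

(** By the mean value theorem and the lower bound on [h']. Hence [v] tends to infinity along each
    slice, so the cutoff in [v] has bounded support there; monotonicity also makes [h]
    invertible. *)
Lemma fol_h_growth : exists2 c : R, 0 < c & forall r s, 2 * M <= r -> r <= s ->
  h r + c * (s - r) <= h s.
Proof.
have [c [C [c0 _ H]]] := fol_bounds; exists c => // r s Hr rs.
have [->|rs'] := eqVneq r s; first by rewrite subrr mulr0 addr0.
have {}rs' : r < s by rewrite lt_neqAle rs' rs.
have dh x : x \in `]r, s[ -> is_derive x (1 : R) h (hp x).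
  by rewrite in_itv /= => /andP[h1 _]; apply: fol_h_derive; rewrite (le_trans Hr)// ltW.
have ch : {within `[r, s], continuous h}.
  apply: continuous_in_subspaceT => x; rewrite inE /= in_itv /= => /andP[h1 _].
  by apply: is_derive1_continuous (fol_h_derive _); exact: le_trans h1.
have [x xI E] := MVT rs' dh ch.
move: xI; rewrite in_itv /= => /andP[h1 _].
have [k _ _ _] := H x (le_trans Hr (ltW h1)).
by rewrite addrC -lerBrDr E ler_wpM2r// subr_ge0.
Qed.

Lemma fol_v_gt0 (t r : R) : tau0 <= t -> 2 * M <= r -> 0 < t + h r.
Proof.
move=> Ht Hr; have := fol_v_init fol Hr; have := M0; move=> h1 h2; lra.
Qed.

End Foliation.

(** * The Dirac system and its commutation with Y *)

Section Dirac.
Variables (R : realType) (M tau0 : R) (h : R -> R).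
Hypothesis M0 : 0 < M.
Hypothesis hsmooth : forall (n : nat) (r : R), 2 * M <= r ->
  \forall x \near r, derivable (h^`(n)%classic) x 1.
Implicit Types F G P Q : spin_scalar R.
Notation reg := (reg M tau0).
Notation Nice := (Nice M tau0).
Notation oY := (op_Y M h).

(** Equality on a neighbourhood of the closed region, for identities that do not use the field
    equations, such as commutators. Unlike equality on [Oset], it can be used on the slice
    [tau = tau0] and at the horizon. *)
Definition eqN F G := exists V, [/\ open V, reg `<=` V & eqOn V F G].

Lemma eqN_refl F : eqN F F.
Proof. by exists setT; split => //; exact: openT. Qed.
Lemma eqN_sym F G : eqN F G -> eqN G F.
Proof. by move=> [V [oV rV H]]; exists V; split => //; exact: eqOn_sym. Qed.
Lemma eqOn_sub V W F G : V `<=` W -> eqOn W F G -> eqOn V F G.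
Proof. by move=> VW [E H]; split => // t r a b /VW; exact: H. Qed.
Lemma eqN_trans F G H : eqN F G -> eqN G H -> eqN F H.
Proof.
move=> [V [oV rV FG]] [W [oW rW GH]]; exists (V `&` W); split.
- exact: openI.
- by move=> p rp; split; [exact: rV|exact: rW].
- apply: (eqOn_trans (G := G)).
    by apply: eqOn_sub FG => p [].
  by apply: eqOn_sub GH => p [].
Qed.
Lemma eqN_tau F G : eqN F G -> eqN (op_tau F) (op_tau G).
Proof. by move=> [V [oV rV H]]; exists V; split; [exact: oV|exact: rV|exact: (eqOn_tau oV H)]. Qed.
Lemma eqN_phi F G : eqN F G -> eqN (op_phi F) (op_phi G).
Proof. by move=> [V [oV rV H]]; exists V; split; [exact: oV|exact: rV|exact: (eqOn_phi oV H)]. Qed.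
Lemma eqN_Y F G : eqN F G -> eqN (oY F) (oY G).
Proof. by move=> [V [oV rV H]]; exists V; split; [exact: oV|exact: rV|exact: (eqOn_Y oV H)]. Qed.
Lemma eqN_ang e F G : eqN F G -> eqN (op_ang e F) (op_ang e G).
Proof. by move=> [V [oV rV H]]; exists V; split; [exact: oV|exact: rV|exact: (eqOn_ang oV H)]. Qed.

Lemma eqN_ip F G t r : reg (t, r) -> eqN F G -> ip F F t r = ip G G t r.
Proof.
by move=> rp [V [oV rV [_ H]]]; apply: eq_ip => th ph Hth; apply: H => //; exact: rV.
Qed.

Let good_dom F k : Nice F -> exists V, [/\ open V, reg `<=` V, smoothOn k V F &
  forall x, domF V x -> derivable (h^`()%classic : R -> R) (x 0 o1) 1].
Proof.
move=> /(Nice_smoothOn k)[V [oV rV [S1 S2]]].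
pose W : set R := [set r | \forall x \near r, derivable (h^`()%classic : R -> R) x 1].
have oW : open W by rewrite openE => r Wr; exact: nbhs_interior.
have oTW : open ([set: R] `*` W).
  rewrite (_ : _ `*` _ = [set p : R * R | W p.2]); last by apply/seteqP; split=> -[p q] //= [].
  by apply: (@open_comp _ _ (@snd R R) W) => // p _; exact: cvg_snd.
have sV : domF (V `&` [set: R] `*` W) `<=` domF V by move=> x [[]].
exists (V `&` [set: R] `*` W); split.
- exact: openI.
- by move=> [t r] rp; split; [exact: rV|split => //; have [_ Hr] := rp; exact: (hsmooth 1)].
- by split; [exact: Cn_sub S1|exact: Cn_sub S2].
- by move=> x [[_ [_ /nbhs_singleton]]].
Qed.

Lemma commN_tau_ang e F : Nice F -> eqN (op_tau (op_ang e F)) (op_ang e (op_tau F)).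
Proof. by move=> /(good_dom 2)[V [oV rV S d]]; exists V; split; [exact: oV|exact: rV|exact: (comm_tau_ang e oV S)]. Qed.
Lemma commN_phi_ang e F : Nice F -> eqN (op_phi (op_ang e F)) (op_ang e (op_phi F)).
Proof. by move=> /(good_dom 2)[V [oV rV S d]]; exists V; split; [exact: oV|exact: rV|exact: (comm_phi_ang e oV S)]. Qed.
Lemma commN_phi_tau F : Nice F -> eqN (op_phi (op_tau F)) (op_tau (op_phi F)).
Proof. by move=> /(good_dom 2)[V [oV rV S d]]; exists V; split; [exact: oV|exact: rV|exact: (comm_phi_tau oV S)]. Qed.
Lemma commN_tau_Y F : Nice F -> eqN (op_tau (oY F)) (oY (op_tau F)).
Proof. by move=> /(good_dom 2)[V [oV rV S d]]; exists V; split; [exact: oV|exact: rV|exact: (comm_tau_Y M oV S d)]. Qed.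
Lemma commN_Y_ang e F : Nice F -> eqN (oY (op_ang e F)) (op_ang e (oY F)).
Proof. by move=> /(good_dom 2)[V [oV rV S d]]; exists V; split; [exact: oV|exact: rV|exact: (comm_Y_ang M e oV S d)]. Qed.
Lemma commN_phi_Y F : Nice F -> eqN (oY (op_phi F)) (op_phi (oY F)).
Proof. by move=> /(good_dom 2)[V [oV rV S d]]; exists V; split; [exact: oV|exact: rV|exact: (comm_phi_Y M oV S d)]. Qed.

Lemma NiceY F : Nice F -> Nice (oY F).
Proof. by move=> NF; exact: Nice_Y. Qed.

Lemma Nice_iter (X : spin_scalar R -> spin_scalar R) n F : (forall G, Nice G -> Nice (X G)) ->
  Nice F -> Nice (iter n X F).
Proof. by move=> HX NF; elim: n => //= n IH; exact: HX. Qed.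

(* The interior of the region, on which the field equations hold. *)
Definition Oset : set (R * R) := [set p | tau0 < p.1 /\ 2 * M < p.2].

Lemma open_Oset : open Oset.
Proof.
rewrite (_ : Oset = [set p | tau0 < p.1] `&` [set p | 2 * M < p.2])//.
by apply: openI; [apply: (@open_comp _ _ (@fst R R) [set x | tau0 < x]) => [p _|]; [exact: cvg_fst|exact: open_gt]|
  apply: (@open_comp _ _ (@snd R R) [set x | 2 * M < x]) => [p _|]; [exact: cvg_snd|exact: open_gt]].
Qed.

Lemma Oset_reg : Oset `<=` reg.
Proof. by move=> p [/= h1 h2]; split; exact: ltW. Qed.

Lemma eqN_O F G : eqN F G -> eqOn Oset F G.
Proof. by move=> [V [_ rV H]]; apply: eqOn_sub H => p /Oset_reg /rV. Qed.

(* The Dirac equations for a pair of weights (e/2, - e/2), with the sign e of a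
   boolean; (e, P, Q) -> (~~ e, op_ang (~~ e) P, op_ang e Q) preserves them. *)
Record DP (e : bool) P Q : Prop := {
  DP_P : Nice P ;
  DP_Q : Nice Q ;
  DP_wP : P.1 = sg R e / 2 ;
  DP_wQ : Q.1 = - (sg R e / 2) ;
  DP_1 : eqOn Oset (oY P) (op_ang e Q) ;
  DP_2 : forall x, domF Oset x ->
    Delta M (x 0 o1) * fre (oY Q).2 x = 2 * (x 0 o1) ^+ 2 * fre (op_tau Q).2 x
      + (x 0 o1 - M) * fre Q.2 x - fre (op_ang (~~ e) P).2 x /\
    Delta M (x 0 o1) * fim (oY Q).2 x = 2 * (x 0 o1) ^+ 2 * fim (op_tau Q).2 x
      + (x 0 o1 - M) * fim Q.2 x - fim (op_ang (~~ e) P).2 x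
}.

Lemma sg_neg e : sg R (~~ e) = - sg R e.
Proof. by case: e; rewrite /sg /= ?opprK. Qed.

Section Relation.
Variables (n : nat) (a a' : 'I_n -> R -> R) (G : 'I_n -> spin_scalar R).
Hypothesis da : forall j r, is_derive r (1 : R) (a j) (a' j r).
Hypothesis NG : forall j, Nice (G j).

(** A field equation as a vanishing linear combination with coefficients depending on [rho] alone:
    [d_tau], [d_phi] and the angular operators then pass through the coefficients. *)
Definition rel := forall x, domF Oset x ->
  \sum_j a j (x 0 o1) * fre (G j).2 x = 0 /\ \sum_j a j (x 0 o1) * fim (G j).2 x = 0.

Let pd_sum i (A : 'I_n -> 'rV[R]_4 -> R) : (forall j, Cn 1 (domF Oset) (A j)) ->
  (forall x, domF Oset x -> \sum_j a j (x 0 o1) * A j x = 0) ->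
  forall x, domF Oset x ->
    \sum_j ((o1 == i)%:R * a' j (x 0 o1) * A j x + a j (x 0 o1) * pd i (A j) x) = 0.
Proof.
move=> CA H x Dx.
have dj j : is_derive x (e_ R i) (fun y : 'rV[R]_4 => a j (y 0 o1) * A j y)
    ((o1 == i)%:R * a' j (x 0 o1) * A j x + a j (x 0 o1) * pd i (A j) x).
  have dA := is_derive_pd i (CA j) Dx.
  have dax := is_derive_comp_coord i (da j (x 0 o1)).
  apply: (is_derive_eq (is_deriveM dax dA)).
  by rewrite /GRing.scale /= addrC; congr (_ + _); rewrite mulrC.
have dS := is_derive_sum dj.
have E := @eq_on_derive R 4 (domF Oset) (\sum_j (fun y : 'rV[R]_4 => a j (y 0 o1) * A j y)) (cst 0) x (e_ R i)
  (open_domF open_Oset).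
have {}E := E (fun y Dy => etrans (congr1 (fun k => k y) (fct_sumE _ _ _)) (H y Dy)) Dx.
by have [_ <-] := dS; rewrite E derive_cst.
Qed.

Let CG j : Cn 1 (domF Oset) (fre (G j).2) /\ Cn 1 (domF Oset) (fim (G j).2).
Proof.
have [V [oV rV [S1 S2]]] := Nice_smoothOn 1 (NG j).
have sV : domF Oset `<=` domF V by move=> x [h1 h2]; split => //; apply: rV; exact: Oset_reg.
by split; [exact: Cn_sub S1|exact: Cn_sub S2].
Qed.

Lemma rel_pd i : rel -> forall x, domF Oset x ->
  \sum_j ((o1 == i)%:R * a' j (x 0 o1) * fre (G j).2 x + a j (x 0 o1) * pd i (fre (G j).2) x) = 0 /\
  \sum_j ((o1 == i)%:R * a' j (x 0 o1) * fim (G j).2 x + a j (x 0 o1) * pd i (fim (G j).2) x) = 0.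
Proof.
move=> H x Dx; split.
- exact: (@pd_sum i (fun j => fre (G j).2) (fun j => (CG j).1) (fun y Dy => (H y Dy).1) x Dx).
- exact: (@pd_sum i (fun j => fim (G j).2) (fun j => (CG j).2) (fun y Dy => (H y Dy).2) x Dx).
Qed.

Let rel_pd0 i : o1 == i = false -> rel -> forall x, domF Oset x ->
  \sum_j a j (x 0 o1) * pd i (fre (G j).2) x = 0 /\
  \sum_j a j (x 0 o1) * pd i (fim (G j).2) x = 0.
Proof.
move=> i1 H x Dx; have [E1 E2] := rel_pd i H Dx.
by split; [rewrite -[RHS]E1|rewrite -[RHS]E2]; apply: eq_bigr => j _; rewrite i1 !mul0r add0r.
Qed.

Lemma rel_tau : rel -> forall x, domF Oset x ->
  \sum_j a j (x 0 o1) * fre (op_tau (G j)).2 x = 0 /\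
  \sum_j a j (x 0 o1) * fim (op_tau (G j)).2 x = 0.
Proof.
move=> H x Dx; have [E1 E2] := rel_pd0 (i := o0) erefl H Dx.
by split; [rewrite -[RHS]E1|rewrite -[RHS]E2]; apply: eq_bigr => j _; rewrite ?fre_d_tauE ?fim_d_tauE.
Qed.

Lemma rel_phi : rel -> forall x, domF Oset x ->
  \sum_j a j (x 0 o1) * fre (op_phi (G j)).2 x = 0 /\
  \sum_j a j (x 0 o1) * fim (op_phi (G j)).2 x = 0.
Proof.
move=> H x Dx; have [E1 E2] := rel_pd0 (i := o3) erefl H Dx.
by split; [rewrite -[RHS]E1|rewrite -[RHS]E2]; apply: eq_bigr => j _; rewrite ?fre_d_phiE ?fim_d_phiE.
Qed.

Lemma rel_ang e s : (forall j, (G j).1 = s) -> rel -> forall x, domF Oset x ->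
  \sum_j a j (x 0 o1) * fre (op_ang e (G j)).2 x = 0 /\
  \sum_j a j (x 0 o1) * fim (op_ang e (G j)).2 x = 0.
Proof.
move=> Gs H x Dx; have [E1 E2] := rel_pd0 (i := o2) erefl H Dx.
have [E3 E4] := rel_pd0 (i := o3) erefl H Dx; have [E5 E6] := H x Dx.
split.
- transitivity (\sum_j a j (x 0 o1) * pd o2 (fre (G j).2) x
      - sg R e * (sin (x 0 o2))^-1 * (\sum_j a j (x 0 o1) * pd o3 (fim (G j).2) x)
      - sg R e * s * (cos (x 0 o2) / sin (x 0 o2)) * (\sum_j a j (x 0 o1) * fre (G j).2 x)).
    rewrite !mulr_sumr -!sumrB; apply: eq_bigr => j _.
    have -> : fre (op_ang e (G j)).2 x = _ := fre_angE e (G j).1 (G j).2 x.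
    rewrite Gs.
    by move: (pd _ _ x) (pd _ _ x) (fre _ _) => u v w; ring.
  by rewrite E1 E4 E5 !mulr0 !subr0.
- transitivity (\sum_j a j (x 0 o1) * pd o2 (fim (G j).2) x
      + sg R e * (sin (x 0 o2))^-1 * (\sum_j a j (x 0 o1) * pd o3 (fre (G j).2) x)
      - sg R e * s * (cos (x 0 o2) / sin (x 0 o2)) * (\sum_j a j (x 0 o1) * fim (G j).2 x)).
    rewrite !mulr_sumr -!big_split -sumrB; apply: eq_bigr => j _ /=.
    have -> : fim (op_ang e (G j)).2 x = _ := fim_angE e (G j).1 (G j).2 x.
    rewrite Gs.
    by move: (pd _ _ x) (pd _ _ x) (fim _ _) => u v w; ring.
  by rewrite E2 E3 E6 !mulr0 addr0 subr0.
Qed.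

(** As [Y = h' d_tau - d_rho], the coefficients are differentiated with a minus sign. *)
Lemma rel_Y : rel -> forall x, domF Oset x ->
  \sum_j (a j (x 0 o1) * fre (oY (G j)).2 x - a' j (x 0 o1) * fre (G j).2 x) = 0 /\
  \sum_j (a j (x 0 o1) * fim (oY (G j)).2 x - a' j (x 0 o1) * fim (G j).2 x) = 0.
Proof.
move=> H x Dx; have [E1 E2] := rel_pd0 (i := o0) erefl H Dx.
have [E3 E4] := rel_pd o1 H Dx.
split.
- transitivity (h^`()%classic (x 0 o1) * (\sum_j a j (x 0 o1) * pd o0 (fre (G j).2) x)
      - \sum_j ((o1 == o1)%:R * a' j (x 0 o1) * fre (G j).2 x + a j (x 0 o1) * pd o1 (fre (G j).2) x)).
    rewrite !mulr_sumr -!sumrB; apply: eq_bigr => j _.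
    have -> : fre (oY (G j)).2 x = _ := fre_YE M h (G j).2 x.
    by rewrite eqxx mul1r; move: (pd o0 _ x) (pd o1 _ x) (fre _ _) => u v w; ring.
  by rewrite E1 E3 !mulr0 subr0.
- transitivity (h^`()%classic (x 0 o1) * (\sum_j a j (x 0 o1) * pd o0 (fim (G j).2) x)
      - \sum_j ((o1 == o1)%:R * a' j (x 0 o1) * fim (G j).2 x + a j (x 0 o1) * pd o1 (fim (G j).2) x)).
    rewrite !mulr_sumr -!sumrB; apply: eq_bigr => j _.
    have -> : fim (oY (G j)).2 x = _ := fim_YE M h (G j).2 x.
    by rewrite eqxx mul1r; move: (pd o0 _ x) (pd o1 _ x) (fim _ _) => u v w; ring.
  by rewrite E2 E4 !mulr0 subr0.
Qed.

End Relation.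

(* The coefficients of [Y^n] applied to
   [Delta Y Q = 2 r^2 d_tau Q + (r - M) Q - op_ang (~~ e) P]. *)
Definition coefs (n j : nat) (r : R) : R :=
  [:: Delta M r; - (2 * r ^+ 2); - ((2 * n + 1)%:R * (r - M)); 1; n%:R ^+ 2;
      4 * n%:R * r; - (2 * n%:R * (n%:R - 1))]`_j.
Definition dcoefs (n j : nat) (r : R) : R :=
  [:: 2 * (r - M); - (4 * r); - (2 * n + 1)%:R; 0; 0; 4 * n%:R; 0]`_j.
(** For [n = 0] or [1] the truncated predecessors give spurious entries; their coefficients [n^2],
    [4 n r] and [2 n (n - 1)] vanish exactly then. *)
Definition fields e P Q (n j : nat) : spin_scalar R :=
  nth Q [:: iter n.+1 oY Q; op_tau (iter n oY Q); iter n oY Q; op_ang (~~ e) (iter n oY P);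
    iter n.-1 oY Q; op_tau (iter n.-1 oY Q); op_tau (iter n.-2 oY Q)] j.

Lemma sum_I7 (f : nat -> R) : \sum_(j < 7) f j = f 0%N + (f 1%N + (f 2%N + (f 3%N + (f 4%N + (f 5%N + f 6%N))))).
Proof. by rewrite !big_ord_recl big_ord0 /= addr0. Qed.

Lemma dcoefsP n (j : 'I_7) (r : R) : is_derive r (1 : R) (coefs n j) (dcoefs n j r).
Proof.
have dx : is_derive r (1 : R) (fun x : R => x) 1 by exact: is_derive_id.
have dc (c : R) : is_derive r (1 : R) (fun _ : R => c) 0 by exact: is_derive_cst.
case: j => -[|[|[|[|[|[|[|//]]]]]]] Hj.
- have D := is_deriveB (is_deriveM dx dx) (is_deriveM (dc (2 * M)) dx).
  rewrite /coefs /dcoefs /=.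
  have -> : Delta M = (fun x : R => x) * (fun x => x) - (fun=> 2 * M) * (fun x => x).
    by apply/funext => x; rewrite !fctE /Delta expr2.
  by apply: (is_derive_eq D); rewrite /GRing.scale /=; ring.
- have D := is_deriveM (dc (- 2)) (is_deriveM dx dx).
  rewrite /coefs /dcoefs /=.
  have -> : (fun r : R => - (2 * r ^+ 2)) = (fun=> -2) * ((fun x : R => x) * (fun x => x)).
    by apply/funext => x; rewrite !fctE expr2 mulNr.
  by apply: (is_derive_eq D); rewrite /GRing.scale /= !fctE; ring.
- have D := is_deriveM (dc (- (2 * n + 1)%:R)) (is_deriveB dx (dc M)).
  rewrite /coefs /dcoefs /=.
  have -> : (fun r : R => - ((2 * n + 1)%:R * (r - M))) = (fun=> - (2 * n + 1)%:R) * ((fun x : R => x) - (fun=> M)).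
    by apply/funext => x; rewrite !fctE mulNr.
  by apply: (is_derive_eq D); rewrite /GRing.scale /= !fctE; ring.
- exact: dc.
- exact: dc.
- have D := is_deriveM (dc (4 * n%:R)) dx.
  by apply: (is_derive_eq D); rewrite /GRing.scale /= /dcoefs /=; ring.
- exact: dc.
Qed.

Section Pair.
Variables (e : bool) (P Q : spin_scalar R).
Hypothesis dp : DP e P Q.

Lemma fields_Nice n (j : 'I_7) : Nice (fields e P Q n j).
Proof.
have NP := DP_P dp; have NQ := DP_Q dp.
have NI m F : Nice F -> Nice (iter m oY F) by apply: Nice_iter => G; exact: NiceY.
case: j => -[|[|[|[|[|[|[|//]]]]]]] Hj; rewrite /fields /nth.
- exact: (NI n.+1).
- exact: Nice_tau (NI _ _ NQ).
- exact: NI.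
- exact: Nice_ang (NI _ _ NP).
- exact: NI.
- exact: Nice_tau (NI _ _ NQ).
- exact: Nice_tau (NI _ _ NQ).
Qed.

Lemma iterY_w n F : (iter n oY F).1 = F.1.
Proof. by elim: n => //= n <-. Qed.

Lemma fields_w n (j : 'I_7) : (fields e P Q n j).1 = Q.1.
Proof.
case: j => -[|[|[|[|[|[|[|//]]]]]]] Hj; rewrite /fields /nth.
- exact: (iterY_w n.+1).
- exact: iterY_w.
- exact: iterY_w.
- apply: (@etrans _ _ ((iter n oY P).1 + sg R (~~ e))); first by [].
  by rewrite iterY_w (DP_wP dp) (DP_wQ dp) sg_neg; field.
- exact: iterY_w.
- exact: iterY_w.
- exact: iterY_w.
Qed.

Lemma iterY_comm (X : spin_scalar R -> spin_scalar R) F n : Nice F ->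
  (forall G, Nice G -> eqN (oY (X G)) (X (oY G))) ->
  eqN (iter n oY (X F)) (X (iter n oY F)).
Proof.
move=> NF HX; elim: n => [|n IH]; first exact: eqN_refl.
apply: (eqN_trans (eqN_Y IH)); apply: HX.
by apply: Nice_iter => // G; exact: NiceY.
Qed.

Lemma DP_1n n : eqOn Oset (oY (iter n oY P)) (op_ang e (iter n oY Q)).
Proof.
have NQ := DP_Q dp.
have -> : oY (iter n oY P) = iter n oY (oY P) by rewrite -iterS iterSr.
have E : eqOn Oset (iter n oY (oY P)) (iter n oY (op_ang e Q)).
  elim: n => [|n IH]; first exact: (DP_1 dp).
  exact: (eqOn_Y open_Oset IH).
apply: (eqOn_trans E); apply: eqN_O; apply: iterY_comm => // G NG.
exact: commN_Y_ang.
Qed.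

Lemma sum_fields n (x : 'rV[R]_4) :
  \sum_(j < 7) coefs n j (x 0 o1) * fre (fields e P Q n j).2 x =
    Delta M (x 0 o1) * fre (iter n.+1 oY Q).2 x + (- (2 * (x 0 o1) ^+ 2) * fre (op_tau (iter n oY Q)).2 x
    + (- ((2 * n + 1)%:R * (x 0 o1 - M)) * fre (iter n oY Q).2 x + (1 * fre (op_ang (~~ e) (iter n oY P)).2 x
    + (n%:R ^+ 2 * fre (iter n.-1 oY Q).2 x + (4 * n%:R * x 0 o1 * fre (op_tau (iter n.-1 oY Q)).2 x
    + - (2 * n%:R * (n%:R - 1)) * fre (op_tau (iter n.-2 oY Q)).2 x))))) /\
  \sum_(j < 7) coefs n j (x 0 o1) * fim (fields e P Q n j).2 x =
    Delta M (x 0 o1) * fim (iter n.+1 oY Q).2 x + (- (2 * (x 0 o1) ^+ 2) * fim (op_tau (iter n oY Q)).2 x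
    + (- ((2 * n + 1)%:R * (x 0 o1 - M)) * fim (iter n oY Q).2 x + (1 * fim (op_ang (~~ e) (iter n oY P)).2 x
    + (n%:R ^+ 2 * fim (iter n.-1 oY Q).2 x + (4 * n%:R * x 0 o1 * fim (op_tau (iter n.-1 oY Q)).2 x
    + - (2 * n%:R * (n%:R - 1)) * fim (op_tau (iter n.-2 oY Q)).2 x))))).
Proof.
split; first exact: (sum_I7 (fun j => coefs n j (x 0 o1) * fre (fields e P Q n j).2 x)).
exact: (sum_I7 (fun j => coefs n j (x 0 o1) * fim (fields e P Q n j).2 x)).
Qed.

(** The recursion of the coefficients under [Y]: [(2n+1) + 2 = 2n+3], [n^2 + (2n+1) = (n+1)^2],
    [4nr + 4r = 4(n+1)r] and [2n(n-1) + 4n = 2(n+1)n]. The first three hypotheses carry factors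
    vanishing where the predecessors are truncated. *)
Let step (n : nat) (D r A1 A2 A3 A4 A5 A6 A7 B2 B4 B5 B6 B7 C6 C7 Z1 Z2 Z3 m : R) :
  n%:R * B5 = n%:R * A5 -> n%:R * C6 = n%:R * A6 -> n%:R * (n%:R - 1) * C7 = n%:R * (n%:R - 1) * A7 ->
  B2 = A2 -> B4 = A4 -> B6 = C6 -> B7 = C7 ->
  D * A1 - 2 * (r - m) * A3 + (- (2 * r ^+ 2) * B2 - - (4 * r) * A6
  + (- ((2 * n + 1)%:R * (r - m)) * A3 - - (2 * n + 1)%:R * A5 + (1 * B4 - 0 * Z1
  + (n%:R ^+ 2 * B5 - 0 * Z2 + (4 * n%:R * r * B6 - 4 * n%:R * A7
  + (- (2 * n%:R * (n%:R - 1)) * B7 - 0 * Z3)))))) = 0 ->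
  D * A1 + (- (2 * r ^+ 2) * A2 + (- ((2 * n.+1 + 1)%:R * (r - m)) * A3 + (1 * A4
   + (n.+1%:R ^+ 2 * A5 + (4 * n.+1%:R * r * A6 + - (2 * n.+1%:R * (n.+1%:R - 1)) * A7))))) = 0.
Proof.
move=> h5 h6 h7 -> -> -> -> E.
transitivity (n%:R * (n%:R * A5 - n%:R * B5) + 4 * r * (n%:R * A6 - n%:R * C6)
   - 2 * (n%:R * (n%:R - 1) * A7 - n%:R * (n%:R - 1) * C7)).
  rewrite -[LHS]subr0 -[X in _ - X]E.
  rewrite !natrD !natrM -[n.+1]addn1 natrD.
  by ring.
by rewrite h5 h6 h7 !subrr !mulr0 subr0 addr0.
Qed.

Lemma DP_rel n : rel (fun j : 'I_7 => coefs n j) (fun j : 'I_7 => fields e P Q n j).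
Proof.
have NP := DP_P dp; have NQ := DP_Q dp.
have NI m F : Nice F -> Nice (iter m oY F) by apply: Nice_iter => G; exact: NiceY.
elim: n => [|n IH] x Dx.
  have [E1 E2] := DP_2 dp Dx.
  have [-> ->] := sum_fields 0 x.
  split.
  - transitivity (Delta M (x 0 o1) * fre (oY Q).2 x - (2 * (x 0 o1) ^+ 2 * fre (op_tau Q).2 x
      + (x 0 o1 - M) * fre Q.2 x - fre (op_ang (~~ e) P).2 x)); last by rewrite E1 subrr.
    rewrite [iter 1 oY Q]/iter [iter 0 oY Q]/iter [iter 0 oY P]/iter.
    by move: (fre _ x) (fre _ x) (fre _ x) (fre _ x) => a b c d; ring.
  - transitivity (Delta M (x 0 o1) * fim (oY Q).2 x - (2 * (x 0 o1) ^+ 2 * fim (op_tau Q).2 x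
      + (x 0 o1 - M) * fim Q.2 x - fim (op_ang (~~ e) P).2 x)); last by rewrite E2 subrr.
    rewrite [iter 1 oY Q]/iter [iter 0 oY Q]/iter [iter 0 oY P]/iter.
    by move: (fim _ x) (fim _ x) (fim _ x) (fim _ x) => a b c d; ring.
have [E1 E2] := rel_Y (dcoefsP n) (fields_Nice n) IH Dx.
have [-> ->] := sum_fields n.+1 x.
have CT m : eqOn Oset (oY (op_tau (iter m oY Q))) (op_tau (iter m.+1 oY Q)).
  exact: eqOn_sym (eqN_O (commN_tau_Y (NI m Q NQ))).
have CA : eqOn Oset (oY (op_ang (~~ e) (iter n oY P))) (op_ang (~~ e) (iter n.+1 oY P)).
  exact: eqN_O (commN_Y_ang _ (NI n P NP)).
have [T1r T1i] := ((eqOnP _ _ _).1 (CT n)).2 x Dx.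
have [T2r T2i] := ((eqOnP _ _ _).1 (CT n.-1)).2 x Dx.
have [T3r T3i] := ((eqOnP _ _ _).1 (CT n.-2)).2 x Dx.
have [Ar Ai] := ((eqOnP _ _ _).1 CA).2 x Dx.
split.
- have h5 : n%:R * fre (iter n.-1.+1 oY Q).2 x = n%:R * fre (iter n oY Q).2 x.
    by clear; case: (n) => [|m]; rewrite ?mul0r.
  have h6 : n%:R * fre (op_tau (iter n.-1.+1 oY Q)).2 x = n%:R * fre (op_tau (iter n oY Q)).2 x.
    by clear; case: (n) => [|m]; rewrite ?mul0r.
  have h7 : n%:R * (n%:R - 1) * fre (op_tau (iter n.-2.+1 oY Q)).2 x = n%:R * (n%:R - 1) * fre (op_tau (iter n.-1 oY Q)).2 x.
    by clear; case: (n) => [|[|m]]; rewrite ?subrr ?mulr0 ?mul0r.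
  apply: (step h5 h6 h7 T1r Ar T2r T3r).
  exact: (etrans (esym (sum_I7 (fun j => coefs n j (x 0 o1) * fre (oY (fields e P Q n j)).2 x
    - dcoefs n j (x 0 o1) * fre (fields e P Q n j).2 x))) E1).
- have h5 : n%:R * fim (iter n.-1.+1 oY Q).2 x = n%:R * fim (iter n oY Q).2 x.
    by clear; case: (n) => [|m]; rewrite ?mul0r.
  have h6 : n%:R * fim (op_tau (iter n.-1.+1 oY Q)).2 x = n%:R * fim (op_tau (iter n oY Q)).2 x.
    by clear; case: (n) => [|m]; rewrite ?mul0r.
  have h7 : n%:R * (n%:R - 1) * fim (op_tau (iter n.-2.+1 oY Q)).2 x = n%:R * (n%:R - 1) * fim (op_tau (iter n.-1 oY Q)).2 x.
    by clear; case: (n) => [|[|m]]; rewrite ?subrr ?mulr0 ?mul0r.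
  apply: (step h5 h6 h7 T1i Ai T2i T3i).
  exact: (etrans (esym (sum_I7 (fun j => coefs n j (x 0 o1) * fim (oY (fields e P Q n j)).2 x
    - dcoefs n j (x 0 o1) * fim (fields e P Q n j).2 x))) E2).
Qed.

End Pair.

Section Closure.
Variables (e : bool) (P Q : spin_scalar R).
Hypothesis dp : DP e P Q.

Let closure2 (X : spin_scalar R -> spin_scalar R) :
  (forall x, domF Oset x ->
    \sum_(j < 7) coefs 0 j (x 0 o1) * fre (X (fields e P Q 0 j)).2 x = 0 /\
    \sum_(j < 7) coefs 0 j (x 0 o1) * fim (X (fields e P Q 0 j)).2 x = 0) ->
  forall x, domF Oset x ->
  Delta M (x 0 o1) * fre (X (oY Q)).2 x = 2 * (x 0 o1) ^+ 2 * fre (X (op_tau Q)).2 x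
      + (x 0 o1 - M) * fre (X Q).2 x - fre (X (op_ang (~~ e) P)).2 x /\
  Delta M (x 0 o1) * fim (X (oY Q)).2 x = 2 * (x 0 o1) ^+ 2 * fim (X (op_tau Q)).2 x
      + (x 0 o1 - M) * fim (X Q).2 x - fim (X (op_ang (~~ e) P)).2 x.
Proof.
have key (D r m a b c d : R) : D * a + (- (2 * r ^+ 2) * b + (- ((2 * 0 + 1)%:R * (r - m)) * c + (1 * d
   + (0 ^+ 2 * c + (4 * 0 * r * b + - (2 * 0 * (0 - 1)) * b))))) = 0 ->
   D * a = 2 * r ^+ 2 * b + (r - m) * c - d.
  by move=> E; apply/eqP; rewrite -subr_eq0 -[X in _ == X]E; apply/eqP; ring.
move=> H x Dx; have [E1 E2] := H x Dx; split; apply: key.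
- exact: (etrans (esym (sum_I7 (fun j => coefs 0 j (x 0 o1) * fre (X (fields e P Q 0 j)).2 x))) E1).
- exact: (etrans (esym (sum_I7 (fun j => coefs 0 j (x 0 o1) * fim (X (fields e P Q 0 j)).2 x))) E2).
Qed.

Let subst2 (A A' B B' C D D' : 'rV[R]_4 -> R) x : A x = A' x -> B x = B' x -> D x = D' x ->
  Delta M (x 0 o1) * A x = 2 * (x 0 o1) ^+ 2 * B x + (x 0 o1 - M) * C x - D x ->
  Delta M (x 0 o1) * A' x = 2 * (x 0 o1) ^+ 2 * B' x + (x 0 o1 - M) * C x - D' x.
Proof. by move=> -> -> ->. Qed.

Lemma DP_tau : DP e (op_tau P) (op_tau Q).
Proof.
have [NP NQ wP wQ H1 H2] := dp.
split; [exact: Nice_tau|exact: Nice_tau|exact: wP|exact: wQ| |].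
  apply: (eqOn_trans (eqOn_sym (eqN_O (commN_tau_Y NP)))).
  apply: (eqOn_trans (eqOn_tau open_Oset H1)).
  exact: eqN_O (commN_tau_ang e NQ).
move=> x Dx.
have [E1 E2] := closure2 (rel_tau (dcoefsP 0) (fields_Nice dp 0) (DP_rel dp 0)) Dx.
have [A1 A2] := ((eqOnP _ _ _).1 (eqN_O (commN_tau_Y NQ))).2 x Dx.
have [D1 D2] := ((eqOnP _ _ _).1 (eqN_O (commN_tau_ang (~~ e) NP))).2 x Dx.
split; [exact: (subst2 A1 erefl D1 E1)|exact: (subst2 A2 erefl D2 E2)].
Qed.

Lemma DP_phi : DP e (op_phi P) (op_phi Q).
Proof.
have [NP NQ wP wQ H1 H2] := dp.
split; [exact: Nice_phi|exact: Nice_phi|exact: wP|exact: wQ| |].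
  apply: (eqOn_trans (eqN_O (commN_phi_Y NP))).
  apply: (eqOn_trans (eqOn_phi open_Oset H1)).
  exact: eqN_O (commN_phi_ang e NQ).
move=> x Dx.
have [E1 E2] := closure2 (rel_phi (dcoefsP 0) (fields_Nice dp 0) (DP_rel dp 0)) Dx.
have [A1 A2] := ((eqOnP _ _ _).1 (eqN_O (eqN_sym (commN_phi_Y NQ)))).2 x Dx.
have [B1 B2] := ((eqOnP _ _ _).1 (eqN_O (commN_phi_tau NQ))).2 x Dx.
have [D1 D2] := ((eqOnP _ _ _).1 (eqN_O (commN_phi_ang (~~ e) NP))).2 x Dx.
split; [exact: (subst2 A1 B1 D1 E1)|exact: (subst2 A2 B2 D2 E2)].
Qed.

Lemma DP_ang : DP (~~ e) (op_ang (~~ e) P) (op_ang e Q).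
Proof.
have [NP NQ wP wQ H1 H2] := dp.
split; [exact: Nice_ang|exact: Nice_ang| | | |].
- by apply: (@etrans _ _ (P.1 + sg R (~~ e))); [|rewrite wP sg_neg; field].
- by apply: (@etrans _ _ (Q.1 + sg R e)); [|rewrite wQ sg_neg; field].
- apply: (eqOn_trans (eqN_O (commN_Y_ang (~~ e) NP))).
  exact: (eqOn_ang open_Oset H1).
move=> x Dx.
have [E1 E2] := closure2 (rel_ang (dcoefsP 0) (fields_Nice dp 0) e (fields_w dp 0) (DP_rel dp 0)) Dx.
have [A1 A2] := ((eqOnP _ _ _).1 (eqN_O (eqN_sym (commN_Y_ang e NQ)))).2 x Dx.
have [B1 B2] := ((eqOnP _ _ _).1 (eqN_O (eqN_sym (commN_tau_ang e NQ)))).2 x Dx.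
rewrite negbK; split; [exact: (subst2 A1 B1 erefl E1)|exact: (subst2 A2 B2 erefl E2)].
Qed.

End Closure.

(** Alternating products with [op_ang e] innermost. These are the angular derivatives that preserve
    the Dirac system, and the derivatives of the multi-index notation are of this kind. *)
Fixpoint alt e m F := if m is m'.+1 then op_ang (e (+) odd m') (alt e m' F) else F.

Lemma Nice_alt e m F : Nice F -> Nice (alt e m F).
Proof. by move=> NF; elim: m => //= m IH; exact: Nice_ang. Qed.

Lemma DP_alt e P Q m : DP e P Q -> DP (e (+) odd m) (alt (~~ e) m P) (alt e m Q).
Proof.
move=> dp; elim: m => [|m IH]; first by rewrite addbF.
have := DP_ang IH; rewrite /= -addbN.
by rewrite addNb addbN.
Qed.

Lemma DP_iter_tau e P Q m : DP e P Q -> DP e (iter m (@op_tau R) P) (iter m (@op_tau R) Q).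
Proof. by move=> dp; elim: m => //= m IH; exact: DP_tau. Qed.
Lemma DP_iter_phi e P Q m : DP e P Q -> DP e (iter m (@op_phi R) P) (iter m (@op_phi R) Q).
Proof. by move=> dp; elim: m => //= m IH; exact: DP_phi. Qed.

Lemma Sint_sum (n : nat) (c : 'I_n -> R) (g : 'I_n -> R -> R -> R) : (forall j, sphfun (g j)) ->
  Sint (fun th ph => \sum_j c j * g j th ph) = \sum_j c j * Sint (g j).
Proof.
elim: n c g => [|n IH] c g Hg.
  rewrite big_ord0 -[RHS](mul0r (Sint (fun _ _ : R => 1))) -SintZ; last exact: sphfun_cst.
  by apply: eq_Sint => th ph _; rewrite big_ord0 mul0r.
rewrite big_ord_recl -IH// -SintZ//.
have sS k (d : 'I_k -> R) (f : 'I_k -> R -> R -> R) : (forall j, sphfun (f j)) ->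
    sphfun (fun th ph => \sum_j d j * f j th ph).
  elim: k d f => [|k IHk] d f Hf.
    have := sphfun_cst (0 : R); congr sphfun.
    by apply/funext => th; apply/funext => ph; rewrite big_ord0.
  have := sphfunD (sphfunM (sphfun_cst (d ord0)) (Hf ord0)) (IHk (fun j => d (lift ord0 j)) (fun j => f (lift ord0 j)) (fun j => Hf _)).
  by congr sphfun; apply/funext => th; apply/funext => ph; rewrite big_ord_recl.
rewrite -SintD; last 2 first.
- by apply: sphfunM => //; exact: sphfun_cst.
- exact: sS.
by apply: eq_Sint => th ph _; rewrite big_ord_recl.
Qed.

Lemma rel_ip n (a : 'I_n -> R -> R) (G : 'I_n -> spin_scalar R) H t r : (forall j, Nice (G j)) ->
  Nice H -> rel a G -> Oset (t, r) -> \sum_j a j r * ip (G j) H t r = 0.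
Proof.
move=> NG NH E Otr; rewrite /ip -Sint_sum; last first.
  by move=> j; apply: sphfun_dens => //; exact: Oset_reg.
rewrite -[RHS](mul0r (Sint (fun _ _ : R => 1))) -SintZ; last exact: sphfun_cst.
apply: eq_Sint => th ph Hth; rewrite mul0r.
have Dx : domF Oset (pt4 t r th ph) by exact: domF_pt4.
have [E1 E2] := E _ Dx; rewrite pt4S /= in E1 E2.
transitivity (fre H.2 (pt4 t r th ph) * (\sum_j a j r * fre (G j).2 (pt4 t r th ph))
  + fim H.2 (pt4 t r th ph) * (\sum_j a j r * fim (G j).2 (pt4 t r th ph))); last by rewrite E1 E2 !mulr0 addr0.
rewrite !mulr_sumr -big_split; apply: eq_bigr => j _ /=.
by rewrite /dens; move: (fre _ _) (fim _ _) (fre _ _) (fim _ _) (a j r) => u v w z c; ring.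
Qed.

Lemma eqOn_ip F G H t r : Oset (t, r) -> eqOn Oset F G -> ip F H t r = ip G H t r.
Proof. by move=> Otr [_ E]; apply: eq_ip => // th ph Hth; exact: E. Qed.

Section Energy.
Variables (e : bool) (P Q : spin_scalar R) (b : nat).
Hypothesis dp : DP e P Q.
Let P1 := iter b oY P.
Let Q1 := iter b oY Q.

(** The terms of [DP_rel] in which [Q] carries fewer than [b] factors [Y], paired with [Y^b Q]; for
    [b = 0] they vanish. *)
Definition forcing t r := b%:R ^+ 2 * ip (iter b.-1 oY Q) Q1 t r
  + 4 * b%:R * r * ip (op_tau (iter b.-1 oY Q)) Q1 t r
  - 2 * b%:R * (b%:R - 1) * ip (op_tau (iter b.-2 oY Q)) Q1 t r.

(** The angular terms of the two paired equations are opposite by [ip_ang]. Of the factor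
    [(2b + 1) (r - M)], one [r - M] is half the derivative of [Delta] and completes a divergence;
    the rest is the red-shift. *)
Lemma energy_identity t r : Oset (t, r) ->
  h^`()%classic r * ip (op_tau P1) P1 t r - ip (op_rho P1) P1 t r
  + (2 * r ^+ 2 - Delta M r * h^`()%classic r) * ip (op_tau Q1) Q1 t r
  + Delta M r * ip (op_rho Q1) Q1 t r
  + (2 * b%:R + 1) * (r - M) * ip Q1 Q1 t r - forcing t r = 0.
Proof.
move=> Otr; have rtr := Oset_reg Otr.
have NP1 : Nice P1 by apply: Nice_iter => [G|]; [exact: NiceY|exact: DP_P dp].
have NQ1 : Nice Q1 by apply: Nice_iter => [G|]; [exact: NiceY|exact: DP_Q dp].
have E1 := eqOn_ip P1 Otr (DP_1n dp b).
have E2 : ip (op_ang e Q1) P1 t r = - ip (op_ang (~~ e) P1) Q1 t r.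
  rewrite (ip_ang rtr NQ1 NP1) ?(ipC Q1)//.
  by rewrite !iterY_w (DP_wP dp) (DP_wQ dp); field.
have := ip_Y h rtr NP1 NP1; rewrite E1 E2.
have := ip_Y h rtr NQ1 NQ1.
have := rel_ip (fields_Nice dp b) NQ1 (DP_rel dp b) Otr.
rewrite (sum_I7 (fun j => coefs b j r * ip (fields e P Q b j) Q1 t r)).
rewrite /coefs /fields /forcing [nth _ _ 0]/= ![nth _ _ _]/= -/P1 -/Q1.
move: (ip (op_rho P1) P1 t r) (ip (op_rho Q1) Q1 t r) (ip (op_tau P1) P1 t r).
move: (ip (op_tau (iter b.-2 oY Q)) Q1 t r) (ip (op_tau (iter b.-1 oY Q)) Q1 t r) (ip (iter b.-1 oY Q) Q1 t r).
move: (ip (op_ang (~~ e) P1) Q1 t r) (ip (op_tau Q1) Q1 t r) (ip Q1 Q1 t r) => X qt q f1 f2 f3 pr qr pt.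
move: (ip (oY Q1) Q1 t r) => qY A B C.
move: A; rewrite B => A; rewrite -C; apply/eqP; rewrite -oppr_eq0 -[X in _ == X]A natrD natrM; apply/eqP.
by ring.
Qed.

End Energy.

End Dirac.

(** * Energy estimates *)

Section Estimates.
Variables (R : realType) (M tau0 : R) (h : R -> R) (r_away r_far : R).
Hypothesis M0 : 0 < M.
Hypothesis fol : foliation M h r_away r_far tau0.
Let hsmooth := fol_smooth fol.
Implicit Types F G P Q : spin_scalar R.
Notation RR := (measurableTypeR R).
Notation lam := (@lebesgue_measure R).
Notation lam2 := (lam \x lam)%E.
Notation reg := (reg M tau0).
Notation Nice := (Nice M tau0).
Notation oY := (op_Y M h).
Notation good := (good M tau0).
Notation hp := (h^`()%classic : R -> R).
Notation mf := (mfun M h).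
Notation Oset := (Oset M tau0).

Definition Nrm G t : \bar R := (\int[lam]_(r in `](2 * M)%R, +oo[) (ip G G t r)%:E)%E.

Lemma Nrm_ub G t (L C X : R) (g : R -> R) : tau0 <= t -> Nice G -> 0 <= C ->
  (forall r, 2 * M <= r -> {for r, continuous g}) ->
  (forall r, 2 * M < r < L -> g r <= C) ->
  (Nrm G t <= X%:E)%E -> \int[lam]_(r in `]2 * M, L[) (g r * ip G G t r) <= C * X.
Proof.
move=> Ht NG C0 cg gC HX.
have gi := good_ip NG NG; have gg : good (fun _ r => g r) by exact: good_rho.
have mI : measurable (`]2 * M, L[%classic : set RR) by exact: measurable_itv.
have mIy : measurable (`]2 * M, +oo[%classic : set RR) by exact: measurable_itv.
have sub : (`]2 * M, L[%classic : set R) `<=` `]2 * M, +oo[.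
  by move=> r /=; rewrite !in_itv /= andbT => /andP[].
have int1 := good_int_r L Ht gi.
have int2 := good_int_r L Ht (goodM gg gi).
have mip : measurable_fun (`]2 * M, +oo[ : set RR) (fun r => (ip G G t r)%:E).
  apply/measurable_EFinP; apply: open_continuous_measurable_fun; first exact: interval_open.
  move=> r; rewrite inE /= in_itv /= andbT => Hr.
  by have [_ + _] := gi; apply; split => //=; exact: ltW.
apply: (@le_trans _ _ (\int[lam]_(r in `]2 * M, L[) (C * ip G G t r))).
  apply: le_Rintegral => //.
    exact: (good_int_r L Ht (goodM (good_cst _ _ C) gi)).
  move=> r; rewrite /= in_itv /= => Hr.
  by rewrite ler_wpM2r ?gC// ip_ge0.
rewrite RintegralZl//; rewrite ler_wpM2l//.
rewrite -lee_fin /Rintegral fineK; last exact: (integrable_fin_num mI int1).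
apply: le_trans HX; apply: ge0_subset_integral => //.
by move=> r _; rewrite lee_fin ip_ge0.
Qed.

Lemma fol_h_continuous r : 2 * M <= r -> {for r, continuous h}.
Proof. by move=> Hr; exact: is_derive1_continuous (fol_h_derive fol Hr). Qed.

Lemma good_v : good (fun t r => t + h r).
Proof.
apply: goodD; last by apply: good_rho => r Hr; exact: fol_h_continuous.
by apply: (@good_tau _ M tau0 (fun t => t)) => t _; exact: cvg_id.
Qed.

Lemma good_zeta c : 0 < c -> good (fun t r => zeta c (t + h r)).
Proof. by move=> c0; exact: (good_comp (continuous_zeta c0) good_v). Qed.
Lemma good_dzeta c : good (fun t r => dzeta c (t + h r)).
Proof. exact: (good_comp (@continuous_dzeta R c) good_v). Qed.

(** One radius serves all times at once, because [t + h (2 M)] is positive for [t >= tau0] and [h]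
    grows at least linearly. *)
Lemma fol_v_unbounded (c : R) : exists2 L : R, 2 * M < L &
  forall t r, tau0 <= t -> L <= r -> c <= t + h r.
Proof.
have [k k0 H] := fol_h_growth M0 fol.
exists (2 * M + 1 + `|c| / k).
  by rewrite -addrA ltrDl ltr_pwDl// divr_ge0// ltW.
move=> t r Ht Hr; have ck : 0 <= `|c| / k by rewrite divr_ge0// ltW.
have H1 := H (2 * M) r (lexx _).
have {H1} : h (2 * M) + k * (r - 2 * M) <= h r by apply: H1; lra.
have : `|c| <= k * (r - 2 * M).
  have -> : `|c| = k * (`|c| / k) by field; rewrite gt_eqF.
  by rewrite ler_wpM2l ?(ltW k0)//; lra.
have := fol_v_gt0 M0 fol Ht (lexx (2 * M)); have := ler_norm c; lra.
Qed.

(** Monotone convergence along [c = n + 1]. Since [zeta] vanishes beyond [L], truncated real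
    integrals are enough to control an energy not known beforehand to be finite. *)
Lemma Nrm_lb G t (X : R) : tau0 <= t -> Nice G ->
  (forall c L : R, 0 < c -> 2 * M < L ->
    (forall t r, tau0 <= t -> L <= r -> c <= t + h r) ->
    \int[lam]_(r in `]2 * M, L[) (zeta c (t + h r) * ip G G t r) <= X) ->
  (Nrm G t <= X%:E)%E.
Proof.
move=> Ht NG H.
pose g (n : nat) (r : RR) : \bar R := (zeta n.+1%:R (t + h r) * ip G G t r)%:E.
have gi := good_ip NG NG.
have mIy : measurable (`]2 * M, +oo[%classic : set RR) by exact: measurable_itv.
have inI r : (`]2 * M, +oo[%classic : set R) r -> 2 * M <= r.
  by rewrite /= in_itv /= andbT => /ltW.
have mg n : measurable_fun (`]2 * M, +oo[ : set RR) (g n).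
  apply/measurable_EFinP; apply: open_continuous_measurable_fun; first exact: interval_open.
  move=> r; rewrite inE => /inI Hr.
  have n0 : 0 < n.+1%:R :> R by [].
  by have [_ + _] := goodM (good_zeta n0) gi; apply; split.
have g0 n r : (`]2 * M, +oo[%classic : set R) r -> (0 <= g n r)%E.
  by move=> _; rewrite lee_fin mulr_ge0 ?zeta_ge0 ?ip_ge0.
have ndg (r : RR) : (`]2 * M, +oo[%classic : set R) r -> {homo g^~ r : n m / (n <= m)%N >-> (n <= m)%E}.
  move=> /inI Hr n m nm; rewrite lee_fin ler_wpM2r ?ip_ge0// zeta_le ?ler_nat//.
  by rewrite ltW// (fol_v_gt0 M0 fol).
have cv := cvg_monotone_convergence mIy mg g0 ndg (mu := lam).
have E : (Nrm G t = \int[lam]_(x in `](2 * M)%R, +oo[) limn (g^~ x))%E.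
  apply: eq_integral => r _; apply: esym; apply/cvg_lim => //.
  apply: cvg_EFin; first exact: nearW.
  rewrite -[X in _ --> X]mul1r; apply: cvgM; last exact: cvg_cst.
  exact: zeta_cvg.
rewrite E -(cvg_lim _ cv)//; apply: lime_le; first by apply/cvg_ex; eexists; exact: cv.
apply: nearW => n.
have [L ML HL] := fol_v_unbounded n.+1%:R.
have n0 : 0 < n.+1%:R :> R by [].
have := H n.+1%:R L n0 ML HL.
rewrite -lee_fin; apply: le_trans.
have int1 := good_int_r L Ht (goodM (good_zeta n0) gi).
rewrite /Rintegral fineK; last by apply: (integrable_fin_num _ int1); exact: measurable_itv.
rewrite (_ : (\int[lam]_(x in `](2 * M)%R, +oo[) g n x = \int[lam]_(x in `](2 * M)%R, L[) g n x)%E)//.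
rewrite integral_mkcond [RHS]integral_mkcond; apply: eq_integral => r _.
rewrite /patch; case: ifPn => [/set_mem r1|r1]; case: ifPn => [/set_mem r2|/negP r2] //.
  rewrite /g zeta0 ?mul0r//; apply: HL => //.
  by rewrite leNgt; apply/negP => rL; apply: r2; apply/mem_set; move: r1; rewrite /= !in_itv /= andbT => ->.
by move/negP: r1; case; apply/mem_set; move: r2; rewrite /= !in_itv /= andbT => /andP[].
Qed.

Section Green.
Variables (e : bool) (P Q : spin_scalar R) (b : nat).
Hypothesis dp : DP M tau0 h e P Q.
Let P1 := iter b oY P.
Let Q1 := iter b oY Q.
Let NP1 : Nice P1. Proof. by apply: Nice_iter => [G|]; [exact: NiceY|exact: DP_P dp]. Qed.
Let NQ1 : Nice Q1. Proof. by apply: Nice_iter => [G|]; [exact: NiceY|exact: DP_Q dp]. Qed.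

Variables (k c : R) (w w' : R -> R).
Hypothesis c0 : 0 < c.
Hypothesis dw : forall r, 2 * M <= r -> is_derive r (1 : R) w (w' r).
Hypothesis cw' : forall r, 2 * M <= r -> {for r, continuous w'}.

Let E (t : R) := expR (k * t).
Let Z t r := zeta c (t + h r).
Let dZ t r := dzeta c (t + h r).
Let p t r := ip P1 P1 t r.
Let q t r := ip Q1 Q1 t r.

(** The divergence of the current weighted by [e^(k t) w(r) zeta(v)]; its summands come from the
    exponential, the cutoff, the weight and the commutation. In the cutoff term the [|P|^2] parts of
    density and flux cancel and [mfun + h' Delta = 2 r^2] remains: only [|Q|^2] crosses
    [{v = c}]. *)
Definition energy_rhs t r :=
  E t * (k * Z t r * w r * (hp r * p t r + mf r * q t r) + dZ t r * w r * (2 * r ^+ 2 * q t r)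
  + Z t r * w' r * (Delta M r * q t r - p t r)
  + Z t r * w r * (2 * forcing M h Q b t r - 4 * b%:R * (r - M) * q t r)).

Let dE t : is_derive t (1 : R) E (k * E t).
Proof.
have dk : is_derive t (1 : R) (fun t : R => k * t) k.
  by apply: (is_derive_eq (is_deriveM (is_derive_cst k t 1) (is_derive_id t 1)));
    rewrite /GRing.scale /= mulr0 addr0 mulr1.
by apply: (is_derive_eq (is_derive1_comp (is_derive_expR (k * t)) dk)); rewrite mulrC.
Qed.

Let dZt t r : is_derive t (1 : R) (Z ^~ r) (dZ t r).
Proof.
have d1 : is_derive t (1 : R) (fun t : R => t + h r) 1.
  by apply: (is_derive_eq (is_deriveD (is_derive_id t 1) (is_derive_cst (h r) t 1))); rewrite addr0.
by apply: (is_derive_eq (@is_derive1_comp _ (zeta c) (fun t => t + h r) t _ _ (is_derive_zeta (t + h r) c0) d1)); rewrite mulr1.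
Qed.

Let dZr t r : 2 * M <= r -> is_derive r (1 : R) (Z t) (dZ t r * hp r).
Proof.
move=> Hr.
have d1 : is_derive r (1 : R) (fun r : R => t + h r) (hp r).
  by apply: (is_derive_eq (is_deriveD (is_derive_cst t r 1) (fol_h_derive fol Hr))); rewrite add0r.
exact: (@is_derive1_comp _ (zeta c) (fun r => t + h r) r _ _ (is_derive_zeta (t + h r) c0) d1).
Qed.

Let dDelta r : is_derive r (1 : R) (Delta M) (2 * (r - M)).
Proof. exact: (dcoefsP M 0 ord0 r). Qed.

Let gE : good (fun t _ => E t).
Proof. by apply: good_tau => t _; exact: is_derive1_continuous (dE t). Qed.
Let gZ : good Z. Proof. exact: good_zeta. Qed.
Let gdZ : good dZ. Proof. exact: good_dzeta. Qed.
Let gw : good (fun _ r => w r).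
Proof. by apply: good_rho => r Hr; exact: is_derive1_continuous (dw Hr). Qed.
Let gw' : good (fun _ r => w' r).
Proof. by apply: good_rho => r Hr; exact: cw'. Qed.
Let ghp : good (fun _ r => hp r).
Proof. by apply: good_rho => r Hr; exact: (fol_hp_continuous fol). Qed.
Let gDelta : good (fun _ r => Delta M r).
Proof. by apply: good_rho => r Hr; exact: is_derive1_continuous (dDelta r). Qed.
Let gid : good (fun _ r => r).
Proof. by apply: (@good_rho _ M tau0 (fun r => r)) => r _; exact: cvg_id. Qed.
Let gmf : good (fun _ r => mf r).
Proof.
rewrite /mfun; apply: goodB; last exact: goodM.
by apply: goodM; [exact: good_cst|under eq_fun do under eq_fun do rewrite expr2; exact: goodM].
Qed.
Let gip F G : Nice F -> Nice G -> good (ip F G). Proof. exact: good_ip. Qed.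

(** [A] is the weighted density and [B] the radial flux, with derivatives [At] and [Br]. *)
Let A t r := E t * Z t r * w r * (hp r * p t r + mf r * q t r).
Let At t r := (k * E t * Z t r + E t * dZ t r) * w r * (hp r * p t r + mf r * q t r)
  + E t * Z t r * w r * (hp r * (2 * ip (op_tau P1) P1 t r) + mf r * (2 * ip (op_tau Q1) Q1 t r)).
Let B t r := E t * Z t r * w r * (Delta M r * q t r - p t r).
Let Br t r := E t * (dZ t r * hp r * w r + Z t r * w' r) * (Delta M r * q t r - p t r)
  + E t * Z t r * w r * (2 * (r - M) * q t r + Delta M r * (2 * ip (op_rho Q1) Q1 t r)
     - 2 * ip (op_rho P1) P1 t r).

Let gA : good A.
Proof. by apply: goodM; [apply: goodM => //; exact: goodM|apply: goodD; apply: goodM => //; exact: gip]. Qed.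
Let gAt : good At.
Proof.
have g1 : good (ip (op_tau P1) P1) by apply: gip => //; exact: Nice_tau.
have g2 : good (ip (op_tau Q1) Q1) by apply: gip => //; exact: Nice_tau.
have gp : good p by exact: gip. have gq : good q by exact: gip.
have gc (x : R) : good (fun _ _ => x) by exact: good_cst.
apply: goodD.
  apply: goodM; last by apply: goodD; exact: goodM.
  apply: goodM => //; apply: goodD; last exact: goodM.
  by apply: goodM => //; apply: goodM.
apply: goodM; first by apply: goodM => //; exact: goodM.
by apply: goodD; apply: goodM => //; apply: goodM.
Qed.
Let gB : good B.
Proof. by apply: goodM; [apply: goodM => //; exact: goodM|apply: goodB; [apply: goodM => //; exact: gip|exact: gip]]. Qed.
Let gBr : good Br.
Proof.
have g1 : good (ip (op_rho P1) P1) by apply: gip => //; exact: Nice_rho.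
have g2 : good (ip (op_rho Q1) Q1) by apply: gip => //; exact: Nice_rho.
have gp : good p by exact: gip. have gq : good q by exact: gip.
have gc (x : R) : good (fun _ _ => x) by exact: good_cst.
apply: goodD.
  apply: goodM; last by apply: goodB => //; exact: goodM.
  by apply: goodM => //; apply: goodD; [apply: goodM => //; exact: goodM|exact: goodM].
apply: goodM; first by apply: goodM => //; exact: goodM.
apply: goodB; last exact: goodM.
apply: goodD; last by apply: goodM => //; exact: goodM.
by apply: goodM => //; apply: goodM => //; exact: goodB.
Qed.

Let dA t r : reg (t, r) -> is_derive t (1 : R) (A ^~ r) (At t r).
Proof.
move=> rtr.
have dp' := is_derive_ip_tau rtr NP1 NP1; have dq' := is_derive_ip_tau rtr NQ1 NQ1.
have cc (x : R) := is_derive_cst x t (1 : R).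
have D := is_deriveM (is_deriveM (is_deriveM (dE t) (dZt t r)) (cc (w r)))
  (is_deriveD (is_deriveM (cc (hp r)) dp') (is_deriveM (cc (mf r)) dq')).
apply: (is_derive_eq D).
rewrite /GRing.scale /= !fctE /At /p /q [ip P1 (op_tau P1) t r]ipC [ip Q1 (op_tau Q1) t r]ipC.
by move: (ip _ _ _ _) (ip _ _ _ _) (ip _ _ _ _) (ip _ _ _ _) (dZ t r) (Z t r) (E t) => *; ring.
Qed.

Let dB t r : reg (t, r) -> is_derive r (1 : R) (B t) (Br t r).
Proof.
move=> rtr; have [Ht Hr] := rtr; rewrite /= in Ht Hr.
have dp' := is_derive_ip_rho rtr NP1 NP1; have dq' := is_derive_ip_rho rtr NQ1 NQ1.
have cc (x : R) := is_derive_cst x r (1 : R).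
have D := is_deriveM (is_deriveM (is_deriveM (cc (E t)) (dZr t Hr)) (dw Hr))
  (is_deriveB (is_deriveM (dDelta r) dq') dp').
apply: (is_derive_eq D).
rewrite /GRing.scale /= !fctE /Br /p /q [ip P1 (op_rho P1) t r]ipC [ip Q1 (op_rho Q1) t r]ipC.
by move: (ip _ _ _ _) (ip _ _ _ _) (ip _ _ _ _) (ip _ _ _ _) (dZ t r) (Z t r) (E t) (w r) (w' r) (hp r) (Delta M r) => *; ring.
Qed.

Let AB t r : Oset (t, r) -> At t r + Br t r = energy_rhs t r.
Proof.
move=> Otr; have := energy_identity hsmooth b dp Otr.
rewrite /At /Br /energy_rhs /mfun -/P1 -/Q1 -/(p t r) -/(q t r).
move: (ip (op_tau P1) _ _ _) (ip (op_tau Q1) _ _ _) (ip (op_rho P1) _ _ _) (ip (op_rho Q1) _ _ _).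
move: (forcing _ _ _ _ _ _) (p t r) (q t r) (dZ t r) (Z t r) (E t) (w r) (w' r) (hp r) (Delta M r) (b%:R : R).
move=> f p' q' dz z x ww ww' hh D n pt qt pr qr Eq.
apply/eqP; rewrite -subr_eq0; apply/eqP.
transitivity (2 * x * z * ww * (hh * pt - pr + (2 * r ^+ 2 - D * hh) * qt + D * qr + (2 * n + 1) * (r - M) * q' - f)).
  by ring.
by rewrite Eq mulr0.
Qed.

(** At [rho = L] the cutoff kills the flux. At [rho = 2M] the factor [Delta] vanishes and only
    [|P|^2] remains, with the sign that puts it on the left-hand side. *)
Lemma energy_green a d L K : tau0 <= a -> a < d -> 2 * M < L ->
  (forall t r, tau0 <= t -> a <= t -> L <= r -> c <= t + h r) ->
  good K -> (forall t r, a < t < d -> 2 * M < r < L -> energy_rhs t r <= K t r) ->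
  \int[lam]_(r in `]2 * M, L[) A d r + \int[lam]_(t in `]a, d[) (E t * Z t (2 * M) * w (2 * M) * p t (2 * M))
  <= \int[lam]_(r in `]2 * M, L[) A a r + fine (\int[lam2]_(z in `]a, d[ `*` `](2 * M)%R, L[) (K z.1 z.2)%:E)%E.
Proof.
move=> Ha ad ML HL gK HK.
have HK' t r : a < t < d -> 2 * M < r < L -> At t r + Br t r <= K t r.
  move=> /andP[t1 t2] /andP[r1 r2]; rewrite AB; last by split => //=; exact: le_lt_trans t1.
  by apply: HK; apply/andP.
have := green Ha gA gAt gB gBr gK dA dB ad ML HK'; apply: le_trans.
rewrite lerD2l.
have -> : \int[lam]_(t in `]a, d[) B t L = 0.
  rewrite /Rintegral integral0_eq// => t; rewrite /= in_itv /= => /andP[t1 _].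
  by rewrite /B /Z zeta0 ?mulr0 ?mul0r//; apply: HL => //; [rewrite (le_trans Ha)// ltW|exact: ltW].
rewrite sub0r.
have gB2 := good_int_t d Ha (lexx (2 * M)) gB.
have -> : - (\int[lam]_(t in `]a, d[) B t (2 * M)) = \int[lam]_(t in `]a, d[) (-1 * B t (2 * M)).
  by rewrite RintegralZl ?mulN1r//; exact: measurable_itv.
have -> // : \int[lam]_(t in `]a, d[) (E t * Z t (2 * M) * w (2 * M) * p t (2 * M)) =
  \int[lam]_(t in `]a, d[) (-1 * B t (2 * M)).
apply: eq_Rintegral => t _; rewrite /B (_ : Delta M (2 * M) = 0); last by rewrite /Delta; ring.
by rewrite mul0r sub0r mulN1r mulrN opprK.
Qed.

End Green.

End Estimates.

(** * The energy estimate without transversal derivatives *)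

Section Uniform.
Variables (R : realType) (M tau0 : R) (h : R -> R) (r_away r_far : R).
Hypothesis M0 : 0 < M.
Hypothesis fol : foliation M h r_away r_far tau0.
Let hsmooth := fol_smooth fol.
Implicit Types F G P Q : spin_scalar R.
Notation RR := (measurableTypeR R).
Notation lam := (@lebesgue_measure R).
Notation lam2 := (lam \x lam)%E.
Notation Nice := (Nice M tau0).
Notation oY := (op_Y M h).
Notation good := (good M tau0).
Notation hp := (h^`()%classic : R -> R).
Notation mf := (mfun M h).
Notation Oset := (Oset M tau0).
Notation DP := (DP M tau0 h).
Notation Nrm := (Nrm M).

Lemma NiceYn n F : Nice F -> Nice (iter n oY F).
Proof. by move=> NF; apply: Nice_iter => // G; exact: NiceY. Qed.

Lemma Nrm_ge0 G t : (0 <= Nrm G t)%E.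
Proof. by apply: integral_ge0 => r _; rewrite lee_fin ip_ge0. Qed.

Lemma Nrm_D_ge0 G t (D : R) : (Nrm G t <= D%:E)%E -> 0 <= D.
Proof. by move=> H; rewrite -lee_fin (le_trans (Nrm_ge0 G t)). Qed.

Lemma eqO_Nrm F G t : tau0 < t -> eqOn Oset F G -> Nrm F t = Nrm G t.
Proof.
move=> Ht [_ E]; apply: eq_integral => r /set_mem; rewrite /= in_itv /= andbT => Hr.
by congr EFin; apply: eq_ip => th ph Hth; exact: E.
Qed.

Lemma eqN_Nrm F G t : tau0 <= t -> eqN M tau0 F G -> Nrm F t = Nrm G t.
Proof.
move=> Ht E; apply: eq_integral => r /set_mem; rewrite /= in_itv /= andbT => Hr.
by congr EFin; apply: eqN_ip E; split => //=; exact: ltW.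
Qed.

Let mI (L : R) : measurable (`]2 * M, L[%classic : set RR). Proof. exact: measurable_itv. Qed.

Let ghp : good (fun _ r => hp r).
Proof. by apply: good_rho => r Hr; exact: (fol_hp_continuous fol). Qed.
Let cr2 (r : R) : {for r, continuous (fun r : R => 2 * r ^+ 2)}.
Proof. by apply: cvgMr; exact: exprn_continuous. Qed.
Let cmf (r : R) : 2 * M <= r -> {for r, continuous mf}.
Proof.
move=> Hr; have D : {for r, continuous (Delta M)} by exact: is_derive1_continuous (dcoefsP M 0 ord0 r).
have c2 := @cr2 r.
have c3 := continuousM D (fol_hp_continuous fol Hr).
exact: (continuousB c2 c3).
Qed.
Let gmf : good (fun _ r => mf r). Proof. by apply: good_rho => r Hr; exact: cmf. Qed.

(** The case [b = 0], [k = 0], [w = 1], where the divergence consists of the cutoff term alone. All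
    three nonnegative quantities it controls are kept: the energy, the horizon flux, and the cutoff
    term, which later yields the flux of [Phi_-] through null infinity. *)
Lemma energy0 : exists2 C : R, 0 < C & forall e P Q a (D : R), DP e P Q -> tau0 <= a ->
  (Nrm P a <= D%:E)%E -> (Nrm Q a <= D%:E)%E ->
  [/\ forall t, a <= t -> (Nrm P t <= (C * D)%:E)%E /\ (Nrm Q t <= (C * D)%:E)%E,
      forall d c : R, a < d -> 0 < c ->
        \int[lam]_(t in `]a, d[) (zeta c (t + h (2 * M)) * ip P P t (2 * M)) <= C * D &
      forall d c L : R, a < d -> 0 < c -> 2 * M < L ->
        (forall t r, tau0 <= t -> a <= t -> L <= r -> c <= t + h r) ->
        fine (\int[lam2]_(z in `]a, d[ `*` `](2 * M)%R, L[)
          (- dzeta c (z.1 + h z.2) * (2 * z.2 ^+ 2 * ip Q Q z.1 z.2))%:E)%E <= C * D].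
Proof.
have [c1 [C1 [c10 C10 HC]]] := fol_bounds M0 fol.
(* The initial density is at most [(C1 + C1) D]; dividing by [c1] returns from the weighted density
   to [P] and [Q]. The last [1] ensures [C >= 1], for [t = a]. *)
pose C := (C1 + C1) * (1 + c1^-1) + 1.
have C0 : 0 < C by rewrite ltr_wpDl// mulr_ge0// addr_ge0// ?invr_ge0 ltW.
exists C => // e P Q a D dp Ha HP HQ.
have D0 := Nrm_D_ge0 HP.
have [NP NQ _ _ _ _] := dp.
have gP := good_ip NP NP; have gQ := good_ip NQ NQ.
have big (x : R) : 0 <= x -> x <= (C1 + C1) * D -> x <= C * D.
  move=> x0 xD; rewrite (le_trans xD)// ler_wpM2r// /C mulrDr mulr1 -addrA lerDl addr_ge0//.
  by rewrite mulr_ge0 ?invr_ge0 ?addr_ge0// ltW.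
have bigc (x : R) : c1 * x <= (C1 + C1) * D -> x <= C * D.
  move=> xD; have xD' : x <= c1^-1 * ((C1 + C1) * D) by rewrite -ler_pdivrMl ?invr_gt0// invrK.
  rewrite (le_trans xD')//.
  have -> : C * D = c1^-1 * ((C1 + C1) * D) + ((C1 + C1) * D + D) by rewrite /C; ring.
  by rewrite lerDl addr_ge0// mulr_ge0// addr_ge0// ltW.
have dw r : 2 * M <= r -> is_derive r (1 : R) (fun _ : R => 1 : R) 0 by move=> _; exact: is_derive_cst.
have cw' r : 2 * M <= r -> {for r, continuous (fun _ : R => 0 : R)} by move=> _; exact: cst_continuous.
have main (d c L : R) : a < d -> 0 < c -> 2 * M < L ->
   (forall t r, tau0 <= t -> a <= t -> L <= r -> c <= t + h r) ->
   \int[lam]_(r in `]2 * M, L[) (zeta c (d + h r) * (hp r * ip P P d r + mf r * ip Q Q d r))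
   + \int[lam]_(t in `]a, d[) (zeta c (t + h (2 * M)) * ip P P t (2 * M))
   + fine (\int[lam2]_(z in `]a, d[ `*` `](2 * M)%R, L[)
          (- dzeta c (z.1 + h z.2) * (2 * z.2 ^+ 2 * ip Q Q z.1 z.2))%:E)%E <= (C1 + C1) * D.
  move=> ad c0 ML HL.
  pose K t r := dzeta c (t + h r) * (2 * r ^+ 2 * ip Q Q t r).
  have gr2 : good (fun _ r => 2 * r ^+ 2).
    by apply: good_rho => r _; exact: cr2.
  have gK : good K by apply: goodM; [exact: (good_dzeta fol)|apply: goodM].
  have HK t r : a < t < d -> 2 * M < r < L ->
     energy_rhs M h P Q 0 0 c (fun=> 1) (fun=> 0) t r <= K t r.
    move=> _ _; rewrite /energy_rhs /K /forcing mul0r expR0 expr0n /= .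
    rewrite le_eqVlt; apply/orP; left; apply/eqP.
    by move: (ip _ _ _ _) (ip _ _ _ _) (dzeta _ _) (zeta _ _) => *; ring.
  have G := energy_green fol dp c0 dw cw' Ha ad ML HL gK HK.
  have -> : fine (\int[lam2]_(z in `]a, d[ `*` `](2 * M)%R, L[)
          (- dzeta c (z.1 + h z.2) * (2 * z.2 ^+ 2 * ip Q Q z.1 z.2))%:E)%E =
     - fine (\int[lam2]_(z in `]a, d[ `*` `](2 * M)%R, L[) (K z.1 z.2)%:E)%E.
    have iK := good_int2 d L Ha gK.
    have -> : - fine (\int[lam2]_(z in `]a, d[ `*` `](2 * M)%R, L[) (K z.1 z.2)%:E)%E =
      \int[lam2]_(z in `]a, d[ `*` `]2 * M, L[) (-1 * K z.1 z.2).
      by rewrite RintegralZl ?mulN1r//; apply: measurableX; exact: measurable_itv.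
    by rewrite /Rintegral; congr fine; apply: eq_integral => z _; rewrite /K mulN1r mulNr.
  rewrite -lerBrDr opprK.
  have E1 s : \int[lam]_(r in `]2 * M, L[) (expR (0 * s) * zeta c (s + h r) * 1 *
      (hp r * ip (iter 0 oY P) (iter 0 oY P) s r + mf r * ip (iter 0 oY Q) (iter 0 oY Q) s r)) =
     \int[lam]_(r in `]2 * M, L[) (zeta c (s + h r) * (hp r * ip P P s r + mf r * ip Q Q s r)).
    by apply: eq_Rintegral => r _; rewrite mul0r expR0 mul1r mulr1.
  have E2 : \int[lam]_(t in `]a, d[) (expR (0 * t) * zeta c (t + h (2 * M)) * 1 * ip (iter 0 oY P) (iter 0 oY P) t (2 * M)) =
     \int[lam]_(t in `]a, d[) (zeta c (t + h (2 * M)) * ip P P t (2 * M)).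
    by apply: eq_Rintegral => r _; rewrite mul0r expR0 mul1r mulr1.
  rewrite !E1 E2 in G; apply: (le_trans G); rewrite lerD2r.
  have gz := good_zeta fol c0.
  have iz1 := good_int_r L Ha (goodM gz (goodM ghp gP)).
  have iz2 := good_int_r L Ha (goodM gz (goodM gmf gQ)).
  have -> : \int[lam]_(r in `]2 * M, L[) (zeta c (a + h r) * (hp r * ip P P a r + mf r * ip Q Q a r)) =
     \int[lam]_(r in `]2 * M, L[) (zeta c (a + h r) * (hp r * ip P P a r)) +
     \int[lam]_(r in `]2 * M, L[) (zeta c (a + h r) * (mf r * ip Q Q a r)).
    by rewrite -RintegralD//; apply: eq_Rintegral => r _; rewrite mulrDr.
  have zr (g : R -> R) : (forall r, 2 * M <= r -> {for r, continuous g}) -> (forall r, 2 * M <= r -> c1 <= g r <= C1) ->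
      forall G, Nice G -> (Nrm G a <= D%:E)%E -> \int[lam]_(r in `]2 * M, L[) (zeta c (a + h r) * (g r * ip G G a r)) <= C1 * D.
    move=> cg Hg G' NG HG.
    have -> : \int[lam]_(r in `]2 * M, L[) (zeta c (a + h r) * (g r * ip G' G' a r)) =
      \int[lam]_(r in `]2 * M, L[) (zeta c (a + h r) * g r * ip G' G' a r).
      by apply: eq_Rintegral => r _; rewrite mulrA.
    apply: (Nrm_ub Ha NG (ltW C10)) => //.
      move=> r Hr; apply: (@continuousM _ _ (fun r => zeta c (a + h r)) g); last exact: cg.
      by have [_ + _] := gz; apply; split.
    move=> r /andP[r1 _]; have /andP[h1 h2] := Hg r (ltW r1).
    rewrite -[leRHS]mul1r ler_pM ?zeta_ge0//; first by rewrite (le_trans (ltW c10)).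
    by rewrite zeta_le1// ltW// (fol_v_gt0 M0 fol)// ltW.
  rewrite [(C1 + C1) * D]mulrDl; apply: lerD; apply: zr => //.
  - by move=> r Hr; exact: (fol_hp_continuous fol).
  - by move=> r Hr; have [-> -> _ _] := HC r Hr.
  - by move=> r Hr; have [_ _ -> ->] := HC r Hr.
have pos1 (d c L : R) : a < d -> 0 < c ->
    0 <= \int[lam]_(r in `]2 * M, L[) (zeta c (d + h r) * (hp r * ip P P d r + mf r * ip Q Q d r)).
  move=> ad c0; apply: Rintegral_ge0 => r; rewrite /= in_itv /= => /andP[/ltW r1 _].
  have [h1 _ h3 _] := HC r r1; have c1' := ltW c10.
  by rewrite mulr_ge0 ?zeta_ge0// addr_ge0// mulr_ge0 ?ip_ge0// (le_trans c1').
have pos2 (d c : R) : 0 <= \int[lam]_(t in `]a, d[) (zeta c (t + h (2 * M)) * ip P P t (2 * M)).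
  by apply: Rintegral_ge0 => t _; rewrite mulr_ge0 ?zeta_ge0 ?ip_ge0.
have pos3 (d c L : R) : 0 <= fine (\int[lam2]_(z in `]a, d[ `*` `](2 * M)%R, L[)
          (- dzeta c (z.1 + h z.2) * (2 * z.2 ^+ 2 * ip Q Q z.1 z.2))%:E)%E.
  apply: fine_ge0; apply: integral_ge0 => z _; rewrite lee_fin mulr_ge0 ?oppr_ge0 ?dzeta_le0//.
  by rewrite mulr_ge0 ?ip_ge0// mulr_ge0// sqr_ge0.
split.
- move=> t; rewrite le_eqVlt => /orP[/eqP <-|at_].
    have C1' : 1 <= C by rewrite /C lerDr mulr_ge0// addr_ge0// ?invr_ge0 ltW.
    by split; [apply: (le_trans HP)|apply: (le_trans HQ)]; rewrite lee_fin ler_peMl.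
  have Ht : tau0 <= t by rewrite (le_trans Ha)// ltW.
  have gz c (c0 : 0 < c) := good_zeta fol c0.
  have low (c L : R) : 0 < c -> 2 * M < L -> (forall t r, tau0 <= t -> L <= r -> c <= t + h r) ->
      \int[lam]_(r in `]2 * M, L[) (zeta c (t + h r) * (hp r * ip P P t r + mf r * ip Q Q t r)) <= (C1 + C1) * D.
    move=> c0 ML HL; apply: le_trans (main t c L at_ c0 ML (fun t r Ht _ Hr => HL t r Ht Hr)).
    by rewrite -addrA lerDl addr_ge0.
  split; apply: (Nrm_lb M0 fol Ht) => // c L c0 ML HL; apply: bigc; apply: le_trans (low c L c0 ML HL);
    rewrite -RintegralZl; do ?exact: mI; do ?exact: (good_int_r L Ht (goodM (gz c c0) _)).
  + apply: le_Rintegral; first exact: mI.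
    * exact: (good_int_r L Ht (goodM (good_cst _ _ c1) (goodM (gz c c0) gP))).
    * exact: (good_int_r L Ht (goodM (gz c c0) (goodD (goodM ghp gP) (goodM gmf gQ)))).
    move=> r; rewrite /= in_itv /= => /andP[/ltW r1 _]; have [h1 _ h3 _] := HC r r1.
    rewrite mulrCA ler_wpM2l ?zeta_ge0// -[leLHS]addr0 lerD ?ler_wpM2r ?ip_ge0//.
    by rewrite mulr_ge0 ?ip_ge0// (le_trans (ltW c10)).
  + apply: le_Rintegral; first exact: mI.
    * exact: (good_int_r L Ht (goodM (good_cst _ _ c1) (goodM (gz c c0) gQ))).
    * exact: (good_int_r L Ht (goodM (gz c c0) (goodD (goodM ghp gP) (goodM gmf gQ)))).
    move=> r; rewrite /= in_itv /= => /andP[/ltW r1 _]; have [h1 _ h3 _] := HC r r1.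
    rewrite mulrCA ler_wpM2l ?zeta_ge0// -[leLHS]add0r lerD ?ler_wpM2r ?ip_ge0//.
    by rewrite mulr_ge0 ?ip_ge0// (le_trans (ltW c10)).
- move=> d c ad c0; have [L ML HL] := fol_v_unbounded M0 fol c.
  have := main d c L ad c0 ML (fun t r Ht _ Hr => HL t r Ht Hr) => H.
  apply: big => //; apply: le_trans H; rewrite addrAC lerDr addr_ge0//.
  exact: pos1.
- move=> d c L ad c0 ML HL; have H := main d c L ad c0 ML HL.
  apply: big => //; apply: le_trans H; rewrite lerDr addr_ge0//.
  exact: pos1.
Qed.

End Uniform.

(** * Transversal derivatives: the red-shift estimate *)

Section Commutation.
Variables (R : realType) (M tau0 : R) (h : R -> R) (r_away r_far : R).
Hypothesis M0 : 0 < M.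
Hypothesis fol : foliation M h r_away r_far tau0.
Let hsmooth := fol_smooth fol.
Implicit Types F G P Q : spin_scalar R.
Notation RR := (measurableTypeR R).
Notation lam := (@lebesgue_measure R).
Notation lam2 := (lam \x lam)%E.
Notation reg := (reg M tau0).
Notation Nice := (Nice M tau0).
Notation oY := (op_Y M h).
Notation good := (good M tau0).
Notation hp := (h^`()%classic : R -> R).
Notation mf := (mfun M h).
Notation Oset := (Oset M tau0).
Notation DP := (DP M tau0 h).
Notation Nrm := (Nrm M).
Notation fields := (fields M h).

(** The words of [Hwords] as a relation, with letters added on the outside and a boolean for the two
    angular letters; it allows induction on a single word. *)
Inductive hword : nat -> spin_scalar R -> spin_scalar R -> Prop :=
| hword0 F : hword 0 F F
| hword_tau n F G : hword n F G -> hword n.+1 F (op_tau G)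
| hword_Y n F G : hword n F G -> hword n.+1 F (oY G)
| hword_ang n F G e : hword n F G -> hword n.+1 F (op_ang e G).

Lemma hword_tau_in n F G : hword n (op_tau F) G -> hword n.+1 F G.
Proof.
move E : (op_tau F) => H HG; elim: HG E => {n H G}.
- by move=> F' <-; apply: hword_tau; exact: hword0.
- by move=> n F' G HG IH E; apply: hword_tau; exact: IH.
- by move=> n F' G HG IH E; apply: hword_Y; exact: IH.
- by move=> n F' G e HG IH E; apply: hword_ang; exact: IH.
Qed.
Lemma hword_ang_in n e F G : hword n (op_ang e F) G -> hword n.+1 F G.
Proof.
move E : (op_ang e F) => H HG; elim: HG E => {n H G}.
- by move=> F' <-; apply: hword_ang; exact: hword0.
- by move=> n F' G HG IH E; apply: hword_tau; exact: IH.
- by move=> n F' G HG IH E; apply: hword_Y; exact: IH.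
- by move=> n F' G e' HG IH E; apply: hword_ang; exact: IH.
Qed.
Lemma hword_iterY n F : hword n F (iter n oY F).
Proof. by elim: n => [|n IH]; [exact: hword0|apply: hword_Y]. Qed.

(** One bound for each word separately rather than for their sum; passing to the sum costs only the
    number of words. *)
Definition wle n F t (D : R) := forall i G, (i <= n)%N -> hword i F G -> (Nrm G t <= D%:E)%E.

Lemma wle_tau n F t D : wle n.+1 F t D -> wle n (op_tau F) t D.
Proof. by move=> H i G Hi /hword_tau_in; apply: H. Qed.
Lemma wle_ang n e F t D : wle n.+1 F t D -> wle n (op_ang e F) t D.
Proof. by move=> H i G Hi /hword_ang_in; apply: H. Qed.
Lemma wle_le n m F t D : (m <= n)%N -> wle n F t D -> wle m F t D.
Proof. by move=> mn H i G Hi; apply: H; exact: leq_trans mn. Qed.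
Lemma wle_ge0 n F t D : wle n F t D -> 0 <= D.
Proof. by move=> H; have := H 0%N F (leq0n n) (hword0 F); exact: Nrm_D_ge0. Qed.

(** Tuned so that the second field enters with coefficient [1/4] however large [a] is; three such
    terms will be absorbed by the red-shift. *)
Lemma young_le F G t r (a : R) : 0 <= a -> Nice F -> Nice G -> reg (t, r) ->
  a * `|2 * ip F G t r| <= 4 * a ^+ 2 * ip F F t r + ip G G t r / 4.
Proof.
move=> a0 NF NG rtr; have [->|a1] := eqVneq a 0.
  by rewrite mul0r expr0n mulr0 mul0r add0r divr_ge0// ip_ge0.
have {a1}a0' : 0 < a by rewrite lt_neqAle eq_sym a1.
have c0 : 0 < 4 * a by rewrite mulr_gt0.
have := ip_young rtr c0 NF NG; rewrite -(ler_pM2l a0'); move=> /le_trans; apply.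
rewrite le_eqVlt; apply/orP; left; apply/eqP.
by field; rewrite gt_eqF.
Qed.

Let six (a b c d e f : R) : 0 <= a -> 0 <= b -> 0 <= c -> 0 <= d -> 0 <= e -> 0 <= f ->
  let S := a + (b + (c + (d + (e + f)))) in
  [/\ a <= S, b <= S, c <= S & [/\ d <= S, e <= S & f <= S]].
Proof. by move=> h1 h2 h3 h4 h5 h6 S; rewrite /S; split; [lra|lra|lra|split; lra]. Qed.

Let seven (p a b c d e f : R) : 0 <= a -> 0 <= b -> 0 <= c -> 0 <= d -> 0 <= e -> 0 <= f ->
  p + (a + (b + c)) <= p + (b + (a + (d + (e + (c + f))))).
Proof. by move=> *; lra. Qed.

Let ratio (r : R) : 2 * M < r -> 0 < r -> 2 <= 4 * (r - M) / r.
Proof. by move=> h1 h2; rewrite ler_pdivlMr//; lra. Qed.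

Let collect (A B C D p q k1 k2 k3 k4 N1 N2 N3 : R) :
  A <= k1 * N1 + k2 * N2 + k3 * N3 + 3 * q / 4 -> B <= p / 2 + q / 2 -> C <= k4 * p -> 2 * q <= D ->
  0 <= p -> 0 <= q -> 0 <= N1 -> 0 <= N2 -> 0 <= N3 -> 0 <= k1 -> 0 <= k2 -> 0 <= k3 -> 0 <= k4 ->
  B + C + A - D <= (2^-1 + k4 + k1 + k2 + k3) * (p + (N1 + (N2 + N3))).
Proof.
move=> H1 H2 H3 H4 p0 q0 n1 n2 n3 s1 s2 s3 s4.
have e1 : k1 * N1 <= (2^-1 + k4 + k1 + k2 + k3) * N1 by rewrite ler_wpM2r//; lra.
have e2 : k2 * N2 <= (2^-1 + k4 + k1 + k2 + k3) * N2 by rewrite ler_wpM2r//; lra.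
have e3 : k3 * N3 <= (2^-1 + k4 + k1 + k2 + k3) * N3 by rewrite ler_wpM2r//; lra.
have e4 : (2^-1 + k4) * p <= (2^-1 + k4 + k1 + k2 + k3) * p by rewrite ler_wpM2r//; lra.
rewrite !mulrDr; lra.
Qed.

Section Step.
Variables (e : bool) (P Q : spin_scalar R) (b : nat).
Hypothesis dp : DP e P Q.
Let NP : Nice P := DP_P dp.
Let NQ : Nice Q := DP_Q dp.
Let NYP : Nice (iter b.+1 oY P) := NiceYn fol b.+1 NP.
Let NYQ : Nice (iter b.+1 oY Q) := NiceYn fol b.+1 NQ.

(* Size of the coefficients of DP_rel relative to r^2. *)
Definition coef_bound : R := 2 + (2 * b + 1)%:R / (2 * M) + (4 * M ^+ 2)^-1 +
  b%:R ^+ 2 / (4 * M ^+ 2) + 4 * b%:R / (2 * M) + 2 * b%:R * (b%:R + 1) / (4 * M ^+ 2).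

Lemma coef_bound_gt0 : 0 < coef_bound.
Proof.
have m0 := ltW M0; rewrite /coef_bound -!addrA ltr_pwDl//.
by rewrite !addr_ge0// ?divr_ge0 ?invr_ge0 ?mulr_ge0 ?sqr_ge0 ?addr_ge0 ?ler0n.
Qed.

Lemma coef_boundP (j : 'I_7) (r : R) : j != ord0 -> 2 * M <= r -> `|coefs M b j r| <= coef_bound * r ^+ 2.
Proof.
move=> j0 Hr; have m0 := ltW M0.
have r0 : 0 < r by apply: lt_le_trans Hr; rewrite mulr_gt0.
have r2 : 0 < r ^+ 2 by rewrite exprn_gt0.
have u1 : r <= r ^+ 2 / (2 * M) by rewrite ler_pdivlMr ?mulr_gt0// expr2 ler_wpM2l// ltW.
have u2 : 1 <= r ^+ 2 / (4 * M ^+ 2).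
  rewrite ler_pdivlMr ?mulr_gt0 ?exprn_gt0// mul1r (_ : 4 * M ^+ 2 = (2 * M) ^+ 2); last by ring.
  by rewrite ler_pXn2r ?nnegrE ?mulr_ge0 ?(ltW r0).
have n0 : 0 <= b%:R :> R by [].
pose t1 : R := 2 * r ^+ 2.
pose t2 : R := (2 * b + 1)%:R * (r ^+ 2 / (2 * M)).
pose t3 : R := r ^+ 2 / (4 * M ^+ 2).
pose t4 : R := b%:R ^+ 2 * (r ^+ 2 / (4 * M ^+ 2)).
pose t5 : R := 4 * b%:R * (r ^+ 2 / (2 * M)).
pose t6 : R := 2 * b%:R * (b%:R + 1) * (r ^+ 2 / (4 * M ^+ 2)).
have E : coef_bound * r ^+ 2 = t1 + (t2 + (t3 + (t4 + (t5 + t6)))).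
  by rewrite /coef_bound /t1 /t2 /t3 /t4 /t5 /t6; move: (2 * b + 1)%:R (b%:R : R) => *; field; rewrite gt_eqF.
have v1 : 0 <= r ^+ 2 / (2 * M) by rewrite (le_trans _ u1)// ltW.
have v2 : 0 <= r ^+ 2 / (4 * M ^+ 2) by rewrite (le_trans _ u2).
have p1 : 0 <= t1 by rewrite /t1 mulr_ge0// ltW.
have p2 : 0 <= t2 by rewrite /t2 mulr_ge0.
have p3 : 0 <= t3 by [].
have p4 : 0 <= t4 by rewrite /t4 mulr_ge0// sqr_ge0.
have p5 : 0 <= t5 by rewrite /t5 mulr_ge0// mulr_ge0.
have p6 : 0 <= t6 by rewrite /t6 mulr_ge0// mulr_ge0 ?mulr_ge0 ?addr_ge0.
rewrite E.
have [q1 q2 q3 [q4 q5 q6]] := six p1 p2 p3 p4 p5 p6.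
have fin (x y : R) : `|x| <= y -> y <= t1 + (t2 + (t3 + (t4 + (t5 + t6)))) -> `|x| <= t1 + (t2 + (t3 + (t4 + (t5 + t6)))).
  exact: le_trans.
case: j j0 => -[|[|[|[|[|[|[|//]]]]]]] Hj //= _; rewrite /coefs /=.
- apply: (fin _ t1); last by [].
  by rewrite normrN ger0_norm// mulr_ge0// ltW.
- apply: (fin _ t2); last by [].
  rewrite normrN normrM ger0_norm ?ler0n// /t2 ler_wpM2l ?ler0n// ger0_norm.
    by apply: le_trans u1; rewrite gerBl.
  by rewrite subr_ge0; lra.
- apply: (fin _ t3); last by [].
  by rewrite normr1.
- apply: (fin _ t4); last by [].
  by rewrite ger0_norm ?sqr_ge0// /t4 ler_peMr// sqr_ge0.
- apply: (fin _ t5); last by [].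
  rewrite ger0_norm; last by rewrite !mulr_ge0 ?(ltW r0).
  by rewrite /t5 ler_wpM2l// mulr_ge0.
- apply: (fin _ t6); last by [].
  rewrite normrN normrM ger0_norm ?mulr_ge0// /t6 -[leRHS]mulrA ler_wpM2l ?mulr_ge0//.
  apply: (@le_trans _ _ (b%:R + 1)); last by rewrite ler_peMr ?addr_ge0.
  by rewrite ler_norml; apply/andP; split; lra.
Qed.

Definition lower t r : R := \sum_(j < 7 | j != ord0) ip (fields e P Q b j) (fields e P Q b j) t r.

(* Away from the horizon the equation itself bounds the transversal derivative. *)
Lemma recover t r : Oset (t, r) ->
  ip (iter b.+1 oY Q) (iter b.+1 oY Q) t r <=
  4 * M * (r^-1 * ip (iter b.+1 oY Q) (iter b.+1 oY Q) t r) + 24 * coef_bound ^+ 2 * lower t r.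
Proof.
move=> Otr; have rtr := Oset_reg Otr; have [_ Hr] := Otr; rewrite /= in Hr.
set H := iter b.+1 oY Q; set q := ip H H t r.
have q0 : 0 <= q by exact: ip_ge0.
have r0 : 0 < r by apply: lt_trans Hr; rewrite mulr_gt0.
have l0 : 0 <= lower t r by apply: sumr_ge0 => j _; exact: ip_ge0.
have B0 := coef_bound_gt0; set B := coef_bound in B0 *.
(* Below [4 M] the weight [1 / r] is not degenerate and the first term suffices; above it
   [Delta >= r^2 / 2], so the equation can be solved for the transversal derivative. *)
have [rM|rM] := leP r (4 * M).
  rewrite -[leLHS]addr0 lerD//; last by rewrite mulr_ge0// mulr_ge0// sqr_ge0.
  by rewrite mulrA ler_peMl// ler_pdivlMr// mul1r.
have E := rel_ip (fields_Nice hsmooth dp b) NYQ (DP_rel hsmooth dp b) Otr.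
rewrite (bigD1 ord0)//= [fields _ _ _ _ _]/= -/H in E.
have E2 : Delta M r * q <= r ^+ 2 * (B * \sum_(j < 7 | j != ord0) `|ip (fields e P Q b j) H t r|).
  have -> : Delta M r * q = - \sum_(j < 7 | j != ord0) coefs M b j r * ip (fields e P Q b j) H t r.
    by apply/eqP; rewrite -addr_eq0; apply/eqP.
  apply: (le_trans (ler_norm _)); rewrite normrN; apply: (le_trans (ler_norm_sum _ _ _)).
  rewrite !mulr_sumr; apply: ler_sum => j j0; rewrite normrM mulrA ler_wpM2r// mulrC.
  by apply: coef_boundP => //; exact: ltW.
have E3 : r ^+ 2 * (2^-1 * q) <= Delta M r * q.
  rewrite mulrA ler_wpM2r// /Delta expr2.
  by rewrite -subr_ge0 (_ : _ - _ = r * (r - 4 * M) / 2); [rewrite divr_ge0// mulr_ge0//; [exact: ltW|rewrite subr_ge0; exact: ltW]|field].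
have {E2 E3} := le_trans E3 E2; rewrite ler_pM2l ?exprn_gt0// => E4.
have E5 : B * \sum_(j < 7 | j != ord0) `|ip (fields e P Q b j) H t r| <= 6 * B ^+ 2 * lower t r + q / 4.
  (* With this parameter each of the six terms leaves [q / 24], in all [q / 4], which is absorbed by
     the [q / 2] on the left; multiplying by [4] gives the factor [24]. *)
  have c0 : 0 < 12 * B by rewrite mulr_gt0.
  have tj (j : 'I_7) : B * `|ip (fields e P Q b j) H t r| <= 6 * B ^+ 2 * ip (fields e P Q b j) (fields e P Q b j) t r + q / 24.
    have Y := ip_young rtr c0 (fields_Nice hsmooth dp b j) NYQ.
    rewrite normrM (ger0_norm (ler0n _ 2)) -/H -/q in Y.
    have {Y} := ler_wpM2l (_ : 0 <= B / 2) Y; rewrite divr_ge0 ?(ltW B0)// => /(_ isT).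
    have -> : B / 2 * (2 * `|ip (fields e P Q b j) H t r|) = B * `|ip (fields e P Q b j) H t r| by field.
    move=> /le_trans; apply; rewrite le_eqVlt; apply/orP; left; apply/eqP.
    by field; rewrite gt_eqF.
  rewrite mulr_sumr; apply: (@le_trans _ _ (\sum_(j < 7 | j != ord0) (6 * B ^+ 2 * ip (fields e P Q b j) (fields e P Q b j) t r + q / 24))).
    by apply: ler_sum => j _; exact: tj.
  rewrite big_split /= -mulr_sumr lerD2l sumr_const.
  rewrite (_ : #|_| = 6); last by rewrite (cardC1 (ord0 : 'I_7)) card_ord.
  by rewrite -mulr_natr le_eqVlt; apply/orP; left; apply/eqP; field.
have : q <= 24 * B ^+ 2 * lower t r.
  by have := le_trans E4 E5; lra.
move=> /le_trans; apply; rewrite lerDr mulr_ge0 ?mulr_ge0 ?invr_ge0 ?(ltW M0) ?(ltW r0)//.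
Qed.

Let good_sum n (f : 'I_n -> R -> R -> R) : (forall j, good (f j)) -> good (fun t r => \sum_j f j t r).
Proof.
elim: n f => [|n IH] f gf.
  rewrite (_ : (fun t r => _) = (fun _ _ => 0)); first exact: good_cst.
  by apply/funext => t; apply/funext => r; rewrite big_ord0.
rewrite (_ : (fun t r => _) = (fun t r => f ord0 t r + \sum_j f (lift ord0 j) t r)).
  by apply: goodD => //; exact: IH.
by apply/funext => t; apply/funext => r; rewrite big_ord_recl.
Qed.

Let Rintegral_good_sum n (f : 'I_n -> R -> R -> R) (t L : R) : tau0 <= t -> (forall j, good (f j)) ->
  \int[lam]_(r in `]2 * M, L[) (\sum_j f j t r) = \sum_j \int[lam]_(r in `]2 * M, L[) f j t r.
Proof.
move=> Ht; elim: n f => [|n IH] f gf.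
  rewrite big_ord0 /Rintegral integral0_eq// => r _; by rewrite big_ord0.
rewrite big_ord_recl -(IH (fun j => f (lift ord0 j)))// -RintegralD//.
- by apply: eq_Rintegral => r _; rewrite big_ord_recl.
- exact: (good_int_r L Ht (gf ord0)).
- exact: (good_int_r L Ht (good_sum (fun j => gf (lift ord0 j)))).
Qed.

(** The entry [Y^(b+1) Q] of [fields], the unknown of the estimate, is replaced by [Y^(b+1) P],
    which the first equation expresses through an angular derivative of [Y^b Q]. All seven entries
    are then controlled by the induction hypothesis. *)
Definition allf (j : nat) := if j is 0%N then iter b.+1 oY P else fields e P Q b j.
Let Nallf (j : 'I_7) : Nice (allf j).
Proof. by case: j => -[|j] Hj; [exact: NYP|exact: (fields_Nice hsmooth dp b (Ordinal Hj))]. Qed.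

Definition Sall t r := \sum_(j < 7) ip (allf j) (allf j) t r.
Let S := Sall.
Let gS : good S. Proof. by apply: good_sum => j; exact: good_ip. Qed.

Let n : R := b.+1%:R.
Let n1 : 1 <= n. Proof. by rewrite /n ler1n. Qed.
Let a1 := n ^+ 2 / (2 * M).
Let a2 := 4 * n.
Let a3 := n * (n - 1) / M.
(** Term by term: [1/2] from the exponential acting on [P], [1 / (4 M^2)] from the derivative of
    [1 / r], and [4 a_i^2] from Young's inequality; [a1], [a2], [a3] bound the commutator
    coefficients divided by [r]. *)
Definition rhs_bound := 2^-1 + (4 * M ^+ 2)^-1 + 4 * a1 ^+ 2 + 4 * a2 ^+ 2 + 4 * a3 ^+ 2.
Let Kc := rhs_bound.

Lemma rhs_bound_ge0 : 0 <= Kc.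
Proof.
have m0 := ltW M0.
have sq (x : R) : 0 <= 4 * x ^+ 2 by rewrite mulr_ge0// sqr_ge0.
by rewrite /Kc /rhs_bound !addr_ge0 ?invr_ge0.
Qed.

(** The budget for [q = |Y^(b+1) Q|^2]: the rate [M / C1] is chosen so that the exponential costs at
    most [q / 2], and the three Young terms cost [3 q / 4]. The red-shift supplies
    [4 (b+1) (r - M) / r >= 2], so no [q] is left. The cutoff term is nonpositive and is dropped. *)
Lemma rhs_le (C1 c t r : R) : 0 < C1 -> (forall r, 2 * M <= r -> 0 <= hp r <= C1 /\ 0 <= mf r <= C1) ->
  Oset (t, r) ->
  energy_rhs M h P Q b.+1 (M / C1) c (fun r => r^-1) (fun r => - (r ^+ 2)^-1) t r
  <= expR (M / C1 * t) * (zeta c (t + h r) * (Kc * S t r)).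
Proof.
move=> C10 HC Otr; have rtr := Oset_reg Otr; have [_ Hr] := Otr; rewrite /= in Hr.
have r0 : 0 < r by apply: lt_trans Hr; rewrite mulr_gt0.
have [/andP[hp0 hpC] /andP[mf0 mfC]] := HC r (ltW Hr).
rewrite /energy_rhs ler_wpM2l ?expR_ge0//.
set P1 := iter b.+1 oY P; set Q1 := iter b.+1 oY Q.
have p0 := ip_ge0 P1 t r; have q0 := ip_ge0 Q1 t r.
move Ep : (ip P1 P1 t r) p0 => p p0; move Eq : (ip Q1 Q1 t r) q0 => q q0.
have z0 := zeta_ge0 c (t + h r); have dz0 := dzeta_le0 c (t + h r).
move: (zeta _ _) (dzeta _ _) z0 dz0 => z dz z0 dz0.
set F1 := iter b oY Q; set F2 := op_tau (iter b oY Q); set F3 := op_tau (iter b.-1 oY Q).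
have NF1 : Nice F1 by exact: (NiceYn fol _ NQ).
have NF2 : Nice F2 by apply: Nice_tau; exact: (NiceYn fol _ NQ).
have NF3 : Nice F3 by apply: Nice_tau; exact: (NiceYn fol _ NQ).
have n0 : 0 <= n by exact: le_trans n1.
have a10 : 0 <= a1 by rewrite /a1 divr_ge0 ?sqr_ge0// mulr_ge0// ltW.
have a20 : 0 <= a2 by rewrite /a2 mulr_ge0.
have a30 : 0 <= a3 by rewrite /a3 divr_ge0 ?mulr_ge0 ?subr_ge0// ltW.
have Y1 := young_le a10 NF1 NYQ rtr; have Y2 := young_le a20 NF2 NYQ rtr; have Y3 := young_le a30 NF3 NYQ rtr.
rewrite -/Q1 Eq in Y1 Y2 Y3.
have SS : p + (ip F1 F1 t r + (ip F2 F2 t r + ip F3 F3 t r)) <= S t r.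
  have g (G : spin_scalar R) : 0 <= ip G G t r by exact: ip_ge0.
  have -> : S t r = p + (ip F2 F2 t r + (ip F1 F1 t r + (ip (op_ang (~~ e) (iter b oY P)) (op_ang (~~ e) (iter b oY P)) t r
     + (ip (iter b.-1 oY Q) (iter b.-1 oY Q) t r + (ip F3 F3 t r + ip (op_tau (iter b.-2 oY Q)) (op_tau (iter b.-2 oY Q)) t r))))).
    rewrite -Ep; exact: (sum_I7 (fun j => ip (allf j) (allf j) t r)).
  exact: (seven p (g F1) (g F2) (g F3) (g (op_ang (~~ e) (iter b oY P))) (g (iter b.-1 oY Q)) (g (op_tau (iter b.-2 oY Q)))).
have HF : r^-1 * (2 * forcing M h Q b.+1 t r) <=
    4 * a1 ^+ 2 * ip F1 F1 t r + 4 * a2 ^+ 2 * ip F2 F2 t r + 4 * a3 ^+ 2 * ip F3 F3 t r + 3 * q / 4.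
  rewrite /forcing -/Q1 -/n [iter b.+1.-1 oY Q]/= [iter b.+1.-2 oY Q]/= -/F1 -/F2 -/F3.
  have i1 : r^-1 <= (2 * M)^-1 by rewrite lef_pV2 ?posrE ?mulr_gt0// ltW.
  have t1 : r^-1 * n ^+ 2 * (2 * ip F1 Q1 t r) <= a1 * `|2 * ip F1 Q1 t r|.
    apply: (@le_trans _ _ (r^-1 * n ^+ 2 * `|2 * ip F1 Q1 t r|)).
      by rewrite ler_wpM2l ?ler_norm// mulr_ge0 ?sqr_ge0// invr_ge0 ltW.
    by rewrite ler_wpM2r// /a1 mulrC ler_wpM2l// sqr_ge0.
  have t2 : a2 * (2 * ip F2 Q1 t r) <= a2 * `|2 * ip F2 Q1 t r|.
    by rewrite ler_wpM2l ?ler_norm.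
  have t3 : r^-1 * (2 * n * (n - 1)) * - (2 * ip F3 Q1 t r) <= a3 * `|2 * ip F3 Q1 t r|.
    have u0 : 0 <= 2 * n * (n - 1) by rewrite !mulr_ge0// subr_ge0.
    apply: (@le_trans _ _ (r^-1 * (2 * n * (n - 1)) * `|2 * ip F3 Q1 t r|)).
      rewrite ler_wpM2l//; first by rewrite mulr_ge0// invr_ge0 ltW.
      by rewrite -normrN ler_norm.
    rewrite ler_wpM2r//; have -> : a3 = (2 * M)^-1 * (2 * n * (n - 1)) by rewrite /a3; field; rewrite gt_eqF.
    by rewrite ler_wpM2r.
  have E : r^-1 * (2 * (n ^+ 2 * ip F1 Q1 t r + 4 * n * r * ip F2 Q1 t r - 2 * n * (n - 1) * ip F3 Q1 t r)) =
    r^-1 * n ^+ 2 * (2 * ip F1 Q1 t r) + a2 * (2 * ip F2 Q1 t r) + r^-1 * (2 * n * (n - 1)) * - (2 * ip F3 Q1 t r).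
    by rewrite /a2; move: (ip F1 Q1 t r) (ip F2 Q1 t r) (ip F3 Q1 t r) => x y w; move: (n) => m; field; rewrite gt_eqF.
  rewrite E; have := lerD (lerD t1 t2) t3; move=> /le_trans; apply.
  have := lerD (lerD Y1 Y2) Y3; move=> /le_trans; apply.
  move: (4 * a1 ^+ 2 * _) (4 * a2 ^+ 2 * _) (4 * a3 ^+ 2 * _) (q) => x y w m.
  by rewrite le_eqVlt; apply/orP; left; apply/eqP; field.
have i1 : r^-1 <= (2 * M)^-1 by rewrite lef_pV2 ?posrE ?mulr_gt0// ltW.
have i2 : (r ^+ 2)^-1 <= (4 * M ^+ 2)^-1.
  rewrite lef_pV2 ?posrE ?mulr_gt0 ?exprn_gt0// (_ : 4 * M ^+ 2 = (2 * M) ^+ 2); last by ring.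
  by rewrite ler_pXn2r ?nnegrE ?mulr_ge0 ?ltW.
have T1 : M / C1 * r^-1 * (hp r * p + mf r * q) <= p / 2 + q / 2.
  apply: (@le_trans _ _ (M / C1 * (2 * M)^-1 * (C1 * p + C1 * q))).
    rewrite ler_pM//.
    - by rewrite !mulr_ge0 ?invr_ge0 ?(ltW M0) ?(ltW C10) ?(ltW r0).
    - exact: (addr_ge0 (mulr_ge0 hp0 p0) (mulr_ge0 mf0 q0)).
    - by rewrite ler_wpM2l// divr_ge0 ?(ltW M0) ?(ltW C10).
    - by rewrite lerD// ler_wpM2r.
  by rewrite le_eqVlt; apply/orP; left; apply/eqP; field; rewrite !gt_eqF.
have T2 : - (r ^+ 2)^-1 * (Delta M r * q - p) <= (4 * M ^+ 2)^-1 * p.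
  have D0 : 0 <= Delta M r.
    rewrite (_ : Delta M r = r * (r - 2 * M)); last by rewrite /Delta; ring.
    by apply: mulr_ge0; [exact: ltW|rewrite subr_ge0; exact: ltW].
  have D1 : 0 <= (r ^+ 2)^-1 * (Delta M r * q).
    by apply: mulr_ge0; [rewrite invr_ge0; exact: sqr_ge0|exact: mulr_ge0].
  have D2 : (r ^+ 2)^-1 * p <= (4 * M ^+ 2)^-1 * p by exact: ler_wpM2r.
  have -> : - (r ^+ 2)^-1 * (Delta M r * q - p) = (r ^+ 2)^-1 * p - (r ^+ 2)^-1 * (Delta M r * q) by ring.
  by rewrite lerBlDr (le_trans D2)// lerDl.
have T3 : r^-1 * (4 * n * (r - M) * q) >= 2 * q.
  rewrite mulrA ler_wpM2r//.
  have -> : r^-1 * (4 * n * (r - M)) = n * (4 * (r - M) / r) by ring.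
  rewrite -[leLHS]mul1r ler_pM//.
  exact: ratio.
have T4 : dz * r^-1 * (2 * r ^+ 2 * q) <= 0.
  rewrite -mulrA mulr_le0_ge0// mulr_ge0 ?invr_ge0 ?(ltW r0)// !mulr_ge0// ltW//.
apply: (@le_trans _ _ (z * (Kc * (p + (ip F1 F1 t r + (ip F2 F2 t r + ip F3 F3 t r)))))); last first.
  by rewrite ler_wpM2l// ler_wpM2l// rhs_bound_ge0.
have -> : M / C1 * z * r^-1 * (hp r * p + mf r * q) + dz * r^-1 * (2 * r ^+ 2 * q) +
    z * - (r ^+ 2)^-1 * (Delta M r * q - p) +
    z * r^-1 * (2 * forcing M h Q b.+1 t r - 4 * b.+1%:R * (r - M) * q) =
    dz * r^-1 * (2 * r ^+ 2 * q) + z * (M / C1 * r^-1 * (hp r * p + mf r * q)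
      + (- (r ^+ 2)^-1 * (Delta M r * q - p)) + r^-1 * (2 * forcing M h Q b.+1 t r) - r^-1 * (4 * n * (r - M) * q)).
  by rewrite -/n; move: (r^-1) ((r^+2)^-1) (forcing _ _ _ _ _ _) => *; ring.
rewrite -[leRHS]add0r lerD// ler_wpM2l//.
have [N1 N2 N3] : [/\ 0 <= ip F1 F1 t r, 0 <= ip F2 F2 t r & 0 <= ip F3 F3 t r] by split; exact: ip_ge0.
have [s1 s2 s3] : [/\ 0 <= 4 * a1 ^+ 2, 0 <= 4 * a2 ^+ 2 & 0 <= 4 * a3 ^+ 2].
  by split; rewrite mulr_ge0// sqr_ge0.
have s4 : 0 <= (4 * M ^+ 2)^-1 by rewrite invr_ge0 mulr_ge0// sqr_ge0.
exact: (collect HF T1 T2 T3 p0 q0 N1 N2 N3 s1 s2 s3 s4).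
Qed.

Lemma good_Sall : good Sall. Proof. exact: gS. Qed.

Lemma lower_le t r : reg (t, r) -> lower t r <= Sall t r.
Proof.
move=> rtr; rewrite /Sall (bigD1 ord0)//= -[leLHS]add0r lerD ?ip_ge0// /lower.
apply: ler_sum => j j0; have {j0} : nat_of_ord j != 0%N by exact: j0.
move=> j0; have -> : allf j = fields e P Q b j; last exact: lexx.
by rewrite /allf; case: (nat_of_ord j) j0 => [H|m _]; [case/negP: H; exact: eqxx|].
Qed.

Lemma Sall_int (t c L X : R) : tau0 <= t -> 0 < c -> (forall j : 'I_7, (Nrm (allf j) t <= X%:E)%E) ->
  \int[lam]_(r in `]2 * M, L[) (zeta c (t + h r) * Sall t r) <= 7 * X.
Proof.
move=> Ht c0 HX; have gz := good_zeta fol c0.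
have -> : \int[lam]_(r in `]2 * M, L[) (zeta c (t + h r) * Sall t r) =
  \int[lam]_(r in `]2 * M, L[) (\sum_(j < 7) zeta c (t + h r) * ip (allf j) (allf j) t r).
  by apply: eq_Rintegral => r _; rewrite /Sall mulr_sumr.
rewrite (Rintegral_good_sum L (f := fun (j : 'I_7) t r => zeta c (t + h r) * ip (allf j) (allf j) t r) Ht); last first.
  by move=> j; apply: goodM => //; exact: good_ip.
apply: (@le_trans _ _ (\sum_(j < 7) X)); last by rewrite sumr_const card_ord mulr_natl.
apply: ler_sum => j _; rewrite -[leRHS]mul1r; apply: (Nrm_ub Ht (Nallf j) ler01) => //.
  by move=> r Hr; have [_ + _] := gz; apply; split.
by move=> r /andP[r1 _]; rewrite zeta_le1// ltW// (fol_v_gt0 M0 fol)// ltW.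
Qed.

End Step.

(** Integrating [e^(k t)] exactly, instead of bounding it by the length of the interval, is what
    makes the final constant independent of time. *)
Lemma bulk_le (K : R -> R -> R) (a d L k Y : R) : tau0 <= a -> a < d -> 0 < k -> good K ->
  (forall t r, a < t < d -> 2 * M < r < L -> 0 <= K t r) ->
  (forall t, a < t < d -> \int[lam]_(r in `]2 * M, L[) K t r <= expR (k * t) * Y) -> 0 <= Y ->
  fine (\int[lam2]_(z in `]a, d[ `*` `](2 * M)%R, L[) (K z.1 z.2)%:E)%E <= Y / k * (expR (k * d) - expR (k * a)).
Proof.
move=> Ha ad k0 gK K0 HK Y0.
have mT : measurable (`]a, d[%classic : set RR) by exact: measurable_itv.
have mI : measurable (`]2 * M, L[%classic : set RR) by exact: measurable_itv.
have iK := good_int2 d L Ha gK.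
have dE (t : R) : is_derive t (1 : R) (fun t => Y / k * expR (k * t)) (expR (k * t) * Y).
  have dk : is_derive t (1 : R) (fun t : R => k * t) k.
    by apply: (is_derive_eq (is_deriveM (is_derive_cst k t 1) (is_derive_id t 1)));
      rewrite /GRing.scale /= mulr0 addr0 mulr1.
  apply: (is_derive_eq (is_deriveM (is_derive_cst (Y / k) t 1) (is_derive1_comp (is_derive_expR (k * t)) dk))).
  rewrite /GRing.scale /= mulr0 addr0; field; exact: lt0r_neq0.
have cE (t : R) : {for t, continuous (fun t => expR (k * t) * Y)}.
  have := is_derive1_continuous (dE t) => c1.
  rewrite (_ : (fun t => _) = (fun t => (Y / k * expR (k * t)) * k)).
    by apply: (continuousM c1); exact: cst_continuous.
  by apply/funext => x; field; exact: lt0r_neq0.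
have I := integral_deriv_oo ad (fun z _ => dE z) (fun z _ => cE z).
rewrite -lee_fin fineK; last exact: (integrable_fin_num (measurableX mT mI) iK).
rewrite mulrBr -I (fubini_rect mT mI iK).1.
apply: ge0_le_integral => //=.
- move=> t /[!in_itv]/= Ht; apply: integral_ge0 => r /=; rewrite in_itv/= => Hr.
  by rewrite lee_fin K0.
- have := (tonelli_measurable mT mI (measurable_int _ iK) _).1; apply => -[t r] /= [].
  by rewrite !in_itv /= => Ht Hr; rewrite lee_fin K0.
- apply/measurable_EFinP; apply: open_continuous_measurable_fun; first exact: interval_open.
  by move=> z _; exact: cE.
- move=> t /[!in_itv]/= Ht.
  have Htt : tau0 <= t by rewrite (le_trans Ha)//; case/andP: Ht => /ltW.
  have := HK t Ht; rewrite -lee_fin /Rintegral fineK//.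
  exact: (integrable_fin_num mI (good_int_r L Htt gK)).
Qed.

(** Quantified over all Dirac pairs at once, because the inductive step applies it to the [d_tau]
    and angular derivatives of the given pair. *)
Definition Est b (C : R) := forall j e P Q a D, (j <= b)%N -> DP e P Q -> tau0 <= a ->
  wle j P a D -> wle j Q a D -> forall t, a <= t ->
  (Nrm (iter j oY P) t <= (C * D)%:E)%E /\ (Nrm (iter j oY Q) t <= (C * D)%:E)%E.

Let eqN_iter_tau n F t : tau0 <= t -> Nice F -> Nrm (op_tau (iter n oY F)) t = Nrm (iter n oY (op_tau F)) t.
Proof.
move=> Ht NF; apply: (eqN_Nrm Ht); apply: eqN_sym.
exact: (iterY_comm hsmooth n NF (fun G NG => eqN_sym (commN_tau_Y hsmooth NG))).
Qed.
Let eqN_iter_ang e n F t : tau0 <= t -> Nice F -> Nrm (op_ang e (iter n oY F)) t = Nrm (iter n oY (op_ang e F)) t.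
Proof.
move=> Ht NF; apply: (eqN_Nrm Ht); apply: eqN_sym.
exact: (iterY_comm hsmooth n NF (fun G NG => commN_Y_ang hsmooth e NG)).
Qed.

(** The inequality [a < t] is strict: expressing [Y^(b+1) P] uses the field equation, which is
    available on the slice only when [t > tau0]. *)
Lemma allf_le b C e P Q a D : Est b C -> DP e P Q -> tau0 <= a -> wle b.+1 P a D -> wle b.+1 Q a D ->
  forall t, a < t -> forall j : 'I_7, (Nrm (allf e P Q b j) t <= (C * D)%:E)%E.
Proof.
move=> HE dp Ha wP wQ t at_; have NP := DP_P dp; have NQ := DP_Q dp.
have Ht : tau0 < t by exact: le_lt_trans at_.
have Ht' := ltW Ht; have at' := ltW at_.
have H0 j : (j <= b)%N -> _ := fun jb => HE j e P Q a D jb dp Ha (wle_le (leqW jb) wP) (wle_le (leqW jb) wQ) t at'.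
have HT j : (j <= b)%N -> _ := fun jb => HE j e _ _ a D jb (DP_tau hsmooth dp) Ha (wle_le jb (wle_tau wP)) (wle_le jb (wle_tau wQ)) t at'.
have HA := HE b _ _ _ a D (leqnn b) (DP_ang hsmooth dp) Ha (wle_ang wP) (wle_ang wQ) t at'.
have b1 := leq_pred b; have b2 := leq_trans (leq_pred b.-1) b1.
case; case=> [|[|[|[|[|[|[|//]]]]]]] Hj; rewrite /allf /fields.
- rewrite iterS (eqO_Nrm Ht (DP_1n hsmooth dp b)) eqN_iter_ang//; exact: HA.2.
- rewrite eqN_iter_tau//; exact: (HT b (leqnn b)).2.
- exact: (H0 b (leqnn b)).2.
- rewrite eqN_iter_ang//; exact: HA.1.
- exact: (H0 _ b1).2.
- rewrite eqN_iter_tau//; exact: (HT _ b1).2.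
- rewrite eqN_iter_tau//; exact: (HT _ b2).2.
Qed.

Let mfun_continuous r : 2 * M <= r -> {for r, continuous mf}.
Proof.
move=> Hr; have D : {for r, continuous (Delta M)} by exact: is_derive1_continuous (dcoefsP M 0 ord0 r).
have c2 : {for r, continuous (fun r : R => 2 * r ^+ 2)} by apply: cvgMr; exact: exprn_continuous.
exact: (continuousB c2 (continuousM D (fol_hp_continuous fol Hr))).
Qed.
Let good_mfun : good (fun _ r => mf r).
Proof. by apply: good_rho => r Hr; exact: mfun_continuous. Qed.

Let lin2 (A : set RR) (f g : RR -> R) (x : R) : measurable A ->
  lam.-integrable A (EFin \o f) -> lam.-integrable A (EFin \o g) ->
  x * (\int[lam]_(r in A) f r + \int[lam]_(r in A) g r) = \int[lam]_(r in A) (x * (f r + g r)).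
Proof.
move=> mA jf jg; rewrite -RintegralD// -RintegralZl//.
rewrite (_ : EFin \o _ = (EFin \o f) \+ (EFin \o g)); first exact: integrableD.
by apply/funext => r.
Qed.

Let gronwall (IA IP IB F x y u v : R) : IA + IP <= IB + F -> 0 <= IP -> IB <= u * x -> F <= y * (v - u) ->
  0 <= u -> u <= v -> 0 <= x -> 0 <= y -> IA <= v * (x + y).
Proof.
move=> H1 H2 H3 H4 u0 uv x0 y0.
have e1 := ler_wpM2r x0 uv; have e2 : 0 <= y * u by exact: mulr_ge0.
by rewrite mulrDr [v * y]mulrC; move: H4; rewrite mulrBr => H4; lra.
Qed.

Lemma Est_succ b C : 1 <= C -> Est b C -> exists2 C', C <= C' & Est b.+1 C'.
Proof.
move=> C1le HE; have [c1 [C1 [c10 C10 HC]]] := fol_bounds M0 fol.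
have C0 : 0 < C by exact: lt_le_trans C1le.
have m0 := ltW M0; have c1' := ltW c10; have C1' := ltW C10.
pose Kc := rhs_bound b; pose B := coef_bound b.
have Kc0 : 0 <= Kc by exact: rhs_bound_ge0.
pose k := M / C1; have k0 : 0 < k by rewrite divr_gt0.
pose y := Kc * (7 * C).
have y0 : 0 <= y by rewrite mulr_ge0// mulr_ge0// ltW.
(* [x1] bounds the energy weighted by [1 / r]: [C1 / M] comes from the data and [y / k] from the
   source. [x2] removes the weight by means of [recover]. *)
pose x1 := c1^-1 * (C1 / M + y / k).
have x10 : 0 <= x1 by rewrite mulr_ge0 ?invr_ge0// addr_ge0// divr_ge0// ltW.
pose x2 := 4 * M * x1 + 24 * B ^+ 2 * (7 * C).
have x20 : 0 <= x2.
  have C07 : 0 <= 7 * C by rewrite mulr_ge0// ltW.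
  by rewrite /x2 addr_ge0// mulr_ge0// mulr_ge0// sqr_ge0.
exists (C + x2); first by rewrite lerDl.
move=> j e P Q a D jb dp Ha wP wQ t at_.
have D0 : 0 <= D by exact: wle_ge0 wP.
have up (v : \bar R) (x : R) : 0 <= x -> x <= C + x2 -> (v <= (x * D)%:E)%E -> (v <= ((C + x2) * D)%:E)%E.
  by move=> _ xC /le_trans; apply; rewrite lee_fin ler_wpM2r.
have CC : C <= C + x2 by rewrite lerDl.
have [jb'|jb'] := leqP j b.
  by have [H1 H2] := HE j e P Q a D jb' dp Ha wP wQ t at_; split; apply: (up _ C) => //; exact: ltW.
have {jb jb'}Ej : j = b.+1 by apply/eqP; rewrite eqn_leq jb.
subst j; set P1 := iter b.+1 oY P; set Q1 := iter b.+1 oY Q.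
have HPa : (Nrm P1 a <= D%:E)%E by apply: (wP b.+1) => //; exact: hword_iterY.
have HQa : (Nrm Q1 a <= D%:E)%E by apply: (wQ b.+1) => //; exact: hword_iterY.
have NP1 : Nice P1 by exact: (NiceYn fol b.+1 (DP_P dp)).
have NQ1 : Nice Q1 by exact: (NiceYn fol b.+1 (DP_Q dp)).
(* At [t = a] the claim is the hypothesis on the data; for [t > a] the exterior part of the slice
   lies in [Oset]. *)
move: at_; rewrite le_eqVlt => /orP[/eqP <-|at_].
  have C21 : 1 <= C + x2 by exact: le_trans CC.
  by split; [apply: (le_trans HPa)|apply: (le_trans HQa)]; rewrite lee_fin ler_peMl.
have HS s (sa : a < s) := allf_le HE dp Ha wP wQ sa.
split; first by apply: (up _ C) => //; [exact: ltW|exact: (HS t at_ ord0)].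
have Ht : tau0 <= t by rewrite (le_trans Ha)// ltW.
have Ht' : tau0 < t by exact: le_lt_trans at_.
apply: (up _ x2) => //; first by rewrite lerDr ltW.
apply: (Nrm_lb M0 fol Ht NQ1) => c L c0 ML HL.
have gz := good_zeta fol c0.
have gQ1 := good_ip NQ1 NQ1; have gP1 := good_ip NP1 NP1.
have gri : good (fun _ r => r^-1).
  apply: good_rho => r Hr; apply: inv_continuous; apply: lt0r_neq0.
  by apply: lt_le_trans Hr; rewrite mulr_gt0.
have gS := good_Sall b dp.
have mI : measurable (`]2 * M, L[%classic : set RR) by exact: measurable_itv.
pose J := \int[lam]_(r in `]2 * M, L[) (zeta c (t + h r) * (r^-1 * ip Q1 Q1 t r)).
have iJ := good_int_r L Ht (goodM gz (goodM gri gQ1)).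
have iS := good_int_r L Ht (goodM gz gS).
have SX := Sall_int dp L Ht c0 (HS t at_).
have step1 : J <= x1 * D.
  have dw r : 2 * M <= r -> is_derive r (1 : R) (fun r : R => r^-1) (- (r ^+ 2)^-1).
    move=> Hr; have r0 : r != 0 by rewrite gt_eqF// (lt_le_trans _ Hr)// mulr_gt0.
    have Dv : is_derive r (1 : R) (fun y : R => y^-1) (- r ^- 2 *: (1 : R)) := is_deriveV r0 (is_derive_id r 1).
    by move: Dv; rewrite /GRing.scale /= mulr1.
  have cw' r : 2 * M <= r -> {for r, continuous (fun r : R => - (r ^+ 2)^-1)}.
    move=> Hr; have r0 : r != 0 by rewrite gt_eqF// (lt_le_trans _ Hr)// mulr_gt0.
    apply: continuousN; apply: (@continuousV _ _ (fun r : R => r ^+ 2)); first by rewrite expf_neq0.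
    exact: exprn_continuous.
  pose K s r := expR (k * s) * (zeta c (s + h r) * (Kc * Sall e P Q b s r)).
  have gE : good (fun s _ => expR (k * s)).
    apply: good_tau => s _; apply: (@continuous_comp _ _ _ (fun s => k * s) (@expR R)).
      by apply: cvgMr; exact: cvg_id.
    exact: continuous_expR.
  have gK : good K by exact: (goodM gE (goodM gz (goodM (good_cst _ _ Kc) gS))).
  have HK s r : a < s < t -> 2 * M < r < L ->
      energy_rhs M h P Q b.+1 k c (fun r => r^-1) (fun r => - (r ^+ 2)^-1) s r <= K s r.
    move=> /andP[s1 _] /andP[r1 _].
    have HC' r' : 2 * M <= r' -> 0 <= hp r' <= C1 /\ 0 <= mf r' <= C1.
      by move=> Hr'; have [h1 h2 h3 h4] := HC r' Hr'; split; apply/andP; split => //; exact: le_trans c1' _.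
    have Osr : Oset (s, r) by split => //=; exact: le_lt_trans s1.
    have HR := @rhs_le e P Q b dp C1 c s r C10 HC' Osr.
    rewrite /K -/k in HR *; exact: HR.
  have HL' s r : tau0 <= s -> a <= s -> L <= r -> c <= s + h r by move=> Hs _; exact: HL.
  have G := energy_green fol dp c0 dw cw' Ha at_ ML HL' gK HK.
  pose y' := y * D.
  have y'0 : 0 <= y' by exact: mulr_ge0.
  have Bk : fine (\int[lam2]_(z in `]a, t[ `*` `](2 * M)%R, L[) (K z.1 z.2)%:E)%E <= y' / k * (expR (k * t) - expR (k * a)).
    apply: bulk_le => // s.
      move=> r /andP[s1 _] /andP[r1 _]; apply: mulr_ge0; first exact: expR_ge0.
      apply: mulr_ge0; first exact: zeta_ge0.
      by apply: mulr_ge0 => //; apply: sumr_ge0 => j _; exact: ip_ge0.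
    move=> /andP[s1 _]; have Hs : tau0 <= s by rewrite (le_trans Ha)// ltW.
    have iSs := good_int_r L Hs (goodM gz gS).
    have -> : \int[lam]_(r in `]2 * M, L[) K s r = expR (k * s) * Kc * \int[lam]_(r in `]2 * M, L[) (zeta c (s + h r) * Sall e P Q b s r).
      rewrite -RintegralZl//; apply: eq_Rintegral => r _; rewrite /K.
      by move: (zeta _ _) (Sall _ _ _ _ _ _) => *; ring.
    rewrite -mulrA ler_wpM2l ?expR_ge0// /y' /y -mulrA ler_wpM2l// -mulrA.
    exact: (Sall_int dp L Hs c0 (HS s s1)).
  have P0 : 0 <= \int[lam]_(s in `]a, t[) (expR (k * s) * zeta c (s + h (2 * M)) * (2 * M)^-1 * ip P1 P1 s (2 * M)).
    apply: Rintegral_ge0 => s _.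
    have i0 : 0 <= (2 * M)^-1 by rewrite invr_ge0 mulr_ge0.
    exact: (mulr_ge0 (mulr_ge0 (mulr_ge0 (expR_ge0 _) (zeta_ge0 _ _)) i0) (ip_ge0 _ _ _)).
  have ghp : good (fun _ r => hp r) by apply: good_rho => r Hr; exact: (fol_hp_continuous fol).
  have gmf : good (fun _ r => mf r) by exact: good_mfun.
  have gA : good (fun s r => expR (k * s) * zeta c (s + h r) * r^-1 * (hp r * ip P1 P1 s r + mf r * ip Q1 Q1 s r)).
    exact: (goodM (goodM (goodM gE gz) gri) (goodD (goodM ghp gP1) (goodM gmf gQ1))).
  have lowA : expR (k * t) * (c1 * J) <= \int[lam]_(r in `]2 * M, L[)
      (expR (k * t) * zeta c (t + h r) * r^-1 * (hp r * ip P1 P1 t r + mf r * ip Q1 Q1 t r)).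
    rewrite mulrA /J -RintegralZl//; apply: le_Rintegral => //.
    - exact: (good_int_r L Ht (goodM (good_cst _ _ (expR (k * t) * c1)) (goodM gz (goodM gri gQ1)))).
    - exact: (good_int_r L Ht gA).
    move=> r; rewrite /= in_itv /= => /andP[r1 r2].
    have [h1 _ h3 _] := HC r (ltW r1).
    have r0 : 0 <= r^-1 by rewrite invr_ge0 (le_trans _ (ltW r1))// mulr_ge0.
    have p0 := ip_ge0 P1 t r; have q0 := ip_ge0 Q1 t r.
    have z0 := zeta_ge0 c (t + h r); have e0 := expR_ge0 (k * t).
    move: (ip P1 P1 t r) (ip Q1 Q1 t r) (zeta _ _) (expR _) p0 q0 z0 e0 => p q z x p0 q0 z0 x0.
    rewrite (_ : x * c1 * _ = x * z * r^-1 * (c1 * q)); last by ring.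
    rewrite ler_wpM2l ?mulr_ge0//; apply: le_trans (ler_wpM2r q0 h3) _.
    by rewrite lerDr; apply: mulr_ge0 => //; exact: le_trans h1.
  have upA : \int[lam]_(r in `]2 * M, L[)
      (expR (k * a) * zeta c (a + h r) * r^-1 * (hp r * ip P1 P1 a r + mf r * ip Q1 Q1 a r)) <= expR (k * a) * (C1 / M * D).
    have zr (g : R -> R) : (forall r, 2 * M <= r -> {for r, continuous g}) -> (forall r, 2 * M <= r -> 0 <= g r <= C1) ->
        forall G, Nice G -> (Nrm G a <= D%:E)%E ->
        \int[lam]_(r in `]2 * M, L[) (zeta c (a + h r) * r^-1 * g r * ip G G a r) <= C1 / (2 * M) * D.
      move=> cg Hg G' NG HG; apply: (Nrm_ub Ha NG) => //.
      - by rewrite divr_ge0// mulr_ge0.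
      - move=> r Hr; have [_ cz _] := good_zeta fol c0.
        have [_ ci _] := gri.
        have c3 := @cz a r; have c4 := @ci a r.
        apply: (@continuousM _ _ (fun r => zeta c (a + h r) * r^-1) g); last exact: cg.
        by apply: continuousM; [apply: c3|apply: c4]; split.
      - move=> r /andP[r1 _]; have /andP[h1 h2] := Hg r (ltW r1).
        have rM : r^-1 <= (2 * M)^-1 by rewrite lef_pV2 ?posrE ?ltW ?mulr_gt0// (lt_trans _ r1)// mulr_gt0.
        have r0 : 0 <= r^-1 by rewrite invr_ge0 (le_trans _ (ltW r1))// mulr_ge0.
        have z1 : zeta c (a + h r) <= 1 by rewrite zeta_le1// ltW// (fol_v_gt0 M0 fol)// ltW.
        have z0 := zeta_ge0 c (a + h r).
        have q1 := ler_pM z0 r0 z1 rM; have q0 := mulr_ge0 z0 r0; rewrite mul1r in q1.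
        by have := ler_pM h1 q0 h2 q1; rewrite mulrC.
    have iz1 := good_int_r L Ha (goodM (goodM (goodM gz gri) ghp) gP1).
    have iz2 := good_int_r L Ha (goodM (goodM (goodM gz gri) gmf) gQ1).
    have iz3 := good_int_r L Ha (goodD (goodM (goodM (goodM gz gri) ghp) gP1) (goodM (goodM (goodM gz gri) gmf) gQ1)).
    have -> : \int[lam]_(r in `]2 * M, L[)
        (expR (k * a) * zeta c (a + h r) * r^-1 * (hp r * ip P1 P1 a r + mf r * ip Q1 Q1 a r)) =
      expR (k * a) * (\int[lam]_(r in `]2 * M, L[) (zeta c (a + h r) * r^-1 * hp r * ip P1 P1 a r) +
        \int[lam]_(r in `]2 * M, L[) (zeta c (a + h r) * r^-1 * mf r * ip Q1 Q1 a r)).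
      rewrite (lin2 _ mI iz1 iz2); apply: eq_Rintegral => r _.
      by move: (ip _ _ _ _) (ip _ _ _ _) (zeta _ _) => *; ring.
    rewrite ler_wpM2l ?expR_ge0//.
    have -> : C1 / M * D = C1 / (2 * M) * D + C1 / (2 * M) * D by field; exact: lt0r_neq0.
    apply: lerD; apply: zr => //.
    - by move=> r Hr; exact: (fol_hp_continuous fol).
    - by move=> r Hr; have [h1 h2 _ _] := HC r Hr; apply/andP; split => //; exact: le_trans h1.
    - by move=> r Hr; have [_ _ h1 h2] := HC r Hr; apply/andP; split => //; exact: le_trans h1.
  have e0 : 0 < expR (k * t) by exact: expR_gt0.
  have ea0 := expR_ge0 (k * a).
  have eat : expR (k * a) <= expR (k * t) by rewrite ler_expR ler_pM2l// ltW.
  (* The data carry [e^(k a)] and the source [(e^(k t) - e^(k a)) / k], both dominated by multiples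
     of [e^(k t)], which then cancels. *)
  have F1 : expR (k * t) * (c1 * J) <= expR (k * t) * (C1 / M * D + y' / k).
    have x0 : 0 <= C1 / M * D by rewrite mulr_ge0// divr_ge0.
    apply: (le_trans lowA); apply: (gronwall G P0 upA Bk ea0 eat x0); by rewrite divr_ge0// ltW.
  rewrite ler_pM2l// in F1.
  rewrite /x1 -mulrA -ler_pdivrMl ?invr_gt0// invrK; apply: (le_trans F1).
  by rewrite /y' mulrDl le_eqVlt; apply/orP; left; apply/eqP; congr (_ + _); rewrite mulrAC.
have step2 : \int[lam]_(r in `]2 * M, L[) (zeta c (t + h r) * ip Q1 Q1 t r) <=
   4 * M * J + 24 * B ^+ 2 * \int[lam]_(r in `]2 * M, L[) (zeta c (t + h r) * Sall e P Q b t r).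
  rewrite /J -!RintegralZl// -RintegralD//; last 2 first.
  - exact: (good_int_r L Ht (goodM (good_cst _ _ (4 * M)) (goodM gz (goodM gri gQ1)))).
  - exact: (good_int_r L Ht (goodM (good_cst _ _ (24 * B ^+ 2)) (goodM gz gS))).
  apply: le_Rintegral => //.
  - exact: (good_int_r L Ht (goodM gz gQ1)).
  - exact: (good_int_r L Ht (goodD (goodM (good_cst _ _ (4 * M)) (goodM gz (goodM gri gQ1))) (goodM (good_cst _ _ (24 * B ^+ 2)) (goodM gz gS)))).
  move=> r; rewrite /= in_itv /= => /andP[r1 r2].
  have Otr : Oset (t, r) by split.
  rewrite mulrCA [24 * _ * _]mulrCA -mulrDr ler_wpM2l ?zeta_ge0//.
  apply: (le_trans (recover b dp Otr)); rewrite lerD2l ler_wpM2l//.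
    by rewrite mulr_ge0// sqr_ge0.
  by apply: lower_le => //; exact: Oset_reg.
have M4 : 0 <= 4 * M by rewrite mulr_ge0.
have B4 : 0 <= 24 * B ^+ 2 by rewrite mulr_ge0// sqr_ge0.
apply: le_trans step2 _; apply: le_trans (lerD (ler_wpM2l M4 step1) (ler_wpM2l B4 SX)) _.
have -> : x2 * D = 4 * M * (x1 * D) + 24 * B ^+ 2 * (7 * (C * D)) by rewrite /x2; move: (x1) (B) => *; ring.
exact: lexx.
Qed.

Lemma Est_exists b : exists2 C, 1 <= C & Est b C.
Proof.
elim: b => [|b [C C1 HE]]; last first.
  by have [C' CC' HE'] := Est_succ C1 HE; exists C' => //; exact: le_trans CC'.
have [C C0 HC] := energy0 M0 fol.
exists (C + 1); first by rewrite lerDr ltW.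
move=> j e P Q a D; rewrite leqn0 => /eqP -> dp Ha wP wQ t at_.
have D0 := wle_ge0 wP.
have HP := wP 0%N P (leqnn 0) (hword0 P); have HQ := wQ 0%N Q (leqnn 0) (hword0 Q).
have [/(_ t at_)[h1 h2] _ _] := HC e P Q a D dp Ha HP HQ.
by split; [apply: (le_trans h1)|apply: (le_trans h2)]; rewrite lee_fin ler_wpM2r// lerDl.
Qed.

End Commutation.

(** * Angular derivatives *)

Section Words.
Variables (R : realType) (M tau0 : R) (h : R -> R).
Implicit Types F G P Q : spin_scalar R.
Notation Nice := (Nice M tau0).
Notation Oset := (Oset M tau0).

Let sum_I3 (f : nat -> R) : \sum_(j < 3) f j = f 0%N + (f 1%N + f 2%N).
Proof. by rewrite !big_ord_recl big_ord0 addr0. Qed.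

Definition lincomb (c : R) F G H := [/\ F.1 = G.1, F.1 = H.1 & forall x, domF Oset x ->
  fre F.2 x = fre G.2 x + c * fre H.2 x /\ fim F.2 x = fim G.2 x + c * fim H.2 x].

Let three F G H (j : nat) := match j with 0 => F | 1 => G | _ => H end.
Let coef3 (c : R) (j : nat) := match j with 0 => -1 | 1 => 1 | _ => c end.

Let lincomb_rel c F G H : lincomb c F G H ->
  rel M tau0 (fun (j : 'I_3) (_ : R) => coef3 c j) (fun j : 'I_3 => three F G H j).
Proof.
move=> [_ _ E] x Dx; have [E1 E2] := E x Dx; split.
- rewrite (sum_I3 (fun j => coef3 c j * fre (three F G H j).2 x)) /= E1.
  by move: (fre G.2 x) (fre H.2 x) => *; ring.
- rewrite (sum_I3 (fun j => coef3 c j * fim (three F G H j).2 x)) /= E2.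
  by move: (fim G.2 x) (fim H.2 x) => *; ring.
Qed.

Let Nthree F G H (j : 'I_3) : Nice F -> Nice G -> Nice H -> Nice (three F G H j).
Proof. by case: j => -[|[|[|//]]] Hj. Qed.

Lemma lincomb_ang e c F G H : Nice F -> Nice G -> Nice H -> lincomb c F G H ->
  lincomb c (op_ang e F) (op_ang e G) (op_ang e H).
Proof.
move=> NF NG NH L; have [w1 w2 _] := L; split; [by rewrite /= w1|by rewrite /= w2|move=> x Dx].
have w (j : 'I_3) : (three F G H j).1 = F.1 by case: j => -[|[|[|//]]].
have [E1 E2] := rel_ang (fun (j : 'I_3) (r : R) => is_derive_cst (coef3 c j) r 1)
   (fun j => Nthree j NF NG NH) e w (lincomb_rel L) Dx.
rewrite (sum_I3 (fun j => coef3 c j * fre (op_ang e (three F G H j)).2 x)) in E1.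
rewrite (sum_I3 (fun j => coef3 c j * fim (op_ang e (three F G H j)).2 x)) in E2.
rewrite [three _ _ _ 0]/= [three _ _ _ 1]/= [three _ _ _ 2]/= [coef3 _ 0]/= [coef3 _ 1]/= [coef3 _ 2]/= in E1 E2.
move: E1 E2; move: (fre _ x) (fre _ x) (fre _ x) (fim _ x) (fim _ x) (fim _ x) => u1 u2 u3 v1 v2 v3 E1 E2.
by split; apply/eqP; rewrite -subr_eq0 -oppr_eq0; apply/eqP; [rewrite -E1|rewrite -E2]; ring.
Qed.

Lemma lincomb_le c F G H t r : Nice F -> Nice G -> Nice H -> lincomb c F G H -> Oset (t, r) ->
  ip F F t r <= 2 * ip G G t r + 2 * c ^+ 2 * ip H H t r.
Proof.
move=> NF NG NH L Otr; have rtr := Oset_reg Otr.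
have := rel_ip (fun j => Nthree j NF NG NH) NF (lincomb_rel L) Otr.
rewrite (sum_I3 (fun j => coef3 c j * ip (three F G H j) F t r)) /= => E.
have c0 : 0 < 2 :> R by [].
have Y1 := ip_young rtr c0 NG NF.
have Y2 : 2 * (c * ip H F t r) <= 2 * c ^+ 2 * ip H H t r + ip F F t r / 2.
  have [->|cn] := eqVneq c 0.
    by rewrite mul0r mulr0 expr0n mulr0 mul0r add0r divr_ge0// ip_ge0.
  have c1 : 0 < 2 * `|c| by rewrite mulr_gt0// normr_gt0.
  have := ip_young rtr c1 NH NF; rewrite -(ler_pM2l (_ : 0 < `|c|)) ?normr_gt0//.
  rewrite -normrM; have := ler_norm (c * (2 * ip H F t r)) => h1 h2; have := le_trans h1 h2.
  have E2 : `|c| * `|c| = c ^+ 2 by rewrite -normrM -expr2 ger0_norm// sqr_ge0.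
  have -> : `|c| * (2 * `|c| * ip H H t r + (2 * `|c|)^-1 * ip F F t r) = 2 * c ^+ 2 * ip H H t r + ip F F t r / 2.
    by rewrite -E2; field; rewrite normr_eq0.
  by rewrite mulrCA.
have Y1' := le_trans (ler_norm _) Y1.
move: E Y1' Y2; move: (ip F F t r) (ip G F t r) (ip H F t r) (ip G G t r) (c ^+ 2 * ip H H t r) => *.
lra.
Qed.

Definition angw (A : seq bool) F := foldr (fun e G => op_ang e G) F A.

Lemma angw_cat A B F : angw (A ++ B) F = angw A (angw B F).
Proof. exact: foldr_cat. Qed.
Lemma Nice_angw A F : Nice F -> Nice (angw A F).
Proof. by move=> NF; elim: A => //= e A; exact: Nice_ang. Qed.
Lemma lincomb_angw A c F G H : Nice F -> Nice G -> Nice H -> lincomb c F G H ->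
  lincomb c (angw A F) (angw A G) (angw A H).
Proof.
move=> NF NG NH L; elim: A => //= e A; apply: lincomb_ang; exact: Nice_angw.
Qed.

Lemma lincomb_comm e F : Nice F ->
  lincomb (2 * sg R e * F.1) (op_ang (~~ e) (op_ang e F)) (op_ang e (op_ang (~~ e) F)) F.
Proof.
move=> NF; have [V [oV rV S]] := Nice_smoothOn 2 NF.
split=> [||x Dx]; [by rewrite /= addrAC|by rewrite /= sg_neg addrK|].
have Dx' : domF V x by have [h1 h2] := Dx; split => //; apply: rV; exact: Oset_reg.
exact: (comm_ang e oV S Dx').
Qed.

Lemma altSS e m F : alt e m.+2 F = alt e m (op_ang (~~ e) (op_ang e F)).
Proof.
elim: m => [|m IH]; first by rewrite /= addbF addbT.
by rewrite [LHS]/= [in RHS]/= -IH /= negbK.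
Qed.

(** An estimate on each sphere separately. The constant may depend on the word and the weight; [e]
    selects the family of alternating products, the one for which the Dirac system provides
    bounds. *)
Definition elliptic e (s : R) (A : seq bool) := exists2 C : R, 0 <= C &
  forall F t r, Nice F -> F.1 = s -> Oset (t, r) ->
  ip (angw A F) (angw A F) t r <= C * \sum_(m < (size A).+1) ip (alt e m F) (alt e m F) t r.

Let wt (A : seq bool) : R := \sum_(e <- A) sg R e.
Let angw_w A F : (angw A F).1 = F.1 + wt A.
Proof.
elim: A => [|e A IH]; first by rewrite /wt big_nil addr0.
by rewrite /= IH /wt big_cons -addrA [sg R e + _]addrC.
Qed.

Let alt_sum_le e F n m t r : (n <= m)%N ->
  \sum_(i < n) ip (alt e i F) (alt e i F) t r <= \sum_(i < m) ip (alt e i F) (alt e i F) t r.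
Proof.
move=> nm; rewrite -(subnKC nm) big_split_ord /= lerDl; apply: sumr_ge0 => i _; exact: ip_ge0.
Qed.

Let norm_sg y : `|sg R y| = 1.
Proof. by case: y; rewrite /sg /= ?normrN normr1. Qed.

Section Elliptic.
Variables (e : bool) (s : R).
Notation ell := (elliptic e s).

Lemma ell_nil : ell [::].
Proof. by exists 1 => // F t r NF Fs Otr; rewrite mul1r big_ord_recl big_ord0 addr0. Qed.

(** By adjointness the squared norms of the two angular derivatives of a field differ by the pairing
    of the commutator with it, a constant times the squared norm of the field. Flipping the
    outermost letter therefore costs a shorter word. *)
Lemma ell_flip y A : ell (~~ y :: A) -> ell A -> ell (y :: A).
Proof.
move=> [C1 C10 H1] [C2 C20 H2].
pose k := 2 * `|s + wt A|; have k0 : 0 <= k by rewrite mulr_ge0.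
exists (C1 + k * C2); first by rewrite addr_ge0// mulr_ge0.
move=> F t r NF Fs Otr; have rtr := Oset_reg Otr.
set G := angw A F; have NG : Nice G by exact: Nice_angw.
have E y' : ip (op_ang y' G) (op_ang y' G) t r = - ip G (op_ang (~~ y') (op_ang y' G)) t r.
  exact: (ip_ang rtr NG (Nice_ang y' NG) (erefl (op_ang y' G).1)).
have EC := lincomb_rel (lincomb_comm y NG).
have N1 := Nice_ang y NG; have N2 := Nice_ang (~~ y) NG.
have := rel_ip (fun j => Nthree j (Nice_ang (~~ y) N1) (Nice_ang y N2) NG) NG EC Otr.
rewrite (sum_I3 (fun j => coef3 _ j * ip (three _ _ _ j) G t r)) /= => E3.
have E1 := E y; have E2 := E (~~ y); rewrite negbK in E2.
rewrite [ip G _ t r]ipC in E1; rewrite [ip G _ t r]ipC in E2.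
have cle : - (2 * sg R y * G.1) <= k.
  apply: le_trans (ler_norm _) _; rewrite normrN !normrM norm_sg mulr1 angw_w Fs ger0_norm//.
have H1' := H1 F t r NF Fs Otr; have H2' := H2 F t r NF Fs Otr.
have L := alt_sum_le e F t r (leqnSn (size A).+1).
have E4 : ip (op_ang y G) (op_ang y G) t r = ip (op_ang (~~ y) G) (op_ang (~~ y) G) t r - (2 * sg R y * G.1) * ip G G t r.
  by rewrite E1 E2; move: E3; move: (ip _ G t r) (ip _ G t r) => u v E3; lra.
rewrite -/G E4 [leRHS]mulrDl; apply: lerD; first exact: H1'.
rewrite -mulNr; apply: le_trans (ler_wpM2r (ip_ge0 _ _ _) cle) _.
rewrite -[leRHS]mulrA ler_wpM2l//; apply: (le_trans H2'); rewrite ler_wpM2l//.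
Qed.

(** Exchanging opposite neighbours changes the word by a multiple of the word with both deleted; the
    rest of the word preserves this relation. *)
Lemma ell_swap_lt y A B : ell (A ++ [:: y, ~~ y & B]) -> ell (A ++ B) -> ell (A ++ [:: ~~ y, y & B]).
Proof.
move=> [C1 C10 H1] [C2 C20 H2].
pose k := 2 * sg R y * (s + wt B).
exists (2 * C1 + 2 * k ^+ 2 * C2); first by rewrite addr_ge0// mulr_ge0// mulr_ge0// sqr_ge0.
move=> F t r NF Fs Otr.
have NB : Nice (angw B F) by exact: Nice_angw.
have L := lincomb_angw A (Nice_ang (~~ y) (Nice_ang y NB)) (Nice_ang y (Nice_ang (~~ y) NB)) NB (lincomb_comm y NB).
rewrite angw_w Fs -/k in L.
have H1' := H1 F t r NF Fs Otr; have H2' := H2 F t r NF Fs Otr.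
rewrite !angw_cat in H1' H2' *; rewrite [angw [:: y, _ & _] _]/= in H1'; rewrite [angw [:: ~~ y, _ & _] _]/=.
have := lincomb_le _ _ _ L Otr; move=> /(_ (Nice_angw A (Nice_ang _ (Nice_ang _ NB))) (Nice_angw A (Nice_ang _ (Nice_ang _ NB))) (Nice_angw A NB)).
move=> /le_trans; apply; rewrite [leRHS]mulrDl; apply: lerD.
  rewrite -[leRHS]mulrA ler_wpM2l//; apply: (le_trans H1').
  by rewrite ler_wpM2l// !size_cat /= alt_sum_le.
have k2 : 0 <= 2 * k ^+ 2 by rewrite mulr_ge0// sqr_ge0.
rewrite -[leRHS]mulrA; apply: (ler_wpM2l k2); apply: (le_trans H2').
by rewrite ler_wpM2l// alt_sum_le// !size_cat /= ltnS leq_add2l; apply: leqW.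
Qed.

Lemma ell_swap x y A B : ell (A ++ [:: y, x & B]) -> ell (A ++ B) -> ell (A ++ [:: x, y & B]).
Proof.
have [->//|xy] := eqVneq x y.
have -> : x = ~~ y by move: xy; case: (x); case: (y).
exact: ell_swap_lt.
Qed.

(** The letter is moved outwards by exchanges, flipped in the outermost position and moved back;
    every error is a shorter word. *)
Lemma ell_flip_at a y A B : (forall D, (size D < a)%N -> ell D) -> size (A ++ y :: B) = a ->
  ell (A ++ ~~ y :: B) -> ell (A ++ y :: B).
Proof.
move=> IH; elim/last_ind: A B => [|A z IHA] B Ha H.
  by apply: ell_flip => //; apply: IH; rewrite -Ha /=.
rewrite cat_rcons in Ha; rewrite cat_rcons in H; rewrite cat_rcons.
have sm : ell (A ++ B) by apply: IH; rewrite -Ha !size_cat /= ltn_add2l; apply: leqW.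
apply: ell_swap => //; apply: IHA; first by rewrite -Ha !size_cat /=.
exact: ell_swap.
Qed.

(** The pair restores the weight, so the estimate for [A] applies to the image of [F], whose
    alternating products are those of [F] two steps further. *)
Lemma ell_pair_end A : ell A -> ell (A ++ [:: ~~ e; e]).
Proof.
move=> [C C0 H]; exists C => // F t r NF Fs Otr.
have NL : Nice (op_ang (~~ e) (op_ang e F)) by exact: Nice_ang (Nice_ang _ NF).
have := H _ t r NL _ Otr; rewrite /= sg_neg addrK => /(_ Fs).
rewrite angw_cat => /le_trans; apply; rewrite ler_wpM2l// size_cat addn2.
rewrite (eq_bigr (fun m : 'I__ => ip (alt e m.+2 F) (alt e m.+2 F) t r)); last by move=> m _; rewrite altSS.
rewrite [leRHS]big_ord_recl -[leLHS]add0r lerD ?ip_ge0// [leRHS]big_ord_recl.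
by rewrite -[leLHS]add0r lerD ?ip_ge0.
Qed.

(** Strong induction on the length: flips turn the two innermost letters into [~~ e], [e], and the
    pair is then absorbed by [ell_pair_end]. *)
Lemma ell_all A : ell A.
Proof.
have [a] := ubnP (size A); elim: a A => // a IH A; rewrite ltnS => Ha.
have {IH} IH D : (size D < size A)%N -> ell D by move=> DA; apply: IH; exact: leq_trans DA Ha.
case/lastP: A Ha IH => [|A y] Ha IH; first exact: ell_nil.
case/lastP: A Ha IH => [|A x] Ha IH.
  have F1 := @ell_flip_at 1 y [::] [::] IH erefl.
  have E1 : ell [:: e].
    exists 1 => // F t r NF Fs Otr.
    by rewrite mul1r 2!big_ord_recl big_ord0 addr0 /= addbF lerDr ip_ge0.
  have [->//|ye] := eqVneq y e.
  by apply: F1; have -> : ~~ y = e by move: ye; case: (y); case: (e).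
rewrite -cats1 cat_rcons /= in Ha IH *.
have EA : ell A by apply: IH; rewrite size_cat /= addn2.
have EE := ell_pair_end EA.
have fl B B' u v : size (B ++ u :: B') = size (A ++ [:: x; y]) -> ell (B ++ v :: B') -> ell (B ++ u :: B').
  move=> sB Hv; have [->//|uv] := eqVneq u v.
  apply: (ell_flip_at IH sB); suff -> : ~~ u = v by [].
  by move: uv; case: (u); case: (v).
apply: (fl A [:: y] x (~~ e)) => //.
have := fl (A ++ [:: ~~ e]) [::] y e; rewrite -!catA /=; apply => //.
by rewrite !size_cat.
Qed.

End Elliptic.

End Words.

(** * Sobolev norms and individual words *)

Section WordNorms.
Variables (R : realType) (M tau0 : R) (h : R -> R) (r_away r_far : R).
Hypothesis M0 : 0 < M.
Hypothesis fol : foliation M h r_away r_far tau0.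
Let hsmooth := fol_smooth fol.
Implicit Types F G P Q : spin_scalar R.
Notation RR := (measurableTypeR R).
Notation lam := (@lebesgue_measure R).
Notation reg := (reg M tau0).
Notation Nice := (Nice M tau0).
Notation oY := (op_Y M h).
Notation Oset := (Oset M tau0).
Notation DP := (DP M tau0 h).
Notation Nrm := (Nrm M).
Notation hword := (hword M h).
Notation wle := (wle M h).
Notation Est := (Est M tau0 h).
Notation iterY n := (iter n oY).

Let Ioo : set RR := `]2 * M, +oo[.
Let mIoo : measurable Ioo. Proof. exact: measurable_itv. Qed.

Lemma Nrm_measurable G t : tau0 <= t -> Nice G -> measurable_fun Ioo (fun r => (ip G G t r)%:E).
Proof.
move=> Ht NG; apply/measurable_EFinP; apply: open_continuous_measurable_fun; first exact: interval_open.
move=> r; rewrite inE /Ioo /= in_itv /= andbT => /ltW Hr.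
by have [_ + _] := good_ip NG NG; apply; split.
Qed.

Definition AllN s := foldr (fun G p => Nice G /\ p) True s.

Lemma int_sum s t : tau0 <= t -> AllN s ->
  measurable_fun Ioo (fun r => (\sum_(G <- s) ip G G t r)%:E) /\
  (\int[lam]_(r in Ioo) (\sum_(G <- s) ip G G t r)%R%:E = \sum_(G <- s) Nrm G t)%E.
Proof.
move=> Ht; elim: s => [_|G s IH [NG /IH[m1 E1]]].
  rewrite big_nil (_ : (fun r => _) = (fun=> 0%E)); last by apply/funext => r; rewrite big_nil.
  by split => //; exact: integral0.
have mG := Nrm_measurable Ht NG.
rewrite (_ : (fun r => _) = (fun r => (ip G G t r)%:E + (\sum_(G <- s) ip G G t r)%:E)%E); last first.
  by apply/funext => r; rewrite big_cons EFinD.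
split; first exact: emeasurable_funD.
rewrite big_cons ge0_integralD//.
- by rewrite E1.
- by move=> r _; rewrite lee_fin ip_ge0.
- by move=> r _; rewrite lee_fin; apply: sumr_ge0 => ? _; exact: ip_ge0.
Qed.

Lemma Nrm_le_sum F s t C (X : \bar R) : tau0 <= t -> Nice F -> AllN s -> 0 <= C ->
  (forall r, 2 * M < r -> ip F F t r <= C * \sum_(G <- s) ip G G t r) ->
  (\sum_(G <- s) Nrm G t <= X)%E -> (Nrm F t <= C%:E * X)%E.
Proof.
move=> Ht NF Ns C0 H HX; have [m1 E1] := int_sum Ht Ns.
apply: (@le_trans _ _ (\int[lam]_(r in Ioo) (C%:E * (\sum_(G <- s) ip G G t r)%R%:E))%E).
  apply: ge0_le_integral => //.
  - by move=> r _; rewrite lee_fin ip_ge0.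
  - exact: Nrm_measurable.
  - exact: measurable_funeM.
  - by move=> r; rewrite /Ioo /= in_itv /= andbT => Hr; rewrite -EFinM lee_fin H.
rewrite ge0_integralZl_EFin//; last by move=> r _; rewrite lee_fin; apply: sumr_ge0 => ? _; exact: ip_ge0.
by rewrite E1 lee_wpmul2l.
Qed.

Lemma sphere_sum s t r : reg (t, r) -> AllN s ->
  sphere_int (fun th ph => \sum_(G <- s) sqmod G t r th ph) = (\sum_(G <- s) ip G G t r)%:E.
Proof.
move=> rtr Ns.
have [sf E] : sphfun (fun th ph => \sum_(G <- s) sqmod G t r th ph) /\
   Sint (fun th ph => \sum_(G <- s) sqmod G t r th ph) = \sum_(G <- s) ip G G t r.
  elim: s Ns => [_|G s IH [NG /IH[s1 E1]]].
    rewrite big_nil (_ : (fun th ph => _) = (fun _ _ => 0)); last first.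
      by apply/funext => th; apply/funext => ph; rewrite big_nil.
    split; first exact: sphfun_cst.
    rewrite -[RHS](mul0r (Sint (fun _ _ : R => 1))) -SintZ; last exact: sphfun_cst.
    by apply: eq_Sint => *; rewrite mul0r.
  rewrite (_ : (fun th ph => _) = (fun th ph => dens G G (pt4 t r th ph) + \sum_(G <- s) sqmod G t r th ph)); last first.
    by apply/funext => th; apply/funext => ph; rewrite big_cons sqmod_dens.
  have sG := sphfun_dens rtr NG NG.
  by split; [exact: sphfunD|rewrite SintD// big_cons E1].
by rewrite sphere_intE// ?E// => th ph _; apply: sumr_ge0 => G _; exact: sqr_ge0.
Qed.

Lemma AllN_cat s1 s2 : AllN s1 -> AllN s2 -> AllN (s1 ++ s2).
Proof. by elim: s1 => //= G s1 IH [NG N1] N2; split => //; exact: IH. Qed.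
Lemma AllN_map (X : spin_scalar R -> spin_scalar R) s : (forall G, Nice G -> Nice (X G)) -> AllN s -> AllN (map X s).
Proof. by move=> HX; elim: s => //= G s IH [NG Ns]; split; [exact: HX|exact: IH]. Qed.

Lemma AllN_Hwords m F : Nice F -> AllN (Hwords M h m F).
Proof.
move=> NF; elim: m => [|m IH]; first by split.
rewrite /Hwords -/(Hwords M h m F) /HH /=.
by do !apply: AllN_cat => //; apply: AllN_map => // G NG; [exact: Nice_tau|exact: NiceY|exact: (Nice_ang true)|exact: (Nice_ang false)].
Qed.

Definition allwords n F := flatten [seq Hwords M h m F | m <- iota 0 n].

Lemma W_normE n F t : tau0 <= t -> Nice F ->
  W_norm_sq M h 0 n t F = (\sum_(G <- allwords n.+1 F) Nrm G t)%E.
Proof.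
move=> Ht NF; have Na : AllN (allwords n.+1 F).
  rewrite /allwords; elim: (iota 0 n.+1) => //= m s IH; apply: AllN_cat => //; exact: AllN_Hwords.
have [m1 E1] := int_sum Ht Na.
rewrite -E1 /W_norm_sq /Lint integral_itv_obnd_cbnd//.
apply: eq_integral => r /set_mem; rewrite /= in_itv /= andbT => Hr.
have rtr : reg (t, r) by split => //=; exact: ltW.
rewrite -(sphere_sum rtr Na); congr sphere_int; apply/funext => th; apply/funext => ph.
by rewrite powRr0 mul1r /sqmodH /allwords big_flatten big_map -(subn0 n.+1) -/(index_iota 0 n.+1) big_mkord.
Qed.

Let bigHH (f : spin_scalar R -> \bar R) m F :
  (\sum_(G <- Hwords M h m.+1 F) f G = \sum_(X <- HH M h) \sum_(G <- Hwords M h m F) f (X G))%E.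
Proof. by rewrite /Hwords -/(Hwords M h m F) big_allpairs_dep. Qed.

Lemma hword_le_sum i F G (f : spin_scalar R -> \bar R) : (forall G, (0 <= f G)%E) -> hword i F G ->
  (f G <= \sum_(G <- Hwords M h i F) f G)%E.
Proof.
move=> f0 HG; elim: HG f f0 => {i F G} [F|i F G _ IH|i F G _ IH|i F G e _ IH] f f0.
- by rewrite /= big_seq1.
- rewrite bigHH !big_cons big_nil; apply: le_trans (IH (f \o @op_tau R) (fun G => f0 _)) _.
  by rewrite leeDl// !adde_ge0//; apply: sume_ge0.
- rewrite bigHH !big_cons big_nil addeCA; apply: le_trans (IH (f \o oY) (fun G => f0 _)) _.
  by rewrite leeDl// !adde_ge0//; apply: sume_ge0.
- case: e.
  + rewrite bigHH !big_cons big_nil; apply: le_trans (IH (f \o @op_ang R true) (fun G => f0 _)) _.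
    rewrite addeA addeCA leeDl// !adde_ge0//; apply: sume_ge0 => //.
  + rewrite bigHH !big_cons big_nil; apply: le_trans (IH (f \o @op_ang R false) (fun G => f0 _)) _.
    rewrite adde0 !addeA leeDr// !adde_ge0//; apply: sume_ge0 => //.
Qed.

Lemma sum_hword_le i F (f : spin_scalar R -> \bar R) (X : R) : (forall G, hword i F G -> (f G <= X%:E)%E) ->
  (\sum_(G <- Hwords M h i F) f G <= ((4 ^ i)%:R * X)%:E)%E.
Proof.
elim: i f => [|i IH] f Hf.
  by rewrite /= big_seq1 mul1r; apply: Hf; exact: hword0.
rewrite bigHH !big_cons big_nil adde0.
have := IH (f \o @op_tau R) (fun G HG => Hf _ (hword_tau HG)).
have := IH (f \o oY) (fun G HG => Hf _ (hword_Y HG)).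
have := IH (f \o @op_ang R true) (fun G HG => Hf _ (hword_ang true HG)).
have := IH (f \o @op_ang R false) (fun G HG => Hf _ (hword_ang false HG)).
move=> h1 h2 h3 h4; apply: le_trans (leeD h4 (leeD h3 (leeD h2 h1))) _.
by rewrite -!EFinD lee_fin expnS natrM le_eqVlt; apply/orP; left; apply/eqP; ring.
Qed.

Lemma W_norm_wle n F t (D : R) : tau0 <= t -> Nice F -> (W_norm_sq M h 0 n t F <= D%:E)%E -> wle n F t D.
Proof.
move=> Ht NF HW i G Hi HG; apply: le_trans HW; rewrite W_normE//.
have f0 G' : (0 <= Nrm G' t)%E by exact: Nrm_ge0.
apply: (le_trans (hword_le_sum f0 HG)).
rewrite /allwords big_flatten big_map -(subn0 n.+1) -/(index_iota 0 n.+1) big_mkord.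
rewrite (bigD1 (Ordinal (Hi : (i < n.+1)%N)))//= leeDl//; apply: sume_ge0 => j _; exact: sume_ge0.
Qed.

Lemma wle_W_norm n F t (D : R) : tau0 <= t -> Nice F -> wle n F t D ->
  (W_norm_sq M h 0 n t F <= ((\sum_(i < n.+1) (4 ^ i)%:R) * D)%:E)%E.
Proof.
move=> Ht NF HD; rewrite W_normE//.
rewrite /allwords big_flatten big_map -(subn0 n.+1) -/(index_iota 0 n.+1) big_mkord subn0.
rewrite mulr_suml -sumEFin; apply: lee_sum => i _; apply: sum_hword_le => G HG.
by apply: (HD i) => //; rewrite -ltnS.
Qed.

Lemma eqN_tau_angw A F : Nice F -> eqN M tau0 (op_tau (angw A F)) (angw A (op_tau F)).
Proof.
move=> NF; elim: A => [|e A IH]; first exact: eqN_refl.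
exact: (eqN_trans (commN_tau_ang hsmooth e (Nice_angw A NF)) (eqN_ang e IH)).
Qed.
Lemma eqN_Y_angw A F : Nice F -> eqN M tau0 (oY (angw A F)) (angw A (oY F)).
Proof.
move=> NF; elim: A => [|e A IH]; first exact: eqN_refl.
exact: (eqN_trans (commN_Y_ang hsmooth e (Nice_angw A NF)) (eqN_ang e IH)).
Qed.
Lemma eqN_angw A F G : eqN M tau0 F G -> eqN M tau0 (angw A F) (angw A G).
Proof. by move=> E; elim: A => //= e A; exact: eqN_ang. Qed.
Lemma eqN_tau_iterY b F : Nice F -> eqN M tau0 (op_tau (iterY b F)) (iterY b (op_tau F)).
Proof.
move=> NF; elim: b => [|b IH]; first exact: eqN_refl.
exact: (eqN_trans (commN_tau_Y hsmooth (NiceYn fol b NF)) (eqN_Y h IH)).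
Qed.
Lemma eqN_iterY_alt e m b F : Nice F -> eqN M tau0 (alt e m (iterY b F)) (iterY b (alt e m F)).
Proof.
move=> NF; elim: m => [|m IH]; first exact: eqN_refl.
apply: (eqN_trans (eqN_ang _ IH)); apply: eqN_sym.
by apply: (iterY_comm hsmooth b (Nice_alt _ _ NF)) => G NG; exact: commN_Y_ang.
Qed.

(** [d_tau] commutes with every letter and [Y] with the angular ones, so both move inwards; only the
    angular letters keep their order and length. *)
Lemma hword_normal i F G : Nice F -> hword i F G -> exists A b j,
  (size A + b + j = i)%N /\ eqN M tau0 G (angw A (iterY b (iter j (@op_tau R) F))).
Proof.
move=> NF; have Nt j : Nice (iter j (@op_tau R) F) by apply: Nice_iter => // G'; exact: Nice_tau.
have NYt b j : Nice (iterY b (iter j (@op_tau R) F)) by exact: (NiceYn fol b (Nt j)).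
move=> HG; elim: HG NF Nt NYt => {i F G} [F|i F G _ IH|i F G _ IH|i F G e _ IH] NF Nt NYt.
- by exists [::], 0%N, 0%N; split => //; exact: eqN_refl.
- have [A [b [j [S E]]]] := IH NF Nt NYt; exists A, b, j.+1; split; first by rewrite addnS S.
  apply: (eqN_trans (eqN_tau E)); apply: (eqN_trans (eqN_tau_angw A (NYt b j))); apply: eqN_angw.
  exact: (eqN_tau_iterY b (Nt j)).
- have [A [b [j [S E]]]] := IH NF Nt NYt; exists A, b.+1, j; split; first by rewrite addnS addSn S.
  apply: (eqN_trans (eqN_Y h E)); exact: (eqN_Y_angw A (NYt b j)).
- have [A [b [j [S E]]]] := IH NF Nt NYt; exists (e :: A), b, j; split; first by rewrite /= !addSn S.
  exact: (eqN_ang e E).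
Qed.

(** There are finitely many words of length at most [n], so the constants, found word by word, can
    be made uniform. *)
Lemma bounded_words (P : seq bool -> R -> Prop) : (forall A, exists2 C, 0 <= C & P A C) ->
  (forall A C C', C <= C' -> P A C -> P A C') ->
  forall n, exists2 C, 0 <= C & forall A, (size A <= n)%N -> P A C.
Proof.
move=> + + n; elim: n P => [|n IH] P HP mP.
  by have [C C0 PC] := HP [::]; exists C => // A; rewrite leqn0 size_eq0 => /eqP ->.
have [C C0 PC] := HP [::].
have [C1 C10 PC1] := IH (fun A => P (true :: A)) (fun A => HP _) (fun A => mP _).
have [C2 C20 PC2] := IH (fun A => P (false :: A)) (fun A => HP _) (fun A => mP _).
exists (C + C1 + C2); first by rewrite !addr_ge0.
move=> [|[] A] /=; rewrite ?ltnS => HA.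
- by apply: mP PC; rewrite -addrA lerDl addr_ge0.
- by apply: mP (PC1 A HA); rewrite addrAC lerDr addr_ge0.
- by apply: mP (PC2 A HA); rewrite lerDr addr_ge0.
Qed.

Lemma elliptic_bounded n : exists2 C : R, 0 <= C & forall e A F t r, (size A <= n)%N ->
  Nice F -> F.1 = - (sg R e / 2) -> Oset (t, r) ->
  ip (angw A F) (angw A F) t r <= C * \sum_(G <- [seq alt e m F | m <- iota 0 (size A).+1]) ip G G t r.
Proof.
pose P e A C := forall F t r, (size A <= n)%N -> Nice F -> F.1 = - (sg R e / 2) -> Oset (t, r) ->
  ip (angw A F) (angw A F) t r <= C * \sum_(G <- [seq alt e m F | m <- iota 0 (size A).+1]) ip G G t r.
have s0 F e t r k : 0 <= \sum_(m < k) ip (alt e m F) (alt e m F) t r.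
  by apply: sumr_ge0 => m _; exact: ip_ge0.
have Es F e t r k : \sum_(G <- [seq alt e m F | m <- iota 0 k]) ip G G t r = \sum_(m < k) ip (alt e m F) (alt e m F) t r.
  by rewrite big_map -{1}(subn0 k) -/(index_iota 0 k) big_mkord.
have HP e A : exists2 C, 0 <= C & P e A C.
  have [C C0 H] := ell_all M tau0 e (- (sg R e / 2)) A; exists C => // F t r sA NF Fs Otr.
  by apply: (le_trans (H F t r NF Fs Otr)); rewrite Es ler_wpM2l.
have mP e A C C' : C <= C' -> P e A C -> P e A C'.
  move=> CC H F t r sA NF Fs Otr; apply: (le_trans (H F t r sA NF Fs Otr)).
  by rewrite Es ler_wpM2r.
have [C1 C10 H1] := bounded_words (HP true) (mP true) n.
have [C2 C20 H2] := bounded_words (HP false) (mP false) n.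
exists (C1 + C2); first exact: addr_ge0.
move=> e A F t r sA; case: e.
  by apply: (mP true A C1) => //; [rewrite lerDl|exact: H1].
by apply: (mP false A C2) => //; [rewrite lerDr|exact: H2].
Qed.

Lemma wle_iter_tau n j F t D : wle (n + j) F t D -> wle n (iter j (@op_tau R) F) t D.
Proof.
elim: j n => [|j IH] n; first by rewrite addn0.
by rewrite addnS -addSn => /IH /wle_tau.
Qed.
Lemma wle_alt n m e F t D : wle (n + m) F t D -> wle n (alt e m F) t D.
Proof.
elim: m n => [|m IH] n; first by rewrite addn0.
by rewrite addnS -addSn => /IH H; exact: wle_ang.
Qed.

Lemma words_bound n : exists2 C : R, 1 <= C & forall e P Q a D, DP e P Q -> tau0 <= a ->
  wle n P a D -> wle n Q a D -> forall t, a <= t -> wle n P t (C * D) /\ wle n Q t (C * D).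
Proof.
have [C1 C1le HE] := Est_exists M0 fol n.
have [C2 C20 HL] := elliptic_bounded n.
have C10 : 0 < C1 by exact: lt_le_trans C1le.
pose C := 1 + C2 * (n.+1%:R * C1).
have C'0 : 0 <= C2 * (n.+1%:R * C1) by rewrite !mulr_ge0// ltW.
exists C; first by rewrite /C lerDl.
move=> e P Q a D dp Ha wP wQ t; have D0 := wle_ge0 wP.
have CD : D <= C * D by rewrite ler_peMl// /C lerDl.
rewrite le_eqVlt => /orP[/eqP <-|at_].
  by split=> i G Hi HG; [apply: le_trans (wP i G Hi HG) _|apply: le_trans (wQ i G Hi HG) _]; rewrite lee_fin.
have at' := ltW at_; have Ht : tau0 <= t by exact: le_trans at'.
have Ht' : tau0 < t by exact: le_lt_trans at_.
(* The relation between weight and sign is that of [Q] with [e' = e] and that of [P] with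
   [e' = ~~ e], so one argument serves both components. *)
have key F e' : Nice F -> F.1 = - (sg R e' / 2) ->
    (forall m b j, (m + b + j <= n)%N ->
       (Nrm (iterY b (alt e' m (iter j (@op_tau R) F))) t <= (C1 * D)%:E)%E) ->
    wle n F t (C * D).
  move=> NF Fs HF i G Hi HG; have [A [b [j [S E]]]] := hword_normal NF HG.
  have NFj : Nice (iter j (@op_tau R) F) by apply: Nice_iter => // G'; exact: Nice_tau.
  have NH : Nice (iterY b (iter j (@op_tau R) F)) by exact: (NiceYn fol b NFj).
  set H := iterY b _ in E NH.
  have Hs : H.1 = - (sg R e' / 2).
    have -> : H.1 = (iter j (@op_tau R) F).1 by exact: iterY_w.
    by rewrite -Fs; elim: (j).
  rewrite (eqN_Nrm Ht E).
  have Na k l : AllN [seq alt e' m H | m <- iota k l].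
    by elim: l k => //= l IH k; split => //; exact: Nice_alt.
  have El r : 2 * M < r -> ip (angw A H) (angw A H) t r <=
      C2 * \sum_(G <- [seq alt e' m H | m <- iota 0 (size A).+1]) ip G G t r.
    move=> Hr; have sA : (size A <= n)%N by rewrite (leq_trans _ Hi)// -S -addnA leq_addr.
    by apply: HL => //; split.
  apply: le_trans (Nrm_le_sum Ht (Nice_angw A NH) (Na 0%N _) C20 El (lexx _)) _.
  have -> : (C * D = C2 * (n.+1%:R * (C1 * D)) + D)%R by rewrite /C; ring.
  apply: (@le_trans _ _ (C2 * (n.+1%:R * (C1 * D)))%:E); last by rewrite lee_fin lerDl.
  rewrite EFinM lee_wpmul2l// big_map -{1}(subn0 (size A).+1) -/(index_iota 0 (size A).+1) big_mkord.
  apply: (@le_trans _ _ (\sum_(m < (size A).+1) (C1 * D)%:E)%E).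
    apply: lee_sum => m _; rewrite (eqN_Nrm Ht (eqN_iterY_alt e' m b NFj)); apply: HF.
    by rewrite (leq_trans _ Hi)// -S -!addnA leq_add2r -ltnS.
  rewrite sumEFin lee_fin sumr_const card_ord -[leLHS]mulr_natl; apply: ler_wpM2r; first by rewrite mulr_ge0// ltW.
  by rewrite ler_nat ltnS (leq_trans _ Hi)// -S -addnA leq_addr.
split.
- apply: (key P (~~ e)) => //; first exact: DP_P dp.
    by rewrite (DP_wP dp) sg_neg mulNr opprK.
  move=> m b j mbj; have dpj := DP_alt hsmooth m (DP_iter_tau hsmooth j dp).
  have mb : (b + m + j <= n)%N by rewrite [(b + m)%N]addnC.
  have bn : (b <= n)%N by rewrite (leq_trans _ mb)// -addnA leq_addr.
  exact: (HE b _ _ _ a D bn dpj Ha (wle_alt (wle_iter_tau (wle_le mb wP))) (wle_alt (wle_iter_tau (wle_le mb wQ))) t at').1.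
- apply: (key Q e) => //; [exact: DP_Q dp|exact: DP_wQ dp|].
  move=> m b j mbj; have dpj := DP_alt hsmooth m (DP_iter_tau hsmooth j dp).
  have mb : (b + m + j <= n)%N by rewrite [(b + m)%N]addnC.
  have bn : (b <= n)%N by rewrite (leq_trans _ mb)// -addnA leq_addr.
  exact: (HE b _ _ _ a D bn dpj Ha (wle_alt (wle_iter_tau (wle_le mb wP))) (wle_alt (wle_iter_tau (wle_le mb wQ))) t at').2.
Qed.

End WordNorms.

(** * The flux through the event horizon *)

Section Horizon.
Variables (R : realType) (M tau0 : R) (h : R -> R) (r_away r_far : R).
Hypothesis M0 : 0 < M.
Hypothesis fol : foliation M h r_away r_far tau0.
Let hsmooth := fol_smooth fol.
Implicit Types F G P Q : spin_scalar R.
Notation RR := (measurableTypeR R).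
Notation lam := (@lebesgue_measure R).
Notation reg := (reg M tau0).
Notation Nice := (Nice M tau0).
Notation oY := (op_Y M h).
Notation iterY n := (iter n oY).

Lemma sub_dec (F F' G : R -> R) (a b : R) : a <= b ->
  (forall x, a <= x <= b -> is_derive x (1 : R) F (F' x)) ->
  (forall x, a <= x <= b -> {for x, continuous F'}) ->
  (forall x y, a <= x -> x < y -> y <= b -> F y < F x) ->
  (forall u, F b <= u <= F a -> {for u, continuous G}) ->
  (\int[lam]_(u in `[F b, F a]) (G u)%:E = \int[lam]_(x in `[a, b]) (G (F x) * - F' x)%:E)%E.
Proof.
rewrite le_eqVlt => /orP[/eqP <- *|ab dF cF' decF cG].
  by rewrite !set_itv1 !integral_set1.
have E x : a <= x <= b -> F^`()%classic x = F' x.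
  by move=> /dF H; rewrite derive1E; have [_ ->] := H.
have cF x : a <= x <= b -> {for x, continuous F} by move=> /dF; exact: is_derive1_continuous.
have aa : a <= a <= b by rewrite lexx ltW.
have bb : a <= b <= b by rewrite lexx ltW.
rewrite (@integration_by_substitution_decreasing _ F G a b (ltW ab)).
- apply: eq_integral => x /set_mem; rewrite /= in_itv /= => /E Ex.
  by rewrite /= !fctE Ex.
- move=> x y; rewrite !in_itv /= => /andP[x1 x2] /andP[y1 y2] xy; exact: decF.
- move=> x; rewrite in_itv /= => /andP[x1 x2].
  have xab : a <= x <= b by rewrite !ltW.
  rewrite /continuous_at (E _ xab); apply: cvg_trans (cF' x xab).
  apply: near_eq_cvg; near=> y; apply/esym/E; apply/andP; split; apply: ltW; near: y.
    exact: lt_nbhsr.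
  exact: lt_nbhsl.
- apply/cvg_ex; exists (F' a); apply: cvg_trans (cvg_at_right_filter (cF' a aa)).
  apply: near_eq_cvg; near=> y; apply/esym/E; apply/andP; split; first by apply: ltW; near: y; exact: nbhs_right_gt.
  by near: y; apply: nbhs_right_le.
- apply/cvg_ex; exists (F' b); apply: cvg_trans (cvg_at_left_filter (cF' b bb)).
  apply: near_eq_cvg; near=> y; apply/esym/E; apply/andP; split; last by apply: ltW; near: y; exact: nbhs_left_lt.
  by near: y; apply: nbhs_left_ge.
- split.
  + move=> x; rewrite in_itv /= => /andP[x1 x2].
    by have [] : is_derive x (1 : R) F (F' x) by apply: dF; rewrite !ltW.
  + exact: cvg_at_right_filter (cF a aa).
  + exact: cvg_at_left_filter (cF b bb).
- apply: (@continuous_in_subspaceT _ _ `[F b, F a] G) => u; rewrite inE /= in_itv /=; exact: cG.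
Unshelve. all: by end_near. Qed.

(** A translation is the composition of two reflections, so the substitution rule for decreasing
    maps suffices. *)
Lemma int_shift (f : R -> R) (a b s : R) : a <= b -> (forall x, a <= x <= b -> {for x, continuous f}) ->
  (\int[lam]_(x in `[(a + s)%R, (b + s)%R]) (f (x - s))%:E = \int[lam]_(x in `[a, b]) (f x)%:E)%E.
Proof.
move=> ab cf.
have main s' : (\int[lam]_(x in `[(a + s')%R, (b + s')%R]) (f (x - s'))%:E =
    \int[lam]_(y in `[(- b)%R, (- a)%R]) (f (- y))%:E)%E.
  have dF x : is_derive x (1 : R) (fun y => s' - y) (-1).
    by apply: (is_derive_eq (is_deriveB (is_derive_cst s' x 1) (is_derive_id x 1))); rewrite sub0r.
  have -> : a + s' = s' - - a by rewrite opprK addrC.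
  have -> : b + s' = s' - - b by rewrite opprK addrC.
  rewrite (@sub_dec (fun y => s' - y) (fun _ => -1) (fun x => f (x - s')) (- b) (- a)).
  - apply: eq_integral => y _; rewrite opprK mulr1; congr (f _)%:E; ring.
  - by rewrite lerN2.
  - by move=> x _; exact: cst_continuous.
  - by move=> x y _ xy _; rewrite ltrD2l ltrN2.
  - move=> u Hu; apply: (@continuous_comp _ _ _ (fun u => u - s') f).
      by apply: cvgB; [exact: cvg_id|exact: cvg_cst].
    by apply: cf; move: Hu; lra.
rewrite main -(main 0) !addr0; apply: eq_integral => x _; by rewrite subr0.
Qed.

Lemma zeta_quarter (c v : R) : 0 < c -> v <= c / 2 -> 4^-1 <= zeta c v.
Proof.
move=> c0 vc; rewrite /zeta.
have -> : 4^-1 = (2^-1 : R) ^+ 2 by field.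
rewrite ler_pXn2r ?nnegrE ?invr_ge0//; last by rewrite divr_ge0 ?(ltW c0)// le_max lexx.
by rewrite ler_pdivlMr// le_max; apply/orP; right; lra.
Qed.

Lemma horizon_le P t1 t2 (X : R) : tau0 <= t1 -> t1 < t2 -> Nice P ->
  (forall c : R, 0 < c -> \int[lam]_(t in `]t1, t2[) (zeta c (t + h (2 * M)) * ip P P t (2 * M)) <= X) ->
  (horizon_int M h t1 t2 (sqmod P) <= (4 * X)%:E)%E.
Proof.
move=> H1 t12 NP HX; set s := h (2 * M).
have gP := good_ip NP NP.
have M2 : 2 * M <= 2 * M by [].
have rt t : t1 <= t -> reg (t, 2 * M) by move=> tt; split => //=; exact: le_trans tt.
have ct t : t1 <= t <= t2 -> {for t, continuous (fun t => ip P P t (2 * M))}.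
  by move=> /andP[/rt tt _]; have [g1 _ _] := gP; exact: (g1 _ _ tt).
have -> : horizon_int M h t1 t2 (sqmod P) = (\int[lam]_(t in `[t1, t2]) (ip P P t (2 * M))%:E)%E.
  rewrite -(int_shift s (ltW t12) ct); apply: eq_integral => v /set_mem; rewrite /= in_itv /= => /andP[v1 v2].
  by apply: sphere_int_sqmod => //; apply: rt; rewrite lerBrDr.
have iP := good_int_t t2 H1 M2 gP.
rewrite (@integral_itv_bndoo _ _ _ _ true false); last first.
  by have /measurable_int := iP.
(* On the whole time interval [v <= c / 2], so [zeta >= 1/4]; this is the origin of the factor
   [4]. *)
pose c := 2 * (`|t2 + s| + 1); have c0 : 0 < c by rewrite mulr_gt0// ltr_wpDl.
have mT : measurable (`]t1, t2[%classic : set RR) by exact: measurable_itv.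
have iZ := good_int_t t2 H1 M2 (goodM (good_zeta fol c0) gP).
have := HX c c0; rewrite -(ler_pM2l (_ : 0 < 4 :> R))// -lee_fin; apply: le_trans.
rewrite -RintegralZl// -[leLHS]fineK; last exact: (integrable_fin_num mT iP).
rewrite lee_fin; apply: le_Rintegral => //.
  exact: (good_int_t t2 H1 M2 (goodM (good_cst _ _ 4) (goodM (good_zeta fol c0) gP))).
move=> t; rewrite /= in_itv /= => /andP[tt1 tt2].
rewrite mulrA ler_peMl ?ip_ge0// -ler_pdivrMl// mulr1 zeta_quarter//.
rewrite /c mulrAC mulfV// mul1r (@le_trans _ _ (t2 + s))//; first by rewrite lerD2r ltW.
by rewrite (le_trans (ler_norm _))// lerDl.
Qed.

End Horizon.

(** * Future null infinity *)

Section Scri.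
Variables (R : realType) (M tau0 : R) (h : R -> R) (r_away r_far : R).
Hypothesis M0 : 0 < M.
Hypothesis fol : foliation M h r_away r_far tau0.
Let hsmooth := fol_smooth fol.
Implicit Types F G P Q : spin_scalar R.
Notation RR := (measurableTypeR R).
Notation lam := (@lebesgue_measure R).
Notation lam2 := (lam \x lam)%E.
Notation reg := (reg M tau0).
Notation Nice := (Nice M tau0).
Notation oY := (op_Y M h).
Notation good := (good M tau0).
Notation Nrm := (Nrm M).
Notation iterY n := (iter n oY).

Lemma rstar_lt (r s : R) : 2 * M < r -> r < s -> rstar M r < rstar M s.
Proof.
move=> Mr rs; rewrite /rstar.
have lt1 : ln (r - 2 * M) < ln (s - 2 * M) by rewrite ltr_ln ?posrE; lra.
have M2 : 0 < 2 * M by rewrite mulr_gt0.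
have : 2 * M * (ln (r - 2 * M) - ln M) < 2 * M * (ln (s - 2 * M) - ln M) by rewrite ltr_pM2l// ltrD2r.
by move: lt1 => _; lra.
Qed.

Lemma rstar_inj (r s : R) : 2 * M < r -> 2 * M < s -> rstar M r = rstar M s -> r = s.
Proof.
move=> Mr Ms E; have [rs|rs|//] := ltgtP r s.
  by have := rstar_lt Mr rs; rewrite E ltxx.
by have := rstar_lt Ms rs; rewrite E ltxx.
Qed.

Lemma r_uvE (u c r : R) : 2 * M < r -> u = c - 2 * rstar M r -> r_uv M u c = r.
Proof.
move=> Mr ->; apply: xget_unique; first by split => //; field.
move=> y [My Ey]; apply: rstar_inj => //; by rewrite Ey; field.
Qed.

(** The coordinate [u] as a function of [r] along [{v = c}]. *)
Let F c r := c - 2 * rstar M r.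

Lemma is_derive_F c r : 2 * M < r -> is_derive r (1 : R) (F c) (- (2 * (mu M r)^-1)).
Proof.
move=> Mr; have D := is_derive_rstar M0 Mr.
apply: (is_derive_eq (is_deriveB (is_derive_cst c r 1) (is_deriveM (is_derive_cst (2 : R) r 1) D))).
by rewrite /GRing.scale /= mulr0 addr0 sub0r.
Qed.

Lemma F_lt c r s : 2 * M < r -> r < s -> F c s < F c r.
Proof. by move=> Mr rs; have := rstar_lt Mr rs; rewrite /F; lra. Qed.

Lemma F_surj c a b u : 2 * M < a -> a <= b -> F c b <= u <= F c a -> exists2 r, a <= r <= b & u = F c r.
Proof.
move=> Ma ab Hu.
have cF : {within `[a, b], continuous (F c)}.
  apply: (@continuous_in_subspaceT _ _ `[a, b] (F c)) => r; rewrite inE /= in_itv /= => /andP[ar _].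
  by apply: is_derive1_continuous (is_derive_F c _); exact: lt_le_trans ar.
have H : Num.min (F c a) (F c b) <= u <= Num.max (F c a) (F c b).
  have /andP[h1 h2] := Hu; have := le_trans h1 h2 => h3.
  by rewrite min_r// max_l// h1.
have [r + E] := IVT ab cF H; rewrite in_itv /= => Hr; by exists r.
Qed.

(** [r_uv] is obtained by choice, but [F c] is strictly decreasing and onto between its values:
    nearby [u] have their radius in [[r - d, r + d]]. *)
Lemma r_uv_continuous c r : 2 * M < r -> {for F c r, continuous (r_uv M ^~ c)}.
Proof.
move=> Mr; rewrite /prop_for /continuous_at (r_uvE Mr erefl).
apply/cvgrPdist_le => /= e e0.
pose d := Num.min e ((r - 2 * M) / 2).
have d0 : 0 < d by rewrite lt_min e0 divr_gt0// subr_gt0.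
have de : d <= e by rewrite ge_min lexx.
have dr : d <= (r - 2 * M) / 2 by rewrite ge_min lexx orbT.
have Ma : 2 * M < r - d by lra.
have rd : r - d < r by rewrite gtrBl.
have rd' : r < r + d by rewrite ltrDl.
near=> u.
have Hu : F c (r + d) <= u <= F c (r - d).
  apply/andP; split; apply: ltW; near: u.
    by apply: lt_nbhsr; exact: F_lt.
  by apply: lt_nbhsl; exact: F_lt.
have [|s /andP[s1 s2] Es] := F_surj Ma _ Hu; first by lra.
rewrite (r_uvE (lt_le_trans Ma s1) Es) ler_norml; apply/andP; split; lra.
Unshelve. all: by end_near. Qed.

Section Slab.
Variables t1 t2 : R.
Hypothesis H1 : tau0 <= t1.
Hypothesis t12 : t1 < t2.

(** Times are clamped to the slab so that the integrands are defined and measurable for all [c] and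
    [r], including points of [{v = c}] outside it. *)
Let clip (t : R) := Num.min t2 (Num.max t1 t).
Let clip_ge t : t1 <= clip t. Proof. by rewrite /clip le_min (ltW t12) le_max lexx. Qed.
Let clip_le t : clip t <= t2. Proof. by rewrite /clip ge_min lexx. Qed.
Let clip_id t : t1 <= t <= t2 -> clip t = t.
Proof. by move=> /andP[h1 h2]; rewrite /clip max_r// min_r. Qed.
Let clip_cont : continuous clip.
Proof.
move=> t; apply: continuous_min; first exact: cst_continuous.
by apply: continuous_max; [exact: cst_continuous|exact: cvg_id].
Qed.
Let clip_tau t : tau0 <= clip t. Proof. exact: le_trans (clip_ge t). Qed.

(** A Lipschitz constant in [t] uniform in [r] upgrades separate continuity to continuity along
    curves [(t(r), r)], as needed on [{v = c}]. *)
Lemma ip_lipschitz G d : Nice G -> exists2 B : R, 0 <= B & forall t t' r, t1 <= t <= t2 -> t1 <= t' <= t2 ->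
  2 * M <= r <= d -> `|ip G G t r - ip G G t' r| <= B * `|t - t'|.
Proof.
move=> NG; have gG : good (ip (op_tau G) G) by apply: good_ip => //; exact: Nice_tau.
have [_ _ /(_ t2 d)[B B0 HB]] := gG.
have dG t r : t1 <= t -> 2 * M <= r -> is_derive t (1 : R) (fun t => ip G G t r) (2 * ip (op_tau G) G t r).
  move=> tt Hr; have rtr : reg (t, r) by split => //=; exact: le_trans tt.
  by apply: (is_derive_eq (is_derive_ip_tau rtr NG NG)); rewrite [ip G _ _ _]ipC -mulr2n mulr_natl.
have main t t' r : t1 <= t -> t <= t' -> t' <= t2 -> 2 * M <= r <= d ->
    `|ip G G t' r - ip G G t r| <= 2 * B * `|t' - t|.
  move=> h1 h2 h3 /andP[r1 r2].
  have D x : x \in `]t, t'[ -> is_derive x (1 : R) (fun t => ip G G t r) (2 * ip (op_tau G) G x r).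
    by rewrite in_itv /= => /andP[x1 _]; apply: dG => //; rewrite (le_trans h1)// ltW.
  have Cn' : {within `[t, t'], continuous (fun t => ip G G t r)}.
    apply: (@continuous_in_subspaceT _ _ `[t, t']) => x; rewrite inE /= in_itv /= => /andP[x1 x2].
    by apply: is_derive1_continuous (dG x r _ r1); exact: le_trans x1.
  have [x + ->] := MVT_segment h2 D Cn'; rewrite in_itv /= => /andP[x1 x2].
  rewrite normrM ler_wpM2r// normrM ger0_norm// ler_wpM2l// HB ?r1//.
  by rewrite (le_trans H1) ?(le_trans h1)//= (le_trans x2).
exists (2 * B); first by rewrite mulr_ge0.
move=> t t' r /andP[h1 h2] /andP[h3 h4] Hr; have [tt|/ltW tt] := leP t t'.
  by rewrite distrC [`|t - t'|]distrC; exact: main.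
exact: main.
Qed.

Lemma ip_clip_continuous G (g : R -> R) r : Nice G -> 2 * M < r -> {for r, continuous g} ->
  {for r, continuous (fun r => ip G G (clip (g r)) r)}.
Proof.
move=> NG Mr cg; have [B B0 HB] := ip_lipschitz (r + 1) NG.
set T := clip (g r).
have rT : reg (T, r) by split => /=; [exact: clip_tau|exact: ltW].
have c1 : ip G G T s @[s --> r] --> ip G G T r by have [_ + _] := good_ip NG NG; apply.
apply: (cvg_sub0 _ c1).
have c2 : B * `|clip (g s) - T| @[s --> r] --> (0 : R).
  have c3 : clip (g s) @[s --> r] --> T by apply: (continuous_comp cg); exact: clip_cont.
  have c4 : `|clip (g s) - T| @[s --> r] --> (0 : R).
    rewrite -(normr0 R) -(subrr T); apply: cvg_norm; apply: cvgB => //; exact: cvg_cst.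
  by rewrite -(mulr0 B); apply: cvgM => //; exact: cvg_cst.
apply: norm_cvg0; apply: (squeeze_cvgr _ (cvg_cst (0 : R)) c2).
near=> s; rewrite normr_ge0 /=; apply: HB.
- by rewrite clip_ge clip_le.
- by rewrite clip_ge clip_le.
- by apply/andP; split; apply: ltW; near: s; [exact: lt_nbhsr|apply: lt_nbhsl; rewrite ltrDl].
Unshelve. all: by end_near. Qed.

Let h_cont r : 2 * M <= r -> {for r, continuous h}.
Proof. exact: (fol_h_continuous fol). Qed.

Let h_le r s : 2 * M <= r -> r <= s -> h r <= h s.
Proof.
have [k k0 H] := fol_h_growth M0 fol => Hr rs; have := H r s Hr rs.
by apply: le_trans; rewrite lerDl mulr_ge0 ?subr_ge0// ltW.
Qed.
Let h_lt_inv r s : 2 * M <= s -> h r < h s -> r < s.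
Proof. by move=> Ms hs; rewrite ltNge; apply/negP => sr; move: hs; rewrite ltNge h_le. Qed.
Let h_le_inv r s : 2 * M <= s -> h r <= h s -> r <= s.
Proof.
have [k k0 H] := fol_h_growth M0 fol => Ms hs; rewrite leNgt; apply/negP => sr.
have := H s r Ms (ltW sr) => hh.
have : 0 < k * (r - s) by rewrite mulr_gt0// subr_gt0.
by move=> ?; lra.
Qed.

Variables P Q Qs : spin_scalar R.
Hypothesis NP : Nice P.
Hypothesis NQ : Nice Q.
Hypothesis HQs : forall t r th ph, reg (t, r) -> 2 * M < r -> 0 < th < pi ->
  sqmod Qs t r th ph = Delta M r * sqmod Q t r th ph.

Let f t r := ip P P t r + Delta M r * ip Q Q t r.

Let Delta_ge0 r : 2 * M <= r -> 0 <= Delta M r.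
Proof.
move=> Hr; rewrite (_ : Delta M r = r * (r - 2 * M)); last by rewrite /Delta; ring.
by rewrite mulr_ge0 ?subr_ge0// (le_trans _ Hr)// mulr_ge0// ltW.
Qed.

Let f_ge0 t r : 2 * M <= r -> 0 <= f t r.
Proof. by move=> Hr; rewrite addr_ge0 ?ip_ge0// mulr_ge0 ?ip_ge0// Delta_ge0. Qed.

Lemma sphere_scri t r : reg (t, r) -> 2 * M < r ->
  sphere_int (fun th ph => sqmod P t r th ph + sqmod Qs t r th ph) = (f t r)%:E.
Proof.
move=> rtr Mr; have sP := sphfun_dens rtr NP NP; have sQ := sphfun_dens rtr NQ NQ.
have sQ' := sphfunM (sphfun_cst (Delta M r)) sQ.
rewrite /f /ip -(SintZ _ sQ) -SintD// -sphere_intE.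
- rewrite /sphere_int /Lint; apply: eq_integral => th /set_mem; rewrite /= in_itv /= => Hth.
  by apply: eq_integral => ph _; rewrite HQs// !sqmod_dens.
- exact: sphfunD.
- move=> th ph _; rewrite addr_ge0 ?dens_ge0// mulr_ge0 ?dens_ge0//; exact: Delta_ge0 (ltW Mr).
Qed.

Let Delta_cont (r : R) : {for r, continuous (Delta M)}.
Proof. exact: is_derive1_continuous (dcoefsP M 0 ord0 r). Qed.

Let f_clip_continuous (g : R -> R) r : 2 * M < r -> {for r, continuous g} ->
  {for r, continuous (fun r => f (clip (g r)) r)}.
Proof.
move=> Mr cg; rewrite /f; apply: continuousD; first exact: (ip_clip_continuous NP Mr cg).
by apply: continuousM; [exact: Delta_cont|exact: (ip_clip_continuous NQ Mr cg)].
Qed.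

(** Selects the part of [{v = c}] in the slab; on [{v = c}] one has [tau = c - h r]. *)
Let chi c r : R := \1_(`[t1, t2]%classic : set RR) (c - h r).

Let mu_inv_le r : 4 * M <= r -> 0 <= (mu M r)^-1 <= 2.
Proof.
move=> Hr; have r0 : 0 < r by apply: lt_le_trans Hr; rewrite mulr_gt0.
have m2 : 2^-1 <= mu M r.
  rewrite /mu lerBrDr -lerBrDl (_ : 1 - 2^-1 = 2^-1); last by field.
  by rewrite ler_pdivrMr//; lra.
have m0 : 0 < mu M r by apply: lt_le_trans m2; rewrite invr_gt0.
by rewrite invr_ge0 (ltW m0)/= -[leRHS]invrK lef_pV2 ?posrE ?invr_gt0.
Qed.

Let mu_cont' r : 2 * M < r -> {for r, continuous (fun r => 2 * (mu M r)^-1)}.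
Proof.
move=> Mr; have r0 : 0 < r by apply: lt_trans Mr; rewrite mulr_gt0.
apply: continuousM; first exact: cst_continuous.
apply: continuousV.
  by rewrite gt_eqF// /mu subr_gt0 ltr_pdivrMr// mul1r.
apply: continuousB; first exact: cst_continuous.
apply: continuousM; first exact: cst_continuous.
by apply: continuousV; [rewrite gt_eqF|exact: cvg_id].
Qed.

Let mu_cont r : 2 * M < r -> {for r, continuous (fun r => - (2 * (mu M r)^-1))}.
Proof. by move=> Mr; apply: continuousN; exact: mu_cont'. Qed.

(* For c large the slice of {v = c} is parametrized by r in [r1, r2]. *)
Lemma v_int_le c L (K : R -> R) : h (4 * M) < c - t2 -> 4 * M < L -> c - t1 < h L ->
  measurable_fun (`]2 * M, L[ : set RR) (fun r => K r * chi c r) ->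
  (forall r, 2 * M < r < L -> 0 <= K r * chi c r) ->
  (forall r, 4 * M <= r -> r < L -> t1 <= c - h r <= t2 -> f (c - h r) r <= K r) ->
  (v_int M h t1 t2 (fun t r th ph => (sqmod P t r th ph + sqmod Qs t r th ph)%R) c <=
   \int[lam]_(r in `](2 * M)%R, L[) (4 * (K r * chi c r))%:E)%E.
Proof.
move=> c1 ML c2 mK K0 HK.
have M24 : 2 * M < 4 * M by rewrite ltr_pM2r// ltr_nat.
have M24' := ltW M24.
have ch : {within `[4 * M, L], continuous h}.
  apply: (@continuous_in_subspaceT _ _ `[4 * M, L] h) => r; rewrite inE /= in_itv /= => /andP[r1 _].
  by apply: h_cont; exact: le_trans r1.
have sol v : h (4 * M) <= v <= h L -> exists2 r, 4 * M <= r <= L & h r = v.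
  move=> /andP[v1 v2]; have H : Num.min (h (4 * M)) (h L) <= v <= Num.max (h (4 * M)) (h L).
    by rewrite ge_min v1 /= le_max v2 orbT.
  by have [r + E] := IVT (ltW ML) ch H; rewrite in_itv /= => Hr; exists r.
have [r1 /andP[r11 r12] E1] : exists2 r, 4 * M <= r <= L & h r = c - t2 by apply: sol; apply/andP; split; have := t12; lra.
have [r2 /andP[r21 r22] E2] : exists2 r, 4 * M <= r <= L & h r = c - t1 by apply: sol; apply/andP; split; have := t12; lra.
have r1M : 2 * M < r1 by exact: lt_le_trans r11.
have r2M : 2 * M < r2 by exact: lt_le_trans r21.
have r12' : r1 < r2 by apply: h_lt_inv; [exact: ltW|rewrite E1 E2; have := t12; lra].
have r2L : r2 < L by apply: h_lt_inv; [lra|rewrite E2].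
have inS r : 2 * M <= r -> (r1 <= r <= r2) = (t1 <= c - h r <= t2).
  move=> Hr; apply/idP/idP => /andP[h1 h2].
    have := h_le (ltW r1M) h1; have := h_le Hr h2; rewrite E1 E2 => g1 g2; apply/andP; split; lra.
  apply/andP; split; apply: h_le_inv => //; [rewrite E1|exact: ltW|rewrite E2]; lra.
have Er r : r1 <= r <= r2 -> 2 * M < r by move=> /andP[h1 _]; exact: lt_le_trans h1.
pose g u := f (clip (c - h (r_uv M u c))) (r_uv M u c).
have EU : [set u | t1 <= c - h (r_uv M u c) <= t2] = `[F c r2, F c r1]%classic.
  apply/seteqP; split => u /=; rewrite in_itv /=.
    rewrite /r_uv; case: xgetP => [r Ex [Mr Er'] Hu|_ Hu].
      have Eu : u = F c r by rewrite /F Er'; field.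
      move: Hu; rewrite -(inS _ (ltW Mr)) => /andP[h1 h2]; rewrite Eu.
      have ant x y : 2 * M < x -> x <= y -> F c y <= F c x.
        by move=> Mx; rewrite le_eqVlt => /orP[/eqP ->//|/(F_lt c Mx)/ltW].
      by rewrite !ant.
    (* If no radius corresponds to [(u, c)], [r_uv] takes its default [3 M]; the point would then
       violate [tau <= t2], since [h (4 M) < c - t2]. *)
    have M3 : h (3 * M) <= h (4 * M) by apply: h_le; rewrite ler_pM2r ?ler_nat.
    by move: Hu; lra.
  move=> /(F_surj r1M (ltW r12'))[r Hr Eu]; have Mr := Er r Hr.
  by rewrite (r_uvE Mr Eu) -(inS _ (ltW Mr)).
rewrite /v_int /Lint EU.
have -> : (\int[lam]_(u in `[F c r2, F c r1])
    sphere_int (fun th ph => (sqmod P (c - h (r_uv M u c)) (r_uv M u c) th ph + sqmod Qs (c - h (r_uv M u c)) (r_uv M u c) th ph)%R) =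
    \int[lam]_(u in `[F c r2, F c r1]) (g u)%:E)%E.
  apply: eq_integral => u /set_mem; rewrite /= in_itv /= => /(F_surj r1M (ltW r12'))[r Hr Eu].
  have Mr := Er r Hr; rewrite /g (r_uvE Mr Eu).
  move: Hr; rewrite (inS _ (ltW Mr)) => Hr; rewrite (clip_id Hr) sphere_scri//.
  by split => /=; [case/andP: Hr => /(le_trans H1)|exact: ltW].
have dF r : r1 <= r <= r2 -> is_derive r (1 : R) (F c) (- (2 * (mu M r)^-1)).
  by move=> Hr; apply: is_derive_F; exact: Er.
have cF r : r1 <= r <= r2 -> {for r, continuous (fun r => - (2 * (mu M r)^-1))}.
  by move=> Hr; apply: mu_cont; exact: Er.
have aF x y : r1 <= x -> x < y -> y <= r2 -> F c y < F c x.
  by move=> x1 xy _; apply: F_lt => //; exact: lt_le_trans x1.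
have cg u : F c r2 <= u <= F c r1 -> {for u, continuous g}.
  move=> /(F_surj r1M (ltW r12'))[r Hr ->]; have Mr := Er r Hr.
  apply: (@continuous_comp _ _ _ (r_uv M ^~ c) (fun r => f (clip (c - h r)) r)); first exact: r_uv_continuous.
  rewrite (r_uvE Mr erefl); apply: f_clip_continuous => //.
  by apply: continuousB; [exact: cst_continuous|apply: h_cont; exact: ltW].
rewrite (sub_dec (ltW r12') dF cF aF cg).
(* The Jacobian [2 / mu] of [u] with respect to [r] is at most [4] because [r1 >= 4 M]. *)
pose k r := f (clip (c - h r)) r * (2 * (mu M r)^-1).
have mI : measurable (`[r1, r2]%classic : set RR) by exact: measurable_itv.
have mJ : measurable (`]2 * M, L[%classic : set RR) by exact: measurable_itv.
have IJ : (`[r1, r2]%classic : set RR) `<=` `]2 * M, L[%classic.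
  by move=> r /=; rewrite !in_itv /= => /andP[h1 h2]; rewrite (lt_le_trans r1M)//= (le_lt_trans h2).
have mK4 : measurable_fun (`]2 * M, L[ : set RR) (fun r => (4 * (K r * chi c r))%:E).
  by apply/measurable_EFinP; apply: measurable_funM => //; exact: measurable_cst.
apply: (@le_trans _ _ (\int[lam]_(r in `[r1, r2]) (4 * (K r * chi c r))%:E)%E); last first.
  apply: ge0_subset_integral => // r; rewrite /= in_itv /= => Hr.
  by rewrite lee_fin mulr_ge0// K0.
apply: (@le_trans _ _ (\int[lam]_(r in `[r1, r2]) (k r)%:E)%E).
  rewrite le_eqVlt; apply/orP; left; apply/eqP; apply: eq_integral => r /set_mem; rewrite /= in_itv /= => Hr.
  by rewrite opprK /g (r_uvE (Er r Hr) erefl).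
apply: ge0_le_integral => //.
- move=> r; rewrite /= in_itv /= => Hr; have Mr := Er r Hr.
  have /andP[Hr1 _] := Hr; have r4 := le_trans r11 Hr1.
  have /andP[m0 _] := mu_inv_le r4.
  by rewrite lee_fin; exact: (mulr_ge0 (f_ge0 _ (ltW Mr)) (mulr_ge0 (ler0n _ 2) m0)).
- apply/measurable_EFinP; apply: (@measurable_funS _ _ _ _ (`]2 * M, +oo[%classic : set RR)).
  + exact: measurable_itv.
  + by move=> r /IJ /=; rewrite !in_itv /= => /andP[-> _].
  apply: open_continuous_measurable_fun; first exact: interval_open.
  move=> r; rewrite inE /= in_itv /= andbT => Mr.
  apply: (@continuousM _ _ (fun r => f (clip (c - h r)) r) (fun r => 2 * (mu M r)^-1)).
    apply: f_clip_continuous => //.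
    by apply: continuousB; [exact: cst_continuous|apply: h_cont; exact: ltW].
  exact: mu_cont'.
- exact: measurable_funS mK4.
- move=> r; rewrite /= in_itv /= => Hr; have Mr := Er r Hr.
  have /andP[Hr1 Hr2] := Hr; have r4 := le_trans r11 Hr1.
  have /andP[m0 m2] := mu_inv_le r4.
  move: Hr; rewrite (inS _ (ltW Mr)) => Hr.
  have -> : chi c r = 1 by rewrite /chi indicE mem_set//= in_itv.
  have m4 : 2 * (mu M r)^-1 <= 4 by move: m2; lra.
  have fK := HK r r4 (le_lt_trans Hr2 r2L) Hr.
  rewrite mulr1 /k clip_id// lee_fin mulrC.
  exact: ler_pM (mulr_ge0 (ler0n _ 2) m0) (f_ge0 _ (ltW Mr)) m4 fK.
Qed.

Variable X : R.
Hypothesis HX : forall t, t1 <= t -> (Nrm P t <= X%:E)%E.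
Hypothesis HF : forall c L : R, 0 < c -> 2 * M < L ->
  (forall t r, tau0 <= t -> t1 <= t -> L <= r -> c <= t + h r) ->
  fine (\int[lam2]_(z in `]t1, t2[ `*` `](2 * M)%R, L[)
    (- dzeta c (z.1 + h z.2) * (2 * z.2 ^+ 2 * ip Q Q z.1 z.2))%:E)%E <= X.

Let X0 : 0 <= X. Proof. exact: Nrm_D_ge0 (HX (lexx t1)). Qed.

Section Average.
Variable N : R.
Hypothesis N0 : 0 < N.

(** Normalized so that [w >= 1/2] for [c <= 2 N], where [- dzeta] at [3 N] is at least [2 / (9 N)].
    Then [w * 2 r^2 >= r^2 >= Delta], so the controlled cutoff term dominates the density of
    [Phi_-]. *)
Let w c := 9 / 4 * N * - dzeta (3 * N) c.
Let w_ge0 c : 0 <= w c.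
Proof. by rewrite mulr_ge0 ?oppr_ge0 ?dzeta_le0// mulr_ge0 ?divr_ge0// ltW. Qed.
Let w_cont : continuous w.
Proof.
move=> c; apply: (@continuousM _ _ (fun _ => 9 / 4 * N) (fun c => - dzeta (3 * N) c)); first exact: cst_continuous.
by apply: continuousN; exact: continuous_dzeta.
Qed.
Let w_ge c : c <= 2 * N -> 2^-1 <= w c.
Proof.
move=> cN; rewrite /w /dzeta opprK.
have -> : 2^-1 = 9 / 4 * N * (2 * N / (3 * N) ^+ 2) by field; exact: lt0r_neq0.
rewrite ler_wpM2l ?mulr_ge0 ?divr_ge0 ?(ltW N0)// ler_pM2r ?invr_gt0 ?exprn_gt0 ?mulr_gt0//.
by rewrite ler_pM2l// le_max; apply/orP; right; lra.
Qed.

Let k c t r := ip P P t r + w c * (2 * r ^+ 2 * ip Q Q t r).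
Let k_ge0 c t r : 0 <= k c t r.
Proof. by rewrite addr_ge0 ?ip_ge0// mulr_ge0// mulr_ge0 ?ip_ge0// mulr_ge0// sqr_ge0. Qed.

Let f_le_k c t r : 2 * M < r -> c <= 2 * N -> f t r <= k c t r.
Proof.
move=> Mr cN; rewrite lerD2l mulrA ler_wpM2r ?ip_ge0//.
have r0 : 0 <= 2 * M * r by rewrite !mulr_ge0// ?ltW// (lt_trans _ Mr)// mulr_gt0.
apply: (@le_trans _ _ (2^-1 * (2 * r ^+ 2))); last by rewrite ler_wpM2r ?w_ge// mulr_ge0// sqr_ge0.
by rewrite mulrA mulVf// mul1r /Delta gerBl.
Qed.

Let K c r := k c (clip (c - h r)) r.
Let chi_ge0 c r : 0 <= chi c r. Proof. by rewrite /chi indicE; case: (_ \in _). Qed.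

Let clip_continuous G r : Nice G -> 2 * M < r -> continuous (fun c => ip G G (clip (c - h r)) r).
Proof.
move=> NG Mr c; apply: (@continuous_comp _ _ _ (fun c => clip (c - h r)) (fun t => ip G G t r)).
  apply: (@continuous_comp _ _ _ (fun c => c - h r) clip); last exact: clip_cont.
  by apply: continuousB; [exact: cvg_id|exact: cst_continuous].
by have [+ _ _] := good_ip NG NG; apply; split => /=; [exact: clip_tau|exact: ltW].
Qed.

Let clip_measurable G : Nice G ->
  measurable_fun ((`]2 * M, +oo[%classic : set RR) `*` setT) (fun z : RR * RR => ip G G (clip (z.2 - h z.1)) z.1).
Proof.
move=> NG.
have oU : open (`]2 * M, +oo[%classic : set R) by exact: interval_open.
apply: (measurable_caratheodory (f := fun (r : R) (c : RR) => ip G G (clip (c - h r)) r) oU).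
- move=> c r; rewrite /= in_itv /= andbT => Mr; apply: (ip_clip_continuous NG Mr (g := fun r => c - h r)).
  by apply: continuousB; [exact: cst_continuous|apply: h_cont; exact: ltW].
- move=> r; rewrite /= in_itv /= andbT => Mr; apply: continuous_measurable_fun; exact: clip_continuous.
Qed.

Let mD : measurable ((`]2 * M, +oo[%classic : set RR) `*` (setT : set RR)).
Proof. by apply: measurableX => //; exact: measurable_itv. Qed.

Let chi_measurable :
  measurable_fun ((`]2 * M, +oo[%classic : set RR) `*` setT) (fun z : RR * RR => chi z.2 z.1).
Proof.
have m1 : measurable_fun setT (\1_(`[t1, t2]%classic : set RR) : RR -> R).
  by apply: measurable_indic; exact: measurable_itv.
have oU : open (`]2 * M, +oo[%classic : set R) by exact: interval_open.
suff m2 : measurable_fun ((`]2 * M, +oo[%classic : set RR) `*` setT) (fun z : RR * RR => z.2 - h z.1).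
  exact: (measurableT_comp m1 m2).
apply: (measurable_caratheodory (f := fun (r : R) (c : RR) => c - h r) oU).
- move=> c r; rewrite /= in_itv /= andbT => Mr.
  by apply: continuousB; [exact: cst_continuous|apply: h_cont; exact: ltW].
- move=> r _; apply: continuous_measurable_fun => c.
  by apply: continuousB; [exact: cvg_id|exact: cst_continuous].
Qed.

Let Kchi_measurable :
  measurable_fun ((`]2 * M, +oo[%classic : set RR) `*` setT) (fun z : RR * RR => K z.2 z.1 * chi z.2 z.1).
Proof.
have m1 := measurable_funS measurableT (@subsetT _ ((`]2 * M, +oo[%classic : set RR) `*` setT)) (measurableT_comp (continuous_measurable_fun w_cont) (@measurable_snd _ _ RR RR)).
have c2 : continuous (fun r : R => 2 * r ^+ 2) by move=> r; apply: cvgMr; exact: exprn_continuous.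
have m2 := measurable_funS measurableT (@subsetT _ ((`]2 * M, +oo[%classic : set RR) `*` setT)) (measurableT_comp (continuous_measurable_fun c2) (@measurable_fst _ _ RR RR)).
exact: (measurable_funM (measurable_funD (clip_measurable NP) (measurable_funM m1 (measurable_funM m2 (clip_measurable NQ)))) chi_measurable).
Qed.

Let K_section r : 2 * M < r -> measurable_fun setT (fun c : RR => K c r * chi c r).
Proof.
move=> Mr; have := measurable_comp mD _ Kchi_measurable (@pair1_measurable _ _ RR RR r); apply.
by move=> z [c _ <-]; split => //=; rewrite in_itv /= andbT.
Qed.

Let K_measurable c : measurable_fun (`]2 * M, +oo[%classic : set RR) (fun r : RR => K c r * chi c r).
Proof.
have m2 := measurable_funS measurableT (@subsetT _ (`]2 * M, +oo[%classic : set RR)) (@pair2_measurable _ _ RR RR c).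
have := measurable_comp mD _ Kchi_measurable m2; apply.
by move=> z [r Hr <-]; split.
Qed.

Let int_P L : 2 * M < L ->
  (\int[lam2]_(z in `]t1, t2[ `*` `](2 * M)%R, L[) (ip P P z.1 z.2)%:E <= ((t2 - t1) * X)%:E)%E.
Proof.
move=> ML; have gP := good_ip NP NP.
have mT : measurable (`]t1, t2[%classic : set RR) by exact: measurable_itv.
have mI : measurable (`]2 * M, L[%classic : set RR) by exact: measurable_itv.
have iP := good_int2 t2 L H1 gP.
rewrite (fubini_rect mT mI iP).1.
apply: (@le_trans _ _ (\int[lam]_(t in `]t1, t2[) X%:E)%E).
  apply: ge0_le_integral => //=.
  - by move=> t _; apply: integral_ge0 => r _; rewrite lee_fin ip_ge0.
  - by apply: (tonelli_measurable mT mI (measurable_int _ iP) _).1 => z _; rewrite lee_fin ip_ge0.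
  - move=> t; rewrite in_itv /= => /andP[tt1 _].
    apply: le_trans (HX (ltW tt1)); apply: ge0_subset_integral => //.
    + have Htt : tau0 <= t by rewrite (le_trans H1)// ltW.
      exact: (Nrm_measurable Htt NP).
    + by move=> r _; rewrite lee_fin ip_ge0.
    + by move=> r /=; rewrite !in_itv /= => /andP[-> _].
rewrite (integral_cst _ mT) /= lebesgue_measure_itv /= lte_fin t12 -EFinB -EFinM mulrC lee_fin.
exact: lexx.
Qed.

(** At fixed [r], [c = t + h r] is a translation of [t], so the double integral is at most one over
    the slab. There the part in [P] contributes [4 (t2 - t1) X <= 4 N X], the cutoff term
    [4 * (9/4) N X = 9 N X]. *)
Let average L : 2 * M < L -> t2 - t1 <= N ->
  (forall t r, tau0 <= t -> t1 <= t -> L <= r -> 3 * N <= t + h r) ->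
  measurable_fun (`]N, 2 * N[%classic : set RR) (fun c => \int[lam]_(r in `](2 * M)%R, L[) (4 * (K c r * chi c r))%:E)%E /\
  (\int[lam]_(c in `]N, (2 * N)%R[) \int[lam]_(r in `](2 * M)%R, L[) (4 * (K c r * chi c r))%:E <= (13 * N * X)%:E)%E.
Proof.
move=> ML Nt HL.
have mI : measurable (`]2 * M, L[%classic : set RR) by exact: measurable_itv.
have mT : measurable (`]t1, t2[%classic : set RR) by exact: measurable_itv.
have mC : measurable (`]N, 2 * N[%classic : set RR) by exact: measurable_itv.
pose ff (z : RR * RR) := (4 * (K z.2 z.1 * chi z.2 z.1))%:E.
have mff : measurable_fun ((`]2 * M, L[%classic : set RR) `*` (`]N, 2 * N[%classic : set RR)) ff.
  apply/measurable_EFinP; apply: measurable_funM; first exact: measurable_cst.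
  apply: measurable_funS Kchi_measurable => //.
  by move=> z [/= + _]; rewrite !in_itv /= andbT => /andP[-> _].
have ff0 z : ((`]2 * M, L[%classic : set RR) `*` (`]N, 2 * N[%classic : set RR)) z -> (0 <= ff z)%E.
  by move=> _; rewrite lee_fin mulr_ge0// mulr_ge0// k_ge0.
split; first exact: (tonelli_measurable mI mC mff ff0).2.
have <- := (tonelli_rect mI mC mff ff0).2.
rewrite (tonelli_rect mI mC mff ff0).1.
pose kk t r := ip P P t r + 9 / 4 * N * (- dzeta (3 * N) (t + h r) * (2 * r ^+ 2 * ip Q Q t r)).
have gP := good_ip NP NP; have gQ := good_ip NQ NQ.
have N3 : 0 < 3 * N by rewrite mulr_gt0.
pose dd t r := - dzeta (3 * N) (t + h r) * (2 * r ^+ 2 * ip Q Q t r).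
have gd : good dd.
  have gz : good (fun t r => - dzeta (3 * N) (t + h r)).
    rewrite (_ : (fun t r => _) = (fun t r => -1 * dzeta (3 * N) (t + h r))).
      by apply: goodM; [exact: good_cst|exact: (good_dzeta fol)].
    by apply/funext => t; apply/funext => r; rewrite mulN1r.
  apply: goodM => //; apply: goodM => //; apply: good_rho => r _; apply: cvgMr; exact: exprn_continuous.
have gk : good kk by apply: goodD => //; exact: (goodM (good_cst _ _ (9 / 4 * N)) gd).
have g4 : good (fun t r => 4 * kk t r) by exact: (goodM (good_cst _ _ 4) gk).
have i4 := good_int2 t2 L H1 g4.
have dd0 t r : 0 <= dd t r.
  by rewrite /dd mulr_ge0 ?oppr_ge0 ?dzeta_le0// mulr_ge0 ?ip_ge0// mulr_ge0// sqr_ge0.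
have N94 : 0 <= 9 / 4 * N by rewrite mulr_ge0 ?divr_ge0// ltW.
have kk0 t r : 0 <= kk t r by rewrite /kk addr_ge0 ?ip_ge0//; exact: (mulr_ge0 N94 (dd0 t r)).
apply: (@le_trans _ _ (\int[lam]_(r in `](2 * M)%R, L[) \int[lam]_(t in `]t1, t2[) (4 * kk t r)%:E)%E).
  apply: ge0_le_integral => //=.
  - by move=> r Hr; apply: integral_ge0 => c Hc; rewrite lee_fin mulr_ge0// mulr_ge0// k_ge0.
  - exact: (tonelli_measurable mI mC mff ff0).1.
  - by apply: (tonelli_measurable mT mI (measurable_int _ i4) _).2 => z _; rewrite lee_fin mulr_ge0.
  move=> r; rewrite /= in_itv /= => /andP[Mr rL]; have Mr' := ltW Mr.
  have ck t : t1 <= t <= t2 -> {for t, continuous (fun t => 4 * kk t r)}.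
    by move=> /andP[tt _]; have [+ _ _] := g4; apply; split => //=; exact: le_trans tt.
  have iT := good_int_t t2 H1 Mr' g4.
  rewrite -(@integral_itv_bndoo _ _ _ (fun t => (4 * kk t r)%:E) true false); last by have /measurable_int := iT.
  rewrite -(int_shift (h r) (ltW t12) ck).
  pose S : set RR := `[t1 + h r, t2 + h r]%classic.
  have mS : measurable S by exact: measurable_itv.
  have Sin c : S c -> t1 <= c - h r <= t2.
    by rewrite /S /= in_itv /= lerBrDr lerBlDr.
  rewrite [leLHS]integral_mkcond [leRHS]integral_mkcond; apply: ge0_le_integral => //=.
  - by move=> c _; rewrite /patch; case: ifP => // _; rewrite lee_fin mulr_ge0// mulr_ge0// k_ge0.
  - apply/(measurable_restrictT _ mC); apply/measurable_EFinP; apply: measurable_funM; first exact: measurable_cst.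
    exact: measurable_funS (K_section Mr).
  - apply/(measurable_restrictT _ mS); apply/measurable_EFinP.
    apply: (@eq_measurable_fun _ _ _ _ S (fun c : RR => 4 * kk (clip (c - h r)) r)).
      by move=> c /set_mem cS; rewrite clip_id//; exact: Sin.
    apply: measurable_funS (measurableT) (@subsetT _ _) _; apply: continuous_measurable_fun => c.
    apply: (@continuous_comp _ _ _ (fun c => clip (c - h r)) (fun t => 4 * kk t r)).
      apply: (@continuous_comp _ _ _ (fun c => c - h r) clip); last exact: clip_cont.
      by apply: continuousB; [exact: cvg_id|exact: cst_continuous].
    by have [+ _ _] := g4; apply; split => //=; exact: clip_tau.
  move=> c _; rewrite /patch; case: ifPn => [_|_]; last first.
    by case: ifP => // _; rewrite lee_fin mulr_ge0.
  rewrite /ff /=; case: ifPn => [/set_mem cS|cS].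
    have Hc := Sin c cS; rewrite lee_fin ler_wpM2l//.
    have -> : chi c r = 1 by rewrite /chi indicE mem_set//= in_itv.
    by rewrite mulr1 /K /k (clip_id Hc) /w /kk subrK !mulrA lexx.
  rewrite (_ : chi c r = 0) ?mulr0//.
  rewrite /chi indicE memNset// /= in_itv /= => Hc; move/negP: cS; apply; apply/mem_set.
  by rewrite /S /= in_itv /=; case/andP: Hc => g1 g2; apply/andP; split; [rewrite -lerBrDr|rewrite -lerBlDr].
rewrite -(fubini_rect mT mI i4).2.
have iP := good_int2 t2 L H1 gP; have id_ := good_int2 t2 L H1 gd.
have mTI := measurableX mT mI.
have -> : (\int[lam2]_(z in `]t1, t2[ `*` `](2 * M)%R, L[) (4 * kk z.1 z.2)%:E =
    4%:E * \int[lam2]_(z in `]t1, t2[ `*` `](2 * M)%R, L[) (ip P P z.1 z.2)%:E +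
    (9 * N)%:E * \int[lam2]_(z in `]t1, t2[ `*` `](2 * M)%R, L[) (dd z.1 z.2)%:E)%E.
  have N9 : 0 <= 9 * N by rewrite mulr_ge0// ltW.
  rewrite -ge0_integralZl_EFin//; last 2 first.
  - by move=> z _; rewrite lee_fin ip_ge0.
  - exact: (measurable_int _ iP).
  rewrite -ge0_integralZl_EFin//; last 2 first.
  - by move=> z _; rewrite lee_fin dd0.
  - exact: (measurable_int _ id_).
  rewrite -ge0_integralD//.
  - by apply: eq_integral => z _; rewrite -!EFinM -EFinD; congr EFin; rewrite /kk -/(dd z.1 z.2); field.
  - by move=> z _; rewrite -EFinM lee_fin mulr_ge0 ?ip_ge0.
  - by apply: measurable_funeM; exact: (measurable_int _ iP).
  - by move=> z _; rewrite -EFinM lee_fin mulr_ge0.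
  - by apply: measurable_funeM; exact: (measurable_int _ id_).
have Hd := HF N3 ML HL.
have {}Hd : (\int[lam2]_(z in `]t1, t2[ `*` `](2 * M)%R, L[) (dd z.1 z.2)%:E <= X%:E)%E.
  by rewrite -[leLHS]fineK ?lee_fin//; exact: (integrable_fin_num mTI id_).
have N9 : (0 <= (9 * N)%:E)%E by rewrite lee_fin mulr_ge0// ltW.
have E4 : (0 <= 4%:E :> \bar R)%E by rewrite lee_fin.
apply: (le_trans (leeD (lee_wpmul2l E4 (int_P ML)) (lee_wpmul2l N9 Hd))).
rewrite -!EFinM -EFinD lee_fin.
have -> : 13 * N * X = 4 * (N * X) + 9 * N * X by ring.
by rewrite lerD2r ler_wpM2l// ler_wpM2r.
Qed.

(** A lower bound for all slices with [c > N] is a lower bound for their mean over an interval of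
    length [N]; dividing [13 N X] by [N] leaves a constant independent of the slab. *)
Lemma inf_le (m : \bar R) : t2 - t1 <= N -> t2 + h (4 * M) < N -> (0 <= m)%E ->
  (forall c, N < c -> (m <= v_int M h t1 t2 (fun t r th ph => (sqmod P t r th ph + sqmod Qs t r th ph)%R) c)%E) ->
  (m <= (13 * X)%:E)%E.
Proof.
move=> a2 a3 m0 Hm.
have [L0 ML0 HL0] := fol_v_unbounded M0 fol (3 * N).
pose L := L0 + 4 * M.
have M4 : 0 < 4 * M by rewrite mulr_gt0.
have LL : L0 <= L by rewrite /L lerDl ltW.
have ML : 2 * M < L by exact: lt_le_trans LL.
have HL t r : tau0 <= t -> t1 <= t -> L <= r -> 3 * N <= t + h r.
  by move=> Ht _ Lr; apply: HL0 => //; exact: le_trans Lr.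
have M2 : 0 < 2 * M by rewrite mulr_gt0.
have ML4 : 4 * M < L by rewrite /L; lra.
have hL : 3 * N <= t1 + h L by exact: HL.
have Kchi_ge0 c r : 0 <= K c r * chi c r by rewrite mulr_ge0// k_ge0.
have mle c : N < c < 2 * N -> (m <= \int[lam]_(r in `](2 * M)%R, L[) (4 * (K c r * chi c r))%:E)%E.
  move=> /andP[c1 c2]; apply: (le_trans (Hm c c1)); apply: v_int_le => //.
  - by rewrite ltrBrDl (lt_trans a3).
  - rewrite ltrBlDl (lt_le_trans _ hL)// (lt_trans c2)// ltr_pM2r// ltr_nat //.
  - apply: measurable_funS (K_measurable c); first exact: measurable_itv.
    by move=> r /=; rewrite !in_itv /= andbT => /andP[-> _].
  - move=> r r4 rL Hr; rewrite /K clip_id//; apply: f_le_k; last exact: ltW.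
    by apply: lt_le_trans r4; rewrite ltr_pM2r// ltr_nat.
have mC : measurable (`]N, 2 * N[%classic : set RR) by exact: measurable_itv.
have [mB avg] := average ML a2 HL.
have H : (m * N%:E <= (13 * N * X)%:E)%E.
  apply: le_trans avg.
  have -> : (m * N%:E = \int[lam]_(c in `]N, (2 * N)%R[) m)%E.
    rewrite (integral_cst _ mC) /= lebesgue_measure_itv /= lte_fin ifT ?ltr_pMl ?ltr1n//.
    by rewrite -EFinB; congr (_ * _%:E)%E; ring.
  apply: ge0_le_integral => //=.
move: m m0 H {Hm mle} => [m|//|//] m0; last by rewrite gt0_mulye ?lte_fin// leNgt ltry.
by rewrite -EFinM !lee_fin mulrAC ler_pM2r.
Qed.

End Average.

Lemma scri_le : (scri_int M h t1 t2 (fun t r th ph => (sqmod P t r th ph + sqmod Qs t r th ph)%R) <= (13 * X)%:E)%E.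
Proof.
rewrite /scri_int limf_einfE; apply: ge_ereal_sup => _ [V [A [_ HA]] <-].
(* Large enough for the slices [c > N] to belong to the given neighbourhood of infinity, for [N] to
   exceed the length of the slab, and for these slices to meet the slab beyond [4 M]. *)
pose N := `|A| + `|t2 - t1| + `|t2 + h (4 * M)| + 1.
have N1 : 1 <= N by rewrite /N lerDr !addr_ge0.
have N0 : 0 < N by exact: lt_le_trans N1.
have a1 : A < N by rewrite /N; have := ler_norm A; have := normr_ge0 (t2 - t1); have := normr_ge0 (t2 + h (4 * M)); lra.
have a2 : t2 - t1 <= N.
  by rewrite /N; have := ler_norm (t2 - t1); have := normr_ge0 A; have := normr_ge0 (t2 + h (4 * M)); lra.
have a3 : t2 + h (4 * M) < N.
  by rewrite /N; have := ler_norm (t2 + h (4 * M)); have := normr_ge0 A; have := normr_ge0 (t2 - t1); lra.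
apply: (inf_le N0 a2 a3).
  apply: le_ereal_inf_tmp => _ [c _ <-]; apply: integral_ge0 => u _; apply: integral_ge0 => th; rewrite /= in_itv /= => Hth.
  apply: integral_ge0 => ph _; rewrite lee_fin mulr_ge0 ?addr_ge0 ?sqr_ge0//.
  by apply/ltW/sin_gt0_pi.
by move=> c Nc; apply: ereal_inf_lbound; exists c => //; apply: HA; exact: lt_trans Nc.
Qed.

End Slab.

End Scri.

(** * The theorem *)

Section Rotation.
Variables (R : realType) (M tau0 : R) (h : R -> R) (r_away r_far : R).
Hypothesis M0 : 0 < M.
Hypothesis fol : foliation M h r_away r_far tau0.
Let hsmooth := fol_smooth fol.
Implicit Types F G P Q : spin_scalar R.
Notation reg := (reg M tau0).
Notation Nice := (Nice M tau0).
Notation oY := (op_Y M h).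
Notation Nrm := (Nrm M).
Notation wle := (wle M h).
Notation iterY n := (iter n oY).

(** [d_phi] is not among the letters of the norm. It is recovered from the difference of [eth] and
    [ethp] times [sin / 2], plus a multiple of the field by [s cos]; [c] and [k] stand for [cos] and
    [sin]. *)
Lemma pd_phi_le (u v w s c k : R) : c ^+ 2 + k ^+ 2 = 1 ->
  (k / 2 * (u - v) + s * c * w) ^+ 2 <= u ^+ 2 + v ^+ 2 + 2 * s ^+ 2 * w ^+ 2.
Proof.
move=> ck.
have h1 : (k / 2 * (u - v) + s * c * w) ^+ 2 <= 2 * (k / 2 * (u - v)) ^+ 2 + 2 * (s * c * w) ^+ 2.
  by rewrite -subr_ge0 (_ : _ - _ = (k / 2 * (u - v) - s * c * w) ^+ 2) ?sqr_ge0//; field.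
apply: (le_trans h1); apply: lerD.
  apply: (@le_trans _ _ (1 * (u ^+ 2 + v ^+ 2))); last by rewrite mul1r.
  apply: (@le_trans _ _ (k ^+ 2 * (u ^+ 2 + v ^+ 2))).
    rewrite -subr_ge0 (_ : _ - _ = 2^-1 * (k * (u + v)) ^+ 2); last by field.
    by rewrite mulr_ge0 ?sqr_ge0// invr_ge0.
  by rewrite ler_wpM2r ?addr_ge0 ?sqr_ge0// -ck lerDr sqr_ge0.
apply: (@le_trans _ _ (2 * s ^+ 2 * w ^+ 2 * c ^+ 2)); first by rewrite le_eqVlt; apply/orP; left; apply/eqP; ring.
have c1 : c ^+ 2 <= 1 by rewrite -ck lerDl sqr_ge0.
have k0 : 0 <= 2 * s ^+ 2 * w ^+ 2.
  by apply: mulr_ge0; [apply: mulr_ge0 => //; exact: sqr_ge0|exact: sqr_ge0].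
by rewrite ler_piMr.
Qed.

Let phi_dens (A1 A2 B1 B2 w1 w2 s c k u1 u2 v1 v2 : R) : 0 < k -> c ^+ 2 + k ^+ 2 = 1 ->
  u1 = A1 - 1 * k^-1 * B2 - 1 * s * (c / k) * w1 -> v1 = A1 - -1 * k^-1 * B2 - -1 * s * (c / k) * w1 ->
  u2 = A2 + 1 * k^-1 * B1 - 1 * s * (c / k) * w2 -> v2 = A2 + -1 * k^-1 * B1 - -1 * s * (c / k) * w2 ->
  B1 * B1 + B2 * B2 <= (1 + 2 * s ^+ 2) * (u1 * u1 + u2 * u2 + (v1 * v1 + v2 * v2 + (w1 * w1 + w2 * w2))).
Proof.
move=> k0 ck Eu1 Ev1 Eu2 Ev2; have kn := lt0r_neq0 k0.
have E1 : B1 = k / 2 * (u2 - v2) + s * c * w2 by rewrite Eu2 Ev2; field.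
have E2 : B2 = k / 2 * (v1 - u1) + (- s) * c * w1 by rewrite Eu1 Ev1; field.
have h1 := pd_phi_le u2 v2 w2 s ck; have h2 := pd_phi_le v1 u1 w1 (- s) ck.
rewrite -E1 in h1; rewrite -E2 in h2; rewrite sqrrN in h2.
rewrite -!expr2; have s0 := sqr_ge0 s.
have p1 : 0 <= s ^+ 2 * u1 ^+ 2 by rewrite mulr_ge0 ?sqr_ge0.
have p2 : 0 <= s ^+ 2 * u2 ^+ 2 by rewrite mulr_ge0 ?sqr_ge0.
have p3 : 0 <= s ^+ 2 * v1 ^+ 2 by rewrite mulr_ge0 ?sqr_ge0.
have p4 : 0 <= s ^+ 2 * v2 ^+ 2 by rewrite mulr_ge0 ?sqr_ge0.
have p5 := sqr_ge0 w1; have p6 := sqr_ge0 w2.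
have -> : (1 + 2 * s ^+ 2) * (u1 ^+ 2 + u2 ^+ 2 + (v1 ^+ 2 + v2 ^+ 2 + (w1 ^+ 2 + w2 ^+ 2))) =
  (u2 ^+ 2 + v2 ^+ 2 + 2 * s ^+ 2 * w2 ^+ 2) + (v1 ^+ 2 + u1 ^+ 2 + 2 * s ^+ 2 * w1 ^+ 2) +
  (2 * (s ^+ 2 * u1 ^+ 2) + 2 * (s ^+ 2 * u2 ^+ 2) + 2 * (s ^+ 2 * v1 ^+ 2) + 2 * (s ^+ 2 * v2 ^+ 2) + w1 ^+ 2 + w2 ^+ 2).
  by ring.
apply: (le_trans (lerD h1 h2)); rewrite lerDl !addr_ge0// mulr_ge0//.
Qed.

Lemma ip_phi t r F : reg (t, r) -> Nice F -> ip (op_phi F) (op_phi F) t r <=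
  (1 + 2 * F.1 ^+ 2) * (ip (op_ang true F) (op_ang true F) t r + (ip (op_ang false F) (op_ang false F) t r + ip F F t r)).
Proof.
move=> rtr NF; pose G1 := op_ang true F; pose G2 := op_ang false F.
have s1 := sphfun_dens rtr (Nice_ang true NF) (Nice_ang true NF).
have s2 := sphfun_dens rtr (Nice_ang false NF) (Nice_ang false NF).
have s3 := sphfun_dens rtr NF NF; have s4 := sphfun_dens rtr (Nice_phi NF) (Nice_phi NF).
have s5 := sphfunD s1 (sphfunD s2 s3); have s6 := sphfunM (sphfun_cst (1 + 2 * F.1 ^+ 2)) s5.
rewrite /ip -(SintD s2 s3) -(SintD s1 (sphfunD s2 s3)) -(SintZ _ s5).
apply: le_Sint => // th ph Hth.
have Hs : 0 < sin th by exact: sin_gt0_pi.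
rewrite /dens.
have -> : fre (op_phi F).2 (pt4 t r th ph) = pd o3 (fre F.2) (pt4 t r th ph) by exact: fre_d_phiE.
have -> : fim (op_phi F).2 (pt4 t r th ph) = pd o3 (fim F.2) (pt4 t r th ph) by exact: fim_d_phiE.
have ck := cos2Dsin2 th.
have E1 := fre_angE true F.1 F.2 (pt4 t r th ph); have E2 := fre_angE false F.1 F.2 (pt4 t r th ph).
have E3 := fim_angE true F.1 F.2 (pt4 t r th ph); have E4 := fim_angE false F.1 F.2 (pt4 t r th ph).
rewrite !pt4S /sg /= in E1 E2 E3 E4.
exact: (phi_dens Hs ck E1 E2 E3 E4).
Qed.

(** Each [d_phi] is traded for one angular letter or none, and commutes with the letters. The weight
    changes on the way, so the induction is for all weights. *)
Lemma phi_bound n s : exists2 C : R, 0 <= C & forall F t D, tau0 <= t -> Nice F -> F.1 = s ->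
  wle n F t D -> (Nrm (iter n (@op_phi R) F) t <= (C * D)%:E)%E.
Proof.
have Nphi m F : Nice F -> Nice (iter m (@op_phi R) F) by move=> NF; apply: Nice_iter => // G; exact: Nice_phi.
elim: n s => [|n IH] s.
  by exists 1 => // F t D Ht NF _ HD; rewrite mul1r; apply: (HD 0%N) => //; exact: hword0.
have [C1 C10 H1] := IH (s + sg R true); have [C2 C20 H2] := IH (s + sg R false); have [C3 C30 H3] := IH s.
have k0 : 0 <= 1 + 2 * s ^+ 2 by rewrite addr_ge0// mulr_ge0// sqr_ge0.
exists ((1 + 2 * s ^+ 2) * (C1 + (C2 + C3))); first by rewrite mulr_ge0// !addr_ge0.
move=> F t D Ht NF Fs HD; set G := iter n (@op_phi R) F; have NG : Nice G by exact: Nphi.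
have Gs : G.1 = s by rewrite -Fs /G; elim: (n).
have E e : eqN M tau0 (op_ang e G) (iter n (@op_phi R) (op_ang e F)).
  rewrite /G; elim: (n) => [|m IHm]; first exact: eqN_refl.
  apply: (eqN_trans (eqN_sym (commN_phi_ang hsmooth e (Nphi m F NF)))); exact: eqN_phi.
have H r : 2 * M < r -> ip (iter n.+1 (@op_phi R) F) (iter n.+1 (@op_phi R) F) t r <=
    (1 + 2 * s ^+ 2) * \sum_(K <- [:: op_ang true G; op_ang false G; G]) ip K K t r.
  move=> Hr; rewrite !big_cons big_nil addr0 -Gs; apply: ip_phi => //; by split => //=; exact: ltW.
have Na : AllN M tau0 [:: op_ang true G; op_ang false G; G].
  by split; [exact: Nice_ang|split; [exact: Nice_ang|split]].
have NF1 := Nphi n.+1 F NF.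
rewrite -mulrA EFinM; apply: (Nrm_le_sum Ht NF1 Na k0 H).
have b1 : (Nrm (op_ang true G) t <= (C1 * D)%:E)%E.
  rewrite (eqN_Nrm Ht (E true)); apply: H1 => //; [exact: Nice_ang|by rewrite /= Fs|exact: wle_ang].
have b2 : (Nrm (op_ang false G) t <= (C2 * D)%:E)%E.
  rewrite (eqN_Nrm Ht (E false)); apply: H2 => //; [exact: Nice_ang|by rewrite /= Fs|exact: wle_ang].
have b3 : (Nrm G t + 0 <= (C3 * D)%:E)%E.
  by rewrite adde0; apply: H3 => //; exact: wle_le (leqnSn n) HD.
have -> : (C1 + (C2 + C3)) * D = C1 * D + (C2 * D + C3 * D) by ring.
have := leeD b1 (leeD b2 b3); rewrite 3!big_cons big_nil; exact.
Qed.

Lemma eqN_iter_phi_alt e m j a F : Nice F ->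
  eqN M tau0 (alt e m (iter j (@op_tau R) (iter a (@op_phi R) F))) (iter a (@op_phi R) (alt e m (iter j (@op_tau R) F))).
Proof.
move=> NF.
have Nphi n G : Nice G -> Nice (iter n (@op_phi R) G) by move=> NG; apply: Nice_iter => // H; exact: Nice_phi.
have Nt n G : Nice G -> Nice (iter n (@op_tau R) G) by move=> NG; apply: Nice_iter => // H; exact: Nice_tau.
have c1 G : Nice G -> eqN M tau0 (op_tau (iter a (@op_phi R) G)) (iter a (@op_phi R) (op_tau G)).
  move=> NG; elim: a => [|a IH]; first exact: eqN_refl.
  exact: (eqN_trans (eqN_sym (commN_phi_tau hsmooth (Nphi a G NG))) (eqN_phi IH)).
have c2 e' G : Nice G -> eqN M tau0 (op_ang e' (iter a (@op_phi R) G)) (iter a (@op_phi R) (op_ang e' G)).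
  move=> NG; elim: a {c1} => [|a IH]; first exact: eqN_refl.
  exact: (eqN_trans (eqN_sym (commN_phi_ang hsmooth e' (Nphi a G NG))) (eqN_phi IH)).
elim: m => [|m IH]; last exact: (eqN_trans (eqN_ang _ IH) (c2 _ _ (Nice_alt _ _ (Nt j F NF)))).
elim: j => [|j IH]; first exact: eqN_refl.
exact: (eqN_trans (eqN_tau IH) (c1 _ (Nt j F NF))).
Qed.

Lemma alt_bound e m j a s : exists2 C : R, 0 <= C & forall F t D n, tau0 <= t -> Nice F -> F.1 = s ->
  (m + j + a <= n)%N -> wle n F t D ->
  (Nrm (alt e m (iter j (@op_tau R) (iter a (@op_phi R) F))) t <= (C * D)%:E)%E.
Proof.
(* A dummy field: only the weight of its alternating product matters, so that the constant is chosen
   before [F]. *)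
pose F0 : spin_scalar R := (s, fun _ _ _ _ => 0).
have [C C0 HC] := phi_bound a (alt e m F0).1; exists C => // F t D n Ht NF Fs mn HD.
rewrite (eqN_Nrm Ht (eqN_iter_phi_alt e m j a NF)); apply: HC => //.
- by apply: Nice_alt; apply: Nice_iter => // G; exact: Nice_tau.
- have w1 : (iter j (@op_tau R) F).1 = s by rewrite -Fs; elim: (j).
  by elim: m {mn} => [|m IH] //=; rewrite IH.
- apply: wle_alt; apply: wle_iter_tau; apply: wle_le HD.
  by rewrite -addnA addnC.
Qed.

End Rotation.

(** * Multi-indices and the rescaled component [Phi_-] *)

Section Multi.
Variables (R : realType) (M tau0 : R) (h : R -> R) (r_away r_far : R).
Hypothesis M0 : 0 < M.
Hypothesis fol : foliation M h r_away r_far tau0.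
Let hsmooth := fol_smooth fol.
Implicit Types F G P Q : spin_scalar R.
Notation reg := (reg M tau0).
Notation Nice := (Nice M tau0).
Notation oY := (op_Y M h).
Notation hp := (h^`()%classic : R -> R).
Notation Oset := (Oset M tau0).
Notation DP := (DP M tau0 h).
Notation iterY n := (iter n oY).

Lemma multiE (b : bool) a1 a2 a3 a4 F : (a1 < 2)%N -> ~~ odd a2 ->
  multi (op_ang b) (op_ang (~~ b)) a1 a2 a3 a4 F = alt b (a1 + a2) (iter a3 (@op_tau R) (iter a4 (@op_phi R) F)).
Proof.
move=> a1lt a2e; rewrite /multi; set G := iter a3 _ _.
have -> : iter a2./2 (op_ang (~~ b) \o op_ang b) G = alt b a2 G.
  rewrite -{2}(odd_double_half a2) (negbTE a2e) add0n.
  elim: (a2./2) => //= m ->; by rewrite odd_double addbF addbT.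
case: a1 a1lt => [|[|//]] _ //=.
by rewrite (negbTE a2e) addbF.
Qed.

Let sD r : R := Num.sqrt (Delta M r).
Let dsD r : R := (r - M) / sD r.

Let Delta_gt0 r : 2 * M < r -> 0 < Delta M r.
Proof.
move=> Mr; rewrite (_ : Delta M r = r * (r - 2 * M)); last by rewrite /Delta; ring.
by rewrite mulr_gt0 ?subr_gt0// (lt_trans _ Mr)// mulr_gt0.
Qed.
Let sD_gt0 r : 2 * M < r -> 0 < sD r.
Proof. by move=> Mr; rewrite sqrtr_gt0 Delta_gt0. Qed.
Let sD_sq r : 2 * M < r -> sD r * sD r = Delta M r.
Proof. by move=> Mr; rewrite -expr2 sqr_sqrtr// ltW// Delta_gt0. Qed.

Let is_derive_sD r : 2 * M < r -> is_derive r (1 : R) sD (dsD r).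
Proof.
move=> Mr; have D := dcoefsP M 0 ord0 r.
have D2 : is_derive r (1 : R) (Delta M) (2 * (r - M)) by exact: D.
apply: (is_derive_eq (@is_derive1_comp _ (@Num.sqrt R) (Delta M) r _ _ (is_derive1_sqrt (Delta_gt0 Mr)) D2)).
by rewrite /dsD -/(sD r); field; rewrite lt0r_neq0// sD_gt0.
Qed.

Lemma scal_pd W i (A B : 'rV[R]_4 -> R) : open W -> (forall p, W p -> 2 * M < p.2) -> Cn 1 (domF W) B ->
  (forall x, domF W x -> A x = sD (x 0 o1) * B x) ->
  forall x, domF W x -> pd i A x = sD (x 0 o1) * pd i B x + (o1 == i)%:R * dsD (x 0 o1) * B x.
Proof.
move=> oW HW CB E x Dx; have [Wx _] := Dx; have Mx := HW _ Wx; rewrite /= in Mx.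
have dB := is_derive_pd i CB Dx.
have ds := is_derive_comp_coord i (is_derive_sD Mx).
have D := is_deriveM ds dB.
rewrite pdE (eq_on_derive _ (open_domF oW) (G := (fun y : 'rV[R]_4 => sD (y 0 o1)) * B) E Dx).
have [_ ->] := D; rewrite /GRing.scale /=; congr (_ + _).
by rewrite mulrC.
Qed.

Definition scal W F G := F.1 = G.1 /\ forall x, domF W x ->
  fre F.2 x = sD (x 0 o1) * fre G.2 x /\ fim F.2 x = sD (x 0 o1) * fim G.2 x.

(** [F] is [Delta^(1/2) G] away from the horizon. This stands in for regularity of [Phi_-] at
    [r = 2M], and survives [d_tau], [d_phi] and the angular operators, which do not differentiate in
    [rho]. The open set goes below [tau0], so the initial slice is included. *)
Definition scalN F G := exists W, [/\ open W, forall p, reg p -> 2 * M < p.2 -> W p,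
  forall p, W p -> 2 * M < p.2 & scal W F G].

Let scalN_good F G : Nice G -> scalN F G -> exists W, [/\ open W, forall p, reg p -> 2 * M < p.2 -> W p,
  forall p, W p -> 2 * M < p.2, scal W F G & Cn 1 (domF W) (fre G.2) /\ Cn 1 (domF W) (fim G.2)].
Proof.
move=> NG [W [oW rW W2 [w E]]]; have [V [oV rV [S1 S2]]] := Nice_smoothOn 1 NG.
exists (W `&` V); split.
- exact: openI.
- by move=> p rp p2; split; [exact: rW|exact: rV].
- by move=> p [Wp _]; exact: W2.
- by split => // x [[Wx _] Hx]; apply: E.
- by split; [apply: Cn_sub S1|apply: Cn_sub S2] => x [[_ Vx] Hx].
Qed.

Lemma scalN_tau F G : Nice G -> scalN F G -> scalN (op_tau F) (op_tau G).
Proof.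
move=> NG /(scalN_good NG)[W [oW rW W2 [w E] [C1 C2]]]; exists W; split => //; split => // x Dx.
have -> : fre (op_tau F).2 x = pd o0 (fre F.2) x by exact: fre_d_tauE.
have -> : fim (op_tau F).2 x = pd o0 (fim F.2) x by exact: fim_d_tauE.
have -> : fre (op_tau G).2 x = pd o0 (fre G.2) x by exact: fre_d_tauE.
have -> : fim (op_tau G).2 x = pd o0 (fim G.2) x by exact: fim_d_tauE.
rewrite (scal_pd o0 oW W2 C1 (fun y Dy => (E y Dy).1) Dx) (scal_pd o0 oW W2 C2 (fun y Dy => (E y Dy).2) Dx).
by rewrite !mul0r !addr0.
Qed.

Lemma scalN_phi F G : Nice G -> scalN F G -> scalN (op_phi F) (op_phi G).
Proof.
move=> NG /(scalN_good NG)[W [oW rW W2 [w E] [C1 C2]]]; exists W; split => //; split => // x Dx.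
have -> : fre (op_phi F).2 x = pd o3 (fre F.2) x by exact: fre_d_phiE.
have -> : fim (op_phi F).2 x = pd o3 (fim F.2) x by exact: fim_d_phiE.
have -> : fre (op_phi G).2 x = pd o3 (fre G.2) x by exact: fre_d_phiE.
have -> : fim (op_phi G).2 x = pd o3 (fim G.2) x by exact: fim_d_phiE.
rewrite (scal_pd o3 oW W2 C1 (fun y Dy => (E y Dy).1) Dx) (scal_pd o3 oW W2 C2 (fun y Dy => (E y Dy).2) Dx).
by rewrite !mul0r !addr0.
Qed.

Lemma scalN_ang e F G : Nice G -> scalN F G -> scalN (op_ang e F) (op_ang e G).
Proof.
move=> NG /(scalN_good NG)[W [oW rW W2 [w E] [C1 C2]]]; exists W; split => //; split; first by rewrite /= w.
move=> x Dx; have [E1 E2] := E x Dx.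
have -> : fre (op_ang e F).2 x = _ := fre_angE e F.1 F.2 x.
have -> : fim (op_ang e F).2 x = _ := fim_angE e F.1 F.2 x.
have -> : fre (op_ang e G).2 x = _ := fre_angE e G.1 G.2 x.
have -> : fim (op_ang e G).2 x = _ := fim_angE e G.1 G.2 x.
rewrite E1 E2 w.
rewrite (scal_pd o3 oW W2 C1 (fun y Dy => (E y Dy).1) Dx) (scal_pd o3 oW W2 C2 (fun y Dy => (E y Dy).2) Dx).
rewrite (scal_pd o2 oW W2 C1 (fun y Dy => (E y Dy).1) Dx) (scal_pd o2 oW W2 C2 (fun y Dy => (E y Dy).2) Dx).
rewrite !mul0r !addr0.
move: (pd _ _ x) (pd _ _ x) (pd _ _ x) (pd _ _ x) (fre _ x) (fim _ x) (sD _) => a1 a2 a3 a4 a5 a6 s.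
by split; ring.
Qed.

Lemma scalN_alt e m F G : Nice G -> scalN F G -> scalN (alt e m F) (alt e m G).
Proof. by move=> NG S; elim: m => //= m IH; apply: scalN_ang => //; exact: Nice_alt. Qed.
Lemma scalN_iter_tau m F G : Nice G -> scalN F G -> scalN (iter m (@op_tau R) F) (iter m (@op_tau R) G).
Proof. by move=> NG S; elim: m => //= m IH; apply: scalN_tau => //; apply: Nice_iter => // K; exact: Nice_tau. Qed.
Lemma scalN_iter_phi m F G : Nice G -> scalN F G -> scalN (iter m (@op_phi R) F) (iter m (@op_phi R) G).
Proof. by move=> NG S; elim: m => //= m IH; apply: scalN_phi => //; apply: Nice_iter => // K; exact: Nice_phi. Qed.

Lemma scalN_sqmod F G t r th ph : scalN F G -> reg (t, r) -> 2 * M < r -> 0 < th < pi ->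
  sqmod F t r th ph = Delta M r * sqmod G t r th ph.
Proof.
move=> [W [_ rW _ [_ E]]] rtr Mr Hth.
have Dx : domF W (pt4 t r th ph) by split; rewrite !pt4S//=; exact: rW.
have [E1 E2] := E _ Dx; rewrite !sqmod_dens /dens E1 E2 !pt4S /= -(sD_sq Mr).
by move: (fre _ _) (fim _ _) (sD _) => *; ring.
Qed.

Let open2M : open [set p : R * R | 2 * M < p.2].
Proof. by apply: (@open_comp _ _ (@snd R R) [set x | 2 * M < x]) => [p _|]; [exact: cvg_snd|exact: open_gt]. Qed.

Let fre_sqrtDelta f x : fre (sqrtDelta M f) x = sD (x 0 o1) * fre f x /\
  fim (sqrtDelta M f) x = sD (x 0 o1) * fim f x.
Proof.
rewrite /fre /fim /sqrtDelta /=; case: (f _ _ _ _) => a b /=.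
by rewrite !mul0r subr0 addr0.
Qed.

Lemma scalN_sqrtDelta w f : scalN (w, sqrtDelta M f) (w, f).
Proof.
exists [set p : R * R | 2 * M < p.2]; split => //; split => // x _ /=; exact: fre_sqrtDelta.
Qed.

(** Since [Vhat = (2 / mu) d_tau - Y] and [Delta / mu = r^2], the product
    [Delta^(1/2) Vhat (Delta^(1/2) Q)] expands to [2 r^2 d_tau Q - Delta Y Q + (r - M) Q], the last
    term being half the derivative of [Delta]. *)
Lemma Dirac_DP psip psim : Dirac_field M h tau0 psip psim -> DP true (2^-1, psip) (- 2^-1, psim).
Proof.
move=> [[U [oU HU sp sm]] HE].
have rU : reg `<=` U by move=> [t r] [/= h1 h2]; exact: HU.
have NP := spin_smooth_Nice oU rU sp; have NQ := spin_smooth_Nice oU rU sm.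
split => //.
- by rewrite /= mul1r.
- by rewrite /= mul1r.
- split; first by rewrite /= /sg; field.
  move=> t r th ph [/= Ht Hr] Hth; have [_ E] := HE t r th ph (ltW Ht) Hr Hth.
  by rewrite -[RHS]/(eth _ _ _ _ _ _) E.
- move=> x Dx; have [[/= Ht Hr] Hth] := Dx.
  have [V [oV rV [S1 S2]]] := Nice_smoothOn 1 NQ.
  have sW : domF Oset `<=` domF V by move=> y [h1 h2]; split => //; apply: rV; exact: Oset_reg.
  have C1 : Cn 1 (domF Oset) (fre psim) := Cn_sub sW S1.
  have C2 : Cn 1 (domF Oset) (fim psim) := Cn_sub sW S2.
  have W2 p : Oset p -> 2 * M < p.2 by case.
  have oO : open Oset by exact: open_Oset.
  have Q1 y : domF Oset y -> fre (sqrtDelta M psim) y = sD (y 0 o1) * fre psim y by move=> _; exact: (fre_sqrtDelta _ _).1.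
  have Q2 y : domF Oset y -> fim (sqrtDelta M psim) y = sD (y 0 o1) * fim psim y by move=> _; exact: (fre_sqrtDelta _ _).2.
  have A1 := scal_pd o0 oO W2 C1 Q1 Dx; have A2 := scal_pd o0 oO W2 C2 Q2 Dx.
  have B1 := scal_pd o1 oO W2 C1 Q1 Dx; have B2 := scal_pd o1 oO W2 C2 Q2 Dx.
  have [E _] := HE _ _ _ (x 0 o3) (ltW Ht) Hr Hth.
  have r0 : 0 < x 0 o1 by apply: lt_trans Hr; rewrite mulr_gt0.
  have mu0 : mu M (x 0 o1) != 0 by rewrite gt_eqF// /mu subr_gt0 ltr_pdivrMr// mul1r.
  have V1 : fre (Vhat M h (sqrtDelta M psim)) x = (2 / mu M (x 0 o1) - hp (x 0 o1)) * pd o0 (fre (sqrtDelta M psim)) x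
      + pd o1 (fre (sqrtDelta M psim)) x.
    rewrite pdE pdE -fre_d_rho -fre_d_tau /fre /Vhat /d_t /d_r.
    case: (d_tau _ _ _ _ _) => a b; case: (d_rho _ _ _ _ _) => c d /=; field; exact: mu0.
  have V2 : fim (Vhat M h (sqrtDelta M psim)) x = (2 / mu M (x 0 o1) - hp (x 0 o1)) * pd o0 (fim (sqrtDelta M psim)) x
      + pd o1 (fim (sqrtDelta M psim)) x.
    rewrite pdE pdE -fim_d_rho -fim_d_tau /fim /Vhat /d_t /d_r.
    case: (d_tau _ _ _ _ _) => a b; case: (d_rho _ _ _ _ _) => c d /=; field; exact: mu0.
  have E1 : fre (ethp 2^-1 psip) x = sD (x 0 o1) * fre (Vhat M h (sqrtDelta M psim)) x.
    by rewrite -(fre_sqrtDelta _ _).1; congr complex.Re; exact: E.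
  have E2 : fim (ethp 2^-1 psip) x = sD (x 0 o1) * fim (Vhat M h (sqrtDelta M psim)) x.
    by rewrite -(fre_sqrtDelta _ _).2; congr complex.Im; exact: E.
  rewrite E1 E2 V1 V2 A1 A2 B1 B2.
  have -> : fre (Y M h psim) x = hp (x 0 o1) * pd o0 (fre psim) x - pd o1 (fre psim) x by exact: fre_YE.
  have -> : fim (Y M h psim) x = hp (x 0 o1) * pd o0 (fim psim) x - pd o1 (fim psim) x by exact: fim_YE.
  have -> : fre (d_tau psim) x = pd o0 (fre psim) x by exact: fre_d_tauE.
  have -> : fim (d_tau psim) x = pd o0 (fim psim) x by exact: fim_d_tauE.
  rewrite /dsD.
  have s0 := sD_gt0 Hr; have sn := lt0r_neq0 s0.
  have Ds := sD_sq Hr; have Dm : Delta M (x 0 o1) = (x 0 o1) ^+ 2 * mu M (x 0 o1).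
    by rewrite /Delta /mu; field; rewrite gt_eqF.
  have fin (s D m hh r a b c : R) : s != 0 -> m != 0 -> s * s = D -> D = r ^+ 2 * m ->
    D * (hh * a - b) = 2 * r ^+ 2 * a + (r - M) * c -
      s * ((2 / m - hh) * (s * a + 0 * ((r - M) / s) * c) + (s * b + 1 * ((r - M) / s) * c)).
    move=> s_ m_ ED ED2.
    have -> : s * ((2 / m - hh) * (s * a + 0 * ((r - M) / s) * c) + (s * b + 1 * ((r - M) / s) * c)) =
      (2 / m - hh) * (s * s) * a + (s * s) * b + (r - M) * c by field; rewrite s_ m_.
    by rewrite ED ED2; field.
  by split; apply: fin.
Qed.

End Multi.

(** * Fluxes for a fixed multi-index and their sum *)

Section Assembly.
Variables (R : realType) (M tau0 : R) (h : R -> R) (r_away r_far : R).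
Hypothesis M0 : 0 < M.
Hypothesis fol : foliation M h r_away r_far tau0.
Let hsmooth := fol_smooth fol.
Implicit Types F G P Q : spin_scalar R.
Notation reg := (reg M tau0).
Notation oY := (op_Y M h).
Notation DP := (DP M tau0 h).
Notation Nrm := (Nrm M).
Notation wle := (wle M h).
Notation iterY n := (iter n oY).

Definition multi_bound n a1 a2 a3 a4 (K : R) := forall psip psim D t1 t2,
  let Psip : spin_scalar R := (2^-1, psip) in
  let Psim : spin_scalar R := (- 2^-1, psim) in
  let Phim : spin_scalar R := (- 2^-1, sqrtDelta M psim) in
  (a1 < 2)%N -> ~~ odd a2 -> (a1 + a2 + a3 + a4 <= n)%N ->
  Dirac_field M h tau0 psip psim -> tau0 <= t1 -> t1 < t2 ->
  wle n Psip t1 D -> wle n Psim t1 D ->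
  (horizon_int M h t1 t2 (sqmod (multi_p a1 a2 a3 a4 Psip))
     + scri_int M h t1 t2 (fun tau rho theta phi =>
         (sqmod (multi_p a1 a2 a3 a4 Psip) tau rho theta phi
         + sqmod (multi_m a1 a2 a3 a4 Phim) tau rho theta phi)%R)
   <= (K * D)%:E)%E.

Lemma index_bound n a1 a2 a3 a4 : exists K : R, 0 <= K /\ multi_bound n a1 a2 a3 a4 K.
Proof.
have [CP CP0 HP] := alt_bound fol false (a1 + a2) a3 a4 2^-1.
have [CQ CQ0 HQ] := alt_bound fol true (a1 + a2) a3 a4 (- 2^-1).
have [C0 C00 HE] := energy0 M0 fol.
(* [17 = 4 + 13]: the factors of the horizon flux and of the flux through null infinity. *)
exists (17 * (C0 * (CP + CQ))); split.
  by apply: mulr_ge0 => //; apply: mulr_ge0; [exact: ltW|exact: addr_ge0].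
move=> psip psim D t1 t2 P0 Q0 Qs0 a1lt a2e an HD H1 t12 wP wQ.
have dp0 := Dirac_DP M0 HD.
have D0 : 0 <= D by exact: wle_ge0 wP.
set P := multi_p a1 a2 a3 a4 _; set Qs := multi_m a1 a2 a3 a4 _.
pose G : spin_scalar R -> spin_scalar R := fun F => iter a3 (@op_tau R) (iter a4 (@op_phi R) F).
have EP : P = alt false (a1 + a2) (G P0) by exact: (multiE false).
have EQs : Qs = alt true (a1 + a2) (G Qs0) by exact: (multiE true).
pose Q := alt true (a1 + a2) (G Q0).
have dpG : DP true (G P0) (G Q0) by apply: (DP_iter_tau hsmooth); apply: (DP_iter_phi hsmooth).
have dp : DP (true (+) odd (a1 + a2)) P Q by rewrite EP; exact: (DP_alt hsmooth (a1 + a2) dpG).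
have NP := DP_P dp; have NQ := DP_Q dp.
have NQ0 := DP_Q dp0.
have sQ : scalN M tau0 Qs Q.
  rewrite EQs; apply: scalN_alt => //; first exact: DP_Q dpG.
  apply: scalN_iter_tau => //; first by apply: Nice_iter => // F NF; exact: Nice_phi.
  by apply: scalN_iter_phi => //; exact: scalN_sqrtDelta.
pose D' := (CP + CQ) * D; pose X := C0 * D'.
have bP : (Nrm P t1 <= D'%:E)%E.
  have := HP P0 t1 D n H1 (DP_P dp0) erefl an wP; rewrite EP => /le_trans; apply.
  by rewrite lee_fin /D' ler_wpM2r// lerDl.
have bQ : (Nrm Q t1 <= D'%:E)%E.
  have := HQ Q0 t1 D n H1 NQ0 erefl an wQ => /le_trans; apply.
  by rewrite lee_fin /D' ler_wpM2r// lerDr.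
have [E1 E2 E3] := HE _ _ _ _ _ dp H1 bP bQ.
have hor := horizon_le fol H1 t12 NP (fun c c0 => E2 t2 c t12 c0).
have HX t : t1 <= t -> (Nrm P t <= X%:E)%E by move=> tt; have [HPt _] := E1 t tt; exact: HPt.
have HQs t r th ph : reg (t, r) -> 2 * M < r -> 0 < th < pi ->
    sqmod Qs t r th ph = Delta M r * sqmod Q t r th ph.
  by move=> rtr Mr Hth; exact: (scalN_sqmod M0 ph sQ rtr Mr Hth).
have scr := scri_le M0 fol H1 t12 NP NQ HQs HX (fun c L c0 ML HL => E3 t2 c L t12 c0 ML HL).
apply: (le_trans (leeD hor scr)); rewrite -EFinD lee_fin le_eqVlt; apply/orP; left; apply/eqP.
by rewrite /X /D'; ring.
Qed.

End Assembly.

Section Final.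
Variable R : realType.

Lemma sum_multi_le n (G : nat -> nat -> nat -> nat -> \bar R) (K : nat -> nat -> nat -> nat -> R) (D : R) :
  (forall a1 a2 a3 a4, (a1 < 2)%N -> ~~ odd a2 -> (a1 + a2 + a3 + a4 <= n)%N -> (G a1 a2 a3 a4 <= (K a1 a2 a3 a4 * D)%:E)%E) ->
  (sum_multi n G <= ((\sum_(a1 < 2) \sum_(a2 < n.+1 | ~~ odd a2) \sum_(a3 < n.+1)
    \sum_(a4 < n.+1 | (a1 + a2 + a3 + a4 <= n)%N) K a1 a2 a3 a4) * D)%:E)%E.
Proof.
move=> H; rewrite mulr_suml -sumEFin; apply: lee_sum => a1 _.
rewrite mulr_suml -sumEFin; apply: lee_sum => a2 oa2.
rewrite mulr_suml -sumEFin; apply: lee_sum => a3 _.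
by rewrite mulr_suml -sumEFin; apply: lee_sum => a4 a4n; exact: H.
Qed.

(** Data of infinite norm make the right-hand side infinite, as [C] is positive; only finite data
    need the estimates. *)
Lemma le_fin_numW (C : R) (x y : \bar R) : 0 < C -> (0 <= x)%E ->
  (x \is a fin_num -> (y <= C%:E * x)%E) -> (y <= C%:E * x)%E.
Proof.
move=> C0; case: x => [r| |] // x0 H; first exact: H.
by rewrite gt0_muley ?lte_fin// leey.
Qed.

End Final.

Theorem theorem3p16 (R : realType) :
  exists2 R0 : R, 0 < R0 &
  forall (M : R) (h : R -> R) (r_away r_far tau0 : R),
  0 < M -> R0 * M <= r_far -> foliation M h r_away r_far tau0 ->
  forall k : nat,
  exists2 C : R, 0 < C &
  forall psip psim : field R, Dirac_field M h tau0 psip psim ->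
  let Psip : spin_scalar R := (2^-1, psip) in
  let Psim : spin_scalar R := (- 2^-1, psim) in
  let Phip : spin_scalar R := Psip in
  let Phim : spin_scalar R := (- 2^-1, sqrtDelta M psim) in
  forall tau1 tau2 : R, tau0 <= tau1 -> tau1 < tau2 ->
  (W_norm_sq M h 0 k.+1 tau2 Psip + W_norm_sq M h 0 k.+1 tau2 Psim
   + sum_multi k.+1 (fun a1 a2 a3 a4 =>
       horizon_int M h tau1 tau2 (sqmod (multi_p a1 a2 a3 a4 Phip))
       + scri_int M h tau1 tau2 (fun tau rho theta phi =>
           (sqmod (multi_p a1 a2 a3 a4 Phip) tau rho theta phi
           + sqmod (multi_m a1 a2 a3 a4 Phim) tau rho theta phi)%R))
   <= C%:E * (W_norm_sq M h 0 k.+1 tau1 Psip + W_norm_sq M h 0 k.+1 tau1 Psim))%E.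
Proof.
exists 1; first exact: ltr01.
move=> M h r_away r_far tau0 M0 _ fol k.
have [Cw Cw1 Hw] := words_bound M0 fol k.+1.
(* The constants for all multi-indices are chosen before the field and the times are introduced. *)
have /choice[K HK] : forall a : nat * nat * nat * nat, exists K : R,
    0 <= K /\ multi_bound M tau0 h k.+1 a.1.1.1 a.1.1.2 a.1.2 a.2 K.
  by move=> a; exact: (index_bound M0 fol).
pose S := \sum_(a1 < 2) \sum_(a2 < k.+2 | ~~ odd a2) \sum_(a3 < k.+2)
    \sum_(a4 < k.+2 | (a1 + a2 + a3 + a4 <= k.+1)%N) K (nat_of_ord a1, nat_of_ord a2, nat_of_ord a3, nat_of_ord a4).
have S0 : 0 <= S.
  apply: sumr_ge0 => a1 _; apply: sumr_ge0 => a2 _; apply: sumr_ge0 => a3 _; apply: sumr_ge0 => a4 _.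
  by have [] := HK (nat_of_ord a1, nat_of_ord a2, nat_of_ord a3, nat_of_ord a4).
(* The number of words of length at most [k + 1] in four letters. *)
pose N4 : R := \sum_(i < k.+2) (4 ^ i)%:R.
have N40 : 0 <= N4 by apply: sumr_ge0.
have Cw0 : 0 <= Cw by exact: le_trans Cw1.
exists (N4 * Cw + N4 * Cw + S + 1).
  by rewrite ltr_wpDl// addr_ge0// addr_ge0// mulr_ge0.
move=> psip psim HD Psip Psim Phip Phim t1 t2 H1 t12.
have dp := Dirac_DP M0 HD; have NP := DP_P dp; have NQ := DP_Q dp.
have H2 : tau0 <= t2 by rewrite (le_trans H1)// ltW.
have W0 F t : (0 <= W_norm_sq M h 0 k.+1 t F)%E.
  apply: integral_ge0 => r _; apply: integral_ge0 => th; rewrite /= in_itv /= => Hth.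
  apply: integral_ge0 => ph _; rewrite lee_fin; apply: mulr_ge0; last by apply/ltW/sin_gt0_pi.
  apply: mulr_ge0; first exact: powR_ge0.
  by apply: sumr_ge0 => i _; apply: sumr_ge0 => G _; exact: sqr_ge0.
set C := N4 * Cw + N4 * Cw + S + 1.
have C0 : 0 < C by rewrite ltr_wpDl// addr_ge0// addr_ge0// mulr_ge0.
apply: le_fin_numW; first exact: C0.
  by apply: adde_ge0; exact: W0.
move=> fin.
pose D := fine (W_norm_sq M h 0 k.+1 t1 Psip + W_norm_sq M h 0 k.+1 t1 Psim)%E.
have DE : (W_norm_sq M h 0 k.+1 t1 Psip + W_norm_sq M h 0 k.+1 t1 Psim = D%:E)%E by rewrite fineK.
have wP : wle M h k.+1 Psip t1 D by apply: (W_norm_wle fol H1 NP); rewrite -DE leeDl.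
have wQ : wle M h k.+1 Psim t1 D by apply: (W_norm_wle fol H1 NQ); rewrite -DE leeDr.
have [wP2 wQ2] := Hw _ _ _ _ _ dp H1 wP wQ t2 (ltW t12).
have bP := wle_W_norm fol H2 NP wP2; have bQ := wle_W_norm fol H2 NQ wQ2.
have bS := @sum_multi_le R k.+1 _ (fun a1 a2 a3 a4 => K (a1, a2, a3, a4)) D
  (fun a1 a2 a3 a4 h1 h2 h3 => (HK (a1, a2, a3, a4)).2 psip psim D t1 t2 h1 h2 h3 HD H1 t12 wP wQ).
apply: (le_trans (leeD (leeD bP bQ) bS)).
rewrite DE -EFinM -!EFinD lee_fin.
have D0 : 0 <= D by exact: wle_ge0 wP.
rewrite -/N4 -/S /C [leRHS]mulrDl mul1r [X in _ <= X + _]mulrDl [X in _ <= X + _ + _]mulrDl !mulrA.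
by rewrite lerDl.
Qed.
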